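(* For any Schwartz function $\phi$ supported in $(0,\infty)$, we have $$\begin{aligned} \sum_{m=1}^\infty \tau_3(m)(-1)^m\phi(m) =\ & \operatorname{res}_{s=1}\left( \tilde\phi(s)\zeta(s)^3\Big( -1+\frac{6}{2^s}-\frac{6}{4^s}+\frac{2}{8^s} \Big) \right)\\ &+ \sum_{m=1}^{\infty} \tau_3(m)\left( -H(m)+3H\Big(\frac{m}{2}\Big)-\frac{3}{2}H\Big(\frac{m}{4}\Big) +\frac{1}{4}H\Big(\frac{m}{8}\Big) \right), \end{aligned}$$ where, for $x>0$, $$H(x)=\frac{1}{2\pi i}\int_{(2)}\tilde\phi(1-s)\,\chi(1-s)^3\,x^{-s}\,ds,\qquad \chi(1-s) = 2(2\pi)^{-s}\cos\!\left(\tfrac{\pi s}{2}\right)\Gamma(s).$$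
   Context: $\tau_3(n)=\#\{(a,b,c)\in\mathbb N^3: abc=n\}$ is the $3$-fold divisor function; $\zeta$ is the Riemann zeta function; $\tilde\phi(s)=\int_0^\infty\phi(x)x^{s-1}dx$ is the Mellin transform; $\int_{(2)}$ denotes integration along the vertical line $\Re(s)=2$, upwards; $\operatorname{res}_{s=1}$ denotes the residue at $s=1$. *)

(* Defs.v *)
(* Stdlib reals, with Coquelicot for complex numbers, derivatives, improper
   integrals and series. *)
From Stdlib Require Import Reals List ClassicalEpsilon.
From Coquelicot Require Import Coquelicot.

Local Open Scope C_scope.

Definition Cexp (z : C) : C :=
  RtoC (exp (Re z)) * (cos (Im z), sin (Im z)).

Definition Ccos (z : C) : C := (Cexp (Ci * z) + Cexp (- (Ci * z))) / 2.

(* x ^ s for a positive real x; no meaning is attached to x <= 0. *)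
Definition cpow (x : R) (s : C) : C := Cexp (s * ln x).

Definition holomorphic_at (f : C -> C) (z : C) : Prop :=
  @ex_derive C_AbsRing C_NormedModule f z.

(* The number of triples of positive integers with product n: for n >= 1 all
   three factors lie in {1, ..., n}. *)
Definition tau3 (n : nat) : nat :=
  length
    (filter (fun t => let '(a, b, c) := t in Nat.eqb (a * b * c) n)
       (list_prod (list_prod (seq 1 n) (seq 1 n)) (seq 1 n))).

Definition schwartz_R (f : R -> R) : Prop :=
  (forall (k : nat) (x : R), ex_derive_n f k x) /\
  (forall j k : nat, exists M : R, forall x : R,
      (Rabs x ^ j * Rabs (Derive_n f k x) <= M)%R).

(* Complex-valued Schwartz functions on the line; Derive_n is only available
   for real-valued functions. *)
Definition schwartz (phi : R -> C) : Prop :=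
  schwartz_R (fun x => Re (phi x)) /\ schwartz_R (fun x => Im (phi x)).

Definition supported_in_pos (phi : R -> C) : Prop :=
  forall x : R, (x <= 0)%R -> phi x = 0.

Definition mellin (f : R -> C) (s : C) : C :=
  @RInt_gen C_R_CompleteNormedModule
    (fun x : R => f x * cpow x (s - 1)) (at_right 0%R) (Rbar_locally p_infty).

(* Integral of F along the line Re s = c, upwards: s = c + i t, ds = i dt. *)
Definition vline_int (c : R) (F : C -> C) : C :=
  Ci * @RInt_gen C_R_CompleteNormedModule
    (fun t : R => F (c, t)) (Rbar_locally m_infty) (Rbar_locally p_infty).

(* Euler's integral, hence only meaningful for Re s > 0. *)
Definition CGamma (s : C) : C := mellin (fun t : R => RtoC (exp (- t))) s.

(* Only meaningful for Re w < 1, where CGamma (1 - w) is. *)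
Definition chi (w : C) : C :=
  let s := 1 - w in
  2 * cpow (2 * PI) (- s) * Ccos (RtoC PI * s / 2) * CGamma s.

Definition is_riemann_zeta (Z : C -> C) : Prop :=
  (forall s : C, (1 < Re s)%R ->
     @is_series C_AbsRing C_NormedModule
       (fun n : nat => cpow (INR (S n)) (- s)) (Z s)) /\
  (forall s : C, s <> 1 -> holomorphic_at Z s).

(* The analytic continuation of the Dirichlet series to C \ {1}; it is unique,
   so that the choice only affects the irrelevant value at s = 1. *)
Definition zeta : C -> C := epsilon (inhabits (fun _ => RtoC 0)) is_riemann_zeta.

(* f is holomorphic in a punctured disc around a, with at most a pole at a, and
   r is the coefficient of (z - a)^(-1) in its Laurent expansion there: c k is
   the coefficient of (z - a)^(-(k + 1)), and g is the regular part. *)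
Definition is_residue (f : C -> C) (a r : C) : Prop :=
  exists (N : nat) (c : nat -> C) (g : C -> C) (eps : R),
    (0 < eps)%R /\
    c 0%nat = r /\
    (forall z : C, (Cmod (z - a) < eps)%R -> holomorphic_at g z) /\
    (forall z : C, (0 < Cmod (z - a) < eps)%R ->
       f z = g z + sum_n (fun k : nat => c k / (z - a) ^ (S k)) N).

Definition H (phi : R -> C) (x : R) : C :=
  / (2 * RtoC PI * Ci) *
  vline_int 2 (fun s : C =>
    mellin phi (1 - s) * chi (1 - s) ^ 3 * cpow x (- s)).

(* Main.v *)
Require Import Defs.
From Stdlib Require Import Reals.
From Coquelicot Require Import Coquelicot.
From Stdlib Require Import Lra Lia ClassicalEpsilon List.

(** The factor A(s) = -1 + 6/2^s - 6/4^s + 2/8^s equals 1 - 2 (1 - 2^-s)^3.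
    Because (-1)^n = 1 - 2 [n odd], because a product is odd exactly when all
    its factors are, and because (1 - 2^-s) zeta(s) is the sum of n^-s over odd
    n, the series of tau3(m) (-1)^m m^-s is A(s) zeta(s)^3 for Re s > 1.  Mellin
    inversion on the line Re s = 2 therefore turns the alternating sum into the
    integral of F(s) = mellin phi s * zeta(s)^3 * A(s) over that line, divided
    by 2 pi i.  The transform of phi decays faster than any power of |s| while
    zeta grows at most polynomially, so the line may be moved to Re s = -1; the
    only singularity in between is the pole at 1, which contributes the residue.
    On the line Re s = -1 the substitution s -> 1 - s and the functional equation
    zeta(1 - s) = chi(1 - s) zeta(s) produce
    mellin phi (1 - s) chi(1 - s)^3 A(1 - s) zeta(s)^3 on Re s = 2, where
    A(1 - s) = -1 + 3 2^s - (3/2) 4^s + (1/4) 8^s.  Expanding zeta(s)^3 as the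
    series of tau3(m) m^-s and writing a^s m^-s = (m/a)^-s gives the dual sum
    over H(m), H(m/2), H(m/4) and H(m/8).

    Four bodies of theory carry the argument.

    Complex analysis on rectangles: Goursat's theorem by bisection ([goursat]),
    Cauchy's formula, the division of a holomorphic function by z - a
    ([holo_divide]), which yields Laurent expansions, and an identity theorem
    ([vanish_in_square]), which makes the analytic continuation of zeta unique.

    The zeta function: Euler-Maclaurin summation to third order gives an explicit
    continuation [EM] to Re w > -2, with a cubic bound in vertical strips.  For
    -2 < Re w < -1 it is a multiple of the Mellin transform of the periodic third
    Bernoulli function; the Fourier series of that function ([fourier_B3]) and
    the Mellin transform of the sine ([mellin_sin], by rotation of the contour in
    Euler's integral) then give the functional equation ([chi_EM]).

    Mellin inversion ([mellin_inversion]): phi is compared at x0 with an explicit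
    kernel whose inversion integral is elementary; the difference is divisible by
    y - x0, and this factor turns its inversion integral into the difference of
    the integrals of one holomorphic function over two vertical lines, which is 0.

    Divisor sums: partial sums of the series with coefficients tau3 are compared
    with sums over cubes, which are third powers ([cube_excess]), uniformly on the
    line Re s = 2, so that sums and integrals may be interchanged. *)

Local Open Scope C_scope.

(** * Limits, continuity and complex derivatives *)

(** Coordinates: an identity between complex numbers becomes two real ones. *)
Ltac Csimp := unfold Cplus, Cminus, Copp, Cmult, RtoC, Re, Im in *; simpl in *.
Ltac Cext := apply injective_projections; Csimp.

(** Limits in the plane measured by the modulus: the product uniform structure
    on pairs, used for limits of complex-valued maps, has the same filters but
    yields unwieldy estimates. *)
Definition clim {T : Type} (F : (T -> Prop) -> Prop) (f : T -> C) (l : C) : Prop :=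
  forall eps : R, (0 < eps)%R -> F (fun t => (Cmod (f t - l) < eps)%R).

Lemma Rlt_half (e : R) : (0 < e -> 0 < e / 2)%R.
Proof. lra. Qed.

Lemma Cmod_fst (z : C) : (Rabs (fst z) <= Cmod z)%R.
Proof. eapply Rle_trans; [apply Rmax_l | apply Rmax_Cmod]. Qed.

Lemma Cmod_snd (z : C) : (Rabs (snd z) <= Cmod z)%R.
Proof. eapply Rle_trans; [apply Rmax_r | apply Rmax_Cmod]. Qed.

Lemma Cmod_pos (z : C) : z <> 0 -> (0 < Cmod z)%R.
Proof. intros H. apply Cmod_gt_0. exact H. Qed.

Lemma Cmod_neq (z : C) : (0 < Cmod z)%R -> z <> 0.
Proof. intros H. apply Cmod_gt_0. exact H. Qed.

Lemma Cmod_le_sum (z : C) : (Cmod z <= Rabs (fst z) + Rabs (snd z))%R.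
Proof.
  destruct z as [x y]; simpl.
  replace (x, y) with (RtoC x + Ci * RtoC y) by (Cext; ring).
  eapply Rle_trans; [apply Cmod_triangle|].
  rewrite Cmod_mult, Cmod_Ci, !Cmod_R. lra.
Qed.

Lemma Cmod_minus_sym (a b : C) : Cmod (a - b) = Cmod (b - a).
Proof. rewrite <- Cmod_opp. f_equal. ring. Qed.

Lemma Cmod_triangle_minus (a b c : C) : (Cmod (a - c) <= Cmod (a - b) + Cmod (b - c))%R.
Proof. replace (a - c) with ((a - b) + (b - c)) by ring. apply Cmod_triangle. Qed.

Lemma Cmod_rev_triangle (a b : C) : (Cmod a - Cmod b <= Cmod (a - b))%R.
Proof.
  assert (H := Cmod_triangle (a - b) b).
  replace (a - b + b) with a in H by ring. lra.
Qed.

Lemma filterlim_clim {T} (F : (T -> Prop) -> Prop) {FF : Filter F} (f : T -> C) (l : C) :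
  filterlim f F (@locally C_UniformSpace l) <-> clim F f l.
Proof.
  split.
  - intros H eps He.
    apply (H (fun z => (Cmod (z - l) < eps)%R)).
    exists (mkposreal _ (Rlt_half eps He)). intros y Hy.
    destruct Hy as [H1 H2]. simpl in H1, H2.
    unfold ball in H1, H2; simpl in H1, H2; unfold AbsRing_ball, abs, minus, plus, opp in H1, H2; simpl in H1, H2.
    eapply Rle_lt_trans; [apply Cmod_le_sum|]. Csimp.
    unfold Rminus in *. lra.
  - intros H. apply filterlim_locally. intros eps.
    generalize (H eps (cond_pos eps)). apply filter_imp. intros t Ht.
    split; unfold ball; simpl; unfold AbsRing_ball, abs, minus, plus, opp; simpl.
    + eapply Rle_lt_trans; [apply (Cmod_fst (f t - l))|exact Ht].
    + eapply Rle_lt_trans; [apply (Cmod_snd (f t - l))|exact Ht].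
Qed.

Section Clim.
Context {T : Type} (F : (T -> Prop) -> Prop) {FF : Filter F}.

Lemma clim_const (a : C) : clim F (fun _ => a) a.
Proof.
  intros e He. apply filter_forall. intros _.
  replace (a - a) with (RtoC 0) by ring. rewrite Cmod_0. exact He.
Qed.

Lemma clim_ext_loc (f g : T -> C) l : F (fun t => f t = g t) -> clim F f l -> clim F g l.
Proof.
  intros E H e He. generalize (filter_and _ _ E (H e He)).
  apply filter_imp. intros t [-> Ht]. exact Ht.
Qed.

Lemma clim_ext (f g : T -> C) l : (forall t, f t = g t) -> clim F f l -> clim F g l.
Proof. intros E. apply clim_ext_loc. apply filter_forall. exact E. Qed.

Lemma clim_plus (f g : T -> C) (a b : C) : clim F f a -> clim F g b -> clim F (fun t => f t + g t) (a + b).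
Proof.
  intros Hf Hg e He.
  generalize (filter_and _ _ (Hf _ (Rlt_half e He)) (Hg _ (Rlt_half e He))).
  apply filter_imp. intros t [H1 H2].
  replace (f t + g t - (a + b)) with ((f t - a) + (g t - b)) by ring.
  eapply Rle_lt_trans; [apply Cmod_triangle|lra].
Qed.

Lemma clim_opp (f : T -> C) (a : C) : clim F f a -> clim F (fun t => - f t) (- a).
Proof.
  intros Hf e He. generalize (Hf e He). apply filter_imp. intros t Ht.
  replace (- f t - - a) with (- (f t - a)) by ring. now rewrite Cmod_opp.
Qed.

Lemma clim_minus (f g : T -> C) (a b : C) : clim F f a -> clim F g b -> clim F (fun t => f t - g t) (a - b).
Proof. intros Hf Hg. apply clim_plus; [exact Hf|now apply clim_opp]. Qed.

Lemma clim_mult (f g : T -> C) (a b : C) : clim F f a -> clim F g b -> clim F (fun t => f t * g t) (a * b).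
Proof.
  intros Hf Hg e He.
  set (d := Rmin 1 (e / (1 + Cmod a + Cmod b))%R).
  assert (Ha := Cmod_ge_0 a). assert (Hb := Cmod_ge_0 b).
  assert (Hd : (0 < d)%R).
  { apply Rmin_pos; [lra|]. apply Rdiv_lt_0_compat; lra. }
  generalize (filter_and _ _ (Hf d Hd) (Hg d Hd)).
  apply filter_imp. intros t [H1 H2].
  replace (f t * g t - a * b) with ((f t - a) * (g t - b) + (a * (g t - b) + b * (f t - a))) by ring.
  assert (d <= 1)%R by apply Rmin_l.
  assert (d * (1 + Cmod a + Cmod b) <= e)%R.
  { replace e with (e / (1 + Cmod a + Cmod b) * (1 + Cmod a + Cmod b))%R by (field; lra).
    apply Rmult_le_compat_r; [lra|apply Rmin_r]. }
  eapply Rle_lt_trans; [apply Cmod_triangle|].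
  eapply Rle_lt_trans; [apply Rplus_le_compat_l, Cmod_triangle|].
  rewrite !Cmod_mult.
  assert (P1 := Cmod_ge_0 (f t - a)). assert (P2 := Cmod_ge_0 (g t - b)).
  set (x := Cmod (f t - a)) in *. set (y := Cmod (g t - b)) in *.
    assert (Cmod a * y <= Cmod a * d)%R by (apply Rmult_le_compat_l; lra).
  assert (Cmod b * x <= Cmod b * d)%R by (apply Rmult_le_compat_l; lra).
  assert (x * y < d * 1)%R.
  { apply Rle_lt_trans with (x * 1)%R; [apply Rmult_le_compat_l; lra|lra]. }
  lra.
Qed.

Lemma clim_inv (f : T -> C) (a : C) : a <> 0 -> clim F f a -> clim F (fun t => / f t) (/ a).
Proof.
  intros Ha Hf e He.
  assert (Pa : (0 < Cmod a)%R) by now apply Cmod_pos.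
  set (d := Rmin (Cmod a / 2) (e * Cmod a * Cmod a / 2)%R).
  assert (Hd : (0 < d)%R).
  { apply Rmin_pos; [lra|]. apply Rlt_half. repeat apply Rmult_lt_0_compat; auto. }
  generalize (Hf d Hd). apply filter_imp. intros t Ht.
  assert (d <= Cmod a / 2)%R by apply Rmin_l.
  assert (d <= e * Cmod a * Cmod a / 2)%R by apply Rmin_r.
  assert (Hft : (Cmod a / 2 < Cmod (f t))%R).
  { generalize (Cmod_rev_triangle a (f t)). rewrite Cmod_minus_sym. lra. }
  assert (f t <> 0) by (apply Cmod_neq; lra).
  replace (/ f t - / a) with ((a - f t) * (/ f t * / a)) by (field; auto).
  rewrite !Cmod_mult, !Cmod_inv by auto. rewrite Cmod_minus_sym.
  apply Rlt_le_trans with (e * Cmod a * Cmod a / 2 * (/ Cmod (f t) * / Cmod a))%R.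
  { apply Rmult_lt_compat_r; [|lra].
    apply Rmult_lt_0_compat; apply Rinv_0_lt_compat; lra. }
  replace (e * Cmod a * Cmod a / 2 * (/ Cmod (f t) * / Cmod a))%R
    with (e * (Cmod a / 2 * / Cmod (f t)))%R by (field; lra).
  rewrite <- (Rmult_1_r e) at 2. apply Rmult_le_compat_l; [lra|].
  apply Rmult_le_reg_r with (Cmod (f t)); [lra|].
  rewrite Rmult_assoc, Rinv_l by lra. lra.
Qed.

Lemma clim_pow (f : T -> C) (a : C) (n : nat) : clim F f a -> clim F (fun t => f t ^ n) (a ^ n).
Proof.
  intros Hf. induction n as [|n IH]; simpl.
  - apply clim_const.
  - now apply clim_mult.
Qed.

Lemma clim_squeeze f (l : C) (b : T -> R) :
  (forall e, (0 < e)%R -> F (fun t => (b t < e)%R)) ->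
  F (fun t => (Cmod (f t - l) <= b t)%R) -> clim F f l.
Proof.
  intros Hb Hf e He. generalize (filter_and _ _ (Hb e He) Hf).
  apply filter_imp. intros t [H1 H2]. lra.
Qed.

Lemma clim_pair (x y : T -> R) a b :
  filterlim x F (locally a) -> filterlim y F (locally b) ->
  clim F (fun t => (x t, y t)) (a, b).
Proof.
  intros Hx Hy e He.
  assert (He' : (0 < e / 2)%R) by lra.
  generalize (filter_and _ _ (proj1 (filterlim_locally x a) Hx (mkposreal _ He'))
    (proj1 (filterlim_locally y b) Hy (mkposreal _ He'))).
  apply filter_imp. intros t [H1 H2].
  unfold ball in H1, H2; simpl in H1, H2; unfold AbsRing_ball, abs, minus, plus, opp in H1, H2; simpl in H1, H2.
  eapply Rle_lt_trans; [apply Cmod_le_sum|]. Csimp. unfold Rminus in *. lra.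
Qed.

Lemma clim_RtoC (x : T -> R) a : filterlim x F (locally a) -> clim F (fun t => RtoC (x t)) (RtoC a).
Proof. intros H. apply clim_pair; [exact H|apply filterlim_const]. Qed.

Lemma clim_Cmod f (l : C) : clim F f l -> filterlim (fun t => Cmod (f t)) F (locally (Cmod l)).
Proof.
  intros H. apply filterlim_locally. intros e. generalize (H e (cond_pos e)).
  apply filter_imp. intros t Ht.
  unfold ball; simpl; unfold AbsRing_ball, abs, minus, plus, opp; simpl.
  assert (A := Cmod_rev_triangle (f t) l). assert (B := Cmod_rev_triangle l (f t)).
  rewrite Cmod_minus_sym in B. apply Rabs_def1; lra.
Qed.

End Clim.

Lemma clim_unique {T} (F : (T -> Prop) -> Prop) {FF : ProperFilter' F} (f : T -> C) (a b : C) :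
  clim F f a -> clim F f b -> a = b.
Proof.
  intros Ha Hb. apply Ceq_minus. apply Cmod_eq_0.
  destruct (Cmod_ge_0 (a - b)) as [P|P]; [exfalso|auto].
  assert (G := filter_and _ _ (Ha _ (Rlt_half _ P)) (Hb _ (Rlt_half _ P))).
  apply (filter_not_empty (F := F)).
  generalize G. apply filter_imp. intros t [H1 H2].
  assert (Q := Cmod_triangle_minus a (f t) b). rewrite (Cmod_minus_sym a (f t)) in Q. lra.
Qed.

Lemma clim_comp {T U} (F : (T -> Prop) -> Prop) (G : (U -> Prop) -> Prop) g f l :
  clim G f l -> filterlim g F G -> clim F (fun t => f (g t)) l.
Proof. intros Hf Hg e He. apply (Hg _ (Hf e He)). Qed.

Tactic Notation "capply" uconstr(L) := apply L; try typeclasses eauto.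

(** The domain is left general because both the line and the plane are needed,
    the latter with its product structure. *)
Definition ccont {T : UniformSpace} (f : T -> C) (x : T) : Prop := clim (locally x) f (f x).

Lemma ccont_continuous {T : UniformSpace} (f : T -> C) x :
  ccont f x <-> @continuous T C_UniformSpace f x.
Proof. unfold ccont, continuous. symmetry. apply filterlim_clim, locally_filter. Qed.

Lemma ccont_comp {T U : UniformSpace} (g : T -> U) (f : U -> C) x :
  ccont f (g x) -> continuous g x -> ccont (fun t => f (g t)) x.
Proof. intros Hf Hg. exact (clim_comp _ _ g f _ Hf Hg). Qed.

Lemma locally_Cmod (z : C) (P : C -> Prop) :
  @locally C_UniformSpace z P <-> exists d, (0 < d)%R /\ forall w, (Cmod (w - z) < d)%R -> P w.
Proof.
  split.
  - intros [d Hd]. exists d. split; [apply cond_pos|]. intros w Hw. apply Hd.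
    split; unfold ball; simpl; unfold AbsRing_ball, abs, minus, plus, opp; simpl.
    + eapply Rle_lt_trans; [apply (Cmod_fst (w - z))|exact Hw].
    + eapply Rle_lt_trans; [apply (Cmod_snd (w - z))|exact Hw].
  - intros [d [Hd H]]. exists (mkposreal _ (Rlt_half d Hd)). intros w [H1 H2]. apply H.
    unfold ball in H1, H2; simpl in H1, H2; unfold AbsRing_ball, abs, minus, plus, opp in H1, H2; simpl in H1, H2.
    eapply Rle_lt_trans; [apply Cmod_le_sum|]. Csimp. unfold Rminus in *. lra.
Qed.

Lemma ccont_ball (f : C -> C) z :
  @ccont C_UniformSpace f z <->
  forall e, (0 < e)%R -> exists d, (0 < d)%R /\ forall w, (Cmod (w - z) < d)%R -> (Cmod (f w - f z) < e)%R.
Proof.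
  split; intros H e He.
  - apply locally_Cmod. now apply H.
  - apply (proj2 (locally_Cmod _ _)). now apply H.
Qed.

(** The complex derivative, phrased so that the usual epsilon estimates apply
    directly. *)
Definition cder (f : C -> C) (z l : C) : Prop :=
  forall e, (0 < e)%R -> exists d, (0 < d)%R /\ forall w, (Cmod (w - z) < d)%R ->
    (Cmod (f w - f z - l * (w - z)) <= e * Cmod (w - z))%R.

Lemma cder_is_derive (f : C -> C) (z l : C) : cder f z l <-> @is_derive C_AbsRing C_NormedModule f z l.
Proof.
  split.
  - intros H. split.
    + apply (is_linear_scal_l (K := C_AbsRing) (V := C_NormedModule)).
    + intros x Hx e.
      apply (is_filter_lim_locally_unique (K:=C_AbsRing) (V:=AbsRing_NormedModule C_AbsRing)) in Hx.
      subst x.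
      destruct (H e (cond_pos e)) as [d [Hd Hw]].
      exists (mkposreal d Hd). intros w Hb.
      specialize (Hw w Hb).
      change (norm (minus (minus (f w) (f z)) (scal (minus w z) l)))
        with (Cmod (f w - f z - (w - z) * l)).
      rewrite (Cmult_comm (w - z) l). exact Hw.
  - intros [_ H] e He.
    destruct (H z (fun P HP => HP) (mkposreal e He)) as [d Hd].
    exists d. split; [apply cond_pos|]. intros w Hw.
    specialize (Hd w Hw).
    change (norm (minus (minus (f w) (f z)) (scal (minus w z) l)))
        with (Cmod (f w - f z - (w - z) * l)) in Hd.
    rewrite (Cmult_comm (w - z) l) in Hd. exact Hd.
Qed.

Lemma holomorphic_cder (f : C -> C) (z : C) : holomorphic_at f z <-> exists l, cder f z l.
Proof.
  unfold holomorphic_at, ex_derive.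
  split; intros [l H]; exists l; now apply cder_is_derive.
Qed.

Lemma cder_holo (f : C -> C) (z l : C) : cder f z l -> holomorphic_at f z.
Proof. intros H. apply holomorphic_cder. now exists l. Qed.

(** Caratheodory's form of the derivative reduces the rules of
    differentiation to rules about limits. *)
Lemma cder_cara (f : C -> C) (z l : C) :
  cder f z l <-> exists q : C -> C, @ccont C_UniformSpace q z /\ q z = l /\
    forall w, f w = f z + q w * (w - z).
Proof.
  split.
  - intros H.
    exists (fun w => if Ceq_dec w z then l else (f w - f z) / (w - z)).
    split; [|split].
    + apply ccont_ball. intros e He.
      destruct (H _ (Rlt_half e He)) as [d [Hd Hw]].
      exists d. split; [exact Hd|]. intros w Hwz.
      destruct (Ceq_dec z z) as [_|N]; [|congruence].
      destruct (Ceq_dec w z) as [E|E].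
      * replace (l - l) with (RtoC 0) by ring. rewrite Cmod_0; lra.
      * assert (E' : w - z <> 0) by (apply Cminus_eq_contra; exact E).
        assert (0 < Cmod (w - z))%R by now apply Cmod_pos.
        replace ((f w - f z) / (w - z) - l) with ((f w - f z - l * (w - z)) / (w - z)) by (field; auto).
        rewrite Cmod_div by auto.
        specialize (Hw w Hwz).
        apply Rle_lt_trans with (e/2)%R; [|lra].
        apply Rmult_le_reg_r with (Cmod (w - z)); [auto|].
        unfold Rdiv at 1. rewrite Rmult_assoc, Rinv_l by lra. lra.
    + destruct (Ceq_dec z z); congruence.
    + intros w. destruct (Ceq_dec w z) as [->|E]; [ring|].
      assert (E' : w - z <> 0) by (apply Cminus_eq_contra; exact E).
      field; auto.
  - intros [q [Hq [<- E]]] e He.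
    destruct (proj1 (ccont_ball q z) Hq e He) as [d [Hd Hw]].
    exists d; split; [exact Hd|]. intros w Hwz.
    replace (f w - f z - q z * (w - z)) with ((q w - q z) * (w - z)).
    2:{ rewrite (E w). ring. }
    rewrite Cmod_mult. apply Rmult_le_compat_r; [apply Cmod_ge_0|].
    left; auto.
Qed.

Lemma cder_cont (f : C -> C) (z l : C) : cder f z l -> @ccont C_UniformSpace f z.
Proof.
  intros H. apply cder_cara in H. destruct H as [q [Hq [_ E]]].
  unfold ccont.
  capply (clim_ext _ (fun w => f z + q w * (w - z))); [intros; symmetry; apply E|].
  assert (L : clim (@locally C_UniformSpace z) (fun w => f z + q w * (w - z)) (f z + q z * (z - z))).
  { capply clim_plus; [capply clim_const|]. capply clim_mult; [exact Hq|].
    capply clim_minus; [|capply clim_const].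
    intros e He. apply (proj2 (locally_Cmod _ _)). exists e. auto. }
  replace (f z + q z * (z - z)) with (f z) in L by ring. exact L.
Qed.

Lemma holo_cont (f : C -> C) (z : C) : holomorphic_at f z -> @ccont C_UniformSpace f z.
Proof. intros H. apply holomorphic_cder in H. destruct H as [l H]. now apply cder_cont in H. Qed.

Lemma cder_const (c z : C) : cder (fun _ => c) z 0.
Proof.
  intros e He. exists 1%R. split; [lra|]. intros w _.
  replace (c - c - 0 * (w - z)) with (RtoC 0) by ring. rewrite Cmod_0.
  assert (A := Cmod_ge_0 (w - z)). nra.
Qed.

Lemma cder_id (z : C) : cder (fun w => w) z 1.
Proof.
  intros e He. exists 1%R. split; [lra|]. intros w _.
  replace (w - z - 1 * (w - z)) with (RtoC 0) by ring. rewrite Cmod_0.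
  assert (A := Cmod_ge_0 (w - z)). nra.
Qed.

Lemma cder_plus (f g : C -> C) (z a b : C) : cder f z a -> cder g z b -> cder (fun w => f w + g w) z (a + b).
Proof.
  rewrite !cder_cara. intros [q [Hq [<- E]]] [p [Hp [<- F]]].
  exists (fun w => q w + p w). repeat split; [|intros w; rewrite (E w), (F w); ring].
  now capply clim_plus.
Qed.

Lemma cder_mult (f g : C -> C) (z a b : C) : cder f z a -> cder g z b ->
  cder (fun w => f w * g w) z (a * g z + f z * b).
Proof.
  intros Hf Hg. assert (Cg := cder_cont _ _ _ Hg).
  revert Hf Hg.
  rewrite !cder_cara. intros [q [Hq [<- E]]] [p [Hp [<- F]]].
  exists (fun w => q w * g w + f z * p w). repeat split.
  - capply clim_plus; capply clim_mult; try capply clim_const; assumption.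
  - intros w. rewrite (E w). rewrite (F w) at 1 2. ring.
Qed.

Lemma cder_opp (f : C -> C) (z a : C) : cder f z a -> cder (fun w => - f w) z (- a).
Proof.
  rewrite !cder_cara. intros [q [Hq [<- E]]].
  exists (fun w => - q w). repeat split; [|intros w; rewrite (E w); ring].
  now capply clim_opp.
Qed.

Lemma cder_minus (f g : C -> C) (z a b : C) : cder f z a -> cder g z b -> cder (fun w => f w - g w) z (a - b).
Proof. intros Hf Hg. apply cder_plus; [auto|now apply cder_opp]. Qed.

Lemma cder_comp (f g : C -> C) (z a b : C) : cder g z b -> cder f (g z) a -> cder (fun w => f (g w)) z (a * b).
Proof.
  intros Hg Hf. assert (Cg := cder_cont _ _ _ Hg). revert Hf Hg.
  rewrite !cder_cara. intros [q [Hq [<- E]]] [p [Hp [<- F]]].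
  exists (fun w => q (g w) * p w). repeat split.
  - capply clim_mult; [|exact Hp].
    apply (ccont_comp (T := C_UniformSpace) (U := C_UniformSpace) g q); [exact Hq|].
    now apply ccont_continuous.
  - intros w. rewrite (E (g w)). rewrite (F w) at 2. ring.
Qed.

Lemma cder_ext_loc (f g : C -> C) (z l : C) (d : R) : (0 < d)%R -> (forall w, (Cmod (w - z) < d)%R -> f w = g w) ->
  cder f z l -> cder g z l.
Proof.
  intros Hd E H e He. destruct (H e He) as [d' [Hd' Hw]].
  exists (Rmin d d'). split; [now apply Rmin_pos|]. intros w Hwz.
  rewrite <- (E w), <- (E z).
  - apply Hw. eapply Rlt_le_trans; [exact Hwz|apply Rmin_r].
  - replace (z - z) with (RtoC 0) by ring. now rewrite Cmod_0.
  - eapply Rlt_le_trans; [exact Hwz|apply Rmin_l].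
Qed.

Lemma cder_inv (f : C -> C) (z a : C) : f z <> 0 -> cder f z a -> cder (fun w => / f w) z (- a / (f z * f z)).
Proof.
  intros Hz Hf. assert (Cf := cder_cont _ _ _ Hf).
  assert (P : (0 < Cmod (f z))%R) by now apply Cmod_pos.
  destruct (proj1 (ccont_ball f z) Cf _ P) as [d [Hd Hw]].
  assert (NZ : forall w, (Cmod (w - z) < d)%R -> f w <> 0).
  { intros w Hwz E. specialize (Hw w Hwz). rewrite E in Hw.
    replace (0 - f z) with (- f z) in Hw by ring. rewrite Cmod_opp in Hw. lra. }
  assert (Inv := clim_inv (locally (z : C_UniformSpace)) f (f z) Hz Cf).
  revert Hf.
  rewrite !cder_cara. intros [q [Hq [<- E]]].
  exists (fun w => if excluded_middle_informative (Cmod (w - z) < d)%R then - q w * (/ f w * / f z) else (/ f w - / f z) / (w - z)).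
  assert (zz : (Cmod (z - z) < d)%R).
  { replace (z - z) with (RtoC 0) by ring. now rewrite Cmod_0. }
  repeat split.
  - unfold ccont. destruct (excluded_middle_informative (Cmod (z - z) < d)%R) as [L|N]; [|now elim N].
    eapply clim_ext_loc with (fun w => - q w * (/ f w * / f z)); [typeclasses eauto| |].
    + apply (proj2 (locally_Cmod _ _)). exists d; split; [auto|]. intros w Hwz.
      destruct (excluded_middle_informative (Cmod (w - z) < d)%R); [auto|tauto].
    + capply clim_mult; [|capply clim_mult].
      * now capply clim_opp.
      * exact Inv.
      * capply clim_const.
  - destruct (excluded_middle_informative (Cmod (z - z) < d)%R) as [L|N]; [|now elim N].
    field. auto.
  - intros w. destruct (excluded_middle_informative (Cmod (w - z) < d)%R) as [L|N].
    + assert (f w <> 0) by auto.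
      replace (- q w * (/ f w * / f z) * (w - z)) with (- (q w * (w - z)) * (/ f w * / f z)) by ring.
      replace (q w * (w - z)) with (f w - f z) by (rewrite (E w); ring).
      field; auto.
    + assert (w - z <> 0).
      { intros Z. apply N. rewrite Z, Cmod_0. auto. }
      unfold Cdiv. rewrite <- Cmult_assoc, Cinv_l by auto. ring.
Qed.

Lemma cder_pow (f : C -> C) (z a : C) (n : nat) : cder f z a -> exists l, cder (fun w => f w ^ n) z l.
Proof.
  intros H. induction n as [|n [l IH]].
  - exists 0. simpl. apply cder_const.
  - eexists. simpl. apply cder_mult; eauto.
Qed.

Lemma holo_ext_loc (f g : C -> C) (z : C) (d : R) : (0 < d)%R -> (forall w, (Cmod (w - z) < d)%R -> f w = g w) ->
  holomorphic_at f z -> holomorphic_at g z.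
Proof.
  rewrite !holomorphic_cder. intros Hd E [l H]. exists l. eapply cder_ext_loc; eauto.
Qed.

Lemma holo_const (c z : C) : holomorphic_at (fun _ => c) z.
Proof. eapply cder_holo, cder_const. Qed.
Lemma holo_id (z : C) : holomorphic_at (fun w => w) z.
Proof. eapply cder_holo, cder_id. Qed.
Lemma holo_plus (f g : C -> C) (z : C) : holomorphic_at f z -> holomorphic_at g z -> holomorphic_at (fun w => f w + g w) z.
Proof. rewrite !holomorphic_cder. intros [a Ha] [b Hb]. eexists. apply cder_plus; eauto. Qed.
Lemma holo_minus (f g : C -> C) (z : C) : holomorphic_at f z -> holomorphic_at g z -> holomorphic_at (fun w => f w - g w) z.
Proof. rewrite !holomorphic_cder. intros [a Ha] [b Hb]. eexists. apply cder_minus; eauto. Qed.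
Lemma holo_mult (f g : C -> C) (z : C) : holomorphic_at f z -> holomorphic_at g z -> holomorphic_at (fun w => f w * g w) z.
Proof. rewrite !holomorphic_cder. intros [a Ha] [b Hb]. eexists. apply cder_mult; eauto. Qed.
Lemma holo_opp (f : C -> C) (z : C) : holomorphic_at f z -> holomorphic_at (fun w => - f w) z.
Proof. rewrite !holomorphic_cder. intros [a Ha]. eexists. apply cder_opp; eauto. Qed.
Lemma holo_inv (f : C -> C) (z : C) : f z <> 0 -> holomorphic_at f z -> holomorphic_at (fun w => / f w) z.
Proof. intros N. rewrite !holomorphic_cder. intros [a Ha]. eexists. apply cder_inv; eauto. Qed.
Lemma holo_div (f g : C -> C) (z : C) : g z <> 0 -> holomorphic_at f z -> holomorphic_at g z -> holomorphic_at (fun w => f w / g w) z.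
Proof. intros N Hf Hg. apply holo_mult; [auto|now apply holo_inv]. Qed.
Lemma holo_pow (f : C -> C) (z : C) (n : nat) : holomorphic_at f z -> holomorphic_at (fun w => f w ^ n) z.
Proof. rewrite !holomorphic_cder. intros [a Ha]. eapply cder_pow; eauto. Qed.
Lemma holo_comp (f g : C -> C) (z : C) : holomorphic_at g z -> holomorphic_at f (g z) -> holomorphic_at (fun w => f (g w)) z.
Proof. rewrite !holomorphic_cder. intros [a Ha] [b Hb]. eexists. eapply cder_comp; eauto. Qed.

(** * Paths in the plane and their integrals *)

(** The derivative along a real parameter, that is, the velocity of a path. *)
Definition pder (f : R -> C) (t : R) (l : C) : Prop := @is_derive R_AbsRing C_R_NormedModule f t l.

Lemma locally_R (t : R) (P : R -> Prop) :
  locally t P <-> exists d, (0 < d)%R /\ forall u, (Rabs (u - t) < d)%R -> P u.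
Proof.
  split.
  - intros [d Hd]. exists d. split; [apply cond_pos|exact Hd].
  - intros [d [Hd H]]. exists (mkposreal d Hd). exact H.
Qed.

Lemma pder_eps (f : R -> C) (t : R) (l : C) :
  pder f t l <-> forall e, (0 < e)%R -> exists d, (0 < d)%R /\ forall u, (Rabs (u - t) < d)%R ->
    (Cmod (f u - f t - l * RtoC (u - t)) <= e * Rabs (u - t))%R.
Proof.
  assert (Q : forall u : R, @norm R_AbsRing C_R_NormedModule (@minus C_R_NormedModule (@minus C_R_NormedModule (f u) (f t)) (@scal R_AbsRing C_R_NormedModule (minus u t) l))
        = Cmod (f u - f t - l * RtoC (u - t))).
  { intros u. change (@scal R_AbsRing C_R_NormedModule (minus u t) l)
      with (@scal R_Ring C_R_ModuleSpace (u - t)%R l).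
    rewrite scal_R_Cmult. rewrite (Cmult_comm l). symmetry. apply Cmod_norm. }
  split.
  - intros [_ H] e He.
    destruct (H t (fun P HP => HP) (mkposreal e He)) as [d Hd].
    exists d. split; [apply cond_pos|]. intros u Hu.
    specialize (Hd u Hu). cbv beta in Hd. rewrite Q in Hd. exact Hd.
  - intros H. split.
    + apply (is_linear_scal_l (K := R_AbsRing) (V := C_R_NormedModule)).
    + intros x Hx e.
      apply (is_filter_lim_locally_unique (K:=R_AbsRing) (V:=AbsRing_NormedModule R_AbsRing)) in Hx.
      subst x.
      destruct (H e (cond_pos e)) as [d [Hd Hw]].
      exists (mkposreal d Hd). intros u Hb. cbv beta. rewrite Q. apply Hw. exact Hb.
Qed.

(** The same reduction of derivative rules to limit rules as for [cder_cara]. *)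
Lemma pder_cara (f : R -> C) (t : R) (l : C) :
  pder f t l <-> exists q : R -> C, @ccont R_UniformSpace q t /\ q t = l /\
    forall u, f u = f t + q u * RtoC (u - t).
Proof.
  rewrite pder_eps. split.
  - intros H.
    exists (fun u => if Req_EM_T u t then l else (f u - f t) / RtoC (u - t)).
    repeat split.
    + intros e He. destruct (H _ (Rlt_half e He)) as [d [Hd Hw]].
      apply (proj2 (locally_R _ _)). exists d; split; [auto|]. intros u Hu.
      destruct (Req_EM_T t t) as [_|N]; [|congruence].
      destruct (Req_EM_T u t) as [E|E].
      * replace (l - l) with (RtoC 0) by ring. rewrite Cmod_0; lra.
      * assert (E' : (u - t <> 0)%R) by lra.
        assert (E2 : RtoC (u - t) <> 0) by (intros Z; apply E'; now apply RtoC_inj).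
        replace ((f u - f t) / RtoC (u - t) - l) with ((f u - f t - l * RtoC (u - t)) / RtoC (u - t)) by (field; auto).
        rewrite Cmod_div by auto. rewrite Cmod_R.
        assert (0 < Rabs (u - t))%R by now apply Rabs_pos_lt.
        specialize (Hw u Hu).
        apply Rle_lt_trans with (e/2)%R; [|lra].
        apply Rmult_le_reg_r with (Rabs (u - t)); [auto|].
        unfold Rdiv at 1. rewrite Rmult_assoc, Rinv_l by lra. lra.
    + destruct (Req_EM_T t t); congruence.
    + intros u. destruct (Req_EM_T u t) as [->|E].
      * replace (t - t)%R with 0%R by ring. ring.
      * assert (E2 : RtoC (u - t) <> 0) by (intros Z; apply E; apply RtoC_inj in Z; lra).
        field; auto.
  - intros [q [Hq [<- E]]] e He.
    destruct (proj1 (locally_R _ _) (Hq e He)) as [d [Hd Hw]].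
    exists d; split; [auto|]. intros u Hu.
    replace (f u - f t - q t * RtoC (u - t)) with ((q u - q t) * RtoC (u - t)) by (rewrite (E u); ring).
    rewrite Cmod_mult, Cmod_R. apply Rmult_le_compat_r; [apply Rabs_pos|]. left; auto.
Qed.

Lemma clim_RtoC_id (t a : R) : clim (locally t) (fun u => RtoC (u - a)) (RtoC (t - a)).
Proof.
  intros e He. apply (proj2 (locally_R _ _)). exists e; split; [auto|]. intros u Hu.
  rewrite <- RtoC_minus. replace (u - a - (t - a))%R with (u - t)%R by ring. now rewrite Cmod_R.
Qed.

Lemma pder_cont (f : R -> C) (t : R) (l : C) : pder f t l -> @ccont R_UniformSpace f t.
Proof.
  intros H. apply pder_cara in H. destruct H as [q [Hq [_ E]]].
  capply (clim_ext _ (fun u => f t + q u * RtoC (u - t))); [intros; symmetry; apply E|].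
  assert (L : clim (locally t) (fun u => f t + q u * RtoC (u - t)) (f t + q t * RtoC (t - t))).
  { capply clim_plus; [capply clim_const|]. capply clim_mult; [exact Hq|apply clim_RtoC_id]. }
  replace (t - t)%R with 0%R in L by ring. replace (f t + q t * 0) with (f t) in L by ring. exact L.
Qed.

Lemma pder_const (c : C) (t : R) : pder (fun _ => c) t 0.
Proof.
  apply pder_cara. exists (fun _ => 0). repeat split; [apply clim_const; typeclasses eauto|intros; ring].
Qed.

Lemma pder_plus (f g : R -> C) (t : R) (a b : C) : pder f t a -> pder g t b -> pder (fun u => f u + g u) t (a + b).
Proof.
  rewrite !pder_cara. intros [q [Hq [<- E]]] [p [Hp [<- F]]].
  exists (fun w => q w + p w). repeat split; [|intros w; rewrite (E w), (F w); ring].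
  now capply clim_plus.
Qed.

Lemma pder_mult (f g : R -> C) (t : R) (a b : C) : pder f t a -> pder g t b ->
  pder (fun u => f u * g u) t (a * g t + f t * b).
Proof.
  intros Hf Hg. assert (Cg := pder_cont _ _ _ Hg). revert Hf Hg.
  rewrite !pder_cara. intros [q [Hq [<- E]]] [p [Hp [<- F]]].
  exists (fun w => q w * g w + f t * p w). repeat split.
  - capply clim_plus; capply clim_mult; try capply clim_const; assumption.
  - intros w. rewrite (E w). rewrite (F w) at 1 2. ring.
Qed.

Lemma pder_opp (f : R -> C) (t : R) (a : C) : pder f t a -> pder (fun u => - f u) t (- a).
Proof.
  rewrite !pder_cara. intros [q [Hq [<- E]]].
  exists (fun w => - q w). repeat split; [|intros w; rewrite (E w); ring].
  now capply clim_opp.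
Qed.

Lemma pder_minus (f g : R -> C) (t : R) (a b : C) : pder f t a -> pder g t b -> pder (fun u => f u - g u) t (a - b).
Proof. intros Hf Hg. apply pder_plus; [auto|now apply pder_opp]. Qed.

Lemma pder_comp (f : C -> C) (g : R -> C) (t : R) (a b : C) :
  pder g t b -> cder f (g t) a -> pder (fun u => f (g u)) t (a * b).
Proof.
  intros Hg Hf. assert (Cg := pder_cont _ _ _ Hg). revert Hf Hg.
  rewrite cder_cara, !pder_cara. intros [q [Hq [<- E]]] [p [Hp [<- F]]].
  exists (fun w => q (g w) * p w). repeat split.
  - capply clim_mult; [|exact Hp].
    apply (ccont_comp (T := R_UniformSpace) (U := C_UniformSpace) g q); [exact Hq|].
    now apply ccont_continuous.
  - intros w. rewrite (E (g w)). rewrite (F w) at 2. ring.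
Qed.

Lemma pder_ext (f g : R -> C) (t : R) (l : C) : (forall u, f u = g u) -> pder f t l -> pder g t l.
Proof. intros E. apply is_derive_ext. exact E. Qed.

Lemma pder_eq (f : R -> C) (t : R) (l m : C) : l = m -> pder f t l -> pder f t m.
Proof. now intros ->. Qed.

Lemma cder_eq (f : C -> C) (z l m : C) : l = m -> cder f z l -> cder f z m.
Proof. now intros ->. Qed.

Lemma pder_pair (x y : R -> R) (t a b : R) :
  is_derive x t a -> is_derive y t b -> pder (fun u => (x u, y u)) t (a, b).
Proof.
  intros Hx Hy. apply pder_eps. intros e He.
  apply is_derive_Reals in Hx. apply is_derive_Reals in Hy.
  destruct (Hx _ (Rlt_half e He)) as [d1 H1]. destruct (Hy _ (Rlt_half e He)) as [d2 H2].
  exists (Rmin d1 d2). split; [apply Rmin_pos; apply cond_pos|]. intros u Hu.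
  destruct (Req_dec u t) as [->|N].
  - replace (t - t)%R with 0%R by ring.
    match goal with |- (Cmod ?z <= _)%R => replace z with (RtoC 0) by (Cext; ring) end.
    rewrite Cmod_0, Rabs_R0. lra.
  - assert (Hh : (u - t <> 0)%R) by lra.
    specialize (H1 (u - t)%R Hh (Rlt_le_trans _ _ _ Hu (Rmin_l _ _))).
    specialize (H2 (u - t)%R Hh (Rlt_le_trans _ _ _ Hu (Rmin_r _ _))).
    replace (t + (u - t))%R with u in H1, H2 by ring.
    assert (P : (0 < Rabs (u - t))%R) by now apply Rabs_pos_lt.
    assert (K : forall z p q : R, (Rabs ((p - q) / (u - t) - z) < e / 2 -> Rabs (p - q - z * (u - t)) <= e / 2 * Rabs (u - t))%R).
    { intros z p q H.
      replace (p - q - z * (u - t))%R with (((p - q) / (u - t) - z) * (u - t))%R by (field; auto).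
      rewrite Rabs_mult. apply Rmult_le_compat_r; lra. }
    apply K in H1. apply K in H2.
    eapply Rle_trans; [apply Cmod_le_sum|].
    replace (e * Rabs (u - t))%R with (e / 2 * Rabs (u - t) + e / 2 * Rabs (u - t))%R by field.
    apply Rplus_le_compat.
    + eapply Rle_trans; [|exact H1]. right. f_equal. Csimp. ring.
    + eapply Rle_trans; [|exact H2]. right. f_equal. Csimp. ring.
Qed.

Lemma pder_RtoC (x : R -> R) (t a : R) : is_derive x t a -> pder (fun u => RtoC (x u)) t (RtoC a).
Proof. intros H. apply pder_pair; [exact H|]. apply is_derive_Reals, derivable_pt_lim_const. Qed.

Lemma pder_id (t : R) : pder RtoC t 1.
Proof. apply pder_RtoC. apply is_derive_Reals, derivable_pt_lim_id. Qed.

(** ** Integrals over segments *)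

Definition Cis_RInt (f : R -> C) (a b : R) (l : C) : Prop := @is_RInt C_R_NormedModule f a b l.
Definition CRInt (f : R -> C) (a b : R) : C := @RInt C_R_CompleteNormedModule f a b.

Lemma C_ex_RInt (f : R -> C) (a b : R) :
  (forall x, (Rmin a b <= x <= Rmax a b)%R -> ccont f x) -> @ex_RInt C_R_NormedModule f a b.
Proof.
  intros H. apply (ex_RInt_continuous (V := C_R_CompleteNormedModule)).
  intros z Hz. apply ccont_continuous. now apply H.
Qed.

Lemma C_RInt_correct (f : R -> C) (a b : R) :
  (forall x, (Rmin a b <= x <= Rmax a b)%R -> ccont f x) -> Cis_RInt f a b (CRInt f a b).
Proof. intros H. apply (RInt_correct (V := C_R_CompleteNormedModule)). now apply C_ex_RInt. Qed.

Lemma C_RInt_unique (f : R -> C) (a b : R) (l : C) : Cis_RInt f a b l -> CRInt f a b = l.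
Proof. apply (is_RInt_unique (V := C_R_CompleteNormedModule)). Qed.

Lemma C_is_RInt_unique (f : R -> C) (a b : R) (l m : C) : Cis_RInt f a b l -> Cis_RInt f a b m -> l = m.
Proof. intros H1 H2. rewrite <- (C_RInt_unique _ _ _ _ H1). now apply C_RInt_unique. Qed.

Lemma C_RInt_FTC (f df : R -> C) (a b : R) :
  (forall x, (Rmin a b <= x <= Rmax a b)%R -> pder f x (df x)) ->
  (forall x, (Rmin a b <= x <= Rmax a b)%R -> ccont df x) ->
  Cis_RInt df a b (f b - f a).
Proof.
  intros H1 H2. apply (is_RInt_derive (V := C_R_CompleteNormedModule) f df a b); [exact H1|].
  intros x Hx. apply ccont_continuous. now apply H2.
Qed.

Lemma C_is_RInt_plus (f g : R -> C) (a b : R) (l m : C) :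
  Cis_RInt f a b l -> Cis_RInt g a b m -> Cis_RInt (fun x => f x + g x) a b (l + m).
Proof. apply (is_RInt_plus (V := C_R_NormedModule)). Qed.

Lemma C_is_RInt_minus (f g : R -> C) (a b : R) (l m : C) :
  Cis_RInt f a b l -> Cis_RInt g a b m -> Cis_RInt (fun x => f x - g x) a b (l - m).
Proof. apply (is_RInt_minus (V := C_R_NormedModule)). Qed.

Lemma C_is_RInt_ext (f g : R -> C) (a b : R) (l : C) :
  (forall x, (Rmin a b < x < Rmax a b)%R -> f x = g x) -> Cis_RInt f a b l -> Cis_RInt g a b l.
Proof. apply (is_RInt_ext (V := C_R_NormedModule)). Qed.

Lemma C_is_RInt_scal (f : R -> C) (a b : R) (c l : C) :
  Cis_RInt f a b l -> Cis_RInt (fun x => c * f x) a b (c * l).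
Proof.
  intros H. destruct c as [u v]. destruct l as [p q].
  assert (H1 := is_RInt_fct_extend_fst (U := R_NormedModule) (V := R_NormedModule) _ _ _ _ H).
  assert (H2 := is_RInt_fct_extend_snd (U := R_NormedModule) (V := R_NormedModule) _ _ _ _ H).
  simpl in H1, H2.
  apply (is_RInt_fct_extend_pair (U := R_NormedModule) (V := R_NormedModule)); simpl.
  - apply (is_RInt_minus (V := R_NormedModule)); apply (is_RInt_scal (V := R_NormedModule)); assumption.
  - apply (is_RInt_plus (V := R_NormedModule)); apply (is_RInt_scal (V := R_NormedModule)); assumption.
Qed.

Lemma C_is_RInt_RtoC (f : R -> R) (a b l : R) : is_RInt f a b l -> Cis_RInt (fun x => RtoC (f x)) a b (RtoC l).
Proof.
  intros H. apply (is_RInt_fct_extend_pair (U := R_NormedModule) (V := R_NormedModule)); simpl; [exact H|].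
  assert (Z := is_RInt_const (V := R_NormedModule) a b 0%R).
  replace (scal (b - a)%R (0%R : R_NormedModule)) with 0%R in Z; [exact Z|].
  unfold scal; simpl; unfold mult; simpl; ring.
Qed.

Lemma C_is_RInt_Chasles (f : R -> C) (a b c : R) (l m : C) :
  Cis_RInt f a b l -> Cis_RInt f b c m -> Cis_RInt f a c (l + m).
Proof. apply (is_RInt_Chasles (V := C_R_NormedModule)). Qed.

Lemma C_is_RInt_swap (f : R -> C) (a b : R) (l : C) : Cis_RInt f b a l -> Cis_RInt f a b (- l).
Proof. apply (is_RInt_swap (V := C_R_NormedModule)). Qed.

Lemma C_is_RInt_const (c : C) (a b : R) : Cis_RInt (fun _ => c) a b (c * RtoC (b - a)).
Proof.
  assert (H := is_RInt_const (V := C_R_NormedModule) a b c).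
  replace (c * RtoC (b - a)) with (@scal R_AbsRing C_R_NormedModule (b - a)%R c); [exact H|].
  rewrite Cmult_comm. apply scal_R_Cmult.
Qed.

Lemma C_RInt_norm_le (f : R -> C) (g : R -> R) (a b : R) (l : C) (m : R) : (a <= b)%R ->
  (forall x, (a <= x <= b)%R -> (Cmod (f x) <= g x)%R) ->
  Cis_RInt f a b l -> is_RInt g a b m -> (Cmod l <= m)%R.
Proof.
  intros Hab H Hf Hg. rewrite Cmod_norm.
  refine (norm_RInt_le (V := C_R_NormedModule) f g a b l m Hab _ Hf Hg).
  intros x Hx. specialize (H x Hx). rewrite Cmod_norm in H. exact H.
Qed.

Lemma C_RInt_norm_const (f : R -> C) (M a b : R) (l : C) : (a <= b)%R ->
  (forall x, (a <= x <= b)%R -> (Cmod (f x) <= M)%R) ->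
  Cis_RInt f a b l -> (Cmod l <= M * (b - a))%R.
Proof.
  intros Hab H Hf. eapply C_RInt_norm_le with (g := fun _ => M); eauto.
  assert (Q := is_RInt_const (V := R_NormedModule) a b M).
  rewrite Rmult_comm. exact Q.
Qed.

(** ** The complex exponential *)

Lemma Cexp_plus (z w : C) : Cexp (z + w) = Cexp z * Cexp w.
Proof.
  unfold Cexp. destruct z as [a b], w as [c d]. Csimp.
  rewrite exp_plus, cos_plus, sin_plus. apply injective_projections; simpl; ring.
Qed.

Lemma Cexp_0 : Cexp 0 = 1.
Proof. unfold Cexp. Csimp. rewrite exp_0, cos_0, sin_0. apply injective_projections; simpl; ring. Qed.

Lemma Cexp_RtoC (x : R) : Cexp (RtoC x) = RtoC (exp x).
Proof. unfold Cexp. Csimp. rewrite cos_0, sin_0. apply injective_projections; simpl; ring. Qed.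

Lemma Cmod_Cexp (z : C) : Cmod (Cexp z) = exp (Re z).
Proof.
  unfold Cexp. rewrite Cmod_mult, Cmod_R. rewrite Rabs_pos_eq by (left; apply exp_pos).
  replace (Cmod (cos (Im z), sin (Im z))) with 1%R; [ring|].
  unfold Cmod; simpl. rewrite !Rmult_1_r.
  replace (cos (Im z) * cos (Im z) + sin (Im z) * sin (Im z))%R with 1%R; [now rewrite sqrt_1|].
  generalize (sin2_cos2 (Im z)). unfold Rsqr. lra.
Qed.

Lemma Cexp_nz (z : C) : Cexp z <> 0.
Proof. apply Cmod_neq. rewrite Cmod_Cexp. apply exp_pos. Qed.

Lemma Cexp_opp (z : C) : Cexp (- z) = / Cexp z.
Proof.
  assert (N := Cexp_nz z).
  assert (E : Cexp (- z) * Cexp z = 1).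
  { rewrite <- Cexp_plus. replace (- z + z) with (RtoC 0) by ring. apply Cexp_0. }
  replace (Cexp (- z)) with (Cexp (- z) * Cexp z * / Cexp z) by (field; auto).
  rewrite E. ring.
Qed.

(** The exponential is only known through exp, cos and sin, which the real
    calculus differentiates along rays; the bounds of its first and second order
    remainders follow by integration along [0, 1] and give [cder_Cexp]. *)
Lemma pder_Cexp_line (z : C) (t : R) : pder (fun u => Cexp (RtoC u * z)) t (z * Cexp (RtoC t * z)).
Proof.
  destruct z as [a b].
  apply pder_ext with (fun u => (exp (u * a) * cos (u * b), exp (u * a) * sin (u * b))%R).
  { intros u. unfold Cexp. Cext.
    - replace (u * a - 0 * b)%R with (u * a)%R by ring. replace (u * b + 0 * a)%R with (u * b)%R by ring. ring.
    - replace (u * a - 0 * b)%R with (u * a)%R by ring. replace (u * b + 0 * a)%R with (u * b)%R by ring. ring. }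
  eapply pder_eq; [|apply pder_pair; auto_derive; auto].
  unfold Cexp. Cext;
    replace (t * a - 0 * b)%R with (t * a)%R by ring; replace (t * b + 0 * a)%R with (t * b)%R by ring; ring.
Qed.

Lemma ccont_Cexp_line (z : C) (t : R) : @ccont R_UniformSpace (fun u => Cexp (RtoC u * z)) t.
Proof. eapply pder_cont, pder_Cexp_line. Qed.

Lemma exp_le_mono (x y : R) : (x <= y -> exp x <= exp y)%R.
Proof. intros [H| ->]; [left; now apply exp_increasing|right; auto]. Qed.

Lemma Re_le_Cmod (z : C) : (Re z <= Cmod z)%R.
Proof. eapply Rle_trans; [apply Rle_abs|apply Cmod_fst]. Qed.

Lemma Cexp_bound1 (z : C) : (Cmod (Cexp z - 1) <= Cmod z * exp (Cmod z))%R.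
Proof.
  assert (I : Cis_RInt (fun t => z * Cexp (RtoC t * z)) 0 1 (Cexp (RtoC 1 * z) - Cexp (RtoC 0 * z))).
  { apply (C_RInt_FTC (fun t => Cexp (RtoC t * z))); intros x _.
    - apply pder_Cexp_line.
    - capply clim_mult; [capply clim_const|apply ccont_Cexp_line]. }
  replace (RtoC 1 * z) with z in I by ring. replace (RtoC 0 * z) with (RtoC 0) in I by ring.
  rewrite Cexp_0 in I.
  replace (Cmod z * exp (Cmod z))%R with (Cmod z * exp (Cmod z) * (1 - 0))%R by ring.
  eapply C_RInt_norm_const; [lra| |exact I].
  intros t Ht. simpl. rewrite Cmod_mult, Cmod_Cexp.
  apply Rmult_le_compat_l; [apply Cmod_ge_0|]. apply exp_le_mono.
  eapply Rle_trans; [apply Re_le_Cmod|]. rewrite Cmod_mult, Cmod_R, Rabs_pos_eq by lra.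
  assert (P := Cmod_ge_0 z). nra.
Qed.

Lemma Cexp_bound2 (z : C) : (Cmod (Cexp z - 1 - z) <= Cmod z * Cmod z * exp (Cmod z))%R.
Proof.
  assert (I : Cis_RInt (fun t => z * Cexp (RtoC t * z) - z) 0 1 (Cexp (RtoC 1 * z) - Cexp (RtoC 0 * z) - z * RtoC (1 - 0))).
  { apply C_is_RInt_minus; [|apply C_is_RInt_const].
    apply (C_RInt_FTC (fun t => Cexp (RtoC t * z))); intros x _.
    - apply pder_Cexp_line.
    - capply clim_mult; [capply clim_const|apply ccont_Cexp_line]. }
  replace (RtoC 1 * z) with z in I by ring. replace (RtoC 0 * z) with (RtoC 0) in I by ring.
  rewrite Cexp_0 in I. replace (z * RtoC (1 - 0)) with z in I by (rewrite RtoC_minus; ring).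
  replace (Cmod z * Cmod z * exp (Cmod z))%R with (Cmod z * Cmod z * exp (Cmod z) * (1 - 0))%R by ring.
  eapply C_RInt_norm_const; [lra| |exact I].
  intros t Ht. simpl.
  replace (z * Cexp (RtoC t * z) - z) with (z * (Cexp (RtoC t * z) - 1)) by ring.
  rewrite Cmod_mult, Rmult_assoc. apply Rmult_le_compat_l; [apply Cmod_ge_0|].
  eapply Rle_trans; [apply Cexp_bound1|].
  assert (P := Cmod_ge_0 z).
  assert (Q : (Cmod (RtoC t * z) <= Cmod z)%R) by (rewrite Cmod_mult, Cmod_R, Rabs_pos_eq by lra; nra).
  apply Rmult_le_compat; [apply Cmod_ge_0|left; apply exp_pos|exact Q|now apply exp_le_mono].
Qed.

Lemma cder_Cexp (z : C) : cder Cexp z (Cexp z).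
Proof.
  intros e He.
  set (K := (Cmod (Cexp z) * exp 1)%R).
  assert (HK : (0 < K)%R) by (apply Rmult_lt_0_compat; [apply Cmod_pos, Cexp_nz|apply exp_pos]).
  exists (Rmin 1 (e / K)). split; [apply Rmin_pos; [lra|now apply Rdiv_lt_0_compat]|].
  intros w Hw.
  assert (H1 : (Cmod (w - z) <= 1)%R) by (left; eapply Rlt_le_trans; [exact Hw|apply Rmin_l]).
  assert (H2 : (Cmod (w - z) <= e / K)%R) by (left; eapply Rlt_le_trans; [exact Hw|apply Rmin_r]).
  replace (Cexp w - Cexp z - Cexp z * (w - z)) with (Cexp z * (Cexp (w - z) - 1 - (w - z))).
  2:{ replace (Cexp w) with (Cexp z * Cexp (w - z)); [ring|]. rewrite <- Cexp_plus. f_equal. ring. }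
  rewrite Cmod_mult.
  assert (P := Cmod_ge_0 (w - z)). set (h := Cmod (w - z)) in *.
  apply Rle_trans with (Cmod (Cexp z) * (h * h * exp 1))%R.
  { apply Rmult_le_compat_l; [apply Cmod_ge_0|]. eapply Rle_trans; [apply Cexp_bound2|].
    fold h. apply Rmult_le_compat_l; [nra|now apply exp_le_mono]. }
  replace (Cmod (Cexp z) * (h * h * exp 1))%R with (K * h * h)%R by (unfold K; ring).
  apply Rmult_le_compat_r; [auto|].
  apply Rmult_le_reg_r with (/ K)%R; [now apply Rinv_0_lt_compat|].
  replace (K * h * / K)%R with h by (field; lra). exact H2.
Qed.

Lemma holo_Cexp (f : C -> C) (z : C) : holomorphic_at f z -> holomorphic_at (fun w => Cexp (f w)) z.
Proof. intros H. apply (holo_comp Cexp f); [exact H|]. eapply cder_holo, cder_Cexp. Qed.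

Lemma ccont_Cexp {T : UniformSpace} (f : T -> C) (x : T) : ccont f x -> ccont (fun u => Cexp (f u)) x.
Proof.
  intros H. apply (ccont_comp (T:=T) (U:=C_UniformSpace) f Cexp).
  - eapply cder_cont, cder_Cexp.
  - now apply ccont_continuous.
Qed.

(** ** Complex powers of positive reals *)

Lemma cpow_plus (x : R) (s w : C) : cpow x (s + w) = cpow x s * cpow x w.
Proof. unfold cpow. rewrite <- Cexp_plus. f_equal. ring. Qed.

Lemma cpow_opp (x : R) (s : C) : cpow x (- s) = / cpow x s.
Proof. unfold cpow. rewrite <- Cexp_opp. f_equal. ring. Qed.

Lemma cpow_0 (x : R) : cpow x 0 = 1.
Proof. unfold cpow. replace (0 * RtoC (ln x)) with (RtoC 0) by ring. apply Cexp_0. Qed.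

Lemma cpow_nz (x : R) (s : C) : cpow x s <> 0.
Proof. apply Cexp_nz. Qed.

Lemma cpow_1 (x : R) : (0 < x)%R -> cpow x 1 = RtoC x.
Proof.
  intros H. unfold cpow. replace (1 * RtoC (ln x)) with (RtoC (ln x)) by ring.
  rewrite Cexp_RtoC, exp_ln; auto.
Qed.

Lemma cpow_INR (x : R) (n : nat) : (0 < x)%R -> cpow x (INR n) = RtoC x ^ n.
Proof.
  intros H. induction n as [|n IH].
  - simpl. apply cpow_0.
  - rewrite S_INR, RtoC_plus, cpow_plus, IH, cpow_1 by auto. simpl. ring.
Qed.

Lemma cpow_base_mult (x y : R) (s : C) : (0 < x)%R -> (0 < y)%R -> cpow (x * y) s = cpow x s * cpow y s.
Proof.
  intros Hx Hy. unfold cpow. rewrite ln_mult by auto. rewrite <- Cexp_plus. f_equal.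
  rewrite RtoC_plus. ring.
Qed.

Lemma Cmod_cpow (x : R) (s : C) : Cmod (cpow x s) = Rpower x (Re s).
Proof.
  unfold cpow. rewrite Cmod_Cexp. unfold Rpower. f_equal. destruct s; Csimp. ring.
Qed.

Lemma cpow_one (s : C) : cpow 1 s = 1.
Proof. unfold cpow. rewrite ln_1. replace (s * 0) with (RtoC 0) by ring. apply Cexp_0. Qed.

Lemma pder_cpow (x : R) (s : C) : (0 < x)%R -> pder (fun y => cpow y s) x (s * cpow x (s - 1)).
Proof.
  intros H.
  assert (D : pder (fun y => s * RtoC (ln y)) x (s * RtoC (/ x))).
  { eapply pder_eq; [|apply pder_mult; [apply pder_const|apply pder_RtoC, is_derive_Reals, derivable_pt_lim_ln; exact H]].
    cbv beta; ring. }
  eapply pder_eq; [|exact (pder_comp Cexp _ x _ _ D (cder_Cexp _))].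
  cbv beta. change (Cexp (s * RtoC (ln x))) with (cpow x s).
  unfold Cminus. rewrite cpow_plus, cpow_opp, cpow_1 by auto. rewrite RtoC_inv by lra. ring.
Qed.

Lemma ccont_cpow (x : R) (s : C) : (0 < x)%R -> @ccont R_UniformSpace (fun y => cpow y s) x.
Proof. intros H. eapply pder_cont, pder_cpow; auto. Qed.

Lemma cder_cpow (x : R) (s : C) : cder (cpow x) s (RtoC (ln x) * cpow x s).
Proof.
  unfold cpow.
  eapply cder_eq; [|apply (cder_comp Cexp (fun w => w * RtoC (ln x)) s)].
  2:{ apply cder_mult; [apply cder_id|apply cder_const]. }
  2: apply cder_Cexp.
  cbv beta. ring.
Qed.

Lemma holo_cpow (x : R) (f : C -> C) (z : C) : holomorphic_at f z -> holomorphic_at (fun w => cpow x (f w)) z.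
Proof. intros H. apply (holo_comp (cpow x) f); [exact H|]. eapply cder_holo, cder_cpow. Qed.

(** * Cauchy's theorem for rectangles *)

Definition rint (f : C -> C) (a b c d : R) : C :=
  CRInt (fun x => f (x, c)) a b + Ci * CRInt (fun y => f (b, y)) c d
  - CRInt (fun x => f (x, d)) a b - Ci * CRInt (fun y => f (a, y)) c d.

Definition on_border (a b c d x y : R) : Prop :=
  (a <= x <= b)%R /\ (c <= y <= d)%R /\ (x = a \/ x = b \/ y = c \/ y = d).

(** Continuity on the border only: singularities inside the rectangle are
    allowed. *)
Definition bcont (f : C -> C) (a b c d : R) : Prop :=
  forall x y, on_border a b c d x y -> @ccont C_UniformSpace f (x, y).

Lemma pder_hline (x c : R) : pder (fun u => (u, c)) x 1.
Proof.
  eapply pder_eq; [|apply pder_pair].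
  2: apply is_derive_Reals, derivable_pt_lim_id.
  2: apply is_derive_Reals, derivable_pt_lim_const.
  reflexivity.
Qed.

Lemma pder_vline (x c : R) : pder (fun u => (c, u)) x Ci.
Proof.
  eapply pder_eq; [|apply pder_pair].
  2: apply is_derive_Reals, derivable_pt_lim_const.
  2: apply is_derive_Reals, derivable_pt_lim_id.
  reflexivity.
Qed.

Lemma ccont_hline (f : C -> C) (x c : R) : @ccont C_UniformSpace f (x, c) -> @ccont R_UniformSpace (fun u => f (u, c)) x.
Proof.
  intros H. apply (ccont_comp (T:=R_UniformSpace) (U:=C_UniformSpace) (fun u => (u, c)) f); [exact H|].
  apply ccont_continuous. eapply pder_cont, pder_hline.
Qed.

Lemma ccont_vline (f : C -> C) (x c : R) : @ccont C_UniformSpace f (c, x) -> @ccont R_UniformSpace (fun u => f (c, u)) x.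
Proof.
  intros H. apply (ccont_comp (T:=R_UniformSpace) (U:=C_UniformSpace) (fun u => (c, u)) f); [exact H|].
  apply ccont_continuous. eapply pder_cont, pder_vline.
Qed.

Lemma hline_RInt (f : C -> C) (a b c : R) : (a <= b)%R ->
  (forall x, (a <= x <= b)%R -> @ccont C_UniformSpace f (x, c)) ->
  Cis_RInt (fun x => f (x, c)) a b (CRInt (fun x => f (x, c)) a b).
Proof.
  intros Hab H. apply C_RInt_correct. rewrite Rmin_left, Rmax_right by auto.
  intros x Hx. apply ccont_hline. auto.
Qed.

Lemma vline_RInt (f : C -> C) (a b c : R) : (a <= b)%R ->
  (forall x, (a <= x <= b)%R -> @ccont C_UniformSpace f (c, x)) ->
  Cis_RInt (fun x => f (c, x)) a b (CRInt (fun x => f (c, x)) a b).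
Proof.
  intros Hab H. apply C_RInt_correct. rewrite Rmin_left, Rmax_right by auto.
  intros x Hx. apply ccont_vline. auto.
Qed.

Ltac border := unfold on_border; repeat split; try lra; auto.

Lemma rint_sides (f : C -> C) (a b c d : R) : (a <= b)%R -> (c <= d)%R -> bcont f a b c d ->
  exists b1 r t l,
   Cis_RInt (fun x => f (x, c)) a b b1 /\ Cis_RInt (fun y => f (b, y)) c d r /\
   Cis_RInt (fun x => f (x, d)) a b t /\ Cis_RInt (fun y => f (a, y)) c d l /\
   rint f a b c d = b1 + Ci * r - t - Ci * l.
Proof.
  intros Hab Hcd H. do 4 eexists.
  split; [|split; [|split; [|split; [|reflexivity]]]].
  - apply hline_RInt; auto. intros; apply H; border.
  - apply vline_RInt; auto. intros; apply H; border.
  - apply hline_RInt; auto. intros; apply H; border.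
  - apply vline_RInt; auto. intros; apply H; border.
Qed.

Lemma rint_of_sides (f : C -> C) (a b c d : R) (b1 r t l : C) :
   Cis_RInt (fun x => f (x, c)) a b b1 -> Cis_RInt (fun y => f (b, y)) c d r ->
   Cis_RInt (fun x => f (x, d)) a b t -> Cis_RInt (fun y => f (a, y)) c d l ->
   rint f a b c d = b1 + Ci * r - t - Ci * l.
Proof.
  intros H1 H2 H3 H4. unfold rint.
  now rewrite (C_RInt_unique _ _ _ _ H1), (C_RInt_unique _ _ _ _ H2), (C_RInt_unique _ _ _ _ H3), (C_RInt_unique _ _ _ _ H4).
Qed.

Lemma rint_plus (f g : C -> C) (a b c d : R) : (a <= b)%R -> (c <= d)%R ->
  bcont f a b c d -> bcont g a b c d ->
  rint (fun z => f z + g z) a b c d = rint f a b c d + rint g a b c d.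
Proof.
  intros Hab Hcd Hf Hg.
  destruct (rint_sides f a b c d Hab Hcd Hf) as (b1 & r1 & t1 & l1 & H1 & H2 & H3 & H4 & ->).
  destruct (rint_sides g a b c d Hab Hcd Hg) as (b2 & r2 & t2 & l2 & G1 & G2 & G3 & G4 & ->).
  rewrite (rint_of_sides _ a b c d (b1 + b2) (r1 + r2) (t1 + t2) (l1 + l2)); [ring|..];
    now apply C_is_RInt_plus.
Qed.

Lemma rint_scal (k : C) (f : C -> C) (a b c d : R) : (a <= b)%R -> (c <= d)%R ->
  bcont f a b c d ->
  rint (fun z => k * f z) a b c d = k * rint f a b c d.
Proof.
  intros Hab Hcd Hf.
  destruct (rint_sides f a b c d Hab Hcd Hf) as (b1 & r1 & t1 & l1 & H1 & H2 & H3 & H4 & ->).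
  rewrite (rint_of_sides _ a b c d (k * b1) (k * r1) (k * t1) (k * l1)); [ring|..];
    now apply C_is_RInt_scal.
Qed.

Lemma rint_ext (f g : C -> C) (a b c d : R) : (a <= b)%R -> (c <= d)%R ->
  (forall x y, on_border a b c d x y -> f (x, y) = g (x, y)) -> bcont f a b c d ->
  rint f a b c d = rint g a b c d.
Proof.
  intros Hab Hcd E Hf.
  destruct (rint_sides f a b c d Hab Hcd Hf) as (b1 & r1 & t1 & l1 & H1 & H2 & H3 & H4 & ->).
  symmetry. apply rint_of_sides.
  - eapply C_is_RInt_ext; [|exact H1]. rewrite Rmin_left, Rmax_right by auto. intros; apply E; border.
  - eapply C_is_RInt_ext; [|exact H2]. rewrite Rmin_left, Rmax_right by auto. intros; apply E; border.
  - eapply C_is_RInt_ext; [|exact H3]. rewrite Rmin_left, Rmax_right by auto. intros; apply E; border.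
  - eapply C_is_RInt_ext; [|exact H4]. rewrite Rmin_left, Rmax_right by auto. intros; apply E; border.
Qed.

Lemma rint_bound (f : C -> C) (a b c d M : R) : (a <= b)%R -> (c <= d)%R -> bcont f a b c d ->
  (forall x y, on_border a b c d x y -> (Cmod (f (x, y)) <= M)%R) ->
  (Cmod (rint f a b c d) <= M * (2 * ((b - a) + (d - c))))%R.
Proof.
  intros Hab Hcd Hf HM.
  destruct (rint_sides f a b c d Hab Hcd Hf) as (b1 & r1 & t1 & l1 & H1 & H2 & H3 & H4 & ->).
  apply C_RInt_norm_const with (M := M) in H1; [|auto|intros; apply HM; border].
  apply C_RInt_norm_const with (M := M) in H2; [|auto|intros; apply HM; border].
  apply C_RInt_norm_const with (M := M) in H3; [|auto|intros; apply HM; border].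
  apply C_RInt_norm_const with (M := M) in H4; [|auto|intros; apply HM; border].
  replace (b1 + Ci * r1 - t1 - Ci * l1) with ((b1 + Ci * r1) + (- t1 + - (Ci * l1))) by ring.
  eapply Rle_trans; [apply Cmod_triangle|].
  eapply Rle_trans; [apply Rplus_le_compat; apply Cmod_triangle|].
  rewrite !Cmod_opp, !Cmod_mult, Cmod_Ci. lra.
Qed.

Lemma rint_primitive (F f : C -> C) (a b c d : R) : (a <= b)%R -> (c <= d)%R -> bcont f a b c d ->
  (forall x y, on_border a b c d x y -> cder F (x, y) (f (x, y))) -> rint f a b c d = 0.
Proof.
  intros Hab Hcd Hf HF.
  destruct (rint_sides f a b c d Hab Hcd Hf) as (b1 & r1 & t1 & l1 & H1 & H2 & H3 & H4 & ->).
  assert (Hh : forall u, (u = c \/ u = d) -> Cis_RInt (fun x => f (x, u)) a b (F (b, u) - F (a, u))).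
  { intros u Hu. apply (C_RInt_FTC (fun x => F (x, u))); rewrite Rmin_left, Rmax_right by auto; intros x Hx.
    - eapply pder_eq; [|apply pder_comp; [apply pder_hline|apply HF; destruct Hu; border]]. ring.
    - apply ccont_hline, Hf. destruct Hu; border. }
  assert (Hv : forall u, (u = a \/ u = b) -> Cis_RInt (fun x => Ci * f (u, x)) c d (F (u, d) - F (u, c))).
  { intros u Hu. apply (C_RInt_FTC (fun x => F (u, x))); rewrite Rmin_left, Rmax_right by auto; intros x Hx.
    - eapply pder_eq; [|apply pder_comp; [apply pder_vline|apply HF; destruct Hu; border]]. ring.
    - capply clim_mult; [capply clim_const|]. apply ccont_vline, Hf. destruct Hu; border. }
  rewrite (C_is_RInt_unique _ _ _ _ _ H1 (Hh c (or_introl eq_refl))).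
  rewrite (C_is_RInt_unique _ _ _ _ _ H3 (Hh d (or_intror eq_refl))).
  rewrite (C_is_RInt_unique _ _ _ _ _ (C_is_RInt_scal _ _ _ Ci _ H2) (Hv b (or_intror eq_refl))).
  rewrite (C_is_RInt_unique _ _ _ _ _ (C_is_RInt_scal _ _ _ Ci _ H4) (Hv a (or_introl eq_refl))).
  ring.
Qed.

Lemma rint_split_v (f : C -> C) (a m b c d : R) : (a <= m <= b)%R ->
  (forall x, (a <= x <= b)%R -> @ccont C_UniformSpace f (x, c) /\ @ccont C_UniformSpace f (x, d)) ->
  rint f a b c d = rint f a m c d + rint f m b c d.
Proof.
  intros Hm H. unfold rint.
  assert (E : forall u, u = c \/ u = d -> CRInt (fun x => f (x, u)) a b = CRInt (fun x => f (x, u)) a m + CRInt (fun x => f (x, u)) m b).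
  { intros u Hu. apply C_RInt_unique. apply C_is_RInt_Chasles with m; apply hline_RInt; try lra;
    intros x Hx; destruct Hu; subst; apply H; lra. }
  rewrite (E c), (E d) by auto. ring.
Qed.

Lemma rint_split_h (f : C -> C) (a b c m d : R) : (c <= m <= d)%R ->
  (forall y, (c <= y <= d)%R -> @ccont C_UniformSpace f (a, y) /\ @ccont C_UniformSpace f (b, y)) ->
  rint f a b c d = rint f a b c m + rint f a b m d.
Proof.
  intros Hm H. unfold rint.
  assert (E : forall u, u = a \/ u = b -> CRInt (fun x => f (u, x)) c d = CRInt (fun x => f (u, x)) c m + CRInt (fun x => f (u, x)) m d).
  { intros u Hu. apply C_RInt_unique. apply C_is_RInt_Chasles with m; apply vline_RInt; try lra;
    intros x Hx; destruct Hu; subst; apply H; lra. }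
  rewrite (E a), (E b) by auto. ring.
Qed.

Definition holo_rect (f : C -> C) (a b c d : R) : Prop :=
  forall x y, (a <= x <= b)%R -> (c <= y <= d)%R -> holomorphic_at f (x, y).

Lemma holo_rect_sub (f : C -> C) (a b c d a' b' c' d' : R) : holo_rect f a b c d ->
  (a <= a')%R -> (b' <= b)%R -> (c <= c')%R -> (d' <= d)%R -> holo_rect f a' b' c' d'.
Proof. intros H ? ? ? ? x y Hx Hy. apply H; lra. Qed.

Lemma holo_rect_bcont (f : C -> C) (a b c d : R) : holo_rect f a b c d -> bcont f a b c d.
Proof. intros H x y (Hx & Hy & _). apply holo_cont. now apply H. Qed.

Lemma rint_flat (f : C -> C) (a b c d : R) : (a <= b)%R -> (c <= d)%R -> bcont f a b c d ->
  ((b - a) + (d - c) <= 0)%R -> rint f a b c d = 0.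
Proof.
  intros Hab Hcd Hf H.
  apply (rint_primitive (fun z => f (a, c) * z)); auto.
  intros x y (Hx & Hy & _).
  replace (x, y) with (a, c) by (f_equal; lra).
  eapply cder_eq; [|apply cder_mult; [apply cder_const|apply cder_id]]. cbv beta. ring.
Qed.

(** The lower left corner of the next rectangle of Goursat's bisection.  The
    fourth quarter is taken by default: if the test fails for three quarters, it
    holds for the last one wherever it is used. *)
Definition quarter (Q : R -> R -> R -> R -> Prop) (w h : R) (p : R * R) : R * R :=
  let (a, c) := p in
  if excluded_middle_informative (Q a (a + w) c (c + h))%R then (a, c) else
  if excluded_middle_informative (Q (a + w) (a + w + w) c (c + h))%R then (a + w, c)%R else
  if excluded_middle_informative (Q a (a + w) (c + h) (c + h + h))%R then (a, c + h)%R else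
  (a + w, c + h)%R.

Fixpoint bis (Q : R -> R -> R -> R -> Prop) (w h : R) (p : R * R) (n : nat) : R * R :=
  match n with
  | O => p
  | S n => quarter Q (w / 2 ^ S n) (h / 2 ^ S n) (bis Q w h p n)
  end.

Lemma quarter_range Q w h p : (0 <= w)%R -> (0 <= h)%R ->
  let q := quarter Q w h p in
  (fst p <= fst q <= fst p + w)%R /\ (snd p <= snd q <= snd p + h)%R.
Proof.
  intros Hw Hh. destruct p as [a c]. simpl.
  repeat destruct excluded_middle_informative; simpl; lra.
Qed.

Lemma pow2_pos n : (0 < 2 ^ n)%R.
Proof. apply pow_lt; lra. Qed.

Lemma div_pow2 w n : (w / 2 ^ n = w / 2 ^ S n + w / 2 ^ S n)%R.
Proof. simpl. field. apply Rgt_not_eq, pow2_pos. Qed.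

Lemma div_pow2_pos w n : (0 <= w)%R -> (0 <= w / 2 ^ n)%R.
Proof. intros H. apply Rmult_le_pos; [auto|]. left. apply Rinv_0_lt_compat, pow2_pos. Qed.

Lemma bis_nested Q w h p : (0 <= w)%R -> (0 <= h)%R -> forall m n,
  (fst (bis Q w h p n) <= fst (bis Q w h p (m + n)) /\
  fst (bis Q w h p (m + n)) + w / 2 ^ (m + n) <= fst (bis Q w h p n) + w / 2 ^ n /\
  snd (bis Q w h p n) <= snd (bis Q w h p (m + n)) /\
  snd (bis Q w h p (m + n)) + h / 2 ^ (m + n) <= snd (bis Q w h p n) + h / 2 ^ n)%R.
Proof.
  intros Hw Hh. induction m as [|m IH]; intros n.
  - simpl. lra.
  - specialize (IH n).
    assert (G := quarter_range Q (w / 2 ^ S (m + n)) (h / 2 ^ S (m + n)) (bis Q w h p (m + n))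
       (div_pow2_pos _ _ Hw) (div_pow2_pos _ _ Hh)).
    cbv zeta in G. change (S m + n)%nat with (S (m + n)).
    change (bis Q w h p (S (m + n))) with (quarter Q (w / 2 ^ S (m + n)) (h / 2 ^ S (m + n)) (bis Q w h p (m + n))).
    rewrite (div_pow2 w (m + n)), (div_pow2 h (m + n)) in IH. lra.
Qed.

Lemma nested_point (u : nat -> R) (w : R) : (0 <= w)%R ->
  (forall m n, u n <= u (m + n)%nat /\ u (m + n)%nat + w / 2 ^ (m + n) <= u n + w / 2 ^ n)%R ->
  exists x, forall n, (u n <= x <= u n + w / 2 ^ n)%R.
Proof.
  intros Hw H.
  assert (B : forall m n, (u m <= u n + w / 2 ^ n)%R).
  { intros m n. destruct (Nat.le_ge_cases m n) as [L|L].
    - destruct (H (n - m)%nat m) as [H1 _]. replace (n - m + m)%nat with n in H1 by lia.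
      assert (P := div_pow2_pos w n Hw). lra.
    - destruct (H (m - n)%nat n) as [_ H1]. replace (m - n + n)%nat with m in H1 by lia.
      assert (P := div_pow2_pos w m Hw). lra. }
  destruct (completeness (fun y => exists n, y = u n)) as [x [Hx1 Hx2]].
  - exists (u O + w / 2 ^ 0)%R. intros y [n ->]. apply B.
  - exists (u O). now exists O.
  - exists x. intros n. split.
    + apply Hx1. now exists n.
    + apply Hx2. intros y [m ->]. apply B.
Qed.

(** A rectangle whose integral exceeds a constant times the square of its size
    has a quarter with the same property.  At the common point of the nested
    quarters the function is linear up to a small error, linear functions have
    primitives, and the error is too small for the inequality. *)
Lemma goursat (f : C -> C) (a b c d : R) : (a <= b)%R -> (c <= d)%R -> holo_rect f a b c d ->
  rint f a b c d = 0.
Proof.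
  intros Hab Hcd Hf.
  destruct (Rle_lt_dec ((b - a) + (d - c)) 0) as [Z|P].
  { apply rint_flat; auto. now apply holo_rect_bcont. }
  destruct (Ceq_dec (rint f a b c d) 0) as [E|N]; [exact E|exfalso].
  set (S := ((b - a) + (d - c))%R) in *.
  assert (N' := Cmod_pos _ N).
  set (k := (Cmod (rint f a b c d) / 2 / (S * S))%R).
  assert (SS : (0 < S * S)%R) by nra.
  assert (Hk : (0 < k)%R) by (apply Rdiv_lt_0_compat; lra).
  (* A rectangle is bad when its integral is large compared with the square
     of its size; some quarter of a bad rectangle is bad. *)
  set (Q := fun a b c d => (k * (((b - a) + (d - c)) * ((b - a) + (d - c))) < Cmod (rint f a b c d))%R).
  set (w := (b - a)%R). set (h := (d - c)%R).
  assert (Hw : (0 <= w)%R) by (unfold w; lra). assert (Hh : (0 <= h)%R) by (unfold h; lra).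
  set (r := bis Q w h (a, c)).
  assert (Nest := bis_nested Q w h (a, c) Hw Hh). fold r in Nest.
  assert (In : forall n, (a <= fst (r n))%R /\ (fst (r n) + w / 2 ^ n <= b)%R /\ (c <= snd (r n))%R /\ (snd (r n) + h / 2 ^ n <= d)%R).
  { intros n. generalize (Nest n O). replace (n + 0)%nat with n by lia.
    change (r O) with (a, c). simpl (fst (a, c)). simpl (snd (a, c)). unfold w, h. simpl (2 ^ 0)%R. lra. }
  assert (Bad : forall n, Q (fst (r n)) (fst (r n) + w / 2 ^ n)%R (snd (r n)) (snd (r n) + h / 2 ^ n)%R).
  { induction n as [|n IH].
    - unfold Q, r, w, h. simpl.
      replace (a + (b - a) / 1)%R with b by field. replace (c + (d - c) / 1)%R with d by field.
      fold S. unfold k. field_simplify; lra.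
    - specialize (In n).
      change (r (Datatypes.S n)) with (quarter Q (w / 2 ^ Datatypes.S n) (h / 2 ^ Datatypes.S n) (r n)).
      destruct (r n) as [x y]. cbn [fst snd] in *.
      rewrite (div_pow2 w n), (div_pow2 h n) in IH, In.
      set (u := (w / 2 ^ Datatypes.S n)%R) in *. set (v := (h / 2 ^ Datatypes.S n)%R) in *.
      assert (Hu : (0 <= u)%R) by now apply div_pow2_pos.
      assert (Hv : (0 <= v)%R) by now apply div_pow2_pos.
      clearbody u v. unfold quarter.
      destruct excluded_middle_informative as [G1|G1]; [exact G1|].
      destruct excluded_middle_informative as [G2|G2]; [exact G2|].
      destruct excluded_middle_informative as [G3|G3]; [exact G3|].
      simpl.
      unfold Q in *. apply Rnot_lt_le in G1, G2, G3.
      assert (Hc : forall p q, (x <= p <= x + (u + u))%R -> (y <= q <= y + (v + v))%R -> @ccont C_UniformSpace f (p, q)).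
      { intros p q Hp Hq. apply holo_cont, Hf; lra. }
      rewrite (rint_split_v f x (x + u)%R) in IH by (try (intros; split; apply Hc); lra).
      rewrite (rint_split_h f x (x + u)%R y (y + v)%R) in IH by (try (intros; split; apply Hc); lra).
      rewrite (rint_split_h f (x + u)%R (x + (u + u))%R y (y + v)%R) in IH by (try (intros; split; apply Hc); lra).
      replace (x + (u + u))%R with (x + u + u)%R in IH by ring.
      replace (y + (v + v))%R with (y + v + v)%R in IH by ring.
      match type of IH with (_ < Cmod (?p + ?q + (?s + ?t)))%R =>
        assert (T := Cmod_triangle (p + q) (s + t)); assert (T1 := Cmod_triangle p q); assert (T2 := Cmod_triangle s t) end.
      lra. }
  destruct (nested_point (fun n => fst (r n)) w Hw) as [x0 Hx0].
  { intros m n. specialize (Nest m n). tauto. }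
  destruct (nested_point (fun n => snd (r n)) h Hh) as [y0 Hy0].
  { intros m n. specialize (Nest m n). tauto. }
  assert (Hz0 : holomorphic_at f (x0, y0)).
  { apply Hf; [specialize (Hx0 O)|specialize (Hy0 O)]; unfold r, w, h in *; simpl in *; lra. }
  apply holomorphic_cder in Hz0. destruct Hz0 as [l Hl].
  destruct (Hl (k / 2)%R ltac:(lra)) as [del [Hdel Hd]].
  assert (exists n, (S / 2 ^ n < del)%R) as [n Hn].
  { assert (Hh2 : (Rabs (/ 2) < 1)%R) by (rewrite Rabs_pos_eq; lra).
    assert (HdS : (0 < del / S)%R) by (apply Rdiv_lt_0_compat; lra).
    destruct (pow_lt_1_zero (/ 2) Hh2 (del / S) HdS) as [n Hn].
    exists n. specialize (Hn n (Nat.le_refl n)). rewrite Rabs_pos_eq in Hn by (left; apply pow_lt; lra).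
    rewrite pow_inv in Hn.
    apply Rmult_lt_reg_r with (/ S)%R; [now apply Rinv_0_lt_compat|].
    replace (S / 2 ^ n * / S)%R with (/ 2 ^ n)%R by (field; assert (PP := pow2_pos n); split; lra). exact Hn. }
  specialize (Bad n). specialize (In n). specialize (Hx0 n). specialize (Hy0 n). cbv beta in Hx0, Hy0.
  assert (SumS : (S / 2 ^ n = w / 2 ^ n + h / 2 ^ n)%R) by (unfold S, w, h; field; apply Rgt_not_eq, pow2_pos).
  assert (Hwn := div_pow2_pos w n Hw). assert (Hhn := div_pow2_pos h n Hh).
  set (u := (w / 2 ^ n)%R) in *. set (v := (h / 2 ^ n)%R) in *.
  destruct (r n) as [x y]. cbn [fst snd] in *.
  unfold Q in Bad.
  set (lin := fun z : C => f (x0, y0) + l * (z - (x0, y0))).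
  assert (Hlin : forall z, holomorphic_at lin z).
  { intros z. apply holo_plus; [apply holo_const|]. apply holo_mult; [apply holo_const|].
    apply holo_minus; [apply holo_id|apply holo_const]. }
  assert (Hfs : holo_rect f x (x + u) y (y + v)) by (eapply holo_rect_sub; eauto; lra).
  assert (Hls : holo_rect lin x (x + u) y (y + v)) by (intros ? ? _ _; apply Hlin).
  assert (Z : rint lin x (x + u) y (y + v) = 0).
  { apply (rint_primitive (fun z => f (x0, y0) * z + l / 2 * ((z - (x0, y0)) * (z - (x0, y0))))); try lra.
    - now apply holo_rect_bcont.
    - intros p q _.
      assert (D : cder (fun z => z - (x0, y0)) (p, q) 1).
      { eapply cder_eq; [|apply cder_minus; [apply cder_id|apply cder_const]]. ring. }
      eapply cder_eq; [|apply cder_plus; [apply cder_mult; [apply cder_const|apply cder_id]|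
        apply cder_mult; [apply cder_const|apply cder_mult; exact D]]].
      unfold lin. cbv beta. field. }
  assert (D : rint f x (x + u) y (y + v) = rint lin x (x + u) y (y + v) + rint (fun z => f z - lin z) x (x + u) y (y + v)).
  { assert (HR : holo_rect (fun z => f z - lin z) x (x + u) y (y + v)).
    { intros p q Hp Hq. apply holo_minus; [now apply Hfs|apply Hlin]. }
    rewrite <- rint_plus; try lra; try now apply holo_rect_bcont.
    apply rint_ext; try lra; [|now apply holo_rect_bcont].
    intros p q _. ring. }
  rewrite D, Z, Cplus_0_l in Bad.
  assert (B : (Cmod (rint (fun z => (f z - lin z)%C) x (x + u) y (y + v)) <= k / 2 * (u + v) * (2 * ((x + u - x) + (y + v - y))))%R).
  { apply rint_bound; try lra.
    - apply holo_rect_bcont. intros p q Hp Hq. apply holo_minus; [now apply Hfs|apply Hlin].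
    - intros p q (Hp & Hq & _).
      assert (Dist : (Cmod ((p, q) - (x0, y0)) <= u + v)%R).
      { eapply Rle_trans; [apply Cmod_le_sum|]. Csimp.
        apply Rplus_le_compat; apply Rabs_le; lra. }
      unfold lin. replace (f (p, q) - (f (x0, y0) + l * ((p, q) - (x0, y0)))) with (f (p, q) - f (x0, y0) - l * ((p, q) - (x0, y0))) by ring.
      eapply Rle_trans; [apply Hd; lra|]. apply Rmult_le_compat_l; lra. }
  nra.
Qed.

(** * Cauchy's integral formula and its consequences *)

Lemma dist_fst (x y x0 y0 : R) : (Rabs (x - x0) <= Cmod ((x, y) - (x0, y0)))%R.
Proof. exact (Cmod_fst ((x, y) - (x0, y0))). Qed.

Lemma dist_snd (x y x0 y0 : R) : (Rabs (y - y0) <= Cmod ((x, y) - (x0, y0)))%R.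
Proof. exact (Cmod_snd ((x, y) - (x0, y0))). Qed.

Definition holo_but (f : C -> C) (z0 : C) (a b c d : R) : Prop :=
  forall x y, (a <= x <= b)%R -> (c <= y <= d)%R -> (x, y) <> z0 -> holomorphic_at f (x, y).

Lemma holo_but_rect (f : C -> C) (x0 y0 a b c d a' b' c' d' : R) : holo_but f (x0, y0) a b c d ->
  (a <= a')%R -> (b' <= b)%R -> (c <= c')%R -> (d' <= d)%R ->
  (b' < x0 \/ x0 < a' \/ d' < y0 \/ y0 < c')%R -> holo_rect f a' b' c' d'.
Proof.
  intros H Ha Hb Hc Hd N x y Hx Hy. apply H; try lra.
  intros E. injection E. intros. lra.
Qed.

Lemma holo_but_cont (f : C -> C) (x0 y0 a b c d x y : R) : holo_but f (x0, y0) a b c d ->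
  (a <= x <= b)%R -> (c <= y <= d)%R -> (x < x0 \/ x0 < x \/ y < y0 \/ y0 < y)%R ->
  @ccont C_UniformSpace f (x, y).
Proof.
  intros H Hx Hy N. apply holo_cont, H; auto. intros E. injection E. intros. lra.
Qed.

(** Four of the pieces cut off around the square avoid the exceptional point, so
    that Goursat's theorem applies to them. *)
Lemma rint_shrink (f : C -> C) (x0 y0 r a b c d : R) : (0 < r)%R ->
  (a <= x0 - r)%R -> (x0 + r <= b)%R -> (c <= y0 - r)%R -> (y0 + r <= d)%R ->
  holo_but f (x0, y0) a b c d ->
  rint f a b c d = rint f (x0 - r) (x0 + r) (y0 - r) (y0 + r).
Proof.
  intros Hr Ha Hb Hc Hd H.
  assert (K : forall x y, (a <= x <= b)%R -> (c <= y <= d)%R -> (x < x0 \/ x0 < x \/ y < y0 \/ y0 < y)%R ->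
    @ccont C_UniformSpace f (x, y)) by (intros; eapply holo_but_cont; eauto).
  rewrite (rint_split_v f a (x0 - r) b c d) by (try (intros; split; apply K); lra).
  rewrite (rint_split_v f (x0 - r) (x0 + r) b c d) by (try (intros; split; apply K); lra).
  rewrite (rint_split_h f (x0 - r) (x0 + r) c (y0 - r) d) by (try (intros; split; apply K); lra).
  rewrite (rint_split_h f (x0 - r) (x0 + r) (y0 - r) (y0 + r) d) by (try (intros; split; apply K); lra).
  rewrite (goursat f a (x0 - r) c d), (goursat f (x0 + r) b c d), (goursat f (x0 - r) (x0 + r) c (y0 - r)),
    (goursat f (x0 - r) (x0 + r) (y0 + r) d); try lra; try (eapply holo_but_rect; eauto; lra).
  ring.
Qed.

(** A function bounded near its only singularity has an integral at most
    8 M r over the square of half side r, for every r. *)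
Lemma rint_bounded_singularity (f : C -> C) (x0 y0 a b c d M rho : R) :
  (a < x0 < b)%R -> (c < y0 < d)%R -> holo_but f (x0, y0) a b c d -> (0 < rho)%R ->
  (forall z, z <> (x0, y0) -> (Cmod (z - (x0, y0)) < rho)%R -> (Cmod (f z) <= M)%R) ->
  rint f a b c d = 0.
Proof.
  intros Hx Hy H Hrho HM.
  apply Cmod_eq_0. apply Rle_antisym; [|apply Cmod_ge_0].
  assert (M0 : (0 <= M)%R).
  { assert (D : (Cmod ((x0 + rho / 2, y0)%R - (x0, y0)) < rho)%R).
    { eapply Rle_lt_trans; [apply Cmod_le_sum|]. Csimp.
      rewrite (Rabs_pos_eq (x0 + rho / 2 + - x0)) by lra. rewrite (Rabs_pos_eq (y0 + - y0)) by lra. lra. }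
    eapply Rle_trans; [apply Cmod_ge_0|apply (fun N => HM _ N D)].
    intros E. injection E. lra. }
  apply le_epsilon. intros e He. rewrite Rplus_0_l.
  set (r := Rmin (Rmin (x0 - a) (b - x0)) (Rmin (Rmin (y0 - c) (d - y0)) (Rmin (rho / 4) (e / (8 * M + 1))))).
  assert (R1 : (r <= Rmin (x0 - a) (b - x0))%R) by apply Rmin_l.
  assert (R2 : (r <= Rmin (Rmin (y0 - c) (d - y0)) (Rmin (rho / 4) (e / (8 * M + 1))))%R) by apply Rmin_r.
  assert (R3 := Rmin_l (x0 - a) (b - x0)). assert (R4 := Rmin_r (x0 - a) (b - x0)).
  assert (R5 := Rmin_l (Rmin (y0 - c) (d - y0)) (Rmin (rho / 4) (e / (8 * M + 1)))).
  assert (R6 := Rmin_r (Rmin (y0 - c) (d - y0)) (Rmin (rho / 4) (e / (8 * M + 1)))).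
  assert (R7 := Rmin_l (y0 - c) (d - y0)). assert (R8 := Rmin_r (y0 - c) (d - y0)).
  assert (R9 := Rmin_l (rho / 4) (e / (8 * M + 1))). assert (R10 := Rmin_r (rho / 4) (e / (8 * M + 1))).
  assert (Hr : (0 < r)%R).
  { assert (0 < e / (8 * M + 1))%R by (apply Rdiv_lt_0_compat; lra). unfold r. repeat apply Rmin_pos; lra. }
  rewrite (rint_shrink f x0 y0 r a b c d) by (auto; lra).
  eapply Rle_trans.
  - apply rint_bound with (M := M); try lra.
    + intros x y (Bx & By & B). eapply holo_but_cont; [exact H|lra|lra|].
      destruct B as [B|[B|[B|B]]]; subst; lra.
    + intros x y (Bx & By & B). apply HM.
      * intros E. injection E. intros. destruct B as [B|[B|[B|B]]]; lra.
      * eapply Rle_lt_trans; [apply Cmod_le_sum|]. Csimp.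
        assert (Rabs (x + - x0) <= r)%R by (apply Rabs_le; lra).
        assert (Rabs (y + - y0) <= r)%R by (apply Rabs_le; lra). lra.
  - assert (r * (8 * M + 1) <= e)%R.
    { apply Rle_trans with (e / (8 * M + 1) * (8 * M + 1))%R; [apply Rmult_le_compat_r; lra|].
      right. field. lra. }
    nra.
Qed.

Lemma holo_shift_inv (z0 z : C) : z <> z0 -> holomorphic_at (fun w => / (w - z0)) z.
Proof.
  intros N. apply holo_inv; [now apply Cminus_eq_contra|].
  apply holo_minus; [apply holo_id|apply holo_const].
Qed.

Lemma sumsq_pos (u r : R) : (0 < r)%R -> (0 < u * u + r * r)%R.
Proof. intros Hr. assert (Q := Rle_0_sqr u). unfold Rsqr in Q. assert (0 < r * r)%R by now apply Rmult_lt_0_compat. lra. Qed.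

(** On opposite sides of the square the odd parts of the integrand cancel; what
    remains is the derivative of the arctangent, over an angle pi/2 for each side. *)
Lemma square_winding (x0 y0 r : R) : (0 < r)%R ->
  rint (fun z => / (z - (x0, y0))) (x0 - r) (x0 + r) (y0 - r) (y0 + r) = 2 * RtoC PI * Ci.
Proof.
  intros Hr.
  assert (Bc : bcont (fun z => / (z - (x0, y0))) (x0 - r) (x0 + r) (y0 - r) (y0 + r)).
  { intros x y (Hx & Hy & B). apply holo_cont, holo_shift_inv. intros E. injection E. intros.
    destruct B as [B|[B|[B|B]]]; lra. }
  assert (A : forall p, is_RInt (fun x => r / ((x - p) * (x - p) + r * r))%R (p - r)%R (p + r)%R (PI / 2)%R).
  { intros p. replace (PI / 2)%R with (atan ((p + r - p) / r) - atan ((p - r - p) / r))%R.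
    - apply (is_RInt_derive (V := R_CompleteNormedModule) (fun x => atan ((x - p) / r))).
      + intros x _. auto_derive; [lra|].
        assert (P := sumsq_pos (x - p) r Hr).
        unfold Rsqr. field. split; lra.
      + intros x _. apply (ex_derive_continuous (V := R_NormedModule)). auto_derive.
        assert (P := sumsq_pos (x - p) r Hr). lra.
    - replace ((p + r - p) / r)%R with 1%R by (field; lra). replace ((p - r - p) / r)%R with (- (1))%R by (field; lra).
      rewrite atan_opp, atan_1. field. }
  destruct (rint_sides _ _ _ _ _ (ltac:(lra) : (x0 - r <= x0 + r)%R) (ltac:(lra) : (y0 - r <= y0 + r)%R) Bc) as (b1 & r1 & t1 & l1 & H1 & H2 & H3 & H4 & ->).
  assert (E1 : b1 - t1 = 2 * Ci * RtoC (PI / 2)).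
  { eapply C_is_RInt_unique; [apply C_is_RInt_minus; [exact H1|exact H3]|].
    eapply C_is_RInt_ext; [|apply C_is_RInt_scal, C_is_RInt_RtoC, (A x0)].
    intros x _. cbv beta.
    assert (P := sumsq_pos (x - x0) r Hr).
    replace ((x, y0 - r)%R - (x0, y0)) with ((x - x0)%R, (- r)%R) by (Cext; ring).
    replace ((x, y0 + r)%R - (x0, y0)) with ((x - x0)%R, r) by (Cext; ring).
    unfold Cinv. Cext; field; nra. }
  assert (E2 : r1 - l1 = 2 * RtoC (PI / 2)).
  { eapply C_is_RInt_unique; [apply C_is_RInt_minus; [exact H2|exact H4]|].
    eapply C_is_RInt_ext; [|apply C_is_RInt_scal, C_is_RInt_RtoC, (A y0)].
    intros y _. cbv beta.
    assert (P := sumsq_pos (y - y0) r Hr).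
    replace ((x0 + r, y)%R - (x0, y0)) with (r, (y - y0)%R) by (Cext; ring).
    replace ((x0 - r, y)%R - (x0, y0)) with ((- r)%R, (y - y0)%R) by (Cext; ring).
    unfold Cinv. Cext; field; nra. }
  replace (b1 + Ci * r1 - t1 - Ci * l1) with ((b1 - t1) + Ci * (r1 - l1)) by ring.
  rewrite E1, E2. rewrite RtoC_div by lra. field.
Qed.

Lemma rint_inv (x0 y0 a b c d : R) : (a < x0 < b)%R -> (c < y0 < d)%R ->
  rint (fun z => / (z - (x0, y0))) a b c d = 2 * RtoC PI * Ci.
Proof.
  intros Hx Hy.
  set (r := Rmin (Rmin (x0 - a) (b - x0)) (Rmin (y0 - c) (d - y0))).
  assert (R1 := Rmin_l (Rmin (x0 - a) (b - x0)) (Rmin (y0 - c) (d - y0))).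
  assert (R2 := Rmin_r (Rmin (x0 - a) (b - x0)) (Rmin (y0 - c) (d - y0))).
  assert (R3 := Rmin_l (x0 - a) (b - x0)). assert (R4 := Rmin_r (x0 - a) (b - x0)).
  assert (R7 := Rmin_l (y0 - c) (d - y0)). assert (R8 := Rmin_r (y0 - c) (d - y0)).
  fold r in R1, R2.
  assert (Hr : (0 < r)%R) by (unfold r; repeat apply Rmin_pos; lra).
  rewrite (rint_shrink _ x0 y0 r); try lra; [now apply square_winding|].
  intros x y _ _ N. now apply holo_shift_inv.
Qed.

(** The quotient (f z - f z0) / (z - z0) is bounded near z0, so its integral
    vanishes, which leaves f z0 times the integral of / (z - z0). *)
Lemma cauchy_formula (f : C -> C) (x0 y0 a b c d : R) : (a < x0 < b)%R -> (c < y0 < d)%R ->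
  holo_rect f a b c d ->
  rint (fun z => f z / (z - (x0, y0))) a b c d = 2 * RtoC PI * Ci * f (x0, y0).
Proof.
  intros Hx Hy Hf. set (z0 := (x0, y0)).
  assert (NB : forall x y, on_border a b c d x y -> (x, y) <> z0).
  { intros x y (Bx & By & B) E. injection E. intros. destruct B as [B|[B|[B|B]]]; lra. }
  set (g := fun z => (f z - f z0) / (z - z0)).
  assert (Hg : holo_but g z0 a b c d).
  { intros x y Px Py N. apply holo_mult; [|now apply holo_shift_inv].
    apply holo_minus; [now apply Hf|apply holo_const]. }
  assert (G0 : rint g a b c d = 0).
  { assert (Hz : holomorphic_at f z0) by (apply Hf; lra).
    apply holomorphic_cder in Hz. destruct Hz as [l Hl].
    destruct (Hl 1%R Rlt_0_1) as [rho [Hrho HH]].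
    apply (rint_bounded_singularity g x0 y0 a b c d (1 + Cmod l) rho); auto.
    intros z N Hz. specialize (HH z Hz).
    assert (N2 : z - z0 <> 0) by (apply Cminus_eq_contra; exact N).
    assert (P := Cmod_pos _ N2).
    unfold g. rewrite Cmod_div by auto.
    apply Rmult_le_reg_r with (Cmod (z - z0)); [auto|].
    unfold Rdiv. rewrite Rmult_assoc, Rinv_l, Rmult_1_r by lra.
    replace (f z - f z0) with ((f z - f z0 - l * (z - z0)) + l * (z - z0)) by ring.
    eapply Rle_trans; [apply Cmod_triangle|]. rewrite Cmod_mult. lra. }
  assert (Bg : bcont g a b c d).
  { intros x y B. apply holo_cont, Hg; [apply B|apply B|now apply NB]. }
  assert (Bi : bcont (fun z => / (z - z0)) a b c d).
  { intros x y B. apply holo_cont, holo_shift_inv. now apply NB. }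
  rewrite (rint_ext _ (fun z => g z + f z0 * / (z - z0))); try lra.
  - rewrite rint_plus; try lra; auto.
    + rewrite rint_scal; try lra; auto. rewrite G0. unfold z0. rewrite rint_inv by lra. ring.
    + intros x y B. capply clim_mult; [capply clim_const|now apply Bi].
  - intros x y B. unfold g. field. now apply Cminus_eq_contra, NB.
  - intros x y B. capply clim_mult; [apply holo_cont, Hf; apply B|now apply Bi].
Qed.

Lemma segment_bounded (k : R -> C) (a b : R) : (a <= b)%R ->
  (forall x, (a <= x <= b)%R -> @ccont R_UniformSpace k x) -> exists M, forall x, (a <= x <= b)%R -> (Cmod (k x) <= M)%R.
Proof.
  intros Hab H.
  destruct (continuity_ab_maj (fun x => Cmod (k x)) a b Hab) as [m [Hm _]].
  - intros x Hx. apply continuity_pt_filterlim. apply clim_Cmod; [typeclasses eauto|].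
    apply (H x Hx).
  - exists (Cmod (k m)). exact Hm.
Qed.

Lemma border_bounded (k : C -> C) (a b c d : R) : (a <= b)%R -> (c <= d)%R -> bcont k a b c d ->
  exists M, forall x y, on_border a b c d x y -> (Cmod (k (x, y)) <= M)%R.
Proof.
  intros Hab Hcd H.
  destruct (segment_bounded (fun x => k (x, c)) a b Hab) as [M1 H1].
  { intros x Hx. apply ccont_hline, H. border. }
  destruct (segment_bounded (fun x => k (x, d)) a b Hab) as [M2 H2].
  { intros x Hx. apply ccont_hline, H. border. }
  destruct (segment_bounded (fun x => k (a, x)) c d Hcd) as [M3 H3].
  { intros x Hx. apply ccont_vline, H. border. }
  destruct (segment_bounded (fun x => k (b, x)) c d Hcd) as [M4 H4].
  { intros x Hx. apply ccont_vline, H. border. }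
  exists (Rmax (Rmax M1 M2) (Rmax M3 M4)).
  assert (Q1 := Rmax_l (Rmax M1 M2) (Rmax M3 M4)). assert (Q2 := Rmax_r (Rmax M1 M2) (Rmax M3 M4)).
  assert (Q3 := Rmax_l M1 M2). assert (Q4 := Rmax_r M1 M2).
  assert (Q5 := Rmax_l M3 M4). assert (Q6 := Rmax_r M3 M4).
  intros x y (Hx & Hy & [B|[B|[B|B]]]); subst.
  - specialize (H3 y Hy). simpl in H3. lra.
  - specialize (H4 y Hy). simpl in H4. lra.
  - specialize (H1 x Hx). simpl in H1. lra.
  - specialize (H2 x Hx). simpl in H2. lra.
Qed.

Lemma border_distance (x0 y0 a b c d : R) : (a < x0 < b)%R -> (c < y0 < d)%R ->
  exists del, (0 < del)%R /\ forall x y, on_border a b c d x y -> (del <= Cmod ((x, y) - (x0, y0)))%R.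
Proof.
  intros Hx Hy.
  set (r := Rmin (Rmin (x0 - a) (b - x0)) (Rmin (y0 - c) (d - y0))).
  assert (R1 := Rmin_l (Rmin (x0 - a) (b - x0)) (Rmin (y0 - c) (d - y0))).
  assert (R2 := Rmin_r (Rmin (x0 - a) (b - x0)) (Rmin (y0 - c) (d - y0))).
  assert (R3 := Rmin_l (x0 - a) (b - x0)). assert (R4 := Rmin_r (x0 - a) (b - x0)).
  assert (R7 := Rmin_l (y0 - c) (d - y0)). assert (R8 := Rmin_r (y0 - c) (d - y0)).
  fold r in R1, R2.
  exists r. split; [unfold r; repeat apply Rmin_pos; lra|].
  intros x y (Bx & By & B).
  assert (F := Cmod_fst ((x, y) - (x0, y0))). assert (S := Cmod_snd ((x, y) - (x0, y0))).
  Csimp.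
  destruct B as [B|[B|[B|B]]]; subst.
  - rewrite Rabs_left in F by lra. lra.
  - rewrite Rabs_right in F by lra. lra.
  - rewrite Rabs_left in S by lra. lra.
  - rewrite Rabs_right in S by lra. lra.
Qed.

(** The error of the difference quotient is the integral of
    k z * h^2 / ((z - z0)^2 (z - s)), which is O(h^2) as the border stays away
    from the point. *)
Lemma cauchy_integral_holo (k : C -> C) (x0 y0 a b c d : R) : (a < x0 < b)%R -> (c < y0 < d)%R ->
  bcont k a b c d -> holomorphic_at (fun s => rint (fun z => k z / (z - s)) a b c d) (x0, y0).
Proof.
  intros Hx Hy Hk. set (z0 := (x0, y0)).
  destruct (border_bounded k a b c d ltac:(lra) ltac:(lra) Hk) as [M HM].
  destruct (border_distance x0 y0 a b c d Hx Hy) as [del [Hdel HD]]. fold z0 in HD.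
  assert (M0 : (0 <= M)%R).
  { eapply Rle_trans; [apply Cmod_ge_0|apply (HM a c)]. border. }
  apply holomorphic_cder. exists (rint (fun z => k z / ((z - z0) * (z - z0))) a b c d).
  set (L := (M * (2 / (del * del * del)) * (2 * ((b - a) + (d - c))))%R).
  assert (HL : (0 <= L)%R).
  { apply Rmult_le_pos; [apply Rmult_le_pos; [auto|]|lra].
    apply Rlt_le, Rdiv_lt_0_compat; [lra|]. repeat apply Rmult_lt_0_compat; auto. }
  intros e He.
  exists (Rmin (del / 2) (e / (L + 1))).
  assert (Pe : (0 < e / (L + 1))%R) by (apply Rdiv_lt_0_compat; lra).
  split; [apply Rmin_pos; lra|].
  intros s Hs.
  assert (S1 : (Cmod (s - z0) < del / 2)%R) by (eapply Rlt_le_trans; [exact Hs|apply Rmin_l]).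
  assert (S2 : (Cmod (s - z0) < e / (L + 1))%R) by (eapply Rlt_le_trans; [exact Hs|apply Rmin_r]).
  assert (NZ : forall x y, on_border a b c d x y -> (x, y) - z0 <> 0 /\ (x, y) - s <> 0 /\ (del / 2 <= Cmod ((x, y) - s))%R).
  { intros x y B. specialize (HD x y B).
    assert (T := Cmod_triangle_minus (x, y) s z0).
    assert (del / 2 <= Cmod ((x, y) - s))%R by lra.
    repeat split; try apply Cmod_neq; lra. }
  assert (C0 : bcont (fun z => / (z - z0)) a b c d).
  { intros x y B. apply holo_cont, holo_shift_inv. intros E. apply (proj1 (NZ x y B)). rewrite E. ring. }
  assert (Cs : bcont (fun z => / (z - s)) a b c d).
  { intros x y B. apply holo_cont, holo_shift_inv. intros E. apply (proj1 (proj2 (NZ x y B))). rewrite E. ring. }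
  assert (B1 : bcont (fun z => k z / (z - z0)) a b c d).
  { intros x y B. capply clim_mult; [now apply Hk|now apply C0]. }
  assert (B2 : bcont (fun z => k z / (z - s)) a b c d).
  { intros x y B. capply clim_mult; [now apply Hk|now apply Cs]. }
  assert (B3 : bcont (fun z => k z / ((z - z0) * (z - z0))) a b c d).
  { intros x y B.
    capply (clim_ext_loc _ (fun z => k z * (/ (z - z0) * / (z - z0)))).
    - apply (proj2 (locally_Cmod _ _)). exists del. split; [auto|]. intros w Hw.
      assert (w - z0 <> 0).
      { intros E. specialize (HD x y B). rewrite Cmod_minus_sym in HD.
        assert (w = z0) by (replace w with (w - z0 + z0) by ring; rewrite E; ring). subst w.
        rewrite Cmod_minus_sym in HD. rewrite Cmod_minus_sym in Hw. lra. }
      field; auto.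
    - replace (k (x, y) / (((x, y) - z0) * ((x, y) - z0))) with (k (x, y) * (/ ((x, y) - z0) * / ((x, y) - z0))).
      2:{ field. apply (NZ x y B). }
      capply clim_mult; [now apply Hk|capply clim_mult; now apply C0]. }
  set (h := s - z0).
  assert (B4 : bcont (fun z => (- h) * (k z / ((z - z0) * (z - z0)))) a b c d).
  { intros x y B. capply clim_mult; [capply clim_const|now apply B3]. }
  assert (B5 : bcont (fun z => - (1) * (k z / (z - z0))) a b c d).
  { intros x y B. capply clim_mult; [capply clim_const|now apply B1]. }
  assert (B6 : bcont (fun z => k z / (z - s) + (- (1)) * (k z / (z - z0))) a b c d).
  { intros x y B. capply clim_plus; [now apply B2|now apply B5]. }
  assert (E : rint (fun z => k z / (z - s)) a b c d - rint (fun z => k z / (z - z0)) a b c d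
     - rint (fun z => k z / ((z - z0) * (z - z0))) a b c d * h
     = rint (fun z => k z / (z - s) + (- (1)) * (k z / (z - z0)) + (- h) * (k z / ((z - z0) * (z - z0)))) a b c d).
  { rewrite rint_plus by (auto; lra). rewrite rint_plus by (auto; lra).
    rewrite !rint_scal by (auto; lra). ring. }
  rewrite E.
  eapply Rle_trans.
  - apply rint_bound with (M := (M * (2 / (del * del * del)) * (Cmod h * Cmod h))%R); try lra.
    + intros x y B. capply clim_plus; [now apply B6|now apply B4].
    + intros x y B. destruct (NZ x y B) as (N1 & N2 & N3). specialize (HD x y B). specialize (HM x y B).
      replace (k (x, y) / ((x, y) - s) + (- (1)) * (k (x, y) / ((x, y) - z0)) + (- h) * (k (x, y) / (((x, y) - z0) * ((x, y) - z0))))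
        with (k (x, y) * ((/ ((x, y) - z0) * / ((x, y) - z0) * / ((x, y) - s)) * (h * h))).
      2:{ unfold h. field. auto. }
      rewrite !Cmod_mult, !Cmod_inv by auto.
      rewrite (Rmult_assoc M). apply Rmult_le_compat; auto.
      * apply Cmod_ge_0.
      * assert (Q : (0 < / Cmod ((x, y) - z0))%R) by (apply Rinv_0_lt_compat; lra).
        assert (Q2 : (0 < / Cmod ((x, y) - s))%R) by (apply Rinv_0_lt_compat; lra).
        assert (Q3 := Cmod_ge_0 h).
        repeat apply Rmult_le_pos; lra.
      * apply Rmult_le_compat_r; [assert (Q3 := Cmod_ge_0 h); nra|].
        replace (2 / (del * del * del))%R with (/ del * / del * / (del / 2))%R by (field; lra).
        assert (I1 : (/ Cmod ((x, y) - z0) <= / del)%R) by (apply Rinv_le_contravar; lra).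
        assert (I2 : (/ Cmod ((x, y) - s) <= / (del / 2))%R) by (apply Rinv_le_contravar; lra).
        assert (Q : (0 < / Cmod ((x, y) - z0))%R) by (apply Rinv_0_lt_compat; lra).
        assert (Q2 : (0 < / Cmod ((x, y) - s))%R) by (apply Rinv_0_lt_compat; lra).
        apply Rmult_le_compat; [nra|lra| |lra]. apply Rmult_le_compat; lra.
  - replace (M * (2 / (del * del * del)) * (Cmod h * Cmod h) * (2 * (b - a + (d - c))))%R with (L * Cmod h * Cmod h)%R by (unfold L; ring).
    fold h in S2. assert (Q3 := Cmod_ge_0 h). fold h.
    apply Rmult_le_compat_r; [auto|].
    assert (Cmod h * (L + 1) <= e)%R.
    { apply Rle_trans with (e / (L + 1) * (L + 1))%R; [apply Rmult_le_compat_r; lra|]. right; field; lra. }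
    nra.
Qed.

Lemma two_pi_i_nz : 2 * RtoC PI * Ci <> 0.
Proof.
  assert (P := PI_RGT_0).
  apply Cmult_neq_0; [apply Cmult_neq_0|]; [| |apply Ci_nz]; intros E; apply RtoC_inj in E; lra.
Qed.

(** The difference quotient extends over [a] because near [a] it agrees with the
    Cauchy integral of P z / (z - a) along a square, which is holomorphic at every
    interior point. *)
Lemma holo_divide (U : C -> Prop) (P : C -> C) (a : C) (r : R) : (0 < r)%R ->
  (forall z, (Cmod (z - a) <= 2 * r)%R -> U z) -> (forall z, U z -> holomorphic_at P z) ->
  exists P1, (forall z, U z -> holomorphic_at P1 z) /\ forall z, P z = P a + (z - a) * P1 z.
Proof.
  intros Hr HU HP. destruct a as [x0 y0]. set (z0 := (x0, y0)) in *.
  (* A square of half side r lies in the disc of radius 2 r. *)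
  set (F := fun s => / (2 * RtoC PI * Ci) * rint (fun z => (P z / (z - z0)) / (z - s)) (x0 - r) (x0 + r) (y0 - r) (y0 + r)).
  assert (HR : holo_rect P (x0 - r) (x0 + r) (y0 - r) (y0 + r)).
  { intros x y Hx Hy. apply HP, HU.
    eapply Rle_trans; [apply Cmod_le_sum|]. unfold z0. Csimp.
    assert (Rabs (x + - x0) <= r)%R by (apply Rabs_le; lra).
    assert (Rabs (y + - y0) <= r)%R by (apply Rabs_le; lra). lra. }
  assert (NB : forall x y, on_border (x0 - r) (x0 + r) (y0 - r) (y0 + r) x y -> (x, y) <> z0).
  { intros x y (Bx & By & B) E. injection E. intros. destruct B as [B|[B|[B|B]]]; lra. }
  assert (Bi : bcont (fun z => / (z - z0)) (x0 - r) (x0 + r) (y0 - r) (y0 + r)).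
  { intros x y B. apply holo_cont, holo_shift_inv. now apply NB. }
  assert (BP := holo_rect_bcont _ _ _ _ _ HR).
  assert (HF : holomorphic_at F z0).
  { apply holo_mult; [apply holo_const|]. apply cauchy_integral_holo; try lra.
    intros x y B. capply clim_mult; [now apply BP|now apply Bi]. }
  set (P1 := fun z => if Ceq_dec z z0 then F z0 else (P z - P z0) / (z - z0)).
  assert (EF : forall z, (Cmod (z - z0) < r)%R -> F z = P1 z).
  { intros z Hz. unfold P1. destruct (Ceq_dec z z0) as [->|N]; [reflexivity|].
    assert (N2 : z - z0 <> 0) by (apply Cminus_eq_contra; exact N).
    unfold F. destruct z as [x1 y1]. set (z := (x1, y1)) in *.
    assert (Fz' := Rle_lt_trans _ _ _ (dist_fst x1 y1 x0 y0) Hz).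
    assert (Sz' := Rle_lt_trans _ _ _ (dist_snd x1 y1 x0 y0) Hz).
    apply Rabs_def2 in Fz'. apply Rabs_def2 in Sz'.
    assert (NB2 : forall x y, on_border (x0 - r) (x0 + r) (y0 - r) (y0 + r) x y -> (x, y) <> z).
    { intros x y (Bx & By & B) E. injection E. intros. destruct B as [B|[B|[B|B]]]; lra. }
    assert (Bz : bcont (fun w => / (w - z)) (x0 - r) (x0 + r) (y0 - r) (y0 + r)).
    { intros x y B. apply holo_cont, holo_shift_inv. now apply NB2. }
    assert (C1 := cauchy_formula P x1 y1 (x0 - r) (x0 + r) (y0 - r) (y0 + r) ltac:(lra) ltac:(lra) HR). fold z in C1.
    assert (C2 := cauchy_formula P x0 y0 (x0 - r) (x0 + r) (y0 - r) (y0 + r) ltac:(lra) ltac:(lra) HR). fold z0 in C2.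
    (* Partial fractions: 1/((w - z0)(w - z)) = (1/(w - z) - 1/(w - z0)) / (z - z0). *)
    assert (E : rint (fun w => P w / (w - z0) / (w - z)) (x0 - r) (x0 + r) (y0 - r) (y0 + r)
      = / (z - z0) * (rint (fun w => P w / (w - z)) (x0 - r) (x0 + r) (y0 - r) (y0 + r) + (- (1)) * rint (fun w => P w / (w - z0)) (x0 - r) (x0 + r) (y0 - r) (y0 + r))).
    { assert (Q1 : bcont (fun w => P w / (w - z)) (x0 - r) (x0 + r) (y0 - r) (y0 + r)).
      { intros x y B. capply clim_mult; [now apply BP|now apply Bz]. }
      assert (Q2 : bcont (fun w => P w / (w - z0)) (x0 - r) (x0 + r) (y0 - r) (y0 + r)).
      { intros x y B. capply clim_mult; [now apply BP|now apply Bi]. }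
      assert (Q3 : bcont (fun w => - (1) * (P w / (w - z0))) (x0 - r) (x0 + r) (y0 - r) (y0 + r)).
      { intros x y B. capply clim_mult; [capply clim_const|now apply Q2]. }
      rewrite <- rint_scal by (auto; lra). rewrite <- rint_plus by (auto; lra).
      rewrite <- rint_scal; try lra.
      - apply rint_ext; try lra.
        + intros x y B. field. repeat split; auto; apply Cminus_eq_contra; auto.
        + intros x y B. capply clim_mult; [now apply Q2|now apply Bz].
      - intros x y B. capply clim_plus; [now apply Q1|now apply Q3]. }
    rewrite E, C1, C2. assert (T := two_pi_i_nz).
    assert (PI0 : RtoC PI <> 0) by (intros X; apply RtoC_inj in X; generalize PI_RGT_0; lra).
    field. repeat split; auto. apply Ci_nz. }
  exists P1. split.
  - intros z Hz. destruct (Ceq_dec z z0) as [->|N].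
    + eapply holo_ext_loc; [exact Hr|exact EF|exact HF].
    + assert (N2 : (0 < Cmod (z - z0))%R) by (apply Cmod_pos, Cminus_eq_contra; exact N).
      apply holo_ext_loc with (f := fun w => (P w - P z0) / (w - z0)) (d := Cmod (z - z0)); auto.
      * intros w Hw. unfold P1. destruct (Ceq_dec w z0) as [->|_]; [|reflexivity].
        rewrite Cmod_minus_sym in Hw. lra.
      * apply holo_mult; [|now apply holo_shift_inv].
        apply holo_minus; [now apply HP|apply holo_const].
  - intros z. unfold P1. destruct (Ceq_dec z z0) as [->|N]; [ring|].
    field. apply Cminus_eq_contra; exact N.
Qed.

(** If [h] vanishes near the centre [c] then [h z / (z - c) ^ n] is holomorphic
    for every [n]; Cauchy's formula bounds it by a multiple of [r ^ -n], so
    [h z] is at most a multiple of the n-th power of a number below 1. *)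
Lemma vanish_in_square (h : C -> C) (cx cy r rho : R) : (0 < r)%R -> (0 < rho)%R ->
  holo_rect h (cx - r) (cx + r) (cy - r) (cy + r) ->
  (forall z, (Cmod (z - (cx, cy)) < rho)%R -> h z = 0) ->
  forall z, (Cmod (z - (cx, cy)) < r)%R -> h z = 0.
Proof.
  intros Hr Hrho Hh H0 z Hz. set (z0 := (cx, cy)) in *.
  destruct (Rlt_le_dec (Cmod (z - z0)) rho) as [L|L]; [now apply H0|].
  set (t := Cmod (z - z0)) in *.
  assert (Ht : (0 < t)%R) by lra.
  destruct z as [x1 y1]. set (z := (x1, y1)) in *.
  assert (Fz' := Rle_lt_trans _ _ _ (dist_fst x1 y1 cx cy) Hz).
  assert (Sz' := Rle_lt_trans _ _ _ (dist_snd x1 y1 cx cy) Hz).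
  apply Rabs_def2 in Fz'. apply Rabs_def2 in Sz'.
  destruct (border_bounded h _ _ _ _ (ltac:(lra) : (cx - r <= cx + r)%R) (ltac:(lra) : (cy - r <= cy + r)%R) (holo_rect_bcont _ _ _ _ _ Hh)) as [M HM].
  destruct (border_distance x1 y1 (cx - r) (cx + r) (cy - r) (cy + r) ltac:(lra) ltac:(lra)) as [del [Hdel HD]]. fold z in HD.
  assert (M0 : (0 <= M)%R).
  { eapply Rle_trans; [apply Cmod_ge_0|apply (HM (cx - r) (cy - r))%R]. border. }
  assert (NB : forall x y, on_border (cx - r) (cx + r) (cy - r) (cy + r) x y -> (r <= Cmod ((x, y) - z0))%R).
  { intros x y (Bx & By & B).
    assert (F := dist_fst x y cx cy). assert (S := dist_snd x y cx cy). fold z0 in F, S.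
    destruct B as [B|[B|[B|B]]]; subst.
    - rewrite Rabs_left in F by lra. lra.
    - rewrite Rabs_right in F by lra. lra.
    - rewrite Rabs_left in S by lra. lra.
    - rewrite Rabs_right in S by lra. lra. }
  set (K := (M / del * (8 * r))%R).
  assert (Bound : forall n, (Cmod (h z) * (r / t) ^ n <= K)%R).
  { intros n. set (g := fun w => h w * (/ (w - z0)) ^ n).
    assert (Hg : holo_rect g (cx - r) (cx + r) (cy - r) (cy + r)).
    { intros x y Hx Hy. destruct (Ceq_dec (x, y) z0) as [E|N].
      - rewrite E. apply holo_ext_loc with (f := fun _ => 0) (d := rho); auto; [|apply holo_const].
        intros w Hw. unfold g. rewrite H0 by auto. ring.
      - apply holo_mult; [now apply Hh|]. apply holo_pow. now apply holo_shift_inv. }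
    assert (CF := cauchy_formula g x1 y1 (cx - r) (cx + r) (cy - r) (cy + r) ltac:(lra) ltac:(lra) Hg).
    fold z in CF.
    assert (Bg := holo_rect_bcont _ _ _ _ _ Hg).
    assert (Hi : (0 < / r)%R) by now apply Rinv_0_lt_compat.
    assert (Up : (Cmod (rint (fun w => (g w / (w - z))%C) (cx - r) (cx + r) (cy - r) (cy + r)) <= (M * (/ r) ^ n / del) * (2 * ((cx + r - (cx - r)) + (cy + r - (cy - r)))))%R).
    { apply rint_bound; try lra.
      - intros x y B.
        assert (Bz : @ccont C_UniformSpace (fun w => / (w - z)) (x, y)).
        { apply holo_cont, holo_shift_inv.
          intros E. specialize (HD x y B). rewrite E in HD. replace (z - z) with (RtoC 0) in HD by ring. rewrite Cmod_0 in HD. lra. }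
        capply clim_mult; [now apply Bg|exact Bz].
      - intros x y B. specialize (HD x y B). specialize (NB x y B). specialize (HM x y B).
        assert ((x, y) - z <> 0) by (apply Cmod_neq; lra). assert ((x, y) - z0 <> 0) by (apply Cmod_neq; lra).
        unfold g. rewrite Cmod_div, Cmod_mult, Cmod_pow, Cmod_inv by auto.
        assert (I1 : (/ Cmod ((x, y) - z0) <= / r)%R) by (apply Rinv_le_contravar; lra).
        assert (I2 : (/ Cmod ((x, y) - z) <= / del)%R) by (apply Rinv_le_contravar; lra).
        assert (Q : (0 < / Cmod ((x, y) - z0))%R) by (apply Rinv_0_lt_compat; lra).
        assert (Q2 : (0 < / Cmod ((x, y) - z))%R) by (apply Rinv_0_lt_compat; lra).
        apply Rmult_le_compat; [|lra| |exact I2].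
        + apply Rmult_le_pos; [apply Cmod_ge_0|apply pow_le; lra].
        + apply Rmult_le_compat; [apply Cmod_ge_0|apply pow_le; lra|exact HM|apply pow_incr; lra]. }
    rewrite CF in Up. rewrite Cmod_mult in Up.
    assert (P2 : (1 <= Cmod (2 * RtoC PI * Ci))%R).
    { rewrite !Cmod_mult, Cmod_Ci, !Cmod_R. rewrite !Rabs_pos_eq by (try apply Rlt_le, PI_RGT_0; lra).
      generalize PI2_1. unfold PI2. lra. }
    assert (Z0 : z - z0 <> 0) by (apply Cmod_neq; unfold t in Ht; lra).
    assert (Gz : Cmod (g z) = (Cmod (h z) * (/ t) ^ n)%R).
    { unfold g. rewrite Cmod_mult, Cmod_pow, Cmod_inv by auto. reflexivity. }
    assert (Pg := Cmod_ge_0 (g z)).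
    assert (G1 : (Cmod (g z) <= M * (/ r) ^ n / del * (8 * r))%R).
    { eapply Rle_trans; [|eapply Rle_trans; [exact Up|]].
      - nra.
      - right. field. lra. }
    assert (Pr := pow_lt r n Hr).
    replace (Cmod (h z) * (r / t) ^ n)%R with (Cmod (g z) * r ^ n)%R.
    2:{ rewrite Gz. unfold Rdiv. rewrite Rpow_mult_distr. ring. }
    replace K with (M * (/ r) ^ n / del * (8 * r) * r ^ n)%R.
    2:{ unfold K. rewrite pow_inv. field. split; lra. }
    apply Rmult_le_compat_r; lra. }
  apply Cmod_eq_0. destruct (Cmod_ge_0 (h z)) as [P|P]; [exfalso|auto].
  assert (Q : (1 < r / t)%R).
  { apply Rmult_lt_reg_r with t; [auto|]. unfold Rdiv. rewrite Rmult_assoc, Rinv_l by lra. lra. }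
  destruct (Pow_x_infinity (r / t)%R ltac:(rewrite Rabs_pos_eq; lra) (K / Cmod (h z) + 1)%R) as [n Hn].
  specialize (Hn n (Nat.le_refl n)). rewrite Rabs_pos_eq in Hn by (apply pow_le; lra).
  specialize (Bound n).
  assert ((K / Cmod (h z) + 1) * Cmod (h z) <= K)%R by nra.
  replace ((K / Cmod (h z) + 1) * Cmod (h z))%R with (K + Cmod (h z))%R in * by (field; lra). lra.
Qed.

(** * Improper integrals and Mellin transforms *)

(** Integrals between filters: the ends are 0+, a point, or infinity. *)
Definition Cis_gen (f : R -> C) (Fa Fb : (R -> Prop) -> Prop) (l : C) : Prop :=
  @is_RInt_gen C_R_NormedModule f Fa Fb l.

(** Both ends of an improper integral are approached inside a convex domain on
    which the integrand is continuous; all segments between such ends stay in it. *)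
Definition convexR (D : R -> Prop) : Prop :=
  forall a b x, D a -> D b -> (Rmin a b <= x <= Rmax a b)%R -> D x.

Lemma filterlim_eps {T} (F : (T -> Prop) -> Prop) (f : T -> R) (l : R) :
  filterlim f F (locally l) -> forall e, (0 < e)%R -> F (fun t => (Rabs (f t - l) < e)%R).
Proof.
  intros H e He. apply (H (fun y => (Rabs (y - l) < e)%R)). apply (proj2 (locally_R _ _)). exists e. auto.
Qed.

Section Gen.
Context {Fa Fb : (R -> Prop) -> Prop} {PFa : ProperFilter Fa} {PFb : ProperFilter Fb}.

(** On a domain of continuity the improper integral is a limit of proper ones,
    which makes the arithmetic of limits available. *)
Lemma Cis_gen_lim (f : R -> C) (D : R -> Prop) (l : C) : convexR D -> Fa D -> Fb D ->
  (forall x, D x -> ccont f x) ->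
  Cis_gen f Fa Fb l <-> clim (filter_prod Fa Fb) (fun ab => CRInt f (fst ab) (snd ab)) l.
Proof.
  intros CD Ha Hb Hf.
  assert (HH : filter_prod Fa Fb (fun ab => D (fst ab) /\ D (snd ab))).
  { exists D D; [auto|auto|]. intros x y Hx Hy. split; assumption. }
  assert (Hi : filter_prod Fa Fb (fun ab => Cis_RInt f (fst ab) (snd ab) (CRInt f (fst ab) (snd ab)))).
  { generalize HH. apply filter_imp. intros [a b] [Da Db]. apply C_RInt_correct. intros x Hx. apply Hf.
    exact (CD a b x Da Db Hx). }
  rewrite <- filterlim_clim by typeclasses eauto.
  split; intros H.
  - intros P HP. specialize (H P HP). unfold filtermapi in H. unfold filtermap.
    generalize (filter_and _ _ Hi H). apply filter_imp. intros ab [H1 [y [H2 H3]]].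
    replace (CRInt f (fst ab) (snd ab)) with y; [exact H3|]. eapply C_is_RInt_unique; eauto.
  - intros P HP. specialize (H P HP). unfold filtermapi. unfold filtermap in H.
    generalize (filter_and _ _ Hi H). apply filter_imp. intros ab [H1 H2]. eexists. split; eauto.
Qed.

Lemma Cis_gen_unique (f : R -> C) (l : C) : Cis_gen f Fa Fb l ->
  @RInt_gen C_R_CompleteNormedModule f Fa Fb = l.
Proof. intros H. apply (is_RInt_gen_unique (V := C_R_CompleteNormedModule)). exact H. Qed.

Lemma Cis_gen_plus (f g : R -> C) (l m : C) : Cis_gen f Fa Fb l -> Cis_gen g Fa Fb m ->
  Cis_gen (fun x => f x + g x) Fa Fb (l + m).
Proof. apply (is_RInt_gen_plus (V := C_R_NormedModule)). Qed.

Lemma Cis_gen_minus (f g : R -> C) (l m : C) : Cis_gen f Fa Fb l -> Cis_gen g Fa Fb m ->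
  Cis_gen (fun x => f x - g x) Fa Fb (l - m).
Proof. apply (is_RInt_gen_minus (V := C_R_NormedModule)). Qed.

Lemma Cis_gen_scal (f : R -> C) (c l : C) : Cis_gen f Fa Fb l -> Cis_gen (fun x => c * f x) Fa Fb (c * l).
Proof.
  intros H P HP.
  assert (Q : filterlim (fun z => c * z) (@locally C_UniformSpace l) (@locally C_UniformSpace (c * l))).
  { apply filterlim_clim; [typeclasses eauto|]. capply clim_mult; [capply clim_const|].
    intros e He. apply (proj2 (locally_Cmod _ _)). exists e; auto. }
  specialize (H _ (Q P HP)). unfold filtermapi in *. generalize H. apply filter_imp.
  intros ab [y [H1 H2]]. exists (c * y). split; [now apply C_is_RInt_scal|exact H2].
Qed.

Lemma Cis_gen_ext (f g : R -> C) (D : R -> Prop) (l : C) : convexR D -> Fa D -> Fb D ->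
  (forall x, D x -> f x = g x) -> Cis_gen f Fa Fb l -> Cis_gen g Fa Fb l.
Proof.
  intros CD Ha Hb E. apply (is_RInt_gen_ext (V := C_R_NormedModule)).
  exists D D; auto. intros a b Da Db x Hx. apply E. apply (CD a b x); auto. simpl in Hx. lra.
Qed.

Lemma Cis_gen_FTC (F f : R -> C) (D : R -> Prop) (la lb : C) : convexR D -> Fa D -> Fb D ->
  (forall x, D x -> pder F x (f x)) -> (forall x, D x -> ccont f x) ->
  clim Fa F la -> clim Fb F lb -> Cis_gen f Fa Fb (lb - la).
Proof.
  intros CD Ha Hb HF Hf La Lb. apply (Cis_gen_lim f D); auto.
  apply clim_ext_loc with (fun ab => F (snd ab) - F (fst ab)); [typeclasses eauto| |].
  - exists D D; auto. intros a b Da Db. simpl. symmetry. apply C_RInt_unique.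
    apply C_RInt_FTC; intros x Hx; [apply HF|apply Hf]; exact (CD a b x Da Db Hx).
  - capply clim_minus.
    + apply (clim_comp _ Fb snd F); [exact Lb|apply filterlim_snd].
    + apply (clim_comp _ Fa fst F); [exact La|apply filterlim_fst].
Qed.

(** An explicit primitive of the majorant replaces a comparison theorem: its
    variation controls the Cauchy criterion and bounds the value. *)
Lemma Cis_gen_dominated (f : R -> C) (g G : R -> R) (D : R -> Prop) (la lb : R) :
  convexR D -> Fa D -> Fb D -> filter_prod Fa Fb (fun ab => (fst ab <= snd ab)%R) ->
  (forall x, D x -> ccont f x) -> (forall x, D x -> (Cmod (f x) <= g x)%R) ->
  (forall x, D x -> is_derive G x (g x)) -> (forall x, D x -> continuous g x) ->
  filterlim G Fa (locally la) -> filterlim G Fb (locally lb) ->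
  exists l, Cis_gen f Fa Fb l /\ (Cmod l <= lb - la)%R.
Proof.
  intros CD Ha Hb Ord Hf Hfg HG Hg La Lb.
  assert (B1 : forall a b, D a -> D b -> (a <= b)%R -> (Cmod (CRInt f a b) <= G b - G a)%R).
  { intros a b Da Db Hab.
    assert (In : forall x, (a <= x <= b)%R -> D x).
    { intros x Hx. apply (CD a b x); auto. now rewrite Rmin_left, Rmax_right by auto. }
    apply (C_RInt_norm_le f g a b); auto.
    - apply C_RInt_correct. rewrite Rmin_left, Rmax_right by auto. auto.
    - apply (is_RInt_derive (V := R_CompleteNormedModule) G g a b); rewrite Rmin_left, Rmax_right by auto; auto. }
  assert (B : forall a b, D a -> D b -> (Cmod (CRInt f a b) <= Rabs (G b - G a))%R).
  { intros a b Da Db. destruct (Rle_dec a b) as [L|L].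
    - eapply Rle_trans; [now apply B1|apply Rle_abs].
    - replace (CRInt f a b) with (- CRInt f b a).
      + rewrite Cmod_opp, Rabs_minus_sym. eapply Rle_trans; [apply B1; auto; lra|apply Rle_abs].
      + symmetry. apply C_RInt_unique. apply C_is_RInt_swap. apply C_RInt_correct.
        intros x Hx. apply Hf. apply (CD b a x); auto. }
  assert (Sp : forall a b c, D a -> D b -> D c -> CRInt f a c = CRInt f a b + CRInt f b c).
  { intros a b c Da Db Dc. apply C_RInt_unique. apply C_is_RInt_Chasles with b; apply C_RInt_correct;
    intros x Hx; apply Hf; [apply (CD a b x)|apply (CD b c x)]; auto. }
  destruct (proj1 (filterlim_locally_cauchy (U := C_R_CompleteNormedModule) (F := filter_prod Fa Fb) (fun ab => CRInt f (fst ab) (snd ab)))) as [l Hl].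
  - intros e.
    assert (He : (0 < e / 4)%R) by (generalize (cond_pos e); lra).
    exists (fun ab => (D (fst ab) /\ Rabs (G (fst ab) - la) < e / 4) /\ (D (snd ab) /\ Rabs (G (snd ab) - lb) < e / 4))%R. split.
    + exists (fun a => D a /\ (Rabs (G a - la) < e / 4)%R) (fun b => D b /\ (Rabs (G b - lb) < e / 4)%R).
      * apply filter_and; [auto|now apply (filterlim_eps Fa G la)].
      * apply filter_and; [auto|now apply (filterlim_eps Fb G lb)].
      * intros a b [H1 H2] [H3 H4]. auto.
    + intros [a b] [a' b'] [[H1 H2] [H3 H4]] [[H5 H6] [H7 H8]]. cbn [fst snd] in *.
      assert (Q : (Cmod (CRInt f a' b' - CRInt f a b) < e)%R).
      { rewrite (Sp a' a b') by auto. rewrite (Sp a b b') by auto.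
        replace (CRInt f a' a + (CRInt f a b + CRInt f b b') - CRInt f a b) with (CRInt f a' a + CRInt f b b') by ring.
        eapply Rle_lt_trans; [apply Cmod_triangle|].
        assert (Q1 := B a' a H5 H1). assert (Q2 := B b b' H3 H7).
        apply Rabs_def2 in H2. apply Rabs_def2 in H4. apply Rabs_def2 in H6. apply Rabs_def2 in H8.
        assert (Rabs (G a - G a') < e / 2)%R by (apply Rabs_def1; lra).
        assert (Rabs (G b' - G b) < e / 2)%R by (apply Rabs_def1; lra). lra. }
      split; unfold ball; simpl; unfold AbsRing_ball, abs, minus, plus, opp; simpl.
      * eapply Rle_lt_trans; [apply (Cmod_fst (CRInt f a' b' - CRInt f a b))|exact Q].
      * eapply Rle_lt_trans; [apply (Cmod_snd (CRInt f a' b' - CRInt f a b))|exact Q].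
  - assert (Hc : clim (filter_prod Fa Fb) (fun ab => CRInt f (fst ab) (snd ab)) l).
    { apply filterlim_clim; [typeclasses eauto|exact Hl]. }
    exists l. split; [apply (Cis_gen_lim f D); auto|].
    apply le_epsilon. intros e He.
    assert (He4 : (0 < e / 4)%R) by lra.
    assert (FF : filter_prod Fa Fb (fun ab => (Cmod l <= lb - la + e)%R)).
    { assert (K : filter_prod Fa Fb (fun ab => (D (fst ab) /\ Rabs (G (fst ab) - la) < e / 4) /\ (D (snd ab) /\ Rabs (G (snd ab) - lb) < e / 4))%R).
      { exists (fun a => D a /\ (Rabs (G a - la) < e / 4)%R) (fun b => D b /\ (Rabs (G b - lb) < e / 4)%R).
        * apply filter_and; [auto|now apply (filterlim_eps Fa G la)].
        * apply filter_and; [auto|now apply (filterlim_eps Fb G lb)].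
        * intros a b [H1 H2] [H3 H4]. auto. }
      generalize (filter_and _ _ (filter_and _ _ K Ord) (Hc _ He4)). apply filter_imp.
      intros [a b] [[[[H1 H2] [H3 H4]] H5] H6]. cbn [fst snd] in *.
      assert (Q := B1 a b H1 H3 H5).
      assert (T := Cmod_rev_triangle l (CRInt f a b)). rewrite Cmod_minus_sym in T.
      apply Rabs_def2 in H2. apply Rabs_def2 in H4. lra. }
    destruct (filter_ex _ FF) as [_ Q]. exact Q.
Qed.

End Gen.

Lemma Cis_gen_Chasles {Fa Fc : (R -> Prop) -> Prop} {FFa : Filter Fa} {FFc : Filter Fc} (f : R -> C) (b : R) (l m : C) :
  Cis_gen f Fa (at_point b) l -> Cis_gen f (at_point b) Fc m -> Cis_gen f Fa Fc (l + m).
Proof. apply (is_RInt_gen_Chasles (V := C_R_NormedModule)). Qed.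

Lemma filterlim_at_point (f : R -> R) (a : R) : filterlim f (at_point a) (locally (f a)).
Proof. intros P HP. unfold filtermap, at_point. now apply locally_singleton. Qed.

Lemma Rpower_pos (x a : R) : (0 < Rpower x a)%R.
Proof. apply exp_pos. Qed.

Lemma Rpower_lim_0 (a : R) : (0 < a)%R -> filterlim (fun x => Rpower x a) (at_right 0) (locally 0%R).
Proof.
  intros Ha P HP. apply (proj1 (locally_R _ _)) in HP. destruct HP as [e [He HP]].
  unfold filtermap, at_right, within.
  apply (proj2 (locally_R _ _)). exists (exp (ln e / a)). split; [apply exp_pos|].
  intros x Hx Hx0. apply HP. rewrite Rminus_0_r in *. rewrite Rabs_pos_eq in Hx by lra.
  rewrite Rabs_pos_eq by (left; apply Rpower_pos).
  unfold Rpower. rewrite <- (exp_ln e) by auto. apply exp_increasing.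
  apply (ln_increasing x) in Hx; [|auto]. rewrite ln_exp in Hx.
  apply Rmult_lt_reg_r with (/ a)%R; [now apply Rinv_0_lt_compat|].
  replace (a * ln x * / a)%R with (ln x) by (field; lra). exact Hx.
Qed.

Lemma Rpower_lim_infty (a : R) : (0 < a)%R -> filterlim (fun x => Rpower x (- a)) (Rbar_locally p_infty) (locally 0%R).
Proof.
  intros Ha P HP. apply (proj1 (locally_R _ _)) in HP. destruct HP as [e [He HP]].
  unfold filtermap. exists (exp (- ln e / a)).
  intros x Hx. apply HP. rewrite Rminus_0_r.
  assert (Px : (0 < x)%R) by (eapply Rlt_trans; [apply exp_pos|exact Hx]).
  rewrite Rabs_pos_eq by (left; apply Rpower_pos).
  unfold Rpower. rewrite <- (exp_ln e) by auto. apply exp_increasing.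
  apply (ln_increasing _ x) in Hx; [|apply exp_pos]. rewrite ln_exp in Hx.
  apply Rmult_lt_reg_r with (/ a)%R; [now apply Rinv_0_lt_compat|].
  replace (- a * ln x * / a)%R with (- ln x)%R by (field; lra).
  replace (- ln e / a)%R with (- (ln e * / a))%R in Hx by (field; lra). lra.
Qed.

Definition posR (x : R) : Prop := (0 < x)%R.

Lemma convex_posR : convexR posR.
Proof. intros a b x Ha Hb [Hx _]. unfold posR in *. eapply Rlt_le_trans; [|exact Hx]. now apply Rmin_pos. Qed.

Lemma at_right_pos : at_right 0 posR.
Proof. exists (mkposreal 1 Rlt_0_1). intros y _ Hy. exact Hy. Qed.

Lemma p_infty_pos : Rbar_locally p_infty posR.
Proof. exists 0%R. auto. Qed.

Definition is_mellin (g : R -> C) (s l : C) : Prop :=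
  Cis_gen (fun x => g x * cpow x (s - 1)) (at_right 0) (Rbar_locally p_infty) l.

Lemma is_mellin_unique (g : R -> C) (s l : C) : is_mellin g s l -> mellin g s = l.
Proof. intros H. unfold mellin. apply (Cis_gen_unique (Fa := at_right 0) (Fb := Rbar_locally p_infty)). exact H. Qed.

Lemma is_mellin_ext (g h : R -> C) (s l : C) : (forall x, (0 < x)%R -> g x = h x) -> is_mellin g s l -> is_mellin h s l.
Proof.
  intros E. apply (Cis_gen_ext _ _ posR).
  - apply convex_posR. - apply at_right_pos. - apply p_infty_pos.
  - intros x Hx. now rewrite E.
Qed.

Lemma is_mellin_plus (g h : R -> C) (s l m : C) : is_mellin g s l -> is_mellin h s m -> is_mellin (fun x => g x + h x) s (l + m).
Proof.
  intros H1 H2. eapply (Cis_gen_ext _ _ posR); [apply convex_posR|apply at_right_pos|apply p_infty_pos| |apply (Cis_gen_plus _ _ _ _ H1 H2)].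
  intros x _. cbv beta. ring.
Qed.

Lemma is_mellin_minus (g h : R -> C) (s l m : C) : is_mellin g s l -> is_mellin h s m -> is_mellin (fun x => g x - h x) s (l - m).
Proof.
  intros H1 H2. eapply (Cis_gen_ext _ _ posR); [apply convex_posR|apply at_right_pos|apply p_infty_pos| |apply (Cis_gen_minus _ _ _ _ H1 H2)].
  intros x _. cbv beta. ring.
Qed.

Lemma is_mellin_scal (g : R -> C) (c s l : C) : is_mellin g s l -> is_mellin (fun x => c * g x) s (c * l).
Proof.
  intros H1. eapply (Cis_gen_ext _ _ posR); [apply convex_posR|apply at_right_pos|apply p_infty_pos| |apply (Cis_gen_scal _ c _ H1)].
  intros x _. cbv beta. ring.
Qed.

Lemma is_mellin_shift (g : R -> C) (w s l : C) : is_mellin g (s + w) l -> is_mellin (fun x => g x * cpow x w) s l.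
Proof.
  intros H1. eapply (Cis_gen_ext _ _ posR); [apply convex_posR|apply at_right_pos|apply p_infty_pos| |apply H1].
  intros x _. cbv beta. replace (s + w - 1) with (w + (s - 1)) by ring. rewrite cpow_plus. ring.
Qed.

(** The transform of a function dominated in this way converges absolutely for
    -p < Re s < q: the integrand is at most K x^(p + Re s - 1) near 0 and at most
    K x^(Re s - q - 1) near infinity. *)
Definition dom (g : R -> C) (p q K : R) : Prop :=
  (forall x, (0 < x)%R -> @ccont R_UniformSpace g x) /\
  (forall x, (0 < x <= 1)%R -> (Cmod (g x) <= K * Rpower x p)%R) /\
  (forall x, (1 <= x)%R -> (Cmod (g x) <= K * Rpower x (- q))%R).

Lemma is_derive_Rpower (a x : R) : (0 < x)%R -> is_derive (fun y => Rpower y a) x (a * Rpower x (a - 1))%R.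
Proof. intros H. apply is_derive_Reals. now apply derivable_pt_lim_power. Qed.

Lemma continuous_Rpower (a x : R) : (0 < x)%R -> continuous (fun y => Rpower y a) x.
Proof.
  intros H. apply (ex_derive_continuous (V := R_NormedModule)). eexists. now apply is_derive_Rpower.
Qed.

Lemma filterlim_scal_R {T} (F : (T -> Prop) -> Prop) {FF : Filter F} (f : T -> R) (k l : R) :
  filterlim f F (locally l) -> filterlim (fun t => (k * f t)%R) F (locally (k * l)%R).
Proof.
  intros H. eapply filterlim_comp; [exact H|].
  apply (filterlim_scal_r (K := R_AbsRing) (V := R_NormedModule) k l).
Qed.

Lemma mellin_integrand_bound (g : R -> C) (K p x : R) (s : C) : (0 < x)%R ->
  (Cmod (g x) <= K * Rpower x p)%R ->
  (Cmod (g x * cpow x (s - 1)) <= K * Rpower x (p + Re s - 1))%R.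
Proof.
  intros Hx H. rewrite Cmod_mult, Cmod_cpow.
  replace (K * Rpower x (p + Re s - 1))%R with (K * Rpower x p * Rpower x (Re (s - 1)))%R.
  - apply Rmult_le_compat_r; [left; apply Rpower_pos|exact H].
  - rewrite Rmult_assoc, <- Rpower_plus. do 2 f_equal. destruct s; simpl. ring.
Qed.

Lemma dom_K_pos (g : R -> C) (p q K : R) : dom g p q K -> (0 <= K)%R.
Proof.
  intros (_ & H & _). specialize (H 1%R ltac:(lra)).
  assert (E : Rpower 1 p = 1%R) by (unfold Rpower; rewrite ln_1, Rmult_0_r; apply exp_0).
  rewrite E in H. generalize (Cmod_ge_0 (g 1%R)). lra.
Qed.

(** Split at 1; both halves are dominated by powers with elementary primitives,
    whose values are the two terms of the bound. *)
Lemma mellin_dom (g : R -> C) (p q K : R) (s : C) : dom g p q K -> (- p < Re s < q)%R ->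
  is_mellin g s (mellin g s) /\ (Cmod (mellin g s) <= K / (p + Re s) + K / (q - Re s))%R.
Proof.
  intros Hd [H1 H2]. assert (HK := dom_K_pos _ _ _ _ Hd). destruct Hd as (Hc & Hl & Hr).
  assert (Cc : forall x, (0 < x)%R -> @ccont R_UniformSpace (fun x => g x * cpow x (s - 1)) x).
  { intros x Hx. capply clim_mult; [now apply Hc|now apply ccont_cpow]. }
  set (a := (p + Re s)%R). set (b := (q - Re s)%R).
  assert (Ha : (0 < a)%R) by (unfold a; lra). assert (Hb : (0 < b)%R) by (unfold b; lra).
  assert (P1 : forall c, Rpower 1 c = 1%R) by (intros; unfold Rpower; rewrite ln_1, Rmult_0_r; apply exp_0).
  destruct (Cis_gen_dominated (Fa := at_right 0) (Fb := at_point 1%R) (fun x => g x * cpow x (s - 1))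
     (fun x => K * Rpower x (a - 1))%R (fun x => (K / a) * Rpower x a)%R (fun x => 0 < x <= 1)%R 0 (K / a)) as [l1 [L1 B1]].
  - intros u v x Hu Hv Hx. split.
    + eapply Rlt_le_trans; [|apply Hx]. apply Rmin_pos; lra.
    + eapply Rle_trans; [apply Hx|]. apply Rmax_lub; lra.
  - exists (mkposreal 1 Rlt_0_1). intros y Hy Hy0.
    unfold ball in Hy; simpl in Hy; unfold AbsRing_ball, abs, minus, plus, opp in Hy; simpl in Hy.
    apply Rabs_def2 in Hy. lra.
  - unfold at_point. lra.
  - exists (fun x => 0 < x <= 1)%R (fun x => x = 1%R).
    + exists (mkposreal 1 Rlt_0_1). intros y Hy Hy0.
      unfold ball in Hy; simpl in Hy; unfold AbsRing_ball, abs, minus, plus, opp in Hy; simpl in Hy.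
      apply Rabs_def2 in Hy. lra.
    + reflexivity.
    + intros x y Hx ->. simpl. lra.
  - intros x Hx. apply Cc. lra.
  - intros x Hx. apply mellin_integrand_bound; [lra|]. now apply Hl.
  - intros x Hx. replace (K * Rpower x (a - 1))%R with ((K / a) * (a * Rpower x (a - 1)))%R by (field; lra).
    apply (is_derive_scal (fun y => Rpower y a)). apply is_derive_Rpower. lra.
  - intros x Hx. apply (continuous_scal_r (V := R_NormedModule) K (fun y => Rpower y (a - 1))). apply continuous_Rpower; lra.
  - assert (Q := filterlim_scal_R _ _ (K / a) _ (Rpower_lim_0 a Ha)). rewrite Rmult_0_r in Q. exact Q.
  - assert (Q := filterlim_at_point (fun x => K / a * Rpower x a)%R 1). cbv beta in Q. rewrite P1, Rmult_1_r in Q. exact Q.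
  - destruct (Cis_gen_dominated (Fa := at_point 1%R) (Fb := Rbar_locally p_infty) (fun x => g x * cpow x (s - 1))
     (fun x => K * Rpower x (- b - 1))%R (fun x => (- K / b) * Rpower x (- b))%R (fun x => 1 <= x)%R (- K / b) 0) as [l2 [L2 B2]].
    + intros u v x Hu Hv Hx.
      eapply Rle_trans; [|apply Hx]. apply Rmin_glb; lra.
    + unfold at_point. lra.
    + exists 1%R. intros; lra.
    + exists (fun x => x = 1%R) (fun x => 1 < x)%R.
      * reflexivity.
      * exists 1%R. auto.
      * intros x y -> Hx. simpl. lra.
    + intros x Hx. apply Cc. lra.
    + intros x Hx. replace (- b - 1)%R with (- q + Re s - 1)%R by (unfold b; ring). apply mellin_integrand_bound; [lra|]. now apply Hr.
    + intros x Hx. replace (K * Rpower x (- b - 1))%R with ((- K / b) * (- b * Rpower x (- b - 1)))%R by (field; lra).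
      apply (is_derive_scal (fun y => Rpower y (- b))). apply is_derive_Rpower. lra.
    + intros x Hx. apply (continuous_scal_r (V := R_NormedModule) K (fun y => Rpower y (- b - 1))). apply continuous_Rpower; lra.
    + assert (Q := filterlim_at_point (fun x => - K / b * Rpower x (- b))%R 1). cbv beta in Q. rewrite P1, Rmult_1_r in Q. exact Q.
    + assert (Q := filterlim_scal_R _ _ (- K / b) _ (Rpower_lim_infty b Hb)). rewrite Rmult_0_r in Q. exact Q.
    + assert (L : is_mellin g s (l1 + l2)) by exact (Cis_gen_Chasles _ 1%R _ _ L1 L2).
      rewrite (is_mellin_unique _ _ _ L). split; [exact L|].
      eapply Rle_trans; [apply Cmod_triangle|].
      replace (- K / b)%R with (- (K / b))%R in B2 by (field; lra). lra.
Qed.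

Lemma mellin_correct (g : R -> C) (p q K : R) (s : C) : dom g p q K -> (- p < Re s < q)%R -> is_mellin g s (mellin g s).
Proof. intros H1 H2. eapply mellin_dom; eauto. Qed.

Lemma Rpower_mono_le1 (x a b : R) : (0 < x <= 1)%R -> (a <= b)%R -> (Rpower x b <= Rpower x a)%R.
Proof.
  intros Hx Hab. unfold Rpower. apply exp_le_mono.
  assert (ln x <= 0)%R. { rewrite <- ln_1. destruct (proj2 Hx) as [L| ->]; [left; apply ln_increasing; lra|right; auto]. }
  nra.
Qed.

Lemma Rpower_mono_ge1 (x a b : R) : (1 <= x)%R -> (a <= b)%R -> (Rpower x a <= Rpower x b)%R.
Proof.
  intros Hx Hab. unfold Rpower. apply exp_le_mono.
  assert (0 <= ln x)%R. { rewrite <- ln_1. destruct Hx as [L| ->]; [left; apply ln_increasing; lra|right; auto]. }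
  nra.
Qed.

Lemma dom_weaken (g : R -> C) (p q K p' q' K' : R) : dom g p q K -> (p' <= p)%R -> (q' <= q)%R -> (K <= K')%R -> dom g p' q' K'.
Proof.
  intros Hd Hp Hq HK. assert (K0 := dom_K_pos _ _ _ _ Hd). destruct Hd as (Hc & Hl & Hr).
  split; [exact Hc|split].
  - intros x Hx. eapply Rle_trans; [now apply Hl|]. apply Rmult_le_compat; auto; [left; apply Rpower_pos|now apply Rpower_mono_le1].
  - intros x Hx. eapply Rle_trans; [now apply Hr|]. apply Rmult_le_compat; auto; [left; apply Rpower_pos|apply Rpower_mono_ge1; lra].
Qed.

(** A factor of the size x^(+-e) costs e in both exponents; this is how logarithms
    and exponentials of logarithms are absorbed. *)
Lemma dom_mult (g m : R -> C) (p q K e A : R) : dom g p q K ->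
  (forall x, (0 < x)%R -> @ccont R_UniformSpace m x) ->
  (forall x, (0 < x)%R -> (Cmod (m x) <= A * exp (e * Rabs (ln x)))%R) ->
  dom (fun x => g x * m x) (p - e) (q - e) (K * A).
Proof.
  intros Hd Hm HA. assert (K0 := dom_K_pos _ _ _ _ Hd). destruct Hd as (Hc & Hl & Hr).
  split; [|split].
  - intros x Hx. capply clim_mult; [now apply Hc|now apply Hm].
  - intros x Hx. rewrite Cmod_mult.
    replace (K * A * Rpower x (p - e))%R with (K * Rpower x p * (A * exp (e * Rabs (ln x))))%R.
    + apply Rmult_le_compat; try apply Cmod_ge_0; [now apply Hl|apply HA; lra].
    + unfold Rminus. rewrite Rpower_plus. unfold Rpower at 3. rewrite Rabs_left1.
      * replace (- e * ln x)%R with (e * - ln x)%R by ring. ring.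
      * rewrite <- ln_1. destruct (proj2 Hx) as [L| ->]; [left; apply ln_increasing; lra|right; auto].
  - intros x Hx. rewrite Cmod_mult.
    replace (K * A * Rpower x (- (q - e)))%R with (K * Rpower x (- q) * (A * exp (e * Rabs (ln x))))%R.
    + apply Rmult_le_compat; try apply Cmod_ge_0; [now apply Hr|apply HA; lra].
    + replace (- (q - e))%R with (- q + e)%R by ring. rewrite Rpower_plus. unfold Rpower at 3. rewrite Rabs_pos_eq; [ring|].
      rewrite <- ln_1. destruct Hx as [L| ->]; [left; apply ln_increasing; lra|right; auto].
Qed.

Lemma ccont_ln (x : R) : (0 < x)%R -> @ccont R_UniformSpace (fun y => RtoC (ln y)) x.
Proof. intros H. eapply pder_cont, pder_RtoC, is_derive_Reals, derivable_pt_lim_ln. exact H. Qed.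

Lemma exp_ge_1p (y : R) : (1 + y <= exp y)%R.
Proof. destruct (Req_dec y 0) as [->|N]; [rewrite exp_0; lra|left; now apply exp_ineq1]. Qed.

Lemma le_exp_scaled (e y : R) : (0 < e)%R -> (0 <= y)%R -> (y <= / e * exp (e * y))%R.
Proof.
  intros He Hy. apply Rmult_le_reg_l with e; [auto|].
  replace (e * (/ e * exp (e * y)))%R with (exp (e * y)) by (field; lra).
  generalize (exp_ge_1p (e * y)). lra.
Qed.

Lemma dom_ln (g : R -> C) (p q K e : R) : (0 < e)%R -> dom g p q K ->
  dom (fun x => g x * RtoC (ln x)) (p - e) (q - e) (K * / e).
Proof.
  intros He Hd. apply dom_mult; auto.
  - intros x Hx. now apply ccont_ln.
  - intros x Hx. rewrite Cmod_R. apply le_exp_scaled; [auto|apply Rabs_pos].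
Qed.

(** Differentiation under the integral sign.  With h = w - s the error of the
    difference quotient is the transform of g m, m = x^h - 1 - h ln x, and
    |m| <= |h|^2 (ln x)^2 exp (|h ln x|).  A part of the room left by
    -p < Re s < q, split into pieces e, absorbs the logarithms and the power. *)
Lemma mellin_cder (g : R -> C) (p q K : R) (s : C) : dom g p q K -> (- p < Re s < q)%R ->
  cder (mellin g) s (mellin (fun x => g x * RtoC (ln x)) s).
Proof.
  intros Hd [H1 H2]. assert (K0 := dom_K_pos _ _ _ _ Hd).
  set (e := (Rmin (p + Re s) (q - Re s) / 8)%R).
  assert (M1 := Rmin_l (p + Re s) (q - Re s)). assert (M2 := Rmin_r (p + Re s) (q - Re s)).
  assert (He : (0 < e)%R) by (unfold e; assert (0 < Rmin (p + Re s) (q - Re s))%R by (apply Rmin_pos; lra); lra).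
  assert (E1 : (8 * e <= p + Re s)%R) by (unfold e; lra). assert (E2 : (8 * e <= q - Re s)%R) by (unfold e; lra).
  set (L := (K * (/ e * / e) * (/ e + / e))%R).
  assert (Ie := Rinv_0_lt_compat e He).
  assert (HL : (0 <= L)%R) by (unfold L; repeat apply Rmult_le_pos; lra).
  intros eps Heps.
  exists (Rmin e (eps / (L + 1))).
  split; [apply Rmin_pos; [auto|apply Rdiv_lt_0_compat; lra]|].
  intros w Hw. set (h := w - s).
  assert (W1 : (Cmod h < e)%R) by (eapply Rlt_le_trans; [exact Hw|apply Rmin_l]).
  assert (W2 : (Cmod h < eps / (L + 1))%R) by (eapply Rlt_le_trans; [exact Hw|apply Rmin_r]).
  assert (Rh : (Rabs (Re w - Re s) < e)%R).
  { eapply Rle_lt_trans; [|exact W1]. apply (Cmod_fst h). }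
  apply Rabs_def2 in Rh.
  set (m := fun x => Cexp (h * RtoC (ln x)) - 1 - h * RtoC (ln x)).
  assert (Ph := Cmod_ge_0 h).
  assert (Dm : dom (fun x => g x * m x) (p - 3 * e) (q - 3 * e) (K * (Cmod h * Cmod h * (/ e * / e)))).
  { apply dom_mult; auto.
    - intros x Hx. assert (Q := ccont_ln x Hx).
      assert (Q2 : @ccont R_UniformSpace (fun y => h * RtoC (ln y)) x) by (capply clim_mult; [capply clim_const|exact Q]).
      capply clim_minus; [capply clim_minus; [exact (ccont_Cexp (T:=R_UniformSpace) (fun y => h * RtoC (ln y)) x Q2)|capply clim_const]|exact Q2].
    - intros x Hx. unfold m. eapply Rle_trans; [apply Cexp_bound2|].
      rewrite Cmod_mult, Cmod_R. set (y := Rabs (ln x)). assert (Py : (0 <= y)%R) by apply Rabs_pos.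
      assert (Q := le_exp_scaled e y He Py).
      replace (exp (3 * e * y)) with (exp (e * y) * exp (e * y) * exp (e * y))%R by (rewrite <- !exp_plus; f_equal; ring).
      assert (Q2 : (exp (Cmod h * y) <= exp (e * y))%R) by (apply exp_le_mono; nra).
      replace (Cmod h * y * (Cmod h * y) * exp (Cmod h * y))%R with (Cmod h * Cmod h * (y * y * exp (Cmod h * y)))%R by ring.
      replace (Cmod h * Cmod h * (/ e * / e) * (exp (e * y) * exp (e * y) * exp (e * y)))%R with
        (Cmod h * Cmod h * ((/ e * exp (e * y)) * (/ e * exp (e * y)) * exp (e * y)))%R by ring.
      apply Rmult_le_compat_l; [nra|]. apply Rmult_le_compat; [nra|left; apply exp_pos| |exact Q2].
      apply Rmult_le_compat; auto. }
  assert (Dl := dom_ln g p q K e He Hd).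
  destruct (mellin_dom _ _ _ _ s Dm ltac:(lra)) as [I1 B1].
  assert (I2 := mellin_correct _ _ _ _ s Dl ltac:(lra)).
  assert (I3 := mellin_correct _ _ _ _ s Hd ltac:(lra)).
  assert (I4 := mellin_correct _ _ _ _ w Hd ltac:(lra)).
  assert (E : mellin (fun x => g x * m x) s = mellin g w - mellin g s - mellin (fun x => g x * RtoC (ln x)) s * h).
  { apply is_mellin_unique.
    replace w with (s + h) in I4 by (unfold h; ring). apply is_mellin_shift in I4.
    replace (s + h) with w in I4 by (unfold h; ring).
    eapply is_mellin_ext; [|apply is_mellin_minus; [apply is_mellin_minus; [exact I4|exact I3]|]].
    2:{ rewrite Cmult_comm. apply is_mellin_scal. exact I2. }
    intros x Hx. unfold m, cpow. ring. }
  rewrite <- E. eapply Rle_trans; [exact B1|].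
  fold h.
  apply Rle_trans with (L * Cmod h * Cmod h)%R.
  - unfold L.
    assert (J1 : (/ (p - 3 * e + Re s) <= / e)%R) by (apply Rinv_le_contravar; lra).
    assert (J2 : (/ (q - 3 * e - Re s) <= / e)%R) by (apply Rinv_le_contravar; lra).
    replace (K * (/ e * / e) * (/ e + / e) * Cmod h * Cmod h)%R with
      (K * (Cmod h * Cmod h * (/ e * / e)) * / e + K * (Cmod h * Cmod h * (/ e * / e)) * / e)%R by ring.
    unfold Rdiv. apply Rplus_le_compat; apply Rmult_le_compat_l; auto; repeat apply Rmult_le_pos; lra.
  - apply Rmult_le_compat_r; [auto|].
    assert (Cmod h * (L + 1) <= eps)%R.
    { apply Rle_trans with (eps / (L + 1) * (L + 1))%R; [apply Rmult_le_compat_r; lra|]. right; field; lra. }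
    nra.
Qed.

Lemma mellin_holo (g : R -> C) (p q K : R) (s : C) : dom g p q K -> (- p < Re s < q)%R -> holomorphic_at (mellin g) s.
Proof. intros Hd Hs. eapply cder_holo, mellin_cder; eauto. Qed.

Lemma dom_limits (g : R -> C) (p q K : R) (s : C) : dom g p q K -> (- p < Re s < q)%R ->
  clim (at_right 0) (fun x => g x * cpow x s) 0 /\ clim (Rbar_locally p_infty) (fun x => g x * cpow x s) 0.
Proof.
  intros Hd [H1 H2]. destruct Hd as (Hc & Hl & Hr). split.
  - apply clim_squeeze with (fun x => K * Rpower x (p + Re s))%R; [typeclasses eauto| |].
    + intros e He.
      assert (L := filterlim_scal_R (at_right 0) _ K _ (Rpower_lim_0 (p + Re s) ltac:(lra))).
      generalize (filterlim_eps _ _ _ L e He). apply filter_imp. intros x Hx.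
      rewrite Rmult_0_r, Rminus_0_r in Hx. eapply Rle_lt_trans; [apply Rle_abs|exact Hx].
    + exists (mkposreal 1 Rlt_0_1). intros x Hy Hx.
      unfold ball in Hy; simpl in Hy; unfold AbsRing_ball, abs, minus, plus, opp in Hy; simpl in Hy.
      apply Rabs_def2 in Hy.
      replace (g x * cpow x s - 0) with (g x * cpow x (s + 1 - 1)).
      2:{ replace (s + 1 - 1) with s by ring. ring. }
      replace (p + Re s)%R with (p + Re (s + 1) - 1)%R by (destruct s; simpl; ring).
      apply mellin_integrand_bound; [auto|]. apply Hl. lra.
  - apply clim_squeeze with (fun x => K * Rpower x (- (q - Re s)))%R; [typeclasses eauto| |].
    + intros e He.
      assert (L := filterlim_scal_R (Rbar_locally p_infty) _ K _ (Rpower_lim_infty (q - Re s) ltac:(lra))).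
      generalize (filterlim_eps _ _ _ L e He). apply filter_imp. intros x Hx.
      rewrite Rmult_0_r, Rminus_0_r in Hx. eapply Rle_lt_trans; [apply Rle_abs|exact Hx].
    + exists 1%R. intros x Hx.
      replace (g x * cpow x s - 0) with (g x * cpow x (s + 1 - 1)).
      2:{ replace (s + 1 - 1) with s by ring. ring. }
      replace (- (q - Re s))%R with (- q + Re (s + 1) - 1)%R by (destruct s; simpl; ring).
      apply mellin_integrand_bound; [lra|]. apply Hr. lra.
Qed.

(** The boundary terms g x * x^s vanish at both ends inside the strip. *)
Lemma mellin_by_parts (g dg : R -> C) (p q K K' : R) (s : C) :
  (forall x, (0 < x)%R -> pder g x (dg x)) ->
  dom g p q K -> dom (fun x => RtoC x * dg x) p q K' -> (- p < Re s < q)%R ->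
  mellin (fun x => RtoC x * dg x) s = - s * mellin g s.
Proof.
  intros Hg D1 D2 Hs.
  assert (I1 := mellin_correct _ _ _ _ s D1 Hs). assert (I2 := mellin_correct _ _ _ _ s D2 Hs).
  destruct (dom_limits _ _ _ _ _ D1 Hs) as [L0 L1].
  assert (I3 := is_mellin_plus _ _ _ _ _ I2 (is_mellin_scal _ s _ _ I1)).
  assert (Z : is_mellin (fun x => RtoC x * dg x + s * g x) s (0 - 0)).
  { apply (Cis_gen_FTC (fun x => g x * cpow x s) _ posR); auto.
    - apply convex_posR. - apply at_right_pos. - apply p_infty_pos.
    - intros x Hx. eapply pder_eq; [|apply pder_mult; [now apply Hg|now apply pder_cpow]].
      cbv beta. unfold Cminus at 1. replace (cpow x s) with (RtoC x * cpow x (s - 1)); [unfold Cminus; ring|].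
      rewrite <- (cpow_1 x) at 1 by exact Hx. rewrite <- cpow_plus. f_equal. ring.
    - intros x Hx. capply clim_mult; [|now apply ccont_cpow].
      capply clim_plus; [now apply D2|]. capply clim_mult; [capply clim_const|now apply D1]. }
  assert (E := eq_trans (eq_sym (is_mellin_unique _ _ _ I3)) (is_mellin_unique _ _ _ Z)).
  replace (mellin (fun x => RtoC x * dg x) s) with (mellin (fun x => RtoC x * dg x) s + s * mellin g s - s * mellin g s) by ring.
  rewrite E. ring.
Qed.

(** * The Gamma function and the Mellin transform of the sine *)

Lemma ccont_RtoC (x : R) : @ccont R_UniformSpace RtoC x.
Proof. eapply pder_cont, pder_id. Qed.

(** The constant comes from x >= q (1 + ln (x / q)), which bounds exp (-x) by
    exp (q ln q - q) x^-q. *)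
Lemma dom_exp_neg (q : R) : (0 < q)%R -> dom (fun t => RtoC (exp (- t))) 0 q (1 + exp (q * ln q - q)).
Proof.
  intros Hq. assert (E0 := exp_pos (q * ln q - q)).
  assert (P : forall x, pder (fun t => RtoC (exp (- t))) x (RtoC (- exp (- x)))).
  { intros x. apply pder_RtoC. auto_derive; auto. ring. }
  split; [|split].
  - intros x _. eapply pder_cont, P.
  - intros x Hx. rewrite Cmod_R, Rabs_pos_eq by (left; apply exp_pos).
    unfold Rpower. rewrite Rmult_0_l, exp_0.
    assert (exp (- x) <= 1)%R by (rewrite <- exp_0; apply exp_le_mono; lra). lra.
  - intros x Hx. rewrite Cmod_R, Rabs_pos_eq by (left; apply exp_pos).
    apply Rle_trans with (exp (q * ln q - q) * Rpower x (- q))%R.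
    + unfold Rpower. rewrite <- exp_plus. apply exp_le_mono.
      assert (Q := exp_ge_1p (ln x - ln q)). unfold Rminus in Q at 2. rewrite exp_plus, exp_Ropp, !exp_ln in Q by lra.
      assert (q * (1 + (ln x - ln q)) <= x)%R.
      { apply Rle_trans with (q * (x * / q))%R; [apply Rmult_le_compat_l; lra|right; field; lra]. }
      lra.
    + apply Rmult_le_compat_r; [left; apply Rpower_pos|lra].
Qed.

Lemma CGamma_mellin (s : C) : (0 < Re s)%R -> is_mellin (fun t => RtoC (exp (- t))) s (CGamma s).
Proof.
  intros H. apply (mellin_correct _ 0 (Re s + 1) _ s (dom_exp_neg (Re s + 1) ltac:(lra))). lra.
Qed.

Lemma CGamma_holo (s : C) : (0 < Re s)%R -> holomorphic_at CGamma s.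
Proof.
  intros H. apply (mellin_holo _ 0 (Re s + 1) _ s (dom_exp_neg (Re s + 1) ltac:(lra))). lra.
Qed.

Lemma is_mellin_times_x (g : R -> C) (s l : C) : is_mellin g (s + 1) l -> is_mellin (fun x => RtoC x * g x) s l.
Proof.
  intros H. apply is_mellin_shift in H. eapply is_mellin_ext; [|exact H].
  intros x Hx. cbv beta. rewrite cpow_1 by auto. ring.
Qed.

Lemma dom_times_x (g : R -> C) (p q K : R) : dom g p q K -> dom (fun x => RtoC x * g x) (p + 1) (q - 1) K.
Proof.
  intros Hd. assert (K0 := dom_K_pos _ _ _ _ Hd). destruct Hd as (Hc & Hl & Hr).
  split; [|split].
  - intros x Hx. capply clim_mult; [apply ccont_RtoC|now apply Hc].
  - intros x Hx. rewrite Cmod_mult, Cmod_R, Rabs_pos_eq by lra. rewrite Rpower_plus, Rpower_1 by lra.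
    assert (Q := Hl x Hx). assert (x * Cmod (g x) <= x * (K * Rpower x p))%R by (apply Rmult_le_compat_l; lra). lra.
  - intros x Hx. rewrite Cmod_mult, Cmod_R, Rabs_pos_eq by lra.
    replace (- (q - 1))%R with (- q + 1)%R by ring. rewrite Rpower_plus, Rpower_1 by lra.
    assert (Q := Hr x Hx). assert (x * Cmod (g x) <= x * (K * Rpower x (- q)))%R by (apply Rmult_le_compat_l; lra). lra.
Qed.

Lemma dom_ext (g h : R -> C) (p q K : R) : (forall x, g x = h x) -> dom g p q K -> dom h p q K.
Proof.
  intros E (H1 & H2 & H3). split; [|split].
  - intros x Hx. unfold ccont. rewrite <- E. capply (clim_ext _ g); [exact E|now apply H1].
  - intros x Hx. rewrite <- E. auto.
  - intros x Hx. rewrite <- E. auto.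
Qed.

Lemma dom_opp (g : R -> C) (p q K : R) : dom g p q K -> dom (fun x => - g x) p q K.
Proof.
  intros (H1 & H2 & H3). split; [|split].
  - intros x Hx. capply clim_opp. now apply H1.
  - intros x Hx. rewrite Cmod_opp. auto.
  - intros x Hx. rewrite Cmod_opp. auto.
Qed.

Lemma CGamma_step (s : C) : (0 < Re s)%R -> CGamma (s + 1) = s * CGamma s.
Proof.
  intros H. set (q := (Re s + 3)%R).
  assert (Hq : (0 < q)%R) by (unfold q; lra).
  assert (D := dom_exp_neg q Hq). set (K := (1 + exp (q * ln q - q))%R) in D.
  assert (D1 := dom_weaken _ _ _ _ 0 (q - 1) K D ltac:(lra) ltac:(lra) ltac:(lra)).
  assert (E := mellin_by_parts (fun t => RtoC (exp (- t))) (fun t => - RtoC (exp (- t))) 0 (q - 1) K K s).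
  assert (Q : mellin (fun x => RtoC x * - RtoC (exp (- x))) s = - s * CGamma s).
  { apply E; auto.
    - intros x _. eapply pder_eq; [|apply pder_RtoC; auto_derive; auto]. rewrite <- RtoC_opp. f_equal. ring.
    - apply (dom_weaken _ (0 + 1) (q - 1) K); try lra. apply dom_times_x. now apply dom_opp.
    - unfold q. lra. }
  assert (I : is_mellin (fun t => RtoC (exp (- t))) (s + 1) (CGamma (s + 1))).
  { apply CGamma_mellin. destruct s; simpl in *. lra. }
  apply is_mellin_times_x in I. apply (is_mellin_scal _ (- (1))) in I.
  apply (is_mellin_ext _ (fun x => RtoC x * - RtoC (exp (- x)))) in I; [|intros; ring].
  apply is_mellin_unique in I. rewrite Q in I.
  replace (CGamma (s + 1)) with (- (- (1) * CGamma (s + 1))) by ring. rewrite <- I. ring.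
Qed.

Lemma pder_Cexp_scal (c : C) (x : R) : pder (fun x => Cexp (c * RtoC x) - 1) x (c * Cexp (c * RtoC x)).
Proof.
  eapply pder_eq; [|apply pder_minus; [|apply pder_const]].
  2:{ apply pder_ext with (fun u => Cexp (RtoC u * c)); [intros; f_equal; ring|]. apply pder_Cexp_line. }
  rewrite (Cmult_comm (RtoC x)). ring.
Qed.

Lemma dom_expm1 (c : C) : Cmod c = 1%R -> (Re c <= 0)%R -> dom (fun x => Cexp (c * RtoC x) - 1) 1 0 3.
Proof.
  intros Hc Hr.
  assert (R1 : forall x, Re (c * RtoC x) = (Re c * x)%R) by (intros; destruct c; Csimp; ring).
  split; [|split].
  - intros x _. eapply pder_cont, pder_Cexp_scal.
  - intros x Hx. rewrite Rpower_1 by lra. eapply Rle_trans; [apply Cexp_bound1|].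
    rewrite Cmod_mult, Hc, Cmod_R, Rabs_pos_eq, Rmult_1_l by lra.
    assert (exp x <= 3)%R by (eapply Rle_trans; [apply exp_le_mono, Hx|apply exp_le_3]).
    rewrite (Rmult_comm 3). apply Rmult_le_compat_l; lra.
  - intros x Hx. rewrite Ropp_0. unfold Rpower. rewrite Rmult_0_l, exp_0.
    eapply Rle_trans; [apply Cmod_triangle|]. rewrite Cmod_opp, Cmod_1, Cmod_Cexp, R1.
    assert (exp (Re c * x) <= 1)%R by (rewrite <- exp_0; apply exp_le_mono; nra). lra.
Qed.

(** As exp (-x) - 1 vanishes at 0, its transform continues Euler's integral to
    -1 < Re z < 0: integration by parts leads to Gamma (z + 1), and two steps of
    the recursion to Gamma (z + 3). *)
Lemma mellin_expm1_real (z : C) : (-1 < Re z < 0)%R ->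
  CGamma (z + 3) = z * (z + 1) * (z + 2) * mellin (fun x => Cexp (- (1) * RtoC x) - 1) z.
Proof.
  intros Hz.
  assert (D := dom_expm1 (- (1)) ltac:(now rewrite Cmod_opp, Cmod_1) ltac:(Csimp; lra)).
  assert (Dx : dom (fun x => RtoC x * (- (1) * Cexp (- (1) * RtoC x))) 1 0 (1 + exp (1 * ln 1 - 1))).
  { apply dom_ext with (fun x => RtoC x * - RtoC (exp (- x))).
    - intros x. replace (- (1) * RtoC x) with (RtoC (- x)) by (rewrite RtoC_opp; ring). rewrite Cexp_RtoC. ring.
    - apply (dom_weaken _ (0 + 1) (1 - 1) (1 + exp (1 * ln 1 - 1))); try lra. apply dom_times_x, dom_opp, dom_exp_neg. lra. }
  assert (E := mellin_by_parts _ _ 1 0 _ _ z (fun x _ => pder_Cexp_scal (- (1)) x) D Dx ltac:(lra)).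
  assert (I : is_mellin (fun t => RtoC (exp (- t))) (z + 1) (CGamma (z + 1))).
  { apply CGamma_mellin. destruct z; simpl in *. lra. }
  apply is_mellin_times_x in I. apply (is_mellin_scal _ (- (1))) in I.
  apply (is_mellin_ext _ (fun x => RtoC x * (- (1) * Cexp (- (1) * RtoC x)))) in I.
  2:{ intros x _. replace (- (1) * RtoC x) with (RtoC (- x)) by (rewrite RtoC_opp; ring). rewrite Cexp_RtoC. ring. }
  apply is_mellin_unique in I. cbv beta in E. rewrite I in E.
  replace (z + 3) with (z + 1 + 1 + 1) by ring.
  rewrite (CGamma_step (z + 1 + 1)) by (destruct z; simpl in *; lra).
  rewrite (CGamma_step (z + 1)) by (destruct z; simpl in *; lra).
  replace (CGamma (z + 1)) with (- (- (1) * CGamma (z + 1))) by ring. rewrite E. ring.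
Qed.

(** ** Rotation of the contour *)

(** In the variable u = ln x the transform of exp (-x) - 1 is the integral of this
    entire function along the real axis.  Along Im u = c the variable x is replaced
    by x exp (i c), and c = pi/2, -pi/2 give exp (-i x) and exp (i x). *)
Definition rot_fun (z u : C) : C := (Cexp (- Cexp u) - 1) * Cexp (z * u).

Lemma rot_fun_holo (z u : C) : holomorphic_at (rot_fun z) u.
Proof.
  apply holo_mult.
  - apply holo_minus; [|apply holo_const]. apply holo_Cexp, holo_opp, holo_Cexp, holo_id.
  - apply holo_Cexp. apply holo_mult; [apply holo_const|apply holo_id].
Qed.

Lemma exp_change_var (G : R -> C) (z : C) (X : R) :
  (forall x, (0 < x)%R -> @ccont R_UniformSpace G x) ->
  Cis_RInt (fun x => G (exp x) * Cexp (z * RtoC x)) (- X) X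
    (CRInt (fun y => G y * cpow y (z - 1)) (exp (- X)) (exp X)).
Proof.
  intros HG.
  assert (Q := is_RInt_comp (V := C_R_CompleteNormedModule) (fun y => G y * cpow y (z - 1)) exp exp (- X) X).
  eapply C_is_RInt_ext; [|apply Q].
  - intros x _. etransitivity; [apply (scal_R_Cmult (exp x) (G (exp x) * cpow (exp x) (z - 1)))|]. unfold cpow. rewrite ln_exp.
    replace ((z - 1) * RtoC x) with (z * RtoC x + - RtoC x) by ring.
    rewrite Cexp_plus, Cexp_opp, Cexp_RtoC. field. intros E. apply RtoC_inj in E. generalize (exp_pos x). lra.
  - intros x _. apply ccont_continuous. capply clim_mult; [apply HG, exp_pos|apply ccont_cpow, exp_pos].
  - intros x _. split; [apply is_derive_Reals, derivable_pt_lim_exp|].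
    apply (ex_derive_continuous (V := R_NormedModule)). eexists. apply is_derive_Reals, derivable_pt_lim_exp.
Qed.

Lemma filterlim_exp_window :
  filterlim (fun X => (exp (- X), exp X)) (Rbar_locally p_infty) (filter_prod (at_right 0) (Rbar_locally p_infty)).
Proof.
  apply filterlim_pair.
  - intros P [d Hd]. unfold filtermap. exists (- ln d)%R. intros X HX. apply Hd; [|apply exp_pos].
    unfold ball; simpl; unfold AbsRing_ball, abs, minus, plus, opp; simpl.
    rewrite Ropp_0, Rplus_0_r, Rabs_pos_eq by (left; apply exp_pos).
    rewrite <- (exp_ln d) by apply cond_pos. apply exp_increasing. lra.
  - intros P [M HM]. exists (M). intros X HX. apply HM. eapply Rlt_trans; [exact HX|].
    generalize (exp_ge_1p X). lra.
Qed.

(** The symmetric windows [-X, X] in the variable u correspond to the windows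
    [exp (-X), exp X] in x. *)
Lemma mellin_window (G : R -> C) (z l : C) : (forall x, (0 < x)%R -> @ccont R_UniformSpace G x) ->
  is_mellin G z l ->
  clim (Rbar_locally p_infty) (fun X => CRInt (fun x => G (exp x) * Cexp (z * RtoC x)) (- X) X) l.
Proof.
  intros HG H.
  apply (Cis_gen_lim _ posR) in H; [|apply convex_posR|apply at_right_pos|apply p_infty_pos|].
  - capply (clim_ext _ (fun X => CRInt (fun y => G y * cpow y (z - 1)) (exp (- X)) (exp X))).
    + intros X. symmetry. apply C_RInt_unique. now apply exp_change_var.
    + apply (clim_comp _ _ (fun X => (exp (- X), exp X)) _ _ H filterlim_exp_window).
  - intros x Hx. capply clim_mult; [now apply HG|now apply ccont_cpow].
Qed.

Lemma Cmod_expm1_le (v : C) : (Re v <= 0)%R -> (Cmod (Cexp v - 1) <= 2)%R.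
Proof.
  intros H. eapply Rle_trans; [apply Cmod_triangle|]. rewrite Cmod_opp, Cmod_1, Cmod_Cexp.
  assert (exp (Re v) <= 1)%R by (rewrite <- exp_0; now apply exp_le_mono). lra.
Qed.

Lemma exp_lim_infty (a : R) : (a < 0)%R -> forall e, (0 < e)%R ->
  Rbar_locally p_infty (fun X => (exp (a * X) < e)%R).
Proof.
  intros Ha e He. exists (ln e / a)%R. intros X HX.
  rewrite <- (exp_ln e) by auto. apply exp_increasing.
  assert (Q := Rmult_lt_gt_compat_neg_l a _ _ Ha HX).
  replace (a * (ln e / a))%R with (ln e) in Q by (field; lra). lra.
Qed.

Lemma scaled_lim {T} (F : (T -> Prop) -> Prop) {FF : Filter F} (f : T -> R) (k : R) : (0 <= k)%R ->
  (forall e, (0 < e)%R -> F (fun t => (f t < e)%R)) -> forall e, (0 < e)%R -> F (fun t => (k * f t < e)%R).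
Proof.
  intros Hk H e He. assert (P : (0 < e / (k + 1))%R) by (apply Rdiv_lt_0_compat; lra).
  generalize (H _ P). apply filter_imp. intros t Ht.
  destruct (Rle_lt_dec (f t) 0); [nra|].
  apply Rlt_le_trans with ((k + 1) * f t)%R; [nra|].
  apply Rle_trans with ((k + 1) * (e / (k + 1)))%R; [apply Rmult_le_compat_l; lra|right; field; lra].
Qed.

(** For |Im u| <= pi/2 the real part of exp u is nonnegative, so the first factor
    of [rot_fun] is bounded on the right side, where Re z < 0 makes the second one
    small; on the left side the first factor is O(exp (-X)), which outweighs the
    second because Re z > -1. *)
Lemma rot_vertical (z : C) (c d : R) : (-1 < Re z < 0)%R -> (c <= d)%R -> (- (PI / 2) <= c)%R -> (d <= PI / 2)%R ->
  clim (Rbar_locally p_infty) (fun X => CRInt (fun y => rot_fun z (X, y)) c d) 0 /\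
  clim (Rbar_locally p_infty) (fun X => CRInt (fun y => rot_fun z (- X, y)%R) c d) 0.
Proof.
  intros Hz Hcd Hc Hd.
  set (A := exp (Rabs (Im z) * (PI / 2))).
  assert (HA : (0 < A)%R) by apply exp_pos.
  assert (Bz : forall X y, (c <= y <= d)%R -> (Cmod (Cexp (z * (X, y))) <= A * exp (Re z * X))%R).
  { intros X y Hy. rewrite Cmod_Cexp. unfold A. rewrite <- exp_plus. apply exp_le_mono.
    replace (Re (z * (X, y))) with (Re z * X - Im z * y)%R by (destruct z; reflexivity).
    assert (- (Im z * y) <= Rabs (Im z) * (PI / 2))%R.
    { eapply Rle_trans; [apply Rle_abs|]. rewrite Rabs_Ropp, Rabs_mult. apply Rmult_le_compat_l; [apply Rabs_pos|].
      apply Rabs_le. lra. }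
    lra. }
  assert (Re1 : forall X y, (c <= y <= d)%R -> (Re (- Cexp (X, y)) <= 0)%R).
  { intros X y Hy. replace (Re (- Cexp (X, y))) with (- (exp X * cos y))%R by (unfold Cexp; Csimp; ring).
    assert (0 <= cos y)%R by (apply cos_ge_0; lra). generalize (exp_pos X). nra. }
  assert (Ic : forall X, Cis_RInt (fun y => rot_fun z (X, y)) c d (CRInt (fun y => rot_fun z (X, y)) c d)).
  { intros X. apply vline_RInt; auto. intros y _. apply holo_cont, rot_fun_holo. }
  split.
  - apply clim_squeeze with (fun X => (2 * A * (d - c)) * exp (Re z * X))%R; [typeclasses eauto| |].
    + apply scaled_lim; [typeclasses eauto| |apply exp_lim_infty; lra].
      repeat apply Rmult_le_pos; lra.
    + apply filter_forall. intros X.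
      replace (CRInt (fun y => rot_fun z (X, y)) c d - 0) with (CRInt (fun y => rot_fun z (X, y)) c d) by ring.
      replace (2 * A * (d - c) * exp (Re z * X))%R with (2 * (A * exp (Re z * X)) * (d - c))%R by ring.
      eapply C_RInt_norm_const; [exact Hcd| |apply Ic].
      intros y Hy. unfold rot_fun. rewrite Cmod_mult. apply Rmult_le_compat; try apply Cmod_ge_0.
      * apply Cmod_expm1_le. now apply Re1.
      * now apply Bz.
  - apply clim_squeeze with (fun X => (3 * A * (d - c)) * exp ((- (1 + Re z)) * X))%R; [typeclasses eauto| |].
    + apply scaled_lim; [typeclasses eauto| |apply exp_lim_infty; lra].
      repeat apply Rmult_le_pos; lra.
    + exists 0%R. intros X HX.
      replace (CRInt (fun y => rot_fun z ((- X)%R, y)) c d - 0) with (CRInt (fun y => rot_fun z ((- X)%R, y)) c d) by ring.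
      replace (3 * A * (d - c) * exp (- (1 + Re z) * X))%R with (exp (- X) * 3 * (A * exp (Re z * - X)) * (d - c))%R.
      2:{ replace (- (1 + Re z) * X)%R with (- X + Re z * - X)%R by ring. rewrite exp_plus. ring. }
      eapply C_RInt_norm_const; [exact Hcd| |apply Ic].
      intros y Hy. unfold rot_fun. rewrite Cmod_mult. apply Rmult_le_compat; try apply Cmod_ge_0.
      * eapply Rle_trans; [apply Cexp_bound1|]. rewrite Cmod_opp, Cmod_Cexp. simpl.
        apply Rmult_le_compat_l; [left; apply exp_pos|].
        eapply Rle_trans; [apply exp_le_mono with (y := 1%R)|apply exp_le_3].
        rewrite <- exp_0. apply exp_le_mono. lra.
      * now apply Bz.
Qed.

(** The rectangle between the two lines contains no singularity and its vertical
    sides vanish in the limit. *)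
Lemma rot_equal (z : C) (c d : R) (lc ld : C) : (-1 < Re z < 0)%R -> (c <= d)%R -> (- (PI / 2) <= c)%R -> (d <= PI / 2)%R ->
  clim (Rbar_locally p_infty) (fun X => CRInt (fun x => rot_fun z (x, c)) (- X) X) lc ->
  clim (Rbar_locally p_infty) (fun X => CRInt (fun x => rot_fun z (x, d)) (- X) X) ld -> lc = ld.
Proof.
  intros Hz Hcd Hc Hd Lc Ld.
  destruct (rot_vertical z c d Hz Hcd Hc Hd) as [V1 V2].
  assert (L : clim (Rbar_locally p_infty) (fun X => rint (rot_fun z) (- X) X c d) (lc + Ci * 0 - ld - Ci * 0)).
  { unfold rint. capply clim_minus; [capply clim_minus; [capply clim_plus; [exact Lc|]|exact Ld]|].
    - capply clim_mult; [capply clim_const|exact V1].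
    - capply clim_mult; [capply clim_const|exact V2]. }
  assert (Z : clim (Rbar_locally p_infty) (fun X => rint (rot_fun z) (- X) X c d) 0).
  { apply clim_ext_loc with (fun _ => 0); [typeclasses eauto| |capply clim_const].
    exists 0%R. intros X HX. symmetry. apply goursat; [lra|auto|]. intros x y _ _. apply rot_fun_holo. }
  assert (E := clim_unique _ _ _ _ L Z).
  replace lc with (lc + Ci * 0 - ld - Ci * 0 + ld) by ring. rewrite E. ring.
Qed.

Lemma Cexp_line_at (x c : R) : Cexp (x, c) = RtoC (exp x) * (cos c, sin c).
Proof. reflexivity. Qed.

Lemma rot_line (z c1 : C) (c : R) : (-1 < Re z < 0)%R -> Cmod c1 = 1%R -> (Re c1 <= 0)%R -> c1 = - (cos c, sin c) ->
  clim (Rbar_locally p_infty) (fun X => CRInt (fun x => rot_fun z (x, c)) (- X) X)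
    (Cexp (z * (0, c)) * mellin (fun x => Cexp (c1 * RtoC x) - 1) z).
Proof.
  intros Hz H1 H2 H3.
  assert (D := dom_expm1 c1 H1 H2).
  assert (I := mellin_correct _ _ _ _ z D ltac:(lra)).
  assert (W := mellin_window _ _ _ (proj1 D) I).
  apply clim_ext with (fun X => Cexp (z * (0, c)) * CRInt (fun x => (Cexp (c1 * RtoC (exp x)) - 1) * Cexp (z * RtoC x)) (- X) X);
    [typeclasses eauto| |capply clim_mult; [capply clim_const|exact W]].
  intros X.
  assert (Ev := exp_change_var (fun x => Cexp (c1 * RtoC x) - 1) z X (proj1 D)).
  assert (Eu := C_RInt_unique _ _ _ _ Ev). cbv beta in Eu, Ev. rewrite <- Eu in Ev.
  symmetry. apply C_RInt_unique.
  eapply C_is_RInt_ext; [|exact (C_is_RInt_scal _ _ _ (Cexp (z * (0, c))) _ Ev)].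
  intros x _. cbv beta. unfold rot_fun.
  replace (z * (x, c)) with (z * (0, c) + z * RtoC x) by (destruct z; Cext; ring).
  rewrite Cexp_plus, Cexp_line_at, H3.
  replace (- (RtoC (exp x) * (cos c, sin c))) with (- (cos c, sin c) * RtoC (exp x)) by ring. ring.
Qed.

Lemma sin_Cexp (x : R) : RtoC (sin x) = (Cexp (Ci * RtoC x) - Cexp (- Ci * RtoC x)) / (2 * Ci).
Proof.
  replace (Ci * RtoC x) with ((0, x) : C) by (Cext; ring).
  replace (- Ci * RtoC x) with ((0, (- x)%R) : C) by (Cext; ring).
  rewrite !Cexp_line_at, exp_0, cos_neg, sin_neg.
  replace (RtoC 1 * (cos x, sin x) - RtoC 1 * (cos x, (- sin x)%R)) with (2 * Ci * RtoC (sin x)) by (Cext; ring).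
  field. apply Ci_nz.
Qed.

(** The sine is a combination of exp (i x) - 1 and exp (-i x) - 1, and both
    transforms are multiples of that of exp (-x) - 1 by rotation.  The strip
    -1 < Re z < 0 is where all three converge absolutely. *)
Lemma mellin_sin (z : C) : (-1 < Re z < 0)%R ->
  is_mellin (fun x => RtoC (sin x)) z
    ((Cexp (Ci * (RtoC PI * z / 2)) - Cexp (- (Ci * (RtoC PI * z / 2)))) / (2 * Ci) * mellin (fun x => Cexp (- (1) * RtoC x) - 1) z).
Proof.
  intros Hz. assert (HP := PI_RGT_0).
  assert (I : forall c, Cmod c = 1%R -> (Re c <= 0)%R -> is_mellin (fun x => Cexp (c * RtoC x) - 1) z (mellin (fun x => Cexp (c * RtoC x) - 1) z)).
  { intros c H1 H2. apply (mellin_correct _ _ _ _ z (dom_expm1 c H1 H2)). lra. }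
  assert (M1 : Cmod (- (1)) = 1%R) by (now rewrite Cmod_opp, Cmod_1).
  assert (M2 : Cmod (- Ci) = 1%R) by (now rewrite Cmod_opp, Cmod_Ci).
  assert (N1 : (Re (- (1)) <= 0)%R) by (simpl; lra).
  assert (N2 : (Re (- Ci) <= 0)%R) by (simpl; lra).
  assert (N3 : (Re Ci <= 0)%R) by (simpl; lra).
  assert (L0 := rot_line z (- (1)) 0 Hz M1 N1 ltac:(rewrite cos_0, sin_0; Cext; ring)).
  assert (Lp := rot_line z (- Ci) (PI / 2) Hz M2 N2 ltac:(rewrite cos_PI2, sin_PI2; Cext; ring)).
  assert (Lm := rot_line z Ci (- (PI / 2)) Hz Cmod_Ci N3 ltac:(rewrite cos_neg, sin_neg, cos_PI2, sin_PI2; Cext; ring)).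
  assert (E1 := rot_equal z 0 (PI / 2) _ _ Hz ltac:(lra) ltac:(lra) ltac:(lra) L0 Lp).
  assert (E2 := rot_equal z (- (PI / 2)) 0 _ _ Hz ltac:(lra) ltac:(lra) ltac:(lra) Lm L0).
  replace (z * (0, 0%R)) with (RtoC 0) in E1, E2 by (destruct z; Cext; ring).
  replace (z * (0, (PI / 2)%R)) with (Ci * (RtoC PI * z / 2)) in E1 by (destruct z; unfold Cdiv, Cinv; Cext; field).
  replace (z * (0, (- (PI / 2))%R)) with (- (Ci * (RtoC PI * z / 2))) in E2 by (destruct z; unfold Cdiv, Cinv; Cext; field).
  rewrite Cexp_0, Cmult_1_l in E1, E2.
  set (w := Ci * (RtoC PI * z / 2)) in *.
  set (J := mellin (fun x => Cexp (- (1) * RtoC x) - 1) z) in *.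
  assert (Q := is_mellin_scal _ (/ (2 * Ci)) _ _ (is_mellin_minus _ _ _ _ _ (I Ci Cmod_Ci N3) (I (- Ci) M2 N2))).
  set (A := mellin (fun x => Cexp (Ci * RtoC x) - 1) z) in *.
  set (B := mellin (fun x => Cexp (- Ci * RtoC x) - 1) z) in *.
  replace ((Cexp w - Cexp (- w)) / (2 * Ci) * J) with (/ (2 * Ci) * (A - B)).
  - eapply is_mellin_ext; [|exact Q]. intros x _. cbv beta. rewrite sin_Cexp. field. apply Ci_nz.
  - assert (NW := Cexp_nz w). rewrite Cexp_opp in *.
    assert (A = Cexp w * J) by (rewrite <- E2; field; auto).
    assert (B = / Cexp w * J) by (rewrite E1; field; auto).
    rewrite H, H0. field. split; [auto|apply Ci_nz].
Qed.

Local Close Scope C_scope.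

(** * The Fourier series of the third Bernoulli function *)

(** The index starts at 1, as in Dirichlet and Fourier series. *)
Fixpoint psum (a : nat -> R) (N : nat) : R :=
  match N with O => 0 | S N => psum a N + a (S N) end.

Lemma psum_derive (a b : nat -> R -> R) (t : R) (N : nat) :
  (forall n, is_derive (a (S n)) t (b (S n) t)) ->
  is_derive (fun u => psum (fun n => a n u) N) t (psum (fun n => b n t) N).
Proof.
  intros H. induction N as [|N IH]; simpl.
  - apply is_derive_Reals, derivable_pt_lim_const.
  - apply (is_derive_plus (V := R_NormedModule)); auto.
Qed.

Lemma INR_S_pos (n : nat) : 0 < INR (S n).
Proof. apply lt_0_INR. lia. Qed.

Lemma dirichlet_kernel (t : R) (N : nat) :
  psum (fun n => cos (INR n * t)) N * (2 * sin (t / 2)) = sin ((INR N + / 2) * t) - sin (t / 2).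
Proof.
  induction N as [|N IH].
  - simpl. replace ((0 + / 2) * t) with (t / 2) by field. ring.
  - cbn [psum]. rewrite Rmult_plus_distr_r, IH. rewrite S_INR.
    replace ((INR N + / 2) * t) with ((INR N + 1) * t - t / 2) by field.
    replace ((INR N + 1 + / 2) * t) with ((INR N + 1) * t + t / 2) by field.
    rewrite sin_minus, sin_plus. ring.
Qed.

Lemma mvt_bound (f df : R -> R) (a b c d M : R) : c <= a <= d -> c <= b <= d -> 0 <= M ->
  (forall x, c <= x <= d -> is_derive f x (df x)) -> (forall x, c <= x <= d -> Rabs (df x) <= M) ->
  Rabs (f b - f a) <= M * (d - c).
Proof.
  intros Ha Hb HM Hf HB.
  destruct (MVT_gen f a b df) as [x [Hx E]].
  - intros x Hx. apply Hf. split; [apply Rle_trans with (Rmin a b); [apply Rmin_glb; lra|lra]|apply Rle_trans with (Rmax a b); [lra|apply Rmax_lub; lra]].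
  - intros x Hx. apply continuity_pt_filterlim. apply (ex_derive_continuous (V := R_NormedModule)). exists (df x). apply Hf.
    split; [apply Rle_trans with (Rmin a b); [apply Rmin_glb; lra|lra]|apply Rle_trans with (Rmax a b); [lra|apply Rmax_lub; lra]].
  - rewrite E, Rabs_mult. apply Rmult_le_compat; try apply Rabs_pos.
    + apply HB. split; [apply Rle_trans with (Rmin a b); [apply Rmin_glb; lra|lra]|apply Rle_trans with (Rmax a b); [lra|apply Rmax_lub; lra]].
    + apply Rabs_le. lra.
Qed.

Lemma sin_half_lower (del t : R) : 0 < del < PI -> del <= t <= 2 * PI - del -> sin (del / 2) <= sin (t / 2).
Proof.
  intros Hd Ht. destruct (Rle_dec t PI) as [L|L].
  - apply sin_incr_1; lra.
  - replace (t / 2) with (PI - (PI - t / 2)) by ring. rewrite sin_PI_x. apply sin_incr_1; lra.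
Qed.

(** The defect of the Fourier series of the sawtooth; it vanishes at pi and its
    derivative is a Dirichlet kernel. *)
Definition saw (N : nat) (t : R) : R := psum (fun n => sin (INR n * t) / INR n) N - (PI - t) / 2.

Lemma saw_derive (N : nat) (t : R) : sin (t / 2) <> 0 ->
  is_derive (saw N) t (sin ((INR N + / 2) * t) / (2 * sin (t / 2))).
Proof.
  intros H. unfold saw.
  replace (sin ((INR N + / 2) * t) / (2 * sin (t / 2))) with (psum (fun n => cos (INR n * t)) N - (- / 2)).
  - apply (is_derive_minus (V := R_NormedModule)).
    + apply (psum_derive (fun n u => sin (INR n * u) / INR n) (fun n u => cos (INR n * u))).
      intros n. cbv beta. generalize (INR_S_pos n). generalize (INR (S n)). intros k P. auto_derive; auto. field. lra.
    + auto_derive; auto. field.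
  - assert (D := dirichlet_kernel t N).
    replace (sin ((INR N + / 2) * t)) with (psum (fun n => cos (INR n * t)) N * (2 * sin (t / 2)) + sin (t / 2)) by lra.
    field. auto.
Qed.

Lemma saw_PI (N : nat) : saw N PI = 0.
Proof.
  unfold saw. replace (psum (fun n => sin (INR n * PI) / INR n) N) with 0; [field|].
  induction N as [|N IH]; [reflexivity|].
  cbn [psum]. rewrite <- IH.
  assert (E : forall n, sin (INR n * PI) = 0).
  { intros n. apply sin_eq_0_1. exists (Z.of_nat n). now rewrite INR_IZR_INZ. }
  rewrite E. unfold Rdiv. ring.
Qed.

(** One integration by parts of the Dirichlet kernel gains a factor 1 / (N + 1/2),
    uniformly away from multiples of 2 pi.  Instead of an integral, the mean value
    inequality is applied to the difference with the boundary term W. *)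
Lemma saw_small (del : R) : 0 < del < PI -> exists K, 0 <= K /\
  forall N t, del <= t <= 2 * PI - del -> Rabs (saw N t) <= K / (INR N + / 2).
Proof.
  intros Hd. set (m := sin (del / 2)).
  assert (Hm : 0 < m) by (apply sin_gt_0; lra).
  set (G := / (2 * m)). set (G1 := / (4 * (m * m))).
  assert (HG : 0 < G) by (apply Rinv_0_lt_compat; lra).
  assert (HG1 : 0 < G1) by (apply Rinv_0_lt_compat; nra).
  assert (HPI := PI_RGT_0).
  exists (2 * G + G1 * (2 * PI)). split; [nra|].
  intros N t Ht. set (k := INR N + / 2). assert (Hk : 0 < k) by (unfold k; generalize (pos_INR N); lra).
  set (W := fun u => - cos (k * u) / k * / (2 * sin (u / 2))).
  assert (Hs : forall u, del <= u <= 2 * PI - del -> m <= sin (u / 2)) by (intros; now apply sin_half_lower).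
  assert (D : forall u, del <= u <= 2 * PI - del ->
     is_derive (fun u => saw N u - W u) u (- (cos (k * u) / k * (cos (u / 2) / (4 * (sin (u / 2) * sin (u / 2))))))).
  { intros u Hu. specialize (Hs u Hu).
    replace (- (cos (k * u) / k * (cos (u / 2) / (4 * (sin (u / 2) * sin (u / 2)))))) with
      (sin (k * u) / (2 * sin (u / 2)) - (sin (k * u) / (2 * sin (u / 2)) + cos (k * u) / k * (cos (u / 2) / (4 * (sin (u / 2) * sin (u / 2)))))) by ring.
    apply (is_derive_minus (V := R_NormedModule)); [apply saw_derive; lra|].
    unfold W. auto_derive; [repeat split; lra|]. replace (u * / 2) with (u / 2) by reflexivity. field. lra. }
  assert (B : Rabs (saw N t - W t - (saw N PI - W PI)) <= G1 / k * ((2 * PI - del) - del)).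
  { eapply (mvt_bound (fun u => saw N u - W u)) with (c := del) (d := 2 * PI - del); [lra|lra| |exact D|].
    - apply Rlt_le, Rdiv_lt_0_compat; lra.
    - intros u Hu. specialize (Hs u Hu). cbv beta; rewrite Rabs_Ropp.
      unfold Rdiv. rewrite !Rabs_mult.
      rewrite (Rabs_pos_eq (/ k)) by (left; now apply Rinv_0_lt_compat).
      assert (Q : m * m <= sin (u / 2) * sin (u / 2)) by (apply Rmult_le_compat; lra).
      assert (Q0 : 0 < 4 * (m * m)) by nra.
      rewrite (Rabs_pos_eq (/ _)) by (left; apply Rinv_0_lt_compat; lra).
      assert (Q2 : / (4 * (sin (u / 2) * sin (u / 2))) <= G1) by (apply Rinv_le_contravar; lra).
      assert (Q3 : 0 < / (4 * (sin (u / 2) * sin (u / 2)))) by (apply Rinv_0_lt_compat; lra).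
      assert (C1 : Rabs (cos (k * u)) <= 1) by (apply Rabs_le, COS_bound).
      assert (C2 : Rabs (cos (u * / 2)) <= 1) by (apply Rabs_le, COS_bound).
      assert (Ik : 0 < / k) by now apply Rinv_0_lt_compat.
      replace (G1 * / k) with (1 * / k * (1 * G1)) by ring.
      apply Rmult_le_compat; [apply Rmult_le_pos; [apply Rabs_pos|lra]|apply Rmult_le_pos; [apply Rabs_pos|unfold Rdiv in *; lra]| |].
      + apply Rmult_le_compat_r; lra.
      + apply Rmult_le_compat; [apply Rabs_pos|unfold Rdiv in *; lra|exact C2|exact Q2]. }
  rewrite saw_PI in B.
  assert (BW : forall u, del <= u <= 2 * PI - del -> Rabs (W u) <= G / k).
  { intros u Hu. specialize (Hs u Hu). unfold W.
    replace (- cos (k * u) / k * / (2 * sin (u / 2))) with (- (cos (k * u) * (/ k * / (2 * sin (u / 2))))) by (field; lra).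
    rewrite Rabs_Ropp, Rabs_mult.
    assert (Ik : 0 < / k) by now apply Rinv_0_lt_compat.
    assert (Q3 : 0 < / (2 * sin (u / 2))) by (apply Rinv_0_lt_compat; lra).
    assert (Q2 : / (2 * sin (u / 2)) <= G) by (apply Rinv_le_contravar; lra).
    rewrite (Rabs_pos_eq (/ k * _)) by (apply Rmult_le_pos; lra).
    assert (C1 : Rabs (cos (k * u)) <= 1) by (apply Rabs_le, COS_bound).
    replace (G / k) with (1 * (/ k * G)) by (unfold Rdiv; ring).
    apply Rmult_le_compat; [apply Rabs_pos|apply Rmult_le_pos; lra|exact C1|apply Rmult_le_compat_l; lra]. }
  assert (B1 := BW t Ht). assert (B2 := BW PI ltac:(lra)).
  replace (saw N t) with ((saw N t - W t - (0 - W PI)) + (W t + - W PI)) by ring.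
  eapply Rle_trans; [apply Rabs_triang|]. eapply Rle_trans; [apply Rplus_le_compat_l, Rabs_triang|].
  rewrite Rabs_Ropp.
  assert (Gk : 0 < G1 / k) by (apply Rdiv_lt_0_compat; lra).
  replace ((2 * G + G1 * (2 * PI)) / k) with (2 * (G / k) + (G1 / k) * (2 * PI)) by (field; lra).
  assert (G1 / k * (2 * PI - del - del) <= G1 / k * (2 * PI)) by (apply Rmult_le_compat_l; lra). lra.
Qed.

Definition sinsum (N : nat) (t : R) : R := psum (fun n => sin (INR n * t) / INR n ^ 3) N.
Definition altsum (N : nat) : R := psum (fun n => cos (INR n * PI) / INR n ^ 2) N.

(** The defect vanishes to second order at pi and its second derivative is
    [- saw N]; two applications of the mean value inequality integrate the bound
    for [saw]. *)
Lemma sinsum_defect (del : R) : 0 < del < PI -> exists K, 0 <= K /\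
  forall N t, del <= t <= 2 * PI - del ->
    Rabs (sinsum N t - altsum N * (t - PI) - (t - PI) ^ 3 / 12) <= K / (INR N + / 2).
Proof.
  intros Hd. destruct (saw_small del Hd) as [K [HK HB]]. assert (HPI := PI_RGT_0).
  exists (K * (2 * PI) * (2 * PI)). split; [apply Rmult_le_pos; [apply Rmult_le_pos|]; lra|].
  intros N t Ht.
  set (k := INR N + / 2). assert (Hk : 0 < k) by (unfold k; generalize (pos_INR N); lra).
  assert (KK : 0 <= K / k) by (apply Rmult_le_pos; [auto|left; now apply Rinv_0_lt_compat]).
  set (e1 := fun t => psum (fun n => cos (INR n * t) / INR n ^ 2) N - altsum N - (t - PI) ^ 2 / 4).
  assert (D2 : forall u, is_derive e1 u (- saw N u)).
  { intros u. unfold e1, saw.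
    replace (- (psum (fun n => sin (INR n * u) / INR n) N - (PI - u) / 2)) with
      (psum (fun n => - sin (INR n * u) / INR n) N - 0 - (u - PI) / 2).
    - apply (is_derive_minus (V := R_NormedModule)); [apply (is_derive_minus (V := R_NormedModule))|].
      + apply (psum_derive (fun n u => cos (INR n * u) / INR n ^ 2) (fun n u => - sin (INR n * u) / INR n)).
        intros n. cbv beta. generalize (INR_S_pos n). generalize (INR (S n)). intros k' P. auto_derive; auto. field. lra.
      + apply is_derive_Reals, derivable_pt_lim_const.
      + auto_derive; auto. field.
    - replace (psum (fun n => - sin (INR n * u) / INR n) N) with (- psum (fun n => sin (INR n * u) / INR n) N); [field|].
      clear. induction N as [|M IH]; simpl; [ring|]. rewrite <- IH. unfold Rdiv. ring. }
  assert (E1 : e1 PI = 0) by (unfold e1, altsum; field).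
  assert (B1 : forall u, del <= u <= 2 * PI - del -> Rabs (e1 u) <= K / k * (2 * PI)).
  { intros u Hu. replace (e1 u) with (e1 u - e1 PI) by (rewrite E1; ring).
    eapply Rle_trans; [apply (mvt_bound e1 (fun u => - saw N u) PI u del (2 * PI - del) (K / k)); auto; try lra|].
    - intros x Hx. rewrite Rabs_Ropp. now apply HB.
    - apply Rmult_le_compat_l; lra. }
  set (e0 := fun t => sinsum N t - altsum N * (t - PI) - (t - PI) ^ 3 / 12).
  assert (D1 : forall u, is_derive e0 u (e1 u)).
  { intros u. unfold e0, e1, sinsum.
    apply (is_derive_minus (V := R_NormedModule)); [apply (is_derive_minus (V := R_NormedModule))|].
    - apply (psum_derive (fun n u => sin (INR n * u) / INR n ^ 3) (fun n u => cos (INR n * u) / INR n ^ 2)).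
      intros n. cbv beta. generalize (INR_S_pos n). generalize (INR (S n)). intros k' P. auto_derive; auto. field. lra.
    - auto_derive; auto. ring.
    - auto_derive; auto. field. }
  assert (E0 : e0 PI = 0).
  { unfold e0, sinsum. replace (psum (fun n => sin (INR n * PI) / INR n ^ 3) N) with 0; [field|].
    clear. induction N as [|N IH]; [reflexivity|]. cbn [psum]. rewrite <- IH.
    replace (sin (INR (S N) * PI)) with 0; [unfold Rdiv; ring|].
    symmetry. apply sin_eq_0_1. exists (Z.of_nat (S N)). now rewrite INR_IZR_INZ. }
  fold (e0 t). replace (e0 t) with (e0 t - e0 PI) by (rewrite E0; ring).
  eapply Rle_trans; [apply (mvt_bound e0 e1 PI t del (2 * PI - del) (K / k * (2 * PI))); auto; try lra|].
  - apply Rmult_le_pos; lra.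
  - replace (K * (2 * PI) * (2 * PI) / k) with (K / k * (2 * PI) * (2 * PI)) by (field; lra).
    apply Rmult_le_compat_l; [apply Rmult_le_pos; lra|lra].
Qed.

Lemma psum_tail (a : nat -> R) (c : R) (N M : nat) : (1 <= N)%nat -> 0 <= c -> (N <= M)%nat ->
  (forall n, (1 <= n)%nat -> Rabs (a n) <= c / INR n ^ 2) ->
  Rabs (psum a M - psum a N) <= c * (/ INR N - / INR M).
Proof.
  intros HN Hc HM Ha. induction HM as [|M HM IH].
  - rewrite !Rminus_diag_eq by reflexivity. rewrite Rabs_R0. lra.
  - cbn [psum]. replace (psum a M + a (S M) - psum a N) with ((psum a M - psum a N) + a (S M)) by ring.
    eapply Rle_trans; [apply Rabs_triang|].
    assert (P : 0 < INR M) by (apply lt_0_INR; lia).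
    assert (Q : Rabs (a (S M)) <= c * (/ INR M - / INR (S M))).
    { eapply Rle_trans; [apply Ha; lia|]. unfold Rdiv. apply Rmult_le_compat_l; [auto|].
      rewrite S_INR. replace (/ INR M - / (INR M + 1)) with (/ (INR M * (INR M + 1))) by (field; lra).
      apply Rinv_le_contravar; nra. }
    lra.
Qed.

Lemma sin_term_bound (t : R) (n : nat) : (1 <= n)%nat -> 0 <= t -> Rabs (sin (INR n * t) / INR n ^ 3) <= Rmin 1 t / INR n ^ 2.
Proof.
  intros Hn Ht. assert (P : 1 <= INR n) by (replace 1 with (INR 1) by reflexivity; now apply le_INR).
  unfold Rdiv. rewrite Rabs_mult. rewrite (Rabs_pos_eq (/ _)) by (left; apply Rinv_0_lt_compat, pow_lt; lra).
  assert (S1 : Rabs (sin (INR n * t)) <= 1) by (apply Rabs_le, SIN_bound).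
  assert (S2 : Rabs (sin (INR n * t)) <= INR n * t).
  { assert (X : forall x, 0 <= x -> Rabs (sin x) <= x).
    { intros x Hx. destruct (MVT_gen sin 0 x cos) as [c [_ E]].
      - intros y _. apply is_derive_Reals, derivable_pt_lim_sin.
      - intros y _. apply continuity_sin.
      - rewrite sin_0, !Rminus_0_r in E. rewrite E, Rabs_mult, (Rabs_pos_eq x) by auto.
        assert (Rabs (cos c) <= 1) by (apply Rabs_le, COS_bound). nra. }
    apply X. apply Rmult_le_pos; lra. }
  replace (/ INR n ^ 3) with (/ INR n * / INR n ^ 2) by (field; lra).
  rewrite <- Rmult_assoc. apply Rmult_le_compat_r; [left; apply Rinv_0_lt_compat, pow_lt; lra|].
  assert (In : 0 < / INR n <= 1). { split; [apply Rinv_0_lt_compat; lra|rewrite <- Rinv_1; apply Rinv_le_contravar; lra]. }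
  apply Rmin_glb.
  - assert (Q := Rabs_pos (sin (INR n * t))). nra.
  - apply Rle_trans with (INR n * t * / INR n); [apply Rmult_le_compat_r; lra|right; field; lra].
Qed.

Lemma is_lim_seq_inv_half (K : R) : is_lim_seq (fun N => K / (INR N + / 2)) 0.
Proof.
  replace (Finite 0) with (Rbar_mult K 0) by (simpl; now rewrite Rmult_0_r).
  apply is_lim_seq_scal_l.
  apply (is_lim_seq_inv (fun N => INR N + / 2) p_infty); [|easy].
  apply (is_lim_seq_plus _ _ p_infty (/ 2)); [apply is_lim_seq_INR|apply is_lim_seq_const|reflexivity].
Qed.

(** (2 pi^3 / 3) B3 (t / (2 pi)), the sum of sin (n t) / n^3. *)
Definition B3t (t : R) : R := t ^ 3 / 12 - PI * t ^ 2 / 4 + PI ^ 2 * t / 6.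

(** [sinsum_defect] identifies the limit up to the slope a, the limit of [altsum];
    continuity at 0 determines a.  The tail bound uses |sin (n t)| <= min 1 (n t),
    and its factor min 1 t is what later makes the remainder integrable against
    negative powers of t near 0. *)
Lemma fourier_B3 (N : nat) (t : R) : (1 <= N)%nat -> 0 <= t <= 2 * PI ->
  Rabs (B3t t - sinsum N t) <= Rmin 1 t / INR N.
Proof.
  assert (HPI := PI_RGT_0).
  assert (Ha : exists a : R, is_lim_seq altsum a).
  { apply ex_lim_seq_cauchy_corr. intros eps.
    destruct (nfloor_ex (/ eps) (Rlt_le _ _ (Rinv_0_lt_compat _ (cond_pos eps)))) as [N0 HN0].
    exists (S N0).
    assert (W : forall n m, (S N0 <= n)%nat -> (n <= m)%nat -> Rabs (altsum m - altsum n) < eps).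
    { intros n m Hn Hm. unfold altsum.
      assert (Pn : / eps < INR n) by (apply Rlt_le_trans with (INR (S N0)); [rewrite S_INR; lra|now apply le_INR]).
      assert (Pe : 0 < / eps) by apply Rinv_0_lt_compat, cond_pos.
      eapply Rle_lt_trans; [apply (psum_tail _ 1); [lia|lra|auto|]|].
      - intros k Hk. unfold Rdiv. rewrite Rabs_mult.
        assert (P : 1 <= INR k) by (replace 1 with (INR 1) by reflexivity; now apply le_INR).
        rewrite (Rabs_pos_eq (/ _)) by (left; apply Rinv_0_lt_compat, pow_lt; lra).
        apply Rmult_le_compat_r; [left; apply Rinv_0_lt_compat, pow_lt; lra|]. apply Rabs_le, COS_bound.
      - assert (0 < / INR m) by (apply Rinv_0_lt_compat, lt_0_INR; lia).
        assert (/ INR n < eps).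
        { rewrite <- (Rinv_inv eps). apply Rinv_lt_contravar; [apply Rmult_lt_0_compat; lra|auto]. }
        lra. }
    intros n m Hn Hm. destruct (Nat.le_ge_cases n m) as [L|L].
    - rewrite Rabs_minus_sym. now apply W.
    - now apply W. }
  destruct Ha as [a Ha].
  set (P := fun t => a * (t - PI) + (t - PI) ^ 3 / 12).
  assert (Lim : forall t, 0 < t < 2 * PI -> is_lim_seq (fun N => sinsum N t) (P t)).
  { intros u Hu. set (del := Rmin u (2 * PI - u) / 2).
    assert (M1 := Rmin_l u (2 * PI - u)). assert (M2 := Rmin_r u (2 * PI - u)).
    assert (M0 : 0 < Rmin u (2 * PI - u)) by (apply Rmin_pos; lra).
    destruct (sinsum_defect del) as [K [HK HB]]; [unfold del; lra|].
    assert (L0 : is_lim_seq (fun N => sinsum N u - altsum N * (u - PI) - (u - PI) ^ 3 / 12) 0).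
    { apply is_lim_seq_abs_0. apply (is_lim_seq_le_le (fun _ => 0) _ (fun N => K / (INR N + / 2))).
      - intros n. split; [apply Rabs_pos|]. apply HB. unfold del. lra.
      - apply is_lim_seq_const.
      - apply is_lim_seq_inv_half. }
    apply (is_lim_seq_ext (fun N => (sinsum N u - altsum N * (u - PI) - (u - PI) ^ 3 / 12) + (altsum N * (u - PI) + (u - PI) ^ 3 / 12))); [intros; ring|].
    replace (P u) with (0 + (a * (u - PI) + (u - PI) ^ 3 / 12)) by (unfold P; ring).
    apply is_lim_seq_plus'; [exact L0|]. apply is_lim_seq_plus'; [|apply is_lim_seq_const].
    apply (is_lim_seq_scal_r altsum (u - PI) a Ha). }
  assert (Tail : forall N t, (1 <= N)%nat -> 0 < t < 2 * PI -> Rabs (P t - sinsum N t) <= Rmin 1 t / INR N).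
  { intros n u Hn Hu.
    assert (L := is_lim_seq_abs _ _ (is_lim_seq_minus' _ _ _ _ (Lim u Hu) (is_lim_seq_const (sinsum n u)))).
    apply (is_lim_seq_le_loc (fun M => Rabs (sinsum M u - sinsum n u)) (fun _ => Rmin 1 u / INR n) (Rabs (P u - sinsum n u)) (Rmin 1 u / INR n)); [|exact L|apply is_lim_seq_const].
    exists n. intros M HM. eapply Rle_trans; [apply (psum_tail _ (Rmin 1 u)); auto|].
    - apply Rmin_glb; lra.
    - intros k Hk. apply sin_term_bound; [auto|lra].
    - assert (0 < / INR M) by (apply Rinv_0_lt_compat, lt_0_INR; lia).
      assert (0 <= Rmin 1 u) by (apply Rmin_glb; lra). unfold Rdiv. nra. }
  (* Letting [t] tend to 0 in the tail bound determines the constant, because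
     the partial sums vanish at 0. *)
  assert (Ea : a = - PI ^ 2 / 12).
  { assert (Z : P 0 = 0).
    { apply cond_eq. intros e He. rewrite Rminus_0_r.
      set (C := Rabs a + 3 * PI ^ 2).
      assert (HC : 0 <= C) by (unfold C; generalize (Rabs_pos a); nra).
      set (u := Rmin (PI / 2) (e / (2 * (C + 3)))).
      assert (U1 := Rmin_l (PI / 2) (e / (2 * (C + 3)))). assert (U2 := Rmin_r (PI / 2) (e / (2 * (C + 3)))).
      fold u in U1, U2.
      assert (U0 : 0 < u) by (apply Rmin_pos; [lra|apply Rdiv_lt_0_compat; lra]).
      assert (T := Tail 1%nat u ltac:(lia) ltac:(lra)).
      assert (S1 := sin_term_bound u 1 ltac:(lia) ltac:(lra)).
      replace (sinsum 1 u) with (sin (INR 1 * u) / INR 1 ^ 3) in T by (unfold sinsum; simpl; ring).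
      assert (M := Rmin_r 1 u).
      assert (Pu : Rabs (P u) <= 2 * u).
      { replace (P u) with ((P u - sin (INR 1 * u) / INR 1 ^ 3) + sin (INR 1 * u) / INR 1 ^ 3) by ring.
        eapply Rle_trans; [apply Rabs_triang|]. simpl in *. lra. }
      replace (P 0) with (P u - (a * u + ((u - PI) ^ 3 - (- PI) ^ 3) / 12)) by (unfold P; field).
      assert (Q : Rabs (a * u + ((u - PI) ^ 3 - (- PI) ^ 3) / 12) <= C * u).
      { eapply Rle_trans; [apply Rabs_triang|]. rewrite Rabs_mult, (Rabs_pos_eq u) by lra.
        replace (((u - PI) ^ 3 - (- PI) ^ 3) / 12) with (u * ((u ^ 2 - 3 * PI * u + 3 * PI ^ 2) / 12)) by field.
        rewrite Rabs_mult, (Rabs_pos_eq u) by lra.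
        assert (Rabs ((u ^ 2 - 3 * PI * u + 3 * PI ^ 2) / 12) <= 3 * PI ^ 2) by (apply Rabs_le; nra).
        unfold C. nra. }
      eapply Rle_lt_trans; [apply Rabs_triang|]. rewrite Rabs_Ropp.
      assert (u * (2 * (C + 3)) <= e).
      { apply Rle_trans with (e / (2 * (C + 3)) * (2 * (C + 3))); [apply Rmult_le_compat_r; lra|right; field; lra]. }
      nra. }
    unfold P in Z. apply Rmult_eq_reg_r with PI; [|lra].
    replace (a * (0 - PI) + (0 - PI) ^ 3 / 12) with (- (a * PI) - PI ^ 3 / 12) in Z by field.
    replace (- PI ^ 2 / 12 * PI) with (- (PI ^ 3 / 12)) by field. lra. }
  assert (EP : forall t, P t = B3t t) by (intros u; unfold P, B3t; rewrite Ea; field).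
  intros HN Ht.
  assert (Edge : forall t, (t = 0 \/ t = 2 * PI) -> B3t t - sinsum N t = 0).
  { intros u Hu. replace (B3t u) with 0 by (unfold B3t; destruct Hu; subst; field).
    replace (sinsum N u) with 0; [ring|]. unfold sinsum. clear - Hu.
    induction N as [|N IH]; [reflexivity|]. cbn [psum]. rewrite <- IH.
    replace (sin (INR (S N) * u)) with 0; [unfold Rdiv; ring|].
    destruct Hu as [-> | ->].
    - now rewrite Rmult_0_r, sin_0.
    - symmetry. apply sin_eq_0_1. exists (2 * Z.of_nat (S N))%Z. rewrite mult_IZR, <- INR_IZR_INZ. ring. }
  assert (PN : 0 < / INR N) by (apply Rinv_0_lt_compat, lt_0_INR; lia).
  destruct (Req_dec t 0) as [T0|T0].
  - rewrite Edge by auto. rewrite Rabs_R0. apply Rmult_le_pos; [apply Rmin_glb; lra|lra].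
  - destruct (Req_dec t (2 * PI)) as [T1|T1].
    + rewrite Edge by auto. rewrite Rabs_R0. apply Rmult_le_pos; [apply Rmin_glb; lra|lra].
    + rewrite <- EP. apply Tail; [auto|lra].
Qed.

Local Open Scope C_scope.

(** * The Euler-Maclaurin continuation of the zeta function *)

Definition B3 (x : R) : R := (x ^ 3 - 3 / 2 * x ^ 2 + x / 2)%R.
Definition B2 (x : R) : R := (x ^ 2 - x + / 6)%R.
Definition B1 (x : R) : R := (x - / 2)%R.

(** The periodic third Bernoulli function. *)
Definition per (x : R) : R := B3 (frac_part x).

Lemma per_unit (n : nat) (x : R) : (INR n <= x <= INR n + 1)%R -> per x = B3 (x - INR n).
Proof.
  intros [H1 H2]. unfold per, frac_part.
  destruct (Req_dec x (INR n + 1)) as [E|E].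
  - rewrite <- (Int_part_spec x (Z.of_nat (S n))).
    + rewrite <- INR_IZR_INZ, S_INR, E. unfold B3. field.
    + rewrite <- INR_IZR_INZ, S_INR. lra.
  - rewrite <- (Int_part_spec x (Z.of_nat n)).
    + now rewrite <- INR_IZR_INZ.
    + rewrite <- INR_IZR_INZ. lra.
Qed.

Lemma per_fourier (x : R) (N : nat) : (0 <= x)%R -> (1 <= N)%nat ->
  (Rabs (2 * PI ^ 3 / 3 * per x - sinsum N (2 * PI * x)) <= Rmin 1 (2 * PI * x) / INR N)%R.
Proof.
  intros Hx HN. assert (HPI := PI_RGT_0).
  destruct (nfloor_ex x Hx) as [n Hn].
  rewrite (per_unit n x) by lra. set (y := (x - INR n)%R).
  assert (Hy : (0 <= y <= 1)%R) by (unfold y; lra).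
  replace (2 * PI ^ 3 / 3 * B3 y)%R with (B3t (2 * PI * y)) by (unfold B3t, B3; field).
  replace (sinsum N (2 * PI * x)) with (sinsum N (2 * PI * y)).
  - eapply Rle_trans; [apply fourier_B3; [auto|nra]|].
    apply Rmult_le_compat_r; [left; apply Rinv_0_lt_compat, lt_0_INR; lia|].
    apply Rle_min_compat_l. assert (y <= x)%R by (unfold y; generalize (pos_INR n); lra). nra.
  - unfold sinsum. clear HN. induction N as [|N IH]; [reflexivity|]. cbn [psum]. rewrite IH. do 2 f_equal.
    replace (INR (S N) * (2 * PI * x))%R with (INR (S N) * (2 * PI * y) + 2 * INR (S N * n) * PI)%R.
    + symmetry. apply sin_period.
    + rewrite mult_INR. unfold y. ring.
Qed.

Lemma sinsum_derivable (N : nat) (t : R) : exists l, is_derive (sinsum N) t l.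
Proof.
  eexists. unfold sinsum. apply (psum_derive (fun n u => (sin (INR n * u) / INR n ^ 3)%R) (fun n u => (cos (INR n * u) / INR n ^ 2)%R)).
  intros n. cbv beta. generalize (INR_S_pos n). generalize (INR (S n)). intros k P. auto_derive; auto. field. lra.
Qed.

Lemma ccont_sinsum (N : nat) (c x : R) : @ccont R_UniformSpace (fun x => RtoC (sinsum N (c * x))) x.
Proof.
  destruct (sinsum_derivable N (c * x)) as [l Hl].
  eapply pder_cont, pder_RtoC. apply (is_derive_comp (K:=R_AbsRing) (V:=R_NormedModule) (sinsum N) (fun x => (c * x)%R)); [exact Hl|].
  auto_derive; auto.
Qed.

(** Continuity at the integers is inherited from the uniform limit of the Fourier
    series. *)
Lemma ccont_per (x : R) : (0 < x)%R -> @ccont R_UniformSpace (fun x => RtoC (per x)) x.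
Proof.
  intros Hx e He. assert (HPI := PI_RGT_0).
  set (c := (2 * PI ^ 3 / 3)%R).
  assert (Hc : (0 < c)%R) by (unfold c; generalize (pow_lt PI 3 HPI); lra).
  assert (Hce : (0 < c * e / 3)%R) by (assert (0 < c * e)%R by (now apply Rmult_lt_0_compat); lra).
  destruct (nfloor_ex (/ (c * e / 3)) (Rlt_le _ _ (Rinv_0_lt_compat _ Hce))) as [N0 HN0].
  set (N := S N0).
  assert (PN : (/ (c * e / 3) < INR N)%R) by (unfold N; rewrite S_INR; lra).
  assert (PN2 : (/ INR N < c * e / 3)%R).
  { rewrite <- (Rinv_inv (c * e / 3)). assert (0 < / (c * e / 3))%R by now apply Rinv_0_lt_compat.
    apply Rinv_lt_contravar; [apply Rmult_lt_0_compat; lra|auto]. }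
  assert (Ap : forall y, (0 <= y)%R -> (Rabs (c * per y - sinsum N (2 * PI * y)) < c * e / 3)%R).
  { intros y Hy. eapply Rle_lt_trans; [apply per_fourier; [auto|unfold N; lia]|].
    eapply Rle_lt_trans; [|exact PN2].
    assert (0 < / INR N)%R by (apply Rinv_0_lt_compat, lt_0_INR; unfold N; lia).
    assert (Q := Rmin_l 1 (2 * PI * y)). unfold Rdiv. nra. }
  assert (S0 := ccont_sinsum N (2 * PI) x _ Hce).
  assert (P0 : locally x (fun y : R => (0 < y)%R)).
  { apply (proj2 (locally_R _ _)). exists x. split; [auto|]. intros u Hu. apply Rabs_def2 in Hu. lra. }
  generalize (filter_and _ _ S0 P0). apply filter_imp. intros y [H1 H2].
  rewrite <- RtoC_minus, Cmod_R in *.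
  assert (A1 := Ap y (Rlt_le _ _ H2)). assert (A2 := Ap x (Rlt_le _ _ Hx)).
  apply Rabs_def2 in H1. apply Rabs_def2 in A1. apply Rabs_def2 in A2.
  apply Rabs_def1.
  - apply Rmult_lt_reg_l with c; [auto|]. lra.
  - apply Rmult_lt_reg_l with c; [auto|]. lra.
Qed.

Lemma per_le_1 (x : R) : (0 <= x)%R -> (Rabs (per x) <= 1)%R.
Proof.
  intros Hx. destruct (nfloor_ex x Hx) as [n Hn]. rewrite (per_unit n x) by lra.
  assert (Hy : (0 <= x - INR n <= 1)%R) by lra. set (y := (x - INR n)%R) in *.
  unfold B3. apply Rabs_le. nra.
Qed.

Lemma per_le_x (x : R) : (0 <= x <= 1)%R -> (Rabs (per x) <= x)%R.
Proof.
  intros Hx. rewrite (per_unit 0 x) by (simpl; lra). simpl (INR 0). rewrite Rminus_0_r.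
  replace (B3 x) with (x * ((x - 1) * (x - / 2)))%R by (unfold B3; field).
  rewrite Rabs_mult, (Rabs_pos_eq x) by lra.
  assert (Rabs ((x - 1) * (x - / 2)) <= 1)%R by (apply Rabs_le; nra). nra.
Qed.

Lemma dom_per : dom (fun x => RtoC (per x)) 1 0 1.
Proof.
  split; [|split].
  - apply ccont_per.
  - intros x Hx. rewrite Cmod_R, Rpower_1 by lra. rewrite Rmult_1_l. apply per_le_x; lra.
  - intros x Hx. rewrite Cmod_R, Ropp_0. unfold Rpower. rewrite Rmult_0_l, exp_0, Rmult_1_r. apply per_le_1. lra.
Qed.

(** Cut off below 1, so that an integral over [1, oo) becomes a Mellin transform;
    continuous because the third Bernoulli polynomial vanishes at 0. *)
Definition per1 (x : R) : C := if Rlt_dec x 1 then 0 else RtoC (per x).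

Lemma per_1 : per 1 = 0%R.
Proof. rewrite (per_unit 0 1) by (simpl; lra). simpl. unfold B3. field. Qed.

Lemma Cmod_per1 (x : R) : (Cmod (per1 x) <= Cmod (RtoC (per x)))%R.
Proof. unfold per1. destruct Rlt_dec; [rewrite Cmod_0; apply Cmod_ge_0|lra]. Qed.

Lemma ccont_per1 (x : R) : (0 < x)%R -> @ccont R_UniformSpace per1 x.
Proof.
  intros Hx. destruct (Rtotal_order x 1) as [H|[->|H]].
  - apply clim_ext_loc with (fun _ => 0); [typeclasses eauto| |].
    + apply (proj2 (locally_R _ _)). exists (1 - x)%R. split; [lra|]. intros u Hu. apply Rabs_def2 in Hu.
      unfold per1. destruct Rlt_dec; [auto|lra].
    + unfold per1. destruct Rlt_dec; [capply clim_const|lra].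
  - apply clim_squeeze with (fun y => Rabs (per y)); [typeclasses eauto| |].
    + intros e He. generalize (ccont_per 1 Hx e He). apply filter_imp. intros y Hy.
      rewrite per_1 in Hy. rewrite <- RtoC_minus, Rminus_0_r, Cmod_R in Hy. exact Hy.
    + apply filter_forall. intros y. replace (per1 y - per1 1) with (per1 y).
      * rewrite <- Cmod_R. apply Cmod_per1.
      * unfold per1 at 3. destruct Rlt_dec; [lra|]. rewrite per_1. ring.
  - apply clim_ext_loc with (fun y => RtoC (per y)); [typeclasses eauto| |].
    + apply (proj2 (locally_R _ _)). exists (x - 1)%R. split; [lra|]. intros u Hu. apply Rabs_def2 in Hu.
      unfold per1. destruct Rlt_dec; [lra|auto].
    + unfold per1. destruct Rlt_dec; [lra|]. now apply ccont_per.
Qed.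

Lemma dom_per1 (p : R) : dom per1 p 0 1.
Proof.
  split; [|split].
  - apply ccont_per1.
  - intros x Hx. assert (Q := Rpower_pos x p). unfold per1. destruct Rlt_dec.
    + rewrite Cmod_0. lra.
    + replace x with 1%R by lra. rewrite per_1, Cmod_0. assert (Q' := Rpower_pos 1 p). lra.
  - intros x Hx. eapply Rle_trans; [apply Cmod_per1|]. now apply dom_per.
Qed.

(** Euler-Maclaurin summation of n^-w to third order; for Re w > 1 it is the sum
    and for Re w > -2 its analytic continuation. *)
Definition EM (w : C) : C :=
  / (w - 1) + / 2 + w / 12 - w * (w + 1) * (w + 2) / 6 * mellin per1 (- w - 2).

Lemma EM_integral_cond (w : C) : (-2 < Re w)%R -> (- (- Re (- w - 2) + 1) < Re (- w - 2) < 0)%R.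
Proof. intros H. destruct w; simpl in *. lra. Qed.

Lemma EM_holo (w : C) : (-2 < Re w)%R -> w <> 1 -> holomorphic_at EM w.
Proof.
  intros Hw N. unfold EM.
  assert (Hi : holomorphic_at (fun w => w) w) by apply holo_id.
  assert (Hcst : forall c : C, holomorphic_at (fun _ => c) w) by (intros; apply holo_const).
  apply holo_minus.
  - apply holo_plus; [apply holo_plus|]; [|apply Hcst|].
    + apply holo_inv; [now apply Cminus_eq_contra|]. now apply holo_minus.
    + apply holo_mult; [auto|apply Hcst].
  - apply holo_mult.
    + apply holo_mult; [|apply Hcst]. apply holo_mult; [apply holo_mult|]; [exact Hi| |]; apply holo_plus; auto.
    + apply (holo_comp (mellin per1) (fun w => - w - 2)).
      * apply holo_minus; [now apply holo_opp|apply Hcst].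
      * eapply mellin_holo; [apply dom_per1|]. apply EM_integral_cond. exact Hw.
Qed.

(** ** Euler-Maclaurin summation *)

(** A primitive on [n, n + 1] of the integrand of the remainder, obtained from
    B3' = 3 B2, B2' = 2 B1, B1' = 1. *)
Definition EMprim (w : C) (n : nat) (x : R) : C :=
  RtoC (B3 (x - INR n)) / 6 * (w * (w + 1)) * cpow x (- w - 2)
  + RtoC (B2 (x - INR n)) / 2 * w * cpow x (- w - 1)
  + RtoC (B1 (x - INR n)) * cpow x (- w) - / (1 - w) * cpow x (1 - w).

Definition EMk (w : C) : C := - (w * (w + 1) * (w + 2) / 6).

Lemma EMprim_der (w : C) (n : nat) (x : R) : (0 < x)%R -> w <> 1 ->
  pder (EMprim w n) x (EMk w * (RtoC (B3 (x - INR n)) * cpow x (- w - 2 - 1))).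
Proof.
  intros Hx Nw.
  assert (N1 : 1 - w <> 0) by (apply Cminus_eq_contra; auto).
  assert (D3 : pder (fun u => RtoC (B3 (u - INR n))) x (3 * RtoC (B2 (x - INR n)))).
  { eapply pder_eq; [|apply pder_RtoC; unfold B3; auto_derive; auto]. rewrite <- RtoC_mult. f_equal. unfold B2. field. }
  assert (D2 : pder (fun u => RtoC (B2 (u - INR n))) x (2 * RtoC (B1 (x - INR n)))).
  { eapply pder_eq; [|apply pder_RtoC; unfold B2; auto_derive; auto]. rewrite <- RtoC_mult. f_equal. unfold B1. field. }
  assert (D1 : pder (fun u => RtoC (B1 (u - INR n))) x 1).
  { eapply pder_eq; [|apply pder_RtoC; unfold B1; auto_derive; auto]. f_equal. }
  assert (M : forall c : C, forall f l, pder f x l -> pder (fun u => f u * c) x (l * c)).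
  { intros c f l Hf. eapply pder_eq; [|apply pder_mult; [exact Hf|apply pder_const]]. cbv beta; ring. }
  eapply pder_eq; [|unfold EMprim; apply pder_minus; [apply pder_plus; [apply pder_plus|]|]].
  2:{ apply pder_mult; [|apply pder_cpow; auto]. apply M. apply M. exact D3. }
  2:{ apply pder_mult; [|apply pder_cpow; auto]. apply M. apply M. exact D2. }
  2:{ apply pder_mult; [exact D1|apply pder_cpow; auto]. }
  2:{ apply pder_mult; [apply pder_const|apply pder_cpow; auto]. }
  cbv beta. unfold EMk.
  replace (- w - 1 - 1) with (- w - 2) by ring. replace (1 - w - 1) with (- w) by ring.
  field. auto.
Qed.

Lemma ccont_per_cpow (s : C) (x : R) : (0 < x)%R -> @ccont R_UniformSpace (fun x => RtoC (per x) * cpow x s) x.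
Proof. intros Hx. capply clim_mult; [now apply ccont_per|now apply ccont_cpow]. Qed.

Lemma EM_unit (w : C) (n : nat) : (1 <= n)%nat -> w <> 1 ->
  Cis_RInt (fun x => EMk w * (RtoC (per x) * cpow x (- w - 2 - 1))) (INR n) (INR (S n))
    (EMprim w n (INR (S n)) - EMprim w n (INR n)).
Proof.
  intros Hn Nw. assert (Pn : (1 <= INR n)%R) by (replace 1%R with (INR 1) by reflexivity; now apply le_INR).
  assert (E : (INR (S n) = INR n + 1)%R) by apply S_INR.
  apply C_is_RInt_ext with (fun x => EMk w * (RtoC (B3 (x - INR n)) * cpow x (- w - 2 - 1))).
  - rewrite Rmin_left, Rmax_right by lra. intros x Hx. rewrite (per_unit n x) by lra. reflexivity.
  - apply (C_RInt_FTC (EMprim w n)); rewrite Rmin_left, Rmax_right by lra; intros x Hx.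
    + apply EMprim_der; [lra|auto].
    + capply clim_mult; [capply clim_const|]. capply clim_mult; [|apply ccont_cpow; lra].
      eapply (pder_cont (fun x => RtoC (B3 (x - INR n)))), pder_RtoC. unfold B3. auto_derive; auto.
Qed.

Fixpoint Cpsum (a : nat -> C) (N : nat) : C :=
  match N with O => 0 | S N => Cpsum a N + a (S N) end.

(** As B3 vanishes at both ends, B2 takes the same value 1/6 there and B1 jumps from
    1/2 to -1/2, the primitives on adjacent intervals differ by n^-w at n. *)
Lemma EMprim_right (w : C) (n : nat) : EMprim w n (INR (S n)) =
  w / 12 * cpow (INR (S n)) (- w - 1) + / 2 * cpow (INR (S n)) (- w) - / (1 - w) * cpow (INR (S n)) (1 - w).
Proof.
  unfold EMprim. replace (INR (S n) - INR n)%R with 1%R by (rewrite S_INR; ring).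
  replace (B3 1) with 0%R by (unfold B3; field). replace (B2 1) with (/ 6)%R by (unfold B2; field).
  replace (B1 1) with (/ 2)%R by (unfold B1; field). rewrite !RtoC_inv by lra.
  set (X := / (1 - w)). field.
Qed.

Lemma EMprim_left (w : C) (n : nat) : EMprim w n (INR n) =
  w / 12 * cpow (INR n) (- w - 1) - / 2 * cpow (INR n) (- w) - / (1 - w) * cpow (INR n) (1 - w).
Proof.
  unfold EMprim. replace (INR n - INR n)%R with 0%R by ring.
  replace (B3 0) with 0%R by (unfold B3; field). replace (B2 0) with (/ 6)%R by (unfold B2; field).
  replace (B1 0) with (- / 2)%R by (unfold B1; field). rewrite RtoC_opp, !RtoC_inv by lra.
  set (X := / (1 - w)). field.
Qed.

Lemma EM_finite (w : C) (N : nat) : w <> 1 ->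
  Cis_RInt (fun x => EMk w * (RtoC (per x) * cpow x (- w - 2 - 1))) 1 (INR (S N))
    (Cpsum (fun n => cpow (INR n) (- w)) N + (w / 12 * cpow (INR (S N)) (- w - 1) + / 2 * cpow (INR (S N)) (- w) - / (1 - w) * cpow (INR (S N)) (1 - w))
     - (w / 12 + / 2 - / (1 - w))).
Proof.
  intros Nw. induction N as [|N IH].
  - change (INR 1) with 1%R. rewrite !cpow_one.
    replace (Cpsum (fun n => cpow (INR n) (- w)) 0 + (w / 12 * 1 + / 2 * 1 - / (1 - w) * 1) - (w / 12 + / 2 - / (1 - w))) with (RtoC 0) by (simpl; ring).
    apply (is_RInt_point (V := C_R_NormedModule)).
  - assert (U := EM_unit w (S N) ltac:(lia) Nw).
    assert (Q := C_is_RInt_Chasles _ _ _ _ _ _ IH U).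
    rewrite EMprim_right, EMprim_left in Q.
    replace (Cpsum (fun n => cpow (INR n) (- w)) (S N)) with (Cpsum (fun n => cpow (INR n) (- w)) N + cpow (INR (S N)) (- w)) by reflexivity.
    match type of Q with Cis_RInt _ _ _ ?A => match goal with |- Cis_RInt _ _ _ ?B => replace B with A; [exact Q|] end end.
    set (X := / (1 - w)). field.
Qed.

Lemma cpow_INR_lim (s : C) : (Re s < 0)%R -> clim eventually (fun N => cpow (INR (S N)) s) 0.
Proof.
  intros Hs. apply (clim_comp eventually (Rbar_locally p_infty) (fun N => INR (S N)) (fun x => cpow x s)).
  - apply clim_squeeze with (fun x => Rpower x (- (- Re s))); [typeclasses eauto| |].
    + intros e He. generalize (filterlim_eps _ _ _ (Rpower_lim_infty (- Re s) ltac:(lra)) e He). apply filter_imp.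
      intros x Hx. rewrite Rminus_0_r in Hx. eapply Rle_lt_trans; [apply Rle_abs|exact Hx].
    + apply filter_forall. intros x. replace (cpow x s - 0) with (cpow x s) by ring. rewrite Cmod_cpow, Ropp_involutive. lra.
  - intros P [M HM]. destruct (nfloor_ex (Rmax 0 M) (Rmax_l _ _)) as [n Hn].
    exists n. intros m Hm. apply HM. rewrite S_INR. assert (INR n <= INR m)%R by now apply le_INR.
    assert (Q := Rmax_r 0 M). lra.
Qed.

Lemma per1_window (w : C) (X : R) : (1 <= X)%R ->
  CRInt (fun x => per1 x * cpow x (- w - 2 - 1)) (/ X) X = CRInt (fun x => RtoC (per x) * cpow x (- w - 2 - 1)) 1 X.
Proof.
  intros HX. assert (I1 : (0 < / X <= 1)%R).
  { split; [apply Rinv_0_lt_compat; lra|rewrite <- Rinv_1; apply Rinv_le_contravar; lra]. }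
  apply C_RInt_unique.
  replace (CRInt (fun x => RtoC (per x) * cpow x (- w - 2 - 1)) 1 X) with (0 * RtoC (1 - / X) + CRInt (fun x => RtoC (per x) * cpow x (- w - 2 - 1)) 1 X) by ring.
  apply C_is_RInt_Chasles with 1%R.
  - eapply C_is_RInt_ext; [|apply C_is_RInt_const]. rewrite Rmin_left, Rmax_right by lra. intros x Hx.
    unfold per1. destruct Rlt_dec; [ring|lra].
  - eapply C_is_RInt_ext; [|apply C_RInt_correct]; rewrite Rmin_left, Rmax_right by lra; intros x Hx.
    + unfold per1. destruct Rlt_dec; [lra|ring].
    + apply ccont_per_cpow. lra.
Qed.

(** The boundary terms at N tend to 0 for Re w > 1. *)
Lemma EM_series (w : C) : (1 < Re w)%R -> clim eventually (Cpsum (fun n => cpow (INR n) (- w))) (EM w).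
Proof.
  intros Hw.
  assert (Nw : w <> 1) by (intros E; rewrite E in Hw; simpl in Hw; lra).
  assert (I : is_mellin per1 (- w - 2) (mellin per1 (- w - 2))).
  { eapply mellin_correct; [apply dom_per1|]. apply EM_integral_cond. lra. }
  apply (Cis_gen_lim _ posR) in I; [|apply convex_posR|apply at_right_pos|apply p_infty_pos|].
  2:{ intros x Hx. capply clim_mult; [now apply ccont_per1|now apply ccont_cpow]. }
  assert (W : filterlim (fun N => (/ INR (S N), INR (S N))%R) eventually (filter_prod (at_right 0) (Rbar_locally p_infty))).
  { assert (Big : forall M, exists n, forall m, (n <= m)%nat -> (M < INR (S m))%R).
    { intros M. destruct (nfloor_ex (Rmax 0 M) (Rmax_l _ _)) as [n Hn].
      exists n. intros m Hm. rewrite S_INR. assert (INR n <= INR m)%R by now apply le_INR.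
      assert (Q := Rmax_r 0 M). lra. }
    apply filterlim_pair.
    - intros P [d Hd]. destruct (Big (/ d)%R) as [n Hn]. exists n. intros m Hm.
      assert (Pm := INR_S_pos m).
      apply Hd; [|now apply Rinv_0_lt_compat].
      unfold ball; simpl; unfold AbsRing_ball, abs, minus, plus, opp; simpl.
      change (Rabs (/ INR (S m) + - 0) < d)%R.
      rewrite Ropp_0, Rplus_0_r, Rabs_pos_eq by (left; now apply Rinv_0_lt_compat).
      rewrite <- (Rinv_inv d). apply Rinv_lt_contravar; [|now apply Hn].
      apply Rmult_lt_0_compat; [apply Rinv_0_lt_compat, cond_pos|auto].
    - intros P [M HM]. destruct (Big M) as [n Hn]. exists n. intros m Hm. apply HM, Hn, Hm. }
  assert (L := clim_comp _ _ _ _ _ I W). cbn [fst snd] in L.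
  assert (T : clim eventually (fun N => EMk w * CRInt (fun x => per1 x * cpow x (- w - 2 - 1)) (/ INR (S N)) (INR (S N))
      - (w / 12 * cpow (INR (S N)) (- w - 1) + / 2 * cpow (INR (S N)) (- w) - / (1 - w) * cpow (INR (S N)) (1 - w)) + (w / 12 + / 2 - / (1 - w)))
      (EMk w * mellin per1 (- w - 2) - (w / 12 * 0 + / 2 * 0 - / (1 - w) * 0) + (w / 12 + / 2 - / (1 - w)))).
  { capply clim_plus; [|capply clim_const]. capply clim_minus.
    - capply clim_mult; [capply clim_const|exact L].
    - capply clim_minus; [capply clim_plus|]; (capply clim_mult; [capply clim_const|]); apply cpow_INR_lim; destruct w; simpl in *; lra. }
  replace (EM w) with (EMk w * mellin per1 (- w - 2) - (w / 12 * 0 + / 2 * 0 - / (1 - w) * 0) + (w / 12 + / 2 - / (1 - w))).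
  2:{ unfold EM, EMk. field. split; apply Cminus_eq_contra; auto. }
  eapply clim_ext; [typeclasses eauto| |exact T].
  intros N. cbv beta. rewrite per1_window by (replace 1%R with (INR 1) by reflexivity; apply le_INR; lia).
  assert (F := EM_finite w N Nw).
  assert (G : Cis_RInt (fun x => EMk w * (RtoC (per x) * cpow x (- w - 2 - 1))) 1 (INR (S N)) (EMk w * CRInt (fun x => RtoC (per x) * cpow x (- w - 2 - 1)) 1 (INR (S N)))).
  { apply C_is_RInt_scal. apply C_RInt_correct. intros x [Hx _]. apply ccont_per_cpow.
    eapply Rlt_le_trans; [|exact Hx]. apply Rmin_pos; [lra|apply INR_S_pos]. }
  rewrite (C_is_RInt_unique _ _ _ _ _ G F). ring.
Qed.

(** ** Left of the line Re w = -1 *)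

Lemma cpow_lim_0 (s : C) : (0 < Re s)%R -> clim (at_right 0) (fun x => cpow x s) 0.
Proof.
  intros Hs. apply clim_squeeze with (fun x => Rpower x (Re s)); [typeclasses eauto| |].
  - intros e He. generalize (filterlim_eps _ _ _ (Rpower_lim_0 (Re s) Hs) e He). apply filter_imp.
    intros x Hx. rewrite Rminus_0_r in Hx. eapply Rle_lt_trans; [apply Rle_abs|exact Hx].
  - apply filter_forall. intros x. replace (cpow x s - 0) with (cpow x s) by ring. rewrite Cmod_cpow. lra.
Qed.

Lemma at_right_ccont (f : R -> C) : @ccont R_UniformSpace f 0%R -> clim (at_right 0) f (f 0%R).
Proof. intros H e He. generalize (H e He). apply filter_le_within. Qed.

(** For Re w < -1 the primitive on (0, 1] tends to 0 at 0, so the polynomial terms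
    of [EM] are the integral over (0, 1) that the cut-off removed. *)
Lemma EM_strip (w : C) : (-2 < Re w < -1)%R -> EM w = EMk w * mellin (fun x => RtoC (per x)) (- w - 2).
Proof.
  intros Hw.
  assert (Nw : w <> 1) by (intros E; rewrite E in Hw; simpl in Hw; lra).
  assert (I1 : is_mellin per1 (- w - 2) (mellin per1 (- w - 2))).
  { eapply mellin_correct; [apply dom_per1|]. apply EM_integral_cond. lra. }
  set (D := fun x => (0 < x <= 1)%R).
  assert (CD : convexR D).
  { intros u v x Hu Hv Hx. unfold D in *. split.
    - eapply Rlt_le_trans; [|apply Hx]. apply Rmin_pos; lra.
    - eapply Rle_trans; [apply Hx|]. apply Rmax_lub; lra. }
  assert (F0 : at_right 0 D).
  { exists (mkposreal 1 Rlt_0_1). intros y Hy Hy0. unfold D.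
    unfold ball in Hy; simpl in Hy; unfold AbsRing_ball, abs, minus, plus, opp in Hy; simpl in Hy.
    apply Rabs_def2 in Hy. lra. }
  assert (F1 : at_point 1%R D) by (unfold at_point, D; lra).
  assert (I0 : Cis_gen (fun x => EMk w * (RtoC (per x) * cpow x (- w - 2 - 1))) (at_right 0) (at_point 1%R) (EMprim w 0 1 - 0)).
  { apply (Cis_gen_FTC (EMprim w 0) _ D); auto.
    - intros x Hx. unfold D in Hx. rewrite (per_unit 0 x) by (simpl; lra). apply EMprim_der; [lra|auto].
    - intros x Hx. unfold D in Hx. capply clim_mult; [capply clim_const|]. apply ccont_per_cpow. lra.
    (* B3 x is divided by x, since x^(- w - 2) alone need not tend to 0. *)
    - assert (L : clim (at_right 0) (fun x => (RtoC ((x ^ 2 - 3 / 2 * x + / 2) / 6) * (w * (w + 1))) * cpow x (- w - 1)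
          + (RtoC (B2 (x - INR 0) / 2) * w) * cpow x (- w - 1)
          + RtoC (B1 (x - INR 0)) * cpow x (- w) - / (1 - w) * cpow x (1 - w))
          ((RtoC ((0 ^ 2 - 3 / 2 * 0 + / 2) / 6) * (w * (w + 1))) * 0 + (RtoC (B2 (0 - INR 0) / 2) * w) * 0
          + RtoC (B1 (0 - INR 0)) * 0 - / (1 - w) * 0)).
      { assert (P : forall h : R -> R, (exists l, is_derive h 0 l) -> clim (at_right 0) (fun x => RtoC (h x)) (RtoC (h 0%R))).
        { intros h [l Hl]. apply (at_right_ccont (fun x => RtoC (h x))). eapply pder_cont, pder_RtoC. exact Hl. }
        capply clim_minus; [capply clim_plus; [capply clim_plus|]|].
        - capply clim_mult; [capply clim_mult; [|capply clim_const]|apply cpow_lim_0; destruct w; simpl in *; lra].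
          apply (P (fun x => ((x ^ 2 - 3 / 2 * x + / 2) / 6)%R)). eexists. auto_derive; auto.
        - capply clim_mult; [capply clim_mult; [|capply clim_const]|apply cpow_lim_0; destruct w; simpl in *; lra].
          apply (P (fun x => (B2 (x - INR 0) / 2)%R)). unfold B2. eexists. auto_derive; auto.
        - capply clim_mult; [|apply cpow_lim_0; destruct w; simpl in *; lra].
          apply (P (fun x => (B1 (x - INR 0))%R)). unfold B1. eexists. auto_derive; auto.
        - capply clim_mult; [capply clim_const|apply cpow_lim_0; destruct w; simpl in *; lra]. }
      match type of L with clim _ _ ?A => replace A with (RtoC 0) in L by ring end.
      eapply clim_ext_loc; [typeclasses eauto| |exact L].
      generalize F0. apply filter_imp. intros x Hx. unfold D in Hx. unfold EMprim.
      replace (cpow x (- w - 1)) with (RtoC x * cpow x (- w - 2)).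
      2:{ rewrite <- (cpow_1 x) at 1 by lra. rewrite <- cpow_plus. f_equal. ring. }
      simpl (INR 0). rewrite !Rminus_0_r.
      unfold B3. rewrite !RtoC_div, !RtoC_plus, !RtoC_minus, !RtoC_mult, !RtoC_div, !RtoC_inv by lra.
      rewrite !RtoC_pow. set (X := / (1 - w)). field.
    - intros e He. unfold at_point. replace (EMprim w 0 1 - EMprim w 0 1) with (RtoC 0) by ring. rewrite Cmod_0. exact He. }
  set (g2 := fun x => RtoC (per x) - per1 x).
  assert (NP : w <> 0 /\ w + 1 <> 0 /\ w + 2 <> 0).
  { repeat split; intros E; apply (f_equal Re) in E; destruct w; simpl in *; lra. }
  assert (NK : EMk w <> 0).
  { unfold EMk. intros E. assert (Z : w * (w + 1) * (w + 2) = 0).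
    { replace (w * (w + 1) * (w + 2)) with (- (- (w * (w + 1) * (w + 2) / 6)) * 6) by field. rewrite E. ring. }
    revert Z. apply Cmult_neq_0; [apply Cmult_neq_0|]; apply NP. }
  assert (I2 : is_mellin g2 (- w - 2) (/ EMk w * EMprim w 0 1 + 0)).
  { unfold is_mellin. apply (Cis_gen_Chasles _ 1%R).
    - replace (/ EMk w * EMprim w 0 1) with (/ EMk w * (EMprim w 0 1 - 0)) by ring.
      eapply (Cis_gen_ext _ _ D); [auto|auto|auto| |apply (Cis_gen_scal _ (/ EMk w) _ I0)].
      intros x Hx. unfold D in Hx. unfold g2, per1. destruct Rlt_dec.
      + field. auto.
      + replace x with 1%R by lra. rewrite per_1. ring.
    - replace (RtoC 0) with (RtoC 0 - RtoC 0) by ring.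
      apply (Cis_gen_FTC (fun _ => 0) _ (fun x => (1 <= x)%R)).
      + intros u v x Hu Hv Hx. eapply Rle_trans; [|apply Hx]. apply Rmin_glb; lra.
      + unfold at_point. lra.
      + exists 1%R. intros; lra.
      + intros x Hx. eapply pder_eq; [|apply pder_const]. unfold g2, per1. destruct Rlt_dec; [lra|ring].
      + intros x Hx. capply clim_mult; [|apply ccont_cpow; lra]. capply clim_minus; [apply ccont_per; lra|apply ccont_per1; lra].
      + capply clim_const.
      + capply clim_const. }
  assert (I3 := is_mellin_plus _ _ _ _ _ I1 I2).
  eapply is_mellin_ext in I3; [apply is_mellin_unique in I3; rewrite I3|].
  - change 1%R with (INR 1). rewrite EMprim_right. change (INR 1) with 1%R. rewrite !cpow_one.
    rewrite Cplus_0_r, Cmult_plus_distr_l, Cmult_assoc, Cinv_r, Cmult_1_l by auto.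
    unfold EM, EMk. field. split; apply Cminus_eq_contra; auto.
  - intros x _. unfold g2. ring.
Qed.

(** * The functional equation *)

Lemma mellin_scale (g : R -> C) (a : R) (s l : C) : (0 < a)%R ->
  (forall x, (0 < x)%R -> @ccont R_UniformSpace g x) ->
  is_mellin g s l -> is_mellin (fun x => g (a * x)%R) s (cpow a (- s) * l).
Proof.
  intros Ha Hg H.
  assert (Cg : forall x, (0 < x)%R -> @ccont R_UniformSpace (fun x => g x * cpow x (s - 1)) x).
  { intros x Hx. capply clim_mult; [now apply Hg|now apply ccont_cpow]. }
  assert (Cl : forall x, (0 < x)%R -> @ccont R_UniformSpace (fun x => g (a * x)%R * cpow x (s - 1)) x).
  { intros x Hx. capply clim_mult; [|now apply ccont_cpow].
    apply (ccont_comp (T:=R_UniformSpace) (U:=R_UniformSpace) (fun x => (a * x)%R) g); [apply Hg; nra|].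
    apply (ex_derive_continuous (V := R_NormedModule)). auto_derive; auto. }
  apply (Cis_gen_lim _ posR); [apply convex_posR|apply at_right_pos|apply p_infty_pos|exact Cl|].
  apply (Cis_gen_lim _ posR) in H; [|apply convex_posR|apply at_right_pos|apply p_infty_pos|exact Cg].
  assert (W : filterlim (fun ab : R * R => (a * fst ab, a * snd ab)%R) (filter_prod (at_right 0) (Rbar_locally p_infty)) (filter_prod (at_right 0) (Rbar_locally p_infty))).
  { apply filterlim_pair.
    - apply (filterlim_comp _ _ _ fst (fun x => (a * x)%R) _ (at_right 0)); [apply filterlim_fst|].
      intros P [d Hd]. unfold filtermap.
      assert (Q : (0 < d / a)%R) by (apply Rdiv_lt_0_compat; [apply cond_pos|auto]).
      exists (mkposreal _ Q). intros x Hx Hx0. apply Hd; [|nra].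
      unfold ball in *; simpl in *; unfold AbsRing_ball, abs, minus, plus, opp in *; simpl in *.
      rewrite Ropp_0, Rplus_0_r in *. rewrite Rabs_pos_eq in Hx by lra. rewrite Rabs_pos_eq by nra.
      apply Rmult_lt_reg_r with (/ a)%R; [now apply Rinv_0_lt_compat|].
      replace (a * x * / a)%R with x by (field; lra). exact Hx.
    - apply (filterlim_comp _ _ _ snd (fun x => (a * x)%R) _ (Rbar_locally p_infty)); [apply filterlim_snd|].
      intros P [M HM]. exists (M / a)%R. intros x Hx. apply HM.
      apply Rmult_lt_reg_r with (/ a)%R; [now apply Rinv_0_lt_compat|].
      replace (a * x * / a)%R with x by (field; lra). exact Hx. }
  assert (L := clim_comp _ _ _ _ _ H W). cbn [fst snd] in L.
  assert (L2 : clim (filter_prod (at_right 0) (Rbar_locally p_infty)) (fun ab => cpow a (- s) * CRInt (fun x => g x * cpow x (s - 1)) (a * fst ab) (a * snd ab)) (cpow a (- s) * l)).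
  { capply clim_mult; [capply clim_const|exact L]. }
  eapply clim_ext_loc; [typeclasses eauto| |exact L2].
  exists posR posR; [apply at_right_pos|apply p_infty_pos|]. intros u v Hu Hv. cbn [fst snd]. unfold posR in *.
  symmetry. apply C_RInt_unique.
  assert (J : Cis_RInt (fun x => g x * cpow x (s - 1)) (a * u + 0) (a * v + 0) (CRInt (fun x => g x * cpow x (s - 1)) (a * u) (a * v))).
  { rewrite !Rplus_0_r. apply C_RInt_correct. intros x [Hx _]. apply Cg. eapply Rlt_le_trans; [|exact Hx]. apply Rmin_pos; nra. }
  assert (J2 := is_RInt_comp_lin (V := C_R_NormedModule) (fun x => g x * cpow x (s - 1)) a 0 u v _ J).
  assert (J3 := C_is_RInt_scal _ _ _ (cpow a (- s)) _ J2).
  eapply C_is_RInt_ext; [|exact J3].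
  intros x [Hx _]. assert (Px : (0 < x)%R) by (eapply Rlt_trans; [|exact Hx]; apply Rmin_pos; auto).
  cbv beta. rewrite Rplus_0_r.
  match goal with |- _ * @scal ?K ?V ?p ?q = _ => replace (@scal K V p q) with (RtoC p * q) by (symmetry; apply (scal_R_Cmult p q)) end.
  rewrite cpow_base_mult by auto.
  assert (Z : cpow a (- s) * cpow a 1 * cpow a (s - 1) = 1).
  { rewrite <- !cpow_plus. replace (- s + 1 + (s - 1)) with (RtoC 0) by ring. apply cpow_0. }
  rewrite cpow_1 in Z by auto.
  replace (g (a * x)%R * cpow x (s - 1)) with ((cpow a (- s) * RtoC a * cpow a (s - 1)) * (g (a * x)%R * cpow x (s - 1))) by (rewrite Z; ring).
  ring.
Qed.

Lemma ccont_sin (x : R) : @ccont R_UniformSpace (fun x => RtoC (sin x)) x.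
Proof. eapply pder_cont, pder_RtoC, is_derive_Reals, derivable_pt_lim_sin. Qed.

Lemma mellin_sinsum (z S : C) (N : nat) : is_mellin (fun x => RtoC (sin x)) z S ->
  is_mellin (fun x => RtoC (sinsum N (2 * PI * x))) z
    (cpow (2 * PI) (- z) * S * Cpsum (fun n => cpow (INR n) (- z - 3)) N).
Proof.
  intros HS. assert (HPI := PI_RGT_0). induction N as [|N IH].
  - simpl. apply (is_mellin_scal _ 0) in HS.
    replace (cpow (2 * PI) (- z) * S * 0) with (0 * S) by ring. eapply is_mellin_ext; [|exact HS].
    intros x _. unfold sinsum. simpl. ring.
  - assert (Pn := INR_S_pos N).
    assert (T := mellin_scale _ (INR (Datatypes.S N) * (2 * PI)) z S ltac:(nra) (fun x _ => ccont_sin x) HS).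
    apply (is_mellin_scal _ (RtoC (/ INR (Datatypes.S N) ^ 3))) in T.
    assert (Q := is_mellin_plus _ _ _ _ _ IH T).
    replace (cpow (2 * PI) (- z) * S * Cpsum (fun n => cpow (INR n) (- z - 3)) (Datatypes.S N)) with
      (cpow (2 * PI) (- z) * S * Cpsum (fun n => cpow (INR n) (- z - 3)) N + RtoC (/ INR (Datatypes.S N) ^ 3) * (cpow (INR (Datatypes.S N) * (2 * PI)) (- z) * S)).
    + eapply is_mellin_ext; [|exact Q]. intros x _. cbv beta. unfold sinsum. cbn [psum].
      rewrite RtoC_plus. f_equal. unfold Rdiv. rewrite RtoC_mult. rewrite Cmult_comm. do 3 f_equal. ring.
    + cbn [Cpsum]. rewrite (cpow_base_mult (INR (Datatypes.S N)) (2 * PI)) by lra.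
      replace (cpow (INR (Datatypes.S N)) (- z - 3)) with (cpow (INR (Datatypes.S N)) (- z) * RtoC (/ INR (Datatypes.S N) ^ 3)); [ring|].
      unfold Cminus. rewrite cpow_plus, cpow_opp. f_equal.
      replace (RtoC 3) with (RtoC (INR 3)) by (f_equal; simpl; ring). rewrite (cpow_opp _ (INR 3)), cpow_INR by auto.
      rewrite RtoC_inv, RtoC_pow; [reflexivity|]. apply pow_nonzero. lra.
Qed.

Lemma clim_inv_INR (K : R) (f : nat -> C) (l : C) : (0 <= K)%R -> (forall N, (1 <= N)%nat -> (Cmod (f N - l) <= K / INR N)%R) -> clim eventually f l.
Proof.
  intros HK H e He.
  destruct (nfloor_ex (K / e)) as [n Hn]; [apply Rmult_le_pos; [auto|left; now apply Rinv_0_lt_compat]|].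
  exists (S n). intros m Hm. eapply Rle_lt_trans; [apply H; lia|].
  assert (Q : (K / e < INR m)%R) by (apply Rlt_le_trans with (INR (S n)); [rewrite S_INR; lra|now apply le_INR]).
  assert (P : (0 < INR m)%R) by (apply lt_0_INR; lia).
  apply Rmult_lt_reg_r with (INR m / e)%R; [now apply Rdiv_lt_0_compat|].
  replace (K / INR m * (INR m / e))%R with (K / e)%R by (field; lra).
  replace (e * (INR m / e))%R with (INR m) by (field; lra). exact Q.
Qed.

(** The bound min 1 (2 pi x) / N for the remainder of the Fourier series is
    integrable against x^(z - 1) exactly for -1 < Re z < 0, so the expansion may be
    integrated term by term. *)
Lemma mellin_per_fourier (z S : C) : (-1 < Re z < 0)%R -> is_mellin (fun x => RtoC (sin x)) z S ->
  RtoC (2 * PI ^ 3 / 3) * mellin (fun x => RtoC (per x)) z = cpow (2 * PI) (- z) * S * EM (z + 3).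
Proof.
  intros Hz HS. assert (HPI := PI_RGT_0).
  set (c := (2 * PI ^ 3 / 3)%R).
  apply (clim_unique eventually (fun N => cpow (2 * PI) (- z) * S * Cpsum (fun n => cpow (INR n) (- z - 3)) N)).
  - apply (clim_inv_INR (2 * PI * (/ (1 + Re z)) + 2 * PI * (/ (- Re z)))).
    { assert (0 < / (1 + Re z))%R by (apply Rinv_0_lt_compat; lra). assert (0 < / - Re z)%R by (apply Rinv_0_lt_compat; lra).
      assert (0 <= 2 * PI)%R by lra. apply Rplus_le_le_0_compat; apply Rmult_le_pos; lra. }
    intros N HN.
    assert (PN : (0 < / INR N)%R) by (apply Rinv_0_lt_compat, lt_0_INR; lia).
    assert (Dm : dom (fun x => RtoC (sinsum N (2 * PI * x)) - RtoC c * RtoC (per x)) 1 0 (2 * PI / INR N)).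
    { assert (B : forall x, (0 <= x)%R -> (Cmod (RtoC (sinsum N (2 * PI * x)) - RtoC c * RtoC (per x)) <= Rmin 1 (2 * PI * x) / INR N)%R).
      { intros x Hx. rewrite Cmod_minus_sym, <- RtoC_mult, <- RtoC_minus, Cmod_R. now apply per_fourier. }
      split; [|split].
      - intros x Hx. capply clim_minus; [apply ccont_sinsum|]. capply clim_mult; [capply clim_const|now apply ccont_per].
      - intros x Hx. eapply Rle_trans; [apply B; lra|]. rewrite Rpower_1 by lra.
        assert (Q := Rmin_r 1 (2 * PI * x)). unfold Rdiv. nra.
      - intros x Hx. eapply Rle_trans; [apply B; lra|].
        rewrite Ropp_0. unfold Rpower. rewrite Rmult_0_l, exp_0, Rmult_1_r.
        assert (Q := Rmin_l 1 (2 * PI * x)). generalize PI2_1. unfold PI2. intros Q2. unfold Rdiv. apply Rmult_le_compat_r; lra. }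
    destruct (mellin_dom _ _ _ _ z Dm ltac:(lra)) as [I B].
    assert (I1 := mellin_sinsum z S N HS).
    assert (I2 := is_mellin_scal _ (RtoC c) _ _ (mellin_correct _ _ _ _ z dom_per ltac:(lra))).
    assert (E := is_mellin_unique _ _ _ (is_mellin_minus _ _ _ _ _ I1 I2)).
    cbv beta in E. rewrite E in B. eapply Rle_trans; [exact B|]. right.
    replace (0 - Re z)%R with (- Re z)%R by ring. field. repeat split; try lra.
    intros X. rewrite X, Rinv_0 in PN. lra.
  - capply clim_mult; [capply clim_const|].
    assert (L := EM_series (z + 3) ltac:(destruct z; simpl in *; lra)).
    replace (- (z + 3)) with (- z - 3) in L by ring. exact L.
Qed.

(** Combine [EM_strip], the Fourier expansion, the transform of the sine and the
    recursion of Gamma.  With z = -w - 2 the angle pi z / 2 differs from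
    pi (1 - w) / 2 by 3 pi / 2, which turns the sine into the cosine of chi. *)
Lemma chi_EM_strip (w : C) : (-2 < Re w < -1)%R -> EM w = chi w * EM (1 - w).
Proof.
  intros Hw. assert (HPI := PI_RGT_0).
  set (z := - w - 2).
  assert (Hz : (-1 < Re z < 0)%R) by (unfold z; destruct w; simpl in *; lra).
  rewrite EM_strip by auto. fold z.
  assert (M := mellin_per_fourier z _ Hz (mellin_sin z Hz)).
  assert (G := mellin_expm1_real z Hz).
  replace (z + 3) with (1 - w) in M, G by (unfold z; ring).
  set (J := mellin (fun x => Cexp (- (1) * RtoC x) - 1) z) in *.
  unfold chi. rewrite G. unfold Ccos.
  set (a := Ci * (RtoC PI * (1 - w) / 2)).
  assert (Ez : Ci * (RtoC PI * z / 2) = a + Ci * RtoC (- (3 * (PI / 2)))).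
  { unfold a, z. rewrite RtoC_opp, RtoC_mult, RtoC_div by lra. field. }
  assert (E3 : Cexp (Ci * RtoC (- (3 * (PI / 2)))) = Ci).
  { replace (Ci * RtoC (- (3 * (PI / 2)))) with ((0, (- (3 * (PI / 2)))%R) : C) by (Cext; ring).
    rewrite Cexp_line_at, exp_0, cos_neg, sin_neg, cos_3PI2, sin_3PI2. Cext; ring. }
  assert (E4 : Cexp (Ci * (RtoC PI * z / 2)) = Ci * Cexp a) by (rewrite Ez, Cexp_plus, E3; ring).
  rewrite E4, (Cexp_opp (Ci * _)), E4 in M. rewrite Cexp_opp.
  assert (Na := Cexp_nz a). set (e := Cexp a) in *.
  assert (P2 : cpow (2 * PI) (- z) = cpow (2 * PI) (- (1 - w)) * RtoC (8 * PI ^ 3)).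
  { replace (- z) with (- (1 - w) + RtoC (INR 3)) by (unfold z; simpl; rewrite !RtoC_plus; ring).
    rewrite cpow_plus, cpow_INR by lra. f_equal. rewrite <- RtoC_pow. f_equal. ring. }
  rewrite P2 in M.
  set (p := cpow (2 * PI) (- (1 - w))) in *. set (Q := mellin (fun x => RtoC (per x)) z) in *.
  assert (NP : RtoC PI <> 0) by (intros X; apply RtoC_inj in X; lra).
  assert (M2 : Q = p * 12 * ((e + / e) / 2 * J) * EM (1 - w)).
  { assert (Ec : RtoC (2 * PI ^ 3 / 3) = 2 * RtoC PI ^ 3 / 3) by (rewrite RtoC_div, !RtoC_mult, RtoC_pow by lra; reflexivity).
    assert (N2 : 2 * RtoC PI ^ 3 / 3 <> 0).
    { rewrite <- Ec. intros X. apply RtoC_inj in X. generalize (pow_lt PI 3 HPI). lra. }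
    rewrite Ec, RtoC_mult, RtoC_pow in M.
    replace Q with (/ (2 * RtoC PI ^ 3 / 3) * (2 * RtoC PI ^ 3 / 3 * Q)) by (rewrite Cmult_assoc, Cinv_l by auto; ring).
    rewrite M.
    assert (CC : Ci * Ci = - (1)) by (Cext; ring).
    replace (/ (Ci * e)) with (- (Ci * / e)).
    2:{ assert (NC := Ci_nz). replace (- (Ci * / e)) with (- (Ci * Ci) * / (Ci * e)) by (field; auto). rewrite CC. ring. }
    field. repeat split; auto. apply Ci_nz. }
  rewrite M2. unfold EMk. replace z with (- w - 2) by reflexivity.
  field. auto.
Qed.

Lemma Re_minus (a b : C) : Re (a - b) = (Re a - Re b)%R.
Proof. reflexivity. Qed.

Lemma Re_close (a b : C) : (Rabs (Re a - Re b) <= Cmod (a - b))%R.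
Proof. exact (Cmod_fst (a - b)). Qed.
Lemma holo_Ccos (f : C -> C) (z : C) : holomorphic_at f z -> holomorphic_at (fun w => Ccos (f w)) z.
Proof.
  intros H. unfold Ccos. apply holo_mult; [|apply holo_const].
  apply holo_plus; apply holo_Cexp; [|apply holo_opp]; (apply holo_mult; [apply holo_const|exact H]).
Qed.

Lemma chi_holo (w : C) : (Re w < 1)%R -> holomorphic_at chi w.
Proof.
  intros H. unfold chi.
  assert (H1 : holomorphic_at (fun w => 1 - w) w) by (apply holo_minus; [apply holo_const|apply holo_id]).
  apply holo_mult; [apply holo_mult; [apply holo_mult; [apply holo_const|]|]|].
  - apply holo_cpow. now apply holo_opp.
  - apply holo_Ccos. apply holo_mult; [|apply holo_const]. apply holo_mult; [apply holo_const|exact H1].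
  - apply (holo_comp CGamma (fun w => 1 - w)); [exact H1|]. apply CGamma_holo. rewrite Re_minus. simpl. lra.
Qed.

Lemma EM_reflected_holo (w : C) : (Re w < 0)%R -> holomorphic_at (fun w => EM (1 - w)) w.
Proof.
  intros H. apply (holo_comp EM (fun w => 1 - w)).
  - apply holo_minus; [apply holo_const|apply holo_id].
  - apply EM_holo; [rewrite Re_minus; simpl; lra|].
    intros E. apply (f_equal Re) in E. rewrite Re_minus in E. simpl in E. lra.
Qed.

Lemma Re_lt_neq_1 (w : C) : (Re w < 1)%R -> w <> 1.
Proof. intros H E. rewrite E in H. simpl in H. lra. Qed.

(** Continuity extends the functional equation to the line Re w = -1, the
    reflection of the line Re s = 2 of the integral defining H. *)
Lemma chi_EM (w : C) : (-2 < Re w <= -1)%R -> EM w = chi w * EM (1 - w).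
Proof.
  intros [H1 H2]. destruct (Rlt_le_dec (Re w) (-1)) as [L|L]; [apply chi_EM_strip; lra|].
  set (f := fun w => EM w - chi w * EM (1 - w)).
  assert (Hf : holomorphic_at f w).
  { apply holo_minus; [apply EM_holo; [auto|apply Re_lt_neq_1; lra]|].
    apply holo_mult; [apply chi_holo; lra|apply EM_reflected_holo; lra]. }
  apply holo_cont in Hf.
  assert (Z : f w = 0).
  { destruct (Ceq_dec (f w) 0) as [E|N]; [exact E|exfalso].
    assert (P := Cmod_pos _ N).
    destruct (proj1 (ccont_ball f w) Hf _ P) as [d [Hd Hw]].
    set (e := Rmin (d / 2) (/ 2)).
    assert (E1 := Rmin_l (d / 2) (/ 2)). assert (E2 := Rmin_r (d / 2) (/ 2)). fold e in E1, E2.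
    assert (E0 : (0 < e)%R) by (apply Rmin_pos; lra).
    specialize (Hw (w - RtoC e)).
    assert (Z : f (w - RtoC e) = 0).
    { unfold f. rewrite chi_EM_strip; [ring|]. rewrite Re_minus. simpl. lra. }
    rewrite Z in Hw. replace (0 - f w) with (- f w) in Hw by ring. rewrite Cmod_opp in Hw.
    apply (Rlt_irrefl (Cmod (f w))). apply Hw.
    replace (w - RtoC e - w) with (- RtoC e) by ring. rewrite Cmod_opp, Cmod_R, Rabs_pos_eq by lra. lra. }
  unfold f in Z. replace (EM w) with (EM w - chi w * EM (1 - w) + chi w * EM (1 - w)) by ring. rewrite Z. ring.
Qed.

(** * The zeta function *)

Lemma sum_n_Cpsum (a : nat -> C) (N : nat) :
  @sum_n C_AbelianMonoid (fun n => a (S n)) N = Cpsum a (S N).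
Proof.
  induction N as [|N IH].
  - rewrite sum_O. simpl. ring.
  - rewrite sum_Sn, IH. reflexivity.
Qed.

Lemma is_series_Cpsum (a : nat -> C) (l : C) :
  @is_series C_AbsRing C_NormedModule (fun n => a (S n)) l <-> clim eventually (Cpsum a) l.
Proof.
  unfold is_series. split.
  - intros H. apply (filterlim_clim eventually) in H.
    intros e He. destruct (H e He) as [N HN]. exists (S N). intros [|n] Hn; [lia|].
    specialize (HN n ltac:(lia)). rewrite <- sum_n_Cpsum. exact HN.
  - intros H. apply (filterlim_clim eventually).
    intros e He. destruct (H e He) as [N HN]. exists N. intros n Hn. specialize (HN (S n) ltac:(lia)).
    rewrite <- sum_n_Cpsum in HN. exact HN.
Qed.

(** [EM] and its reflection by the functional equation overlap in -2 < Re w < -1 and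
    together cover the plane. *)
Definition zeta_glued (w : C) : C := if Rlt_dec (- (3 / 2)) (Re w) then EM w else chi w * EM (1 - w).

Lemma zeta_glued_right (w : C) : (-2 < Re w)%R -> zeta_glued w = EM w.
Proof. intros H. unfold zeta_glued. destruct Rlt_dec; [reflexivity|]. symmetry. apply chi_EM_strip. lra. Qed.

Lemma zeta_glued_left (w : C) : (Re w < -1)%R -> zeta_glued w = chi w * EM (1 - w).
Proof. intros H. unfold zeta_glued. destruct Rlt_dec; [|reflexivity]. apply chi_EM_strip. lra. Qed.

Lemma zeta_glued_spec : is_riemann_zeta zeta_glued.
Proof.
  split.
  - intros s Hs. rewrite zeta_glued_right by lra.
    apply (is_series_Cpsum (fun n => cpow (INR n) (- s))). now apply EM_series.
  - intros s Hs. destruct (Rlt_le_dec (- (3 / 2)) (Re s)) as [L|L].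
    + apply holo_ext_loc with (f := EM) (d := (/ 2)%R); [lra| |apply EM_holo; [lra|auto]].
      intros w Hw. symmetry. apply zeta_glued_right. assert (Q := Re_close w s).
      apply Rle_lt_trans with (r3 := (/ 2)%R) in Q; [|exact Hw]. apply Rabs_def2 in Q. lra.
    + apply holo_ext_loc with (f := fun w => chi w * EM (1 - w)) (d := (/ 2)%R); [lra| |].
      * intros w Hw. symmetry. apply zeta_glued_left. assert (Q := Re_close w s).
        apply Rle_lt_trans with (r3 := (/ 2)%R) in Q; [|exact Hw]. apply Rabs_def2 in Q. lra.
      * apply holo_mult; [apply chi_holo; lra|apply EM_reflected_holo; lra].
Qed.

Lemma zeta_spec : is_riemann_zeta zeta.
Proof. unfold zeta. apply epsilon_spec. exists zeta_glued. apply zeta_glued_spec. Qed.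

Lemma riemann_zeta_halfplane (Z1 Z2 : C -> C) (s : C) : is_riemann_zeta Z1 -> is_riemann_zeta Z2 -> (1 < Re s)%R -> Z1 s = Z2 s.
Proof.
  intros [S1 _] [S2 _] H.
  specialize (S1 s H). specialize (S2 s H).
  apply (is_series_Cpsum (fun n => cpow (INR n) (- s))) in S1.
  apply (is_series_Cpsum (fun n => cpow (INR n) (- s))) in S2.
  apply (clim_unique eventually _ _ _ S1 S2).
Qed.

(** Off the real axis the continuation is reached from the half plane of
    convergence by one large square that avoids the point 1. *)
Lemma riemann_zeta_off_axis (Z1 Z2 : C -> C) (w : C) : is_riemann_zeta Z1 -> is_riemann_zeta Z2 -> Im w <> 0%R -> Z1 w = Z2 w.
Proof.
  intros H1 H2 Hw. destruct w as [a b]. simpl in Hw.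
  set (B := Rabs b). assert (HB : (0 < B)%R) by now apply Rabs_pos_lt.
  (* The centre 2 + i Y is so high that the square of half side Y - B/2 reaches w but
     avoids the real axis; below the axis the centre is 2 - i Y. *)
  set (Y := (((2 - a) * (2 - a) + B * B) / B + B + 1)%R).
  assert (Q0 := Rle_0_sqr (2 - a)). unfold Rsqr in Q0.
  assert (HY : (B + 1 <= Y)%R).
  { unfold Y. assert (0 <= ((2 - a) * (2 - a) + B * B) / B)%R by (apply Rmult_le_pos; [nra|left; now apply Rinv_0_lt_compat]). lra. }
  assert (YB : (Y * B >= (2 - a) * (2 - a) + B * B + B * B)%R).
  { unfold Y. replace ((((2 - a) * (2 - a) + B * B) / B + B + 1) * B)%R with ((2 - a) * (2 - a) + B * B + B * B + B)%R by (field; lra). lra. }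
  set (r := (Y - B / 2)%R).
  assert (Hr : (0 < r)%R) by (unfold r; lra).
  set (sg := (b / B)%R).
  assert (Hsg : (sg * sg = 1)%R).
  { unfold sg, B. destruct (Rle_lt_dec 0 b); [rewrite Rabs_pos_eq by lra|rewrite Rabs_left by lra]; field; auto. }
  assert (bB : (b = sg * B)%R) by (unfold sg; field; lra).
  assert (Hsg2 : (sg = 1 \/ sg = -1)%R).
  { assert ((sg - 1) * (sg + 1) = 0)%R by lra. destruct (Rmult_integral _ _ H); [left|right]; lra. }
  set (h := fun z => Z1 z - Z2 z).
  assert (Z : h (a, b) = 0).
  { apply (vanish_in_square h 2 (sg * Y) r 1); auto; try lra.
    - intros x y Hx Hy. assert (N : (x, y) <> RtoC 1).
      { intros E. injection E. intros Ey Ex. unfold r in Hy. destruct Hsg2 as [-> | ->]; lra. }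
      apply holo_minus; [now apply H1|now apply H2].
    - intros z Hz. unfold h.
      assert (Q := Rle_lt_trans _ _ _ (Re_close z (2, (sg * Y)%R)) Hz). simpl in Q. apply Rabs_def2 in Q.
      rewrite (riemann_zeta_halfplane Z1 Z2 z H1 H2); [ring|lra].
    - replace ((a, b) - (2, (sg * Y)%R)) with ((a - 2)%R, (b - sg * Y)%R) by (Cext; ring).
      unfold Cmod. simpl fst. simpl snd.
      rewrite <- (sqrt_pow2 r) by lra. apply sqrt_lt_1_alt. split; [nra|].
      replace ((a - 2) ^ 2 + (b - sg * Y) ^ 2)%R with ((a - 2) ^ 2 + (sg * sg) * (B - Y) ^ 2)%R by (rewrite bB; ring).
      rewrite Hsg. unfold r. nra. }
  unfold h in Z. replace (Z1 (a, b)) with (Z1 (a, b) - Z2 (a, b) + Z2 (a, b)) by ring. rewrite Z. ring.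
Qed.

(** The punctured plane is connected, but a square centred in the half plane of
    convergence reaches points off the real axis without meeting 1; the real axis
    then follows by continuity. *)
Lemma riemann_zeta_unique (Z1 Z2 : C -> C) (w : C) : is_riemann_zeta Z1 -> is_riemann_zeta Z2 -> w <> 1 -> Z1 w = Z2 w.
Proof.
  intros H1 H2 Hw.
  destruct (Req_dec (Im w) 0) as [E|N]; [|now apply riemann_zeta_off_axis].
  set (f := fun z => Z1 z - Z2 z).
  assert (Hf : holomorphic_at f w) by (apply holo_minus; [now apply H1|now apply H2]).
  apply holo_cont in Hf.
  assert (Z : f w = 0).
  { destruct (Ceq_dec (f w) 0) as [E0|N]; [exact E0|exfalso].
    assert (P := Cmod_pos _ N).
    destruct (proj1 (ccont_ball f w) Hf _ P) as [d [Hd Hb]].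
    specialize (Hb (w + Ci * RtoC (d / 2))).
    assert (Z : f (w + Ci * RtoC (d / 2)) = 0).
    { unfold f. rewrite (riemann_zeta_off_axis Z1 Z2); auto; [ring|]. destruct w; simpl in *. lra. }
    rewrite Z in Hb. replace (0 - f w) with (- f w) in Hb by ring. rewrite Cmod_opp in Hb.
    apply (Rlt_irrefl (Cmod (f w))). apply Hb.
    replace (w + Ci * RtoC (d / 2) - w) with (Ci * RtoC (d / 2)) by ring.
    rewrite Cmod_mult, Cmod_Ci, Cmod_R, Rabs_pos_eq by lra. lra. }
  unfold f in Z. replace (Z1 w) with (Z1 w - Z2 w + Z2 w) by ring. rewrite Z. ring.
Qed.

Lemma zeta_EM (w : C) : (-2 < Re w)%R -> w <> 1 -> zeta w = EM w.
Proof.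
  intros H N. rewrite <- zeta_glued_right by auto. apply riemann_zeta_unique; auto; [apply zeta_spec|apply zeta_glued_spec].
Qed.

(** ** Bounds *)

Lemma Cmod_le_Re_Im (w : C) : (Cmod w <= Rabs (Re w) + Rabs (Im w))%R.
Proof. apply Cmod_le_sum. Qed.

Lemma inv_le_1 (x : R) : (1 <= x)%R -> (/ x <= 1)%R.
Proof. intros H. rewrite <- Rinv_1. apply Rinv_le_contravar; lra. Qed.

(** The cut-off function satisfies [dom] with every p, and p = 5 makes both
    denominators in the bound of its transform at least 1 for -1 <= Re w <= 2. *)
Lemma EM_bound (w : C) : (-1 <= Re w <= 2)%R -> (1 <= Cmod (w - 1))%R -> (Cmod (EM w) <= 64 * (1 + Rabs (Im w)) ^ 3)%R.
Proof.
  intros Hw H1.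
  assert (Nw : w - 1 <> 0) by (apply Cmod_neq; lra).
  destruct (mellin_dom _ _ _ _ (- w - 2) (dom_per1 5)) as [_ B].
  { destruct w; simpl in *; lra. }
  replace (Re (- w - 2)) with (- Re w - 2)%R in B by (destruct w; simpl; ring).
  assert (I1 : (/ (5 + (- Re w - 2)) <= 1)%R) by (rewrite <- Rinv_1; apply Rinv_le_contravar; lra).
  assert (I2 : (/ (0 - (- Re w - 2)) <= 1)%R) by (rewrite <- Rinv_1; apply Rinv_le_contravar; lra).
  assert (B2 : (Cmod (mellin per1 (- w - 2)) <= 2)%R) by (unfold Rdiv in B; lra).
  assert (W := Cmod_le_Re_Im w). set (t := Rabs (Im w)) in *. assert (Ht : (0 <= t)%R) by apply Rabs_pos.
  assert (W1 : (Rabs (Re w) <= 2)%R) by (apply Rabs_le; lra).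
  assert (N0 := Cmod_ge_0 w).
  assert (A1 : (Cmod (w + 1) <= t + 3)%R) by (eapply Rle_trans; [apply Cmod_triangle|]; rewrite Cmod_1; lra).
  assert (A2 : (Cmod (w + 2) <= t + 4)%R) by (eapply Rle_trans; [apply Cmod_triangle|]; rewrite Cmod_R, Rabs_pos_eq by lra; lra).
  unfold EM.
  replace (/ (w - 1) + / 2 + w / 12 - w * (w + 1) * (w + 2) / 6 * mellin per1 (- w - 2)) with
    (/ (w - 1) + (/ 2 + (w * / 12 + - (w * (w + 1) * (w + 2) * / 6 * mellin per1 (- w - 2))))) by (field; auto).
  eapply Rle_trans; [apply Cmod_triangle|].
  eapply Rle_trans; [apply Rplus_le_compat_l, Cmod_triangle|].
  eapply Rle_trans; [apply Rplus_le_compat_l, Rplus_le_compat_l, Cmod_triangle|].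
  assert (C2 : Cmod (/ 2) = (/ 2)%R) by (rewrite <- RtoC_inv, Cmod_R, Rabs_pos_eq by lra; reflexivity).
  assert (C12 : Cmod (/ 12) = (/ 12)%R) by (rewrite <- RtoC_inv, Cmod_R, Rabs_pos_eq by lra; reflexivity).
  assert (C6 : Cmod (/ 6) = (/ 6)%R) by (rewrite <- RtoC_inv, Cmod_R, Rabs_pos_eq by lra; reflexivity).
  rewrite Cmod_opp, !Cmod_mult, C2, C12, C6, Cmod_inv by auto.
  assert (I3 : (/ Cmod (w - 1) <= 1)%R) by (apply inv_le_1; exact H1).
  assert (P1 : (Cmod w * Cmod (w + 1) <= (t + 2) * (t + 3))%R) by (apply Rmult_le_compat; try apply Cmod_ge_0; lra).
  assert (P2 : (Cmod w * Cmod (w + 1) * Cmod (w + 2) <= (t + 2) * (t + 3) * (t + 4))%R).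
  { apply Rmult_le_compat; auto; try apply Cmod_ge_0. apply Rmult_le_pos; apply Cmod_ge_0. }
  assert (P3 : (Cmod w * Cmod (w + 1) * Cmod (w + 2) * / 6 * Cmod (mellin per1 (- w - 2)) <= (t + 2) * (t + 3) * (t + 4) * / 6 * 2)%R).
  { apply Rmult_le_compat; try apply Cmod_ge_0; [|lra|exact B2].
    apply Rmult_le_pos; [|lra]. repeat apply Rmult_le_pos; apply Cmod_ge_0. }
  assert (P4 : (1 + / 2 + (t + 2) * / 12 + (t + 2) * (t + 3) * (t + 4) * / 6 * 2 <= 64 * (1 + t) ^ 3)%R).
  { assert (0 <= t * t)%R by nra. assert (0 <= t * t * t)%R by nra.
    replace (64 * (1 + t) ^ 3)%R with (64 + 192 * t + 192 * (t * t) + 64 * (t * t * t))%R by ring.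
    replace ((t + 2) * (t + 3) * (t + 4))%R with (24 + 26 * t + 9 * (t * t) + t * t * t)%R by ring. lra. }
  lra.
Qed.

(** |zeta(2 + i t) - 1| is at most 1/4 plus the tail from 3 on, at most 1/2. *)
Lemma EM_lower (w : C) : Re w = 2%R -> (/ 4 <= Cmod (EM w))%R.
Proof.
  intros Hw.
  assert (L := EM_series w ltac:(lra)).
  assert (T : forall N, (1 <= N)%nat -> (Cmod (Cpsum (fun n => cpow (INR n) (- w)) (S N) - 1) <= / 4 + (/ 2 - / INR (S N)))%R).
  { assert (M : forall n, (1 <= n)%nat -> Cmod (cpow (INR n) (- w)) = (/ (INR n * INR n))%R).
    { intros n Hn. rewrite Cmod_cpow. replace (Re (- w)) with (- (2))%R by (destruct w; simpl in *; lra).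
      assert (0 < INR n)%R by (apply lt_0_INR; lia).
      rewrite Rpower_Ropp. f_equal. replace 2%R with (1 + 1)%R by ring. rewrite Rpower_plus, Rpower_1 by auto. reflexivity. }
    induction N as [|N IH]; intros HN; [lia|].
    destruct (Nat.eq_dec N 0) as [->|N0].
    - cbn [Cpsum]. simpl (INR 1). rewrite cpow_one.
      replace (0 + 1 + cpow (INR 2) (- w) - 1) with (cpow (INR 2) (- w)) by ring.
      rewrite M by lia. simpl. lra.
    - specialize (IH ltac:(lia)).
      replace (Cpsum (fun n => cpow (INR n) (- w)) (S (S N)) - 1) with ((Cpsum (fun n => cpow (INR n) (- w)) (S N) - 1) + cpow (INR (S (S N))) (- w)) by (cbn [Cpsum]; ring).
      eapply Rle_trans; [apply Cmod_triangle|]. rewrite M by lia.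
      assert (P := INR_S_pos N).
      assert (Q : (/ (INR (S (S N)) * INR (S (S N))) <= / INR (S N) - / INR (S (S N)))%R).
      { rewrite (S_INR (S N)). replace (/ INR (S N) - / (INR (S N) + 1))%R with (/ (INR (S N) * (INR (S N) + 1)))%R by (field; lra).
        apply Rinv_le_contravar; nra. }
      lra. }
  apply Rnot_lt_le. intros Hlt.
  destruct (L (/ 4 - Cmod (EM w))%R ltac:(lra)) as [N HN].
  specialize (HN (S (S N)) ltac:(lia)). specialize (T (S N) ltac:(lia)).
  set (X := Cpsum (fun n => cpow (INR n) (- w)) (S (S N))) in *.
  assert (0 < / INR (S (S N)))%R by (apply Rinv_0_lt_compat, INR_S_pos).
  assert (Q1 := Cmod_rev_triangle 1 X). rewrite (Cmod_minus_sym 1 X), Cmod_1 in Q1.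
  assert (Q2 := Cmod_rev_triangle X (EM w)). lra.
Qed.

Local Close Scope C_scope.

(** * Schwartz functions supported in the positive half line *)

(** Real and imaginary parts are treated separately, as the iterated derivatives are
    only available for real functions. *)
Definition schwartz_posR (f : R -> R) : Prop := schwartz_R f /\ forall x, x <= 0 -> f x = 0.

Lemma Derive_n_Derive (f : R -> R) (k : nat) (x : R) : Derive_n (Derive f) k x = Derive_n f (S k) x.
Proof.
  revert x. induction k as [|k IH]; intros x; [reflexivity|].
  cbn [Derive_n]. apply Derive_ext. exact IH.
Qed.

Lemma schwartz_posR_ex_derive (f : R -> R) (k : nat) (x : R) : schwartz_posR f -> ex_derive (Derive_n f k) x.
Proof. intros [[H _] _]. exact (H (S k) x). Qed.

Lemma schwartz_posR_is_derive (f : R -> R) (x : R) : schwartz_posR f -> is_derive f x (Derive f x).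
Proof. intros H. apply Derive_correct. exact (schwartz_posR_ex_derive f 0 x H). Qed.

(** The difference quotient to the left gives the vanishing of the derivative at 0. *)
Lemma schwartz_posR_Derive (f : R -> R) : schwartz_posR f -> schwartz_posR (Derive f).
Proof.
  intros Hf. split; [split|].
  - intros [|k] x; [exact I|]. simpl.
    apply (ex_derive_ext (Derive_n f (S k))); [intros; symmetry; apply Derive_n_Derive|]. now apply schwartz_posR_ex_derive.
  - intros j k. destruct Hf as [[_ HB] _]. destruct (HB j (S k)) as [M HM]. exists M. intros x.
    rewrite Derive_n_Derive. apply HM.
  - intros x Hx. assert (D := schwartz_posR_is_derive f x Hf). set (l := Derive f x) in *.
    destruct (Req_dec l 0) as [E|N]; [exact E|exfalso].
    apply is_derive_Reals in D.
    assert (P : 0 < Rabs l / 2) by (generalize (Rabs_pos_lt l N); lra).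
    destruct (D _ P) as [d Hd]. assert (Pd := cond_pos d).
    specialize (Hd (- (d / 2)) ltac:(lra)).
    rewrite Rabs_Ropp, (Rabs_pos_eq (d / 2)) in Hd by lra. specialize (Hd ltac:(lra)).
    destruct Hf as [_ Z]. rewrite (Z (x + - (d / 2))), (Z x) in Hd by lra.
    replace ((0 - 0) / - (d / 2) - l) with (- l) in Hd by (field; lra). rewrite Rabs_Ropp in Hd. lra.
Qed.

(** The operator x d/dx acts as -s on Mellin transforms and preserves this class;
    its iterates give the decay in vertical strips. *)
Lemma schwartz_posR_euler (f : R -> R) : schwartz_posR f -> schwartz_posR (fun x => x * Derive f x).
Proof.
  intros Hf.
  assert (E : forall k x, Derive_n (fun x => x * Derive f x) k x = x * Derive_n f (S k) x + INR k * Derive_n f k x).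
  { induction k as [|k IH]; intros x; [change (Derive_n f 1 x) with (Derive f x); cbn [Derive_n INR]; ring|].
    change (Derive_n (fun x0 => x0 * Derive f x0) (S k) x) with (Derive (Derive_n (fun x0 => x0 * Derive f x0) k) x).
    rewrite (Derive_ext _ _ x IH).
    apply is_derive_unique.
    assert (D1 : is_derive (Derive_n f (S k)) x (Derive_n f (S (S k)) x)) by (apply Derive_correct; now apply schwartz_posR_ex_derive).
    assert (D0 : is_derive (Derive_n f k) x (Derive_n f (S k) x)) by (apply Derive_correct; now apply schwartz_posR_ex_derive).
    rewrite S_INR.
    replace (x * Derive_n f (S (S k)) x + (INR k + 1) * Derive_n f (S k) x) with
      ((1 * Derive_n f (S k) x + x * Derive_n f (S (S k)) x) + INR k * Derive_n f (S k) x) by ring.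
    apply (is_derive_plus (V := R_NormedModule)).
    - apply (is_derive_mult (K := R_AbsRing)); [apply is_derive_Reals, derivable_pt_lim_id|exact D1|intros; apply Rmult_comm].
    - apply (is_derive_scal (Derive_n f k)). exact D0. }
  split; [split|].
  - intros [|k] x; [exact I|]. simpl.
    apply (ex_derive_ext (fun x => x * Derive_n f (S k) x + INR k * Derive_n f k x)); [intros; symmetry; apply E|].
    apply (ex_derive_plus (V := R_NormedModule)).
    + apply ex_derive_mult; [apply ex_derive_id|]. now apply schwartz_posR_ex_derive.
    + apply (ex_derive_scal (Derive_n f k)). now apply schwartz_posR_ex_derive.
  - intros j k. destruct Hf as [[_ HB] _].
    destruct (HB (S j) (S k)) as [M1 H1]. destruct (HB j k) as [M2 H2].
    exists (M1 + INR k * M2). intros x. rewrite E.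
    eapply Rle_trans; [apply Rmult_le_compat_l; [apply pow_le, Rabs_pos|apply Rabs_triang]|].
    rewrite !Rabs_mult, (Rabs_pos_eq (INR k)) by apply pos_INR.
    specialize (H1 x). specialize (H2 x). simpl in H1.
    assert (INR k * (Rabs x ^ j * Rabs (Derive_n f k x)) <= INR k * M2) by (apply Rmult_le_compat_l; [apply pos_INR|auto]).
    simpl. lra.
  - intros x Hx. rewrite (proj2 (schwartz_posR_Derive f Hf) x Hx). ring.
Qed.

(** All derivatives vanish at 0, so each application of the mean value theorem gains
    one power of x. *)
Lemma schwartz_posR_bound_0 (N : nat) : forall f, schwartz_posR f -> exists M, 0 <= M /\ forall x, 0 <= x -> Rabs (f x) <= M * x ^ N.
Proof.
  induction N as [|N IH]; intros f Hf.
  - destruct Hf as [[_ HB] _]. destruct (HB O O) as [M HM]. simpl in HM.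
    exists M. split; [specialize (HM 0); generalize (Rabs_pos (f 0)); lra|]. intros x _. specialize (HM x). simpl. lra.
  - destruct (IH (Derive f) (schwartz_posR_Derive f Hf)) as [M [M0 HM]].
    exists M. split; [auto|]. intros x Hx.
    destruct (MVT_gen f 0 x (Derive f)) as [c [Hc E]].
    + intros y _. now apply schwartz_posR_is_derive.
    + intros y _. apply continuity_pt_filterlim. apply (ex_derive_continuous (V := R_NormedModule)). eexists. now apply schwartz_posR_is_derive.
    + rewrite Rmin_left, Rmax_right in Hc by auto.
      rewrite (proj2 Hf 0), !Rminus_0_r in E by lra. rewrite E, Rabs_mult, (Rabs_pos_eq x) by auto.
      simpl. rewrite (Rmult_comm x), <- Rmult_assoc. apply Rmult_le_compat_r; [auto|].
      eapply Rle_trans; [apply HM; lra|]. apply Rmult_le_compat_l; [auto|]. apply pow_incr. lra.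
Qed.

Lemma schwartz_posR_bound_infty (N : nat) (f : R -> R) : schwartz_posR f -> exists M, 0 <= M /\ forall x, 1 <= x -> Rabs (f x) <= M * / x ^ N.
Proof.
  intros [[_ HB] _]. destruct (HB N O) as [M HM]. simpl in HM.
  exists (Rmax M 0). split; [apply Rmax_r|]. intros x Hx.
  assert (P : 0 < x ^ N) by (apply pow_lt; lra).
  apply Rmult_le_reg_r with (x ^ N); [auto|]. rewrite Rmult_assoc, Rinv_l, Rmult_1_r by lra.
  specialize (HM x). rewrite (Rabs_pos_eq x) in HM by lra. generalize (Rmax_l M 0). lra.
Qed.

Local Open Scope C_scope.

Definition schwartz_pos (phi : R -> C) : Prop := schwartz_posR (fun x => Re (phi x)) /\ schwartz_posR (fun x => Im (phi x)).

Lemma schwartz_pos_of_schwartz (phi : R -> C) : schwartz phi -> supported_in_pos phi -> schwartz_pos phi.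
Proof.
  intros [H1 H2] Hs. split; split; auto; intros x Hx; rewrite (Hs x Hx); reflexivity.
Qed.

Definition dphi (phi : R -> C) (x : R) : C := (Derive (fun x => Re (phi x)) x, Derive (fun x => Im (phi x)) x).

Lemma schwartz_pos_pder (phi : R -> C) (x : R) : schwartz_pos phi -> pder phi x (dphi phi x).
Proof.
  intros [H1 H2]. apply pder_ext with (fun x => (Re (phi x), Im (phi x))).
  - intros u. destruct (phi u); reflexivity.
  - apply pder_pair; now apply schwartz_posR_is_derive.
Qed.

Lemma schwartz_pos_euler (phi : R -> C) : schwartz_pos phi -> schwartz_pos (fun x => RtoC x * dphi phi x).
Proof.
  intros [H1 H2]. apply schwartz_posR_euler in H1. apply schwartz_posR_euler in H2.
  assert (X : forall f g, (forall x, f x = g x) -> schwartz_posR f -> schwartz_posR g).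
  { intros f g E [[A1 A2] A3]. split; [split|].
    - intros k x. apply (ex_derive_n_ext f g); auto.
    - intros j k. destruct (A2 j k) as [M HM]. exists M. intros x. rewrite <- (Derive_n_ext f g) by auto. apply HM.
    - intros x Hx. rewrite <- E. auto. }
  split; [eapply X; [|exact H1]|eapply X; [|exact H2]]; intros x; unfold dphi; simpl; ring.
Qed.

Lemma exists_nat_ge (p : R) : exists n, (p <= INR n)%R.
Proof.
  destruct (nfloor_ex (Rmax 0 p) (Rmax_l _ _)) as [n Hn]. exists (S n). rewrite S_INR.
  generalize (Rmax_r 0 p). lra.
Qed.

Lemma schwartz_pos_dom (phi : R -> C) (p q : R) : schwartz_pos phi -> exists K, dom phi p q K.
Proof.
  intros H. destruct (exists_nat_ge p) as [n Hn]. destruct (exists_nat_ge q) as [m Hm].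
  destruct H as [H1 H2] eqn:EH.
  destruct (schwartz_posR_bound_0 n _ H1) as [M1 [P1 B1]]. destruct (schwartz_posR_bound_0 n _ H2) as [M2 [P2 B2]].
  destruct (schwartz_posR_bound_infty m _ H1) as [M3 [P3 B3]]. destruct (schwartz_posR_bound_infty m _ H2) as [M4 [P4 B4]].
  exists (M1 + M2 + M3 + M4)%R. split; [|split].
  - intros x _. eapply pder_cont, schwartz_pos_pder, H.
  - intros x Hx. eapply Rle_trans; [apply Cmod_le_sum|].
    specialize (B1 x ltac:(lra)). specialize (B2 x ltac:(lra)). unfold Re, Im in B1, B2.
    assert (Q : (x ^ n <= Rpower x p)%R) by (rewrite <- Rpower_pow by lra; apply Rpower_mono_le1; auto).
    assert (P := Rpower_pos x p).
    assert (M1 * x ^ n <= M1 * Rpower x p)%R by (apply Rmult_le_compat_l; auto).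
    assert (M2 * x ^ n <= M2 * Rpower x p)%R by (apply Rmult_le_compat_l; auto). nra.
  - intros x Hx. eapply Rle_trans; [apply Cmod_le_sum|].
    specialize (B3 x ltac:(lra)). specialize (B4 x ltac:(lra)). unfold Re, Im in B3, B4.
    assert (Q : (/ x ^ m <= Rpower x (- q))%R).
    { rewrite <- Rpower_pow by lra. rewrite <- Rpower_Ropp. apply Rpower_mono_ge1; lra. }
    assert (P := Rpower_pos x (- q)).
    assert (M3 * / x ^ m <= M3 * Rpower x (- q))%R by (apply Rmult_le_compat_l; auto).
    assert (M4 * / x ^ m <= M4 * Rpower x (- q))%R by (apply Rmult_le_compat_l; auto). nra.
Qed.

Lemma schwartz_pos_mellin (phi : R -> C) (s : C) : schwartz_pos phi -> is_mellin phi s (mellin phi s).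
Proof.
  intros H. destruct (schwartz_pos_dom phi (Rabs (Re s) + 1) (Rabs (Re s) + 1) H) as [K HK].
  eapply mellin_correct; [exact HK|]. assert (A := Rle_abs (Re s)). assert (B := Rle_abs (- Re s)). rewrite Rabs_Ropp in B. lra.
Qed.

Lemma schwartz_pos_mellin_holo (phi : R -> C) (s : C) : schwartz_pos phi -> holomorphic_at (mellin phi) s.
Proof.
  intros H. destruct (schwartz_pos_dom phi (Rabs (Re s) + 1) (Rabs (Re s) + 1) H) as [K HK].
  eapply mellin_holo; [exact HK|]. assert (A := Rle_abs (Re s)). assert (B := Rle_abs (- Re s)). rewrite Rabs_Ropp in B. lra.
Qed.

Lemma schwartz_pos_mellin_euler (phi : R -> C) (s : C) : schwartz_pos phi ->
  mellin (fun x => RtoC x * dphi phi x) s = - s * mellin phi s.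
Proof.
  intros H. destruct (schwartz_pos_dom phi (Rabs (Re s) + 1) (Rabs (Re s) + 1) H) as [K HK].
  destruct (schwartz_pos_dom _ (Rabs (Re s) + 1) (Rabs (Re s) + 1) (schwartz_pos_euler phi H)) as [K' HK'].
  eapply mellin_by_parts; [|exact HK|exact HK'|].
  - intros x _. now apply schwartz_pos_pder.
  - assert (A := Rle_abs (Re s)). assert (B := Rle_abs (- Re s)). rewrite Rabs_Ropp in B. lra.
Qed.

(** Each integration by parts gains one power of [s]. *)
(** Each integration by parts gains one power of [s]. *)
Lemma schwartz_pos_mellin_decay (k : nat) : forall phi, schwartz_pos phi -> exists K, (0 <= K)%R /\
  forall s, (-1 <= Re s <= 2)%R -> (Cmod s ^ k * Cmod (mellin phi s) <= K)%R.
Proof.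
  induction k as [|k IH]; intros phi H.
  - destruct (schwartz_pos_dom phi 2 3 H) as [K HK]. assert (K0 := dom_K_pos _ _ _ _ HK).
    exists (2 * K)%R. split; [lra|]. intros s Hs. simpl. rewrite Rmult_1_l.
    destruct (mellin_dom _ _ _ _ s HK ltac:(lra)) as [_ B].
    assert (I1 : (/ (2 + Re s) <= 1)%R) by (apply inv_le_1; lra).
    assert (I2 : (/ (3 - Re s) <= 1)%R) by (apply inv_le_1; lra).
    unfold Rdiv in B. nra.
  - destruct (IH _ (schwartz_pos_euler phi H)) as [K [K0 HK]]. exists K. split; [auto|]. intros s Hs.
    specialize (HK s Hs). rewrite schwartz_pos_mellin_euler, Cmod_mult, Cmod_opp in HK by auto. simpl. lra.
Qed.

(** For |Im s| <= 1 the transform is bounded; otherwise 1 + |Im s| <= 2 |s|. *)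
Lemma schwartz_pos_mellin_decay_line (k : nat) (phi : R -> C) : schwartz_pos phi -> exists K, (0 <= K)%R /\
  forall s, (-1 <= Re s <= 2)%R -> ((1 + Rabs (Im s)) ^ k * Cmod (mellin phi s) <= K)%R.
Proof.
  intros H. destruct (schwartz_pos_mellin_decay 0 phi H) as [K0 [P0 H0]]. destruct (schwartz_pos_mellin_decay k phi H) as [K1 [P1 H1]].
  exists (2 ^ k * (K0 + K1))%R. split; [apply Rmult_le_pos; [apply pow_le; lra|lra]|].
  intros s Hs. specialize (H0 s Hs). specialize (H1 s Hs). simpl in H0.
  assert (P := Cmod_ge_0 (mellin phi s)). set (m := Cmod (mellin phi s)) in *.
  assert (T := Cmod_snd s). change (snd s) with (Im s) in T. set (t := Rabs (Im s)) in *.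
  assert (Pt : (0 <= t)%R) by apply Rabs_pos.
  assert (Pk := pow_le 2 k ltac:(lra)).
  destruct (Rle_lt_dec t 1) as [L|L].
  - assert (Q : ((1 + t) ^ k <= 2 ^ k)%R) by (apply pow_incr; lra).
    apply Rle_trans with (2 ^ k * m)%R; [now apply Rmult_le_compat_r|]. apply Rmult_le_compat_l; lra.
  - assert (Q : ((1 + t) ^ k <= 2 ^ k * Cmod s ^ k)%R).
    { rewrite <- Rpow_mult_distr. apply pow_incr. lra. }
    apply Rle_trans with (2 ^ k * Cmod s ^ k * m)%R; [now apply Rmult_le_compat_r|].
    rewrite Rmult_assoc. apply Rmult_le_compat_l; [auto|]. lra.
Qed.

Local Close Scope C_scope.

(** * Mellin inversion *)

(** ** Hadamard's quotient *)

Lemma is_derive_continuous (f : R -> R) (x l : R) : is_derive f x l -> continuous f x.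
Proof. intros H. apply (ex_derive_continuous (V := R_NormedModule)). now exists l. Qed.

Lemma is_derive_segment_param (g g' w : R -> R) (x0 u : R) :
  (forall x, is_derive g x (g' x)) -> (forall x, continuous g' x) -> (forall v, continuous w v) ->
  is_derive (fun u => RInt (fun v => w v * g (x0 + v * (u - x0))) 0 1) u
    (RInt (fun v => w v * (v * g' (x0 + v * (u - x0)))) 0 1).
Proof.
  intros Hg Hg' Hw.
  assert (D : forall y t, is_derive (fun z => w t * g (x0 + t * (z - x0))) y (w t * (t * g' (x0 + t * (y - x0))))).
  { intros y t. apply (is_derive_scal (fun z => g (x0 + t * (z - x0)))).
    apply (is_derive_comp (K := R_AbsRing) (V := R_NormedModule) g (fun z => x0 + t * (z - x0))); [apply Hg|].
    auto_derive; auto. ring. }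
  assert (Cgv : forall y t, continuous (fun t => w t * g (x0 + t * (y - x0))) t).
  { intros y t. apply (continuous_mult (K := R_AbsRing)); [apply Hw|].
    apply (continuous_comp (fun t => x0 + t * (y - x0)) g).
    - apply (is_derive_continuous _ _ (y - x0)). auto_derive; auto. ring.
    - eapply is_derive_continuous. apply Hg. }
  assert (Cg' : forall x, continuity_pt g' x) by (intros; apply continuity_pt_filterlim; apply Hg').
  assert (Cw : forall x, continuity_pt w x) by (intros; apply continuity_pt_filterlim; apply Hw).
  rewrite (RInt_ext _ (fun t => Derive (fun z => w t * g (x0 + t * (z - x0))) u)).
  2:{ intros t _. symmetry. apply is_derive_unique. apply D. }
  apply (is_derive_RInt_param (fun z t => w t * g (x0 + t * (z - x0)))).
  - apply filter_forall. intros y t _. eexists. apply D.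
  - intros t _. apply (continuity_2d_pt_ext (fun a b => w b * (b * g' (x0 + b * (a - x0))))).
    + intros a b. symmetry. apply is_derive_unique. apply D.
    + apply continuity_2d_pt_mult; [|apply continuity_2d_pt_mult].
      * apply (continuity_1d_2d_pt_comp w (fun _ b => b)); [apply Cw|apply continuity_2d_pt_id2].
      * apply continuity_2d_pt_id2.
      * apply (continuity_1d_2d_pt_comp g' (fun a b => x0 + b * (a - x0))); [apply Cg'|].
        apply continuity_2d_pt_plus; [apply continuity_2d_pt_const|]. apply continuity_2d_pt_mult; [apply continuity_2d_pt_id2|].
        apply continuity_2d_pt_minus; [apply continuity_2d_pt_id1|apply continuity_2d_pt_const].
  - apply filter_forall. intros y. apply (ex_RInt_continuous (V := R_CompleteNormedModule)). intros t _. apply Cgv.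
Qed.

(** The quotient is the integral over v in [0, 1] of f' (x0 + v (y - x0)), which may
    be differentiated twice under the integral sign. *)
Lemma hadamard (f : R -> R) (x0 : R) : (forall k x, ex_derive (Derive_n f k) x) ->
  exists q dq : R -> R, (forall y, f y = f x0 + (y - x0) * q y) /\
    (forall y, is_derive q y (dq y)) /\ (forall y, continuous dq y).
Proof.
  intros Hf.
  assert (D : forall k x, is_derive (Derive_n f k) x (Derive_n f (S k) x)) by (intros; apply Derive_correct, Hf).
  assert (Ct : forall k x, continuous (Derive_n f k) x) by (intros; eapply is_derive_continuous; apply D).
  exists (fun u => RInt (fun v => 1 * Derive_n f 1 (x0 + v * (u - x0))) 0 1),
    (fun u => RInt (fun v => (1 * v) * Derive_n f 2 (x0 + v * (u - x0))) 0 1).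
  split; [|split].
  - intros y. symmetry.
    assert (I : is_RInt (fun v => scal (y - x0) (1 * Derive_n f 1 (x0 + v * (y - x0)))) 0 1 (f (x0 + 1 * (y - x0)) - f (x0 + 0 * (y - x0)))).
    { apply (is_RInt_derive (V := R_CompleteNormedModule) (fun v => f (x0 + v * (y - x0)))).
      - intros v _.
        replace (scal (y - x0) (1 * Derive_n f 1 (x0 + v * (y - x0)))) with ((y - x0) * Derive_n f 1 (x0 + v * (y - x0))) by (unfold scal; simpl; unfold mult; simpl; ring).
        apply (is_derive_comp (K := R_AbsRing) (V := R_NormedModule) f (fun v => x0 + v * (y - x0))); [apply (D O)|].
        auto_derive; auto. ring.
      - intros v _. apply (continuous_scal_r (V := R_NormedModule) (y - x0)).
        apply (continuous_mult (K := R_AbsRing)); [apply continuous_const|].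
        apply (continuous_comp (fun v => x0 + v * (y - x0)) (Derive_n f 1)); [|apply Ct].
        apply (is_derive_continuous _ _ (y - x0)). auto_derive; auto. ring. }
    assert (J : is_RInt (fun v => 1 * Derive_n f 1 (x0 + v * (y - x0))) 0 1 (RInt (fun v => 1 * Derive_n f 1 (x0 + v * (y - x0))) 0 1)).
    { apply (RInt_correct (V := R_CompleteNormedModule)). apply (ex_RInt_continuous (V := R_CompleteNormedModule)).
      intros v _. apply (continuous_mult (K := R_AbsRing)); [apply continuous_const|].
      apply (continuous_comp (fun v => x0 + v * (y - x0)) (Derive_n f 1)); [|apply Ct].
      apply (is_derive_continuous _ _ (y - x0)). auto_derive; auto. ring. }
    apply (is_RInt_scal (V := R_NormedModule) _ _ _ (y - x0)) in J.
    assert (E := eq_trans (eq_sym (is_RInt_unique (V := R_CompleteNormedModule) _ _ _ _ I)) (is_RInt_unique (V := R_CompleteNormedModule) _ _ _ _ J)).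
    unfold scal in E at 1; simpl in E; unfold mult in E; simpl in E.
    replace (x0 + 1 * (y - x0)) with y in E by ring. replace (x0 + 0 * (y - x0)) with x0 in E by ring.
    change (Derive_n f 1) with (Derive f) in *.
    transitivity (f x0 + (f y - f x0)); [|ring]. f_equal. symmetry. exact E.
  - intros y.
    assert (Q := is_derive_segment_param (Derive_n f 1) (Derive_n f 2) (fun _ => 1) x0 y (D 1%nat) (Ct 2%nat) (fun _ => continuous_const _ _)).
    cbv beta in Q. erewrite (RInt_ext _ _ 0 1); [exact Q|]. intros v _. cbv beta. apply Rmult_assoc.
  - intros y.
    assert (Cid : forall v : R, continuous (fun v => 1 * v) v).
    { intros v. apply (is_derive_continuous _ _ 1). auto_derive; [auto|ring]. }
    eapply is_derive_continuous.
    apply (is_derive_segment_param (Derive_n f 2) (Derive_n f 3) (fun v => 1 * v) x0 y (D 2%nat) (Ct 3%nat) Cid).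
Qed.

(** ** The comparison kernel *)

Definition sqpos (v : R) : R := Rmax v 0 ^ 2.

Lemma sqpos_derive (v : R) : is_derive sqpos v (2 * Rmax v 0).
Proof.
  apply is_derive_Reals. intros e He. exists (mkposreal e He). intros h Nh Hh. simpl in Hh.
  assert (K : Rabs (sqpos (v + h) - sqpos v - 2 * Rmax v 0 * h) <= h * h).
  { unfold sqpos. unfold Rmax. repeat destruct Rle_dec; apply Rabs_le; nra. }
  replace ((sqpos (v + h) - sqpos v) / h - 2 * Rmax v 0) with ((sqpos (v + h) - sqpos v - 2 * Rmax v 0 * h) * / h) by (field; auto).
  rewrite Rabs_mult, Rabs_inv.
  assert (P : 0 < Rabs h) by now apply Rabs_pos_lt.
  apply Rle_lt_trans with (h * h * / Rabs h); [apply Rmult_le_compat_r; [left; now apply Rinv_0_lt_compat|auto]|].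
  replace (h * h) with (Rabs h * Rabs h) by (rewrite <- Rabs_mult; apply Rabs_pos_eq, Rle_0_sqr).
  replace (Rabs h * Rabs h * / Rabs h) with (Rabs h) by (field; lra). exact Hh.
Qed.

Lemma continuous_Rmax0 (v : R) : continuous (fun v => Rmax v 0) v.
Proof.
  intros P HP. apply (proj1 (locally_R _ _)) in HP. destruct HP as [e [He HP]].
  apply (proj2 (locally_R _ _)). exists e. split; [auto|]. intros u Hu. apply HP.
  eapply Rle_lt_trans; [|exact Hu]. unfold Rmax.
  repeat destruct Rle_dec; unfold Rabs; repeat destruct Rcase_abs; lra.
Qed.

(** Chosen so that [kerE] is 2/u - 1 on (0, 1] and 2/u^3 - 1/u^4 on [1, oo): a
    function with value 1 at 1, continuously differentiable there, whose Mellin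
    transform on Re s = 2 is real, even and integrable.  The square of the positive
    part joins the two pieces and keeps the quotient by u - 1 explicit. *)
Definition kerq (u : R) : R := 2 / u - sqpos (u - 1) * ((u + 1) / u ^ 4).
Definition dkerq (u : R) : R :=
  - 2 / u ^ 2 - (2 * Rmax (u - 1) 0 * ((u + 1) / u ^ 4) + sqpos (u - 1) * (/ u ^ 4 - 4 * (u + 1) / u ^ 5)).
Definition kerE (u : R) : R := 1 - (u - 1) * kerq u.

Lemma kerq_derive (u : R) : 0 < u -> is_derive kerq u (dkerq u).
Proof.
  intros Hu. unfold kerq, dkerq.
  apply (is_derive_minus (V := R_NormedModule)).
  - auto_derive; [lra|]. field. lra.
  - apply (is_derive_mult (K := R_AbsRing) (fun u => sqpos (u - 1)) (fun u => (u + 1) / u ^ 4)); [| |intros; apply Rmult_comm].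
    + replace (2 * Rmax (u - 1) 0) with (1 * (2 * Rmax (u - 1) 0)) by ring.
      apply (is_derive_comp (K := R_AbsRing) (V := R_NormedModule) sqpos (fun u => u - 1)); [apply sqpos_derive|].
      auto_derive; auto.
    + assert (0 < u ^ 4) by now apply pow_lt. auto_derive; [simpl in *; lra|]. field. lra.
Qed.

Lemma dkerq_continuous (u : R) : 0 < u -> continuous dkerq u.
Proof.
  intros Hu. unfold dkerq.
  assert (P4 := pow_lt u 4 Hu). assert (P5 := pow_lt u 5 Hu). assert (P2 := pow_lt u 2 Hu).
  assert (Cm : continuous (fun u => u - 1) u) by (apply (is_derive_continuous _ _ 1); auto_derive; auto).
  assert (CR : continuous (fun u => Rmax (u - 1) 0) u) by (apply (continuous_comp (fun u => u - 1) (fun v => Rmax v 0)); [exact Cm|apply continuous_Rmax0]).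
  assert (CS : continuous (fun u => sqpos (u - 1)) u).
  { apply (continuous_comp (fun u => u - 1) sqpos); [exact Cm|]. eapply is_derive_continuous, sqpos_derive. }
  apply (continuous_minus (V := R_NormedModule)).
  - apply (ex_derive_continuous (V := R_NormedModule)). auto_derive. simpl in *; lra.
  - apply (continuous_plus (V := R_NormedModule)); apply (continuous_mult (K := R_AbsRing)).
    + apply (continuous_mult (K := R_AbsRing)); [apply continuous_const|exact CR].
    + apply (ex_derive_continuous (V := R_NormedModule)). auto_derive. simpl in *; lra.
    + exact CS.
    + apply (ex_derive_continuous (V := R_NormedModule)). auto_derive. simpl in *; lra.
Qed.

Lemma kerE_left (u : R) : 0 < u <= 1 -> kerE u = 2 / u - 1.
Proof.
  intros Hu. unfold kerE, kerq, sqpos. rewrite Rmax_right by lra. field. lra.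
Qed.

Lemma kerE_right (u : R) : 1 <= u -> kerE u = 2 / u ^ 3 - / u ^ 4.
Proof.
  intros Hu. unfold kerE, kerq, sqpos. rewrite Rmax_left by lra. field. lra.
Qed.

Lemma kerE_derive (u : R) : 0 < u -> is_derive kerE u (- (1 * kerq u + (u - 1) * dkerq u)).
Proof.
  intros Hu. unfold kerE.
  replace (- (1 * kerq u + (u - 1) * dkerq u)) with (0 - (1 * kerq u + (u - 1) * dkerq u)) by ring.
  apply (is_derive_minus (V := R_NormedModule)); [apply is_derive_Reals, derivable_pt_lim_const|].
  apply (is_derive_mult (K := R_AbsRing) (fun u => u - 1) kerq); [auto_derive; auto|now apply kerq_derive|intros; apply Rmult_comm].
Qed.

Lemma kerE_euler_left (u : R) : 0 < u < 1 -> u * (1 * kerq u + (u - 1) * dkerq u) = 2 / u.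
Proof.
  intros Hu. unfold kerq, dkerq, sqpos. rewrite !Rmax_right by lra. field. lra.
Qed.

Lemma kerE_euler_right (u : R) : 1 <= u -> u * (1 * kerq u + (u - 1) * dkerq u) = 6 / u ^ 3 - 4 / u ^ 4.
Proof.
  intros Hu. unfold kerq, dkerq, sqpos. rewrite !Rmax_left by lra. field. lra.
Qed.

Local Open Scope C_scope.

Lemma kerE_mellin (s : C) : (1 < Re s < 3)%R ->
  is_mellin (fun u => RtoC (kerE u)) s (2 / (s - 1) - / s + (2 / (3 - s) - / (4 - s))).
Proof.
  intros Hs.
  assert (N1 : s - 1 <> 0) by (apply Cminus_eq_contra; intros E; apply (f_equal Re) in E; simpl in E; lra).
  assert (N0 : s <> 0) by (intros E; apply (f_equal Re) in E; simpl in E; lra).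
  assert (N3 : 3 - s <> 0) by (apply Cminus_eq_contra; intros E; apply (f_equal Re) in E; simpl in E; lra).
  assert (N4 : 4 - s <> 0) by (apply Cminus_eq_contra; intros E; apply (f_equal Re) in E; simpl in E; lra).
  assert (Pk : forall x n, (0 < x)%R -> cpow x (- RtoC (INR n)) = / RtoC x ^ n) by (intros x n Hx; now rewrite cpow_opp, cpow_INR).
  assert (P1 : forall x, (0 < x)%R -> / RtoC x = cpow x (- (1))) by (intros x Hx; rewrite cpow_opp, cpow_1; auto).
  assert (Pp : forall n, RtoC (IZR (Z.of_nat n)) = RtoC (INR n)) by (intros; now rewrite INR_IZR_INZ).
  assert (Cc : forall x, (0 < x)%R -> @ccont R_UniformSpace (fun x => RtoC (kerE x) * cpow x (s - 1)) x).
  { intros x Hx. capply clim_mult; [|now apply ccont_cpow].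
    exact (pder_cont _ _ _ (pder_RtoC kerE x _ (kerE_derive x Hx))). }
  assert (M : forall (c e : C) x, (0 < x)%R -> e <> 0 -> pder (fun x => c / e * cpow x e) x (c * cpow x (e - 1))).
  { intros c e x Hx He. eapply pder_eq; [|apply pder_mult; [apply pder_const|apply pder_cpow; auto]]. cbv beta. field. auto. }
  apply (Cis_gen_Chasles _ 1%R).
  - replace (2 / (s - 1) - / s) with (2 / (s - 1) - 1 / s - (2 / (s - 1) * 0 - 1 / s * 0)) by (field; auto).
    assert (Q : clim (at_point 1%R) (fun x => 2 / (s - 1) * cpow x (s - 1) - 1 / s * cpow x s) (2 / (s - 1) - 1 / s)).
    { intros e He. unfold at_point. rewrite !cpow_one.
      match goal with |- (Cmod ?A < _)%R => replace A with (RtoC 0) by ring end. now rewrite Cmod_0. }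
    apply (Cis_gen_FTC (fun x => 2 / (s - 1) * cpow x (s - 1) - 1 / s * cpow x s) _ (fun x => (0 < x <= 1)%R)); [| | | | | |exact Q].
    + intros u v x Hu Hv Hx. split; [eapply Rlt_le_trans; [|apply Hx]; apply Rmin_pos; lra|eapply Rle_trans; [apply Hx|]; apply Rmax_lub; lra].
    + exists (mkposreal 1 Rlt_0_1). intros y Hy Hy0.
      unfold ball in Hy; simpl in Hy; unfold AbsRing_ball, abs, minus, plus, opp in Hy; simpl in Hy. apply Rabs_def2 in Hy. lra.
    + unfold at_point. lra.
    + intros x Hx. eapply pder_eq; [|apply pder_minus; apply M; auto; lra].
      rewrite kerE_left by lra. rewrite RtoC_minus, RtoC_div by lra. unfold Cdiv. rewrite P1 by lra.
      replace (s - 1 - 1) with (- (1) + (s - 1)) by ring. rewrite (cpow_plus x (- (1))). ring.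
    + intros x Hx. apply Cc. lra.
    + capply clim_minus; (capply clim_mult; [capply clim_const|apply cpow_lim_0]).
      * destruct s; simpl in *; lra.
      * lra.
  - assert (N3' : s - 3 <> 0) by (intros E; apply N3; replace (3 - s) with (- (s - 3)) by ring; rewrite E; ring).
    assert (N4' : s - 4 <> 0) by (intros E; apply N4; replace (4 - s) with (- (s - 4)) by ring; rewrite E; ring).
    replace (2 / (3 - s) - / (4 - s)) with (2 / (s - 3) * 0 - 1 / (s - 4) * 0 - (2 / (s - 3) - 1 / (s - 4))) by (field; repeat split; auto).
    assert (Q : clim (at_point 1%R) (fun x => 2 / (s - 3) * cpow x (s - 3) - 1 / (s - 4) * cpow x (s - 4)) (2 / (s - 3) - 1 / (s - 4))).
    { intros e He. unfold at_point. rewrite !cpow_one.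
      match goal with |- (Cmod ?A < _)%R => replace A with (RtoC 0) by ring end. now rewrite Cmod_0. }
    assert (L : forall e : C, (Re e < 0)%R -> clim (Rbar_locally p_infty) (fun x => cpow x e) 0).
    { intros e He. apply clim_squeeze with (fun x => Rpower x (- (- Re e))); [typeclasses eauto| |].
      - intros ep Hep. generalize (filterlim_eps _ _ _ (Rpower_lim_infty (- Re e) ltac:(lra)) ep Hep). apply filter_imp.
        intros x Hx. rewrite Rminus_0_r in Hx. eapply Rle_lt_trans; [apply Rle_abs|exact Hx].
      - apply filter_forall. intros x. replace (cpow x e - 0) with (cpow x e) by ring. rewrite Cmod_cpow, Ropp_involutive. lra. }
    apply (Cis_gen_FTC (fun x => 2 / (s - 3) * cpow x (s - 3) - 1 / (s - 4) * cpow x (s - 4)) _ (fun x => (1 <= x)%R)); [| | | | |exact Q|].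
    + intros u v x Hu Hv Hx. eapply Rle_trans; [|apply Hx]. apply Rmin_glb; lra.
    + unfold at_point. lra.
    + exists 1%R. intros; lra.
    + intros x Hx. eapply pder_eq; [|apply pder_minus; apply M; auto; lra].
      rewrite kerE_right by lra. rewrite RtoC_minus, RtoC_div, RtoC_inv, !RtoC_pow by (apply pow_nonzero; lra).
      unfold Cdiv. rewrite <- !Pk by lra.
      replace (s - 3 - 1) with (- RtoC (INR 3) + (s - 1)) by (replace (RtoC (INR 3)) with (RtoC 3) by (f_equal; simpl; ring); ring).
      replace (s - 4 - 1) with (- RtoC (INR 4) + (s - 1)) by (replace (RtoC (INR 4)) with (RtoC 4) by (f_equal; simpl; ring); ring).
      rewrite !(cpow_plus x (- _)). ring.
    + intros x Hx. apply Cc. lra.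
    + capply clim_minus; (capply clim_mult; [capply clim_const|apply L]); destruct s; simpl in *; lra.
Qed.

(** Compactness takes care of the middle range. *)
Lemma dom_of_ends (g : R -> C) (al be K1 K2 : R) : (0 < al)%R -> (0 < be)%R ->
  (forall x, (0 < x)%R -> @ccont R_UniformSpace g x) ->
  (forall x, (0 < x <= al)%R -> (Cmod (g x) <= K1 * / x)%R) ->
  (forall x, (be <= x)%R -> (Cmod (g x) <= K2 * / x ^ 4)%R) -> exists K, dom g (-1) 4 K.
Proof.
  intros Ha Hb Hc H1 H2.
  set (a := Rmin al 1). set (b := Rmax be 1).
  assert (A1 := Rmin_l al 1). assert (A2 := Rmin_r al 1). assert (B1 := Rmax_l be 1). assert (B2 := Rmax_r be 1).
  fold a in A1, A2. fold b in B1, B2.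
  assert (A0 : (0 < a)%R) by (apply Rmin_pos; lra).
  assert (Pw : forall x, (0 < x)%R -> Rpower x (-1) = (/ x)%R).
  { intros x Hx. replace (-1)%R with (- (1))%R by lra. now rewrite Rpower_Ropp, Rpower_1. }
  assert (Pw4 : forall x, (0 < x)%R -> Rpower x (- (4)) = (/ x ^ 4)%R).
  { intros x Hx. rewrite Rpower_Ropp. f_equal. replace 4%R with (INR 4) by (simpl; ring). now apply Rpower_pow. }
  destruct (segment_bounded (fun x => RtoC x * g x) a 1 A2) as [M1 HM1].
  { intros x Hx. capply clim_mult; [apply ccont_RtoC|apply Hc; lra]. }
  destruct (segment_bounded (fun x => RtoC x ^ 4 * g x) 1 b B2) as [M2 HM2].
  { intros x Hx. capply clim_mult; [capply clim_pow; apply ccont_RtoC|apply Hc; lra]. }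
  set (K := (Rabs K1 + Rabs K2 + Rabs M1 + Rabs M2)%R).
  assert (Q1 := Rle_abs K1). assert (Q2 := Rle_abs K2). assert (Q3 := Rle_abs M1). assert (Q4 := Rle_abs M2).
  assert (R1 := Rabs_pos K1). assert (R2 := Rabs_pos K2). assert (R3 := Rabs_pos M1). assert (R4 := Rabs_pos M2).
  exists K. split; [exact Hc|split].
  - intros x Hx. rewrite Pw by lra. assert (Ix : (0 < / x)%R) by (apply Rinv_0_lt_compat; lra).
    destruct (Rle_lt_dec x a) as [L|L].
    + eapply Rle_trans; [apply H1; lra|]. apply Rmult_le_compat_r; unfold K; lra.
    + specialize (HM1 x ltac:(lra)). cbv beta in HM1. rewrite Cmod_mult, Cmod_R, Rabs_pos_eq in HM1 by lra.
      apply Rmult_le_reg_l with x; [lra|]. replace (x * (K * / x))%R with K by (field; lra). unfold K. lra.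
  - intros x Hx. rewrite Pw4 by lra. assert (Px : (0 < x ^ 4)%R) by (apply pow_lt; lra).
    assert (Ix : (0 < / x ^ 4)%R) by now apply Rinv_0_lt_compat.
    destruct (Rle_lt_dec b x) as [L|L].
    + eapply Rle_trans; [apply H2; lra|]. apply Rmult_le_compat_r; unfold K; lra.
    + specialize (HM2 x ltac:(lra)). cbv beta in HM2. rewrite Cmod_mult, Cmod_pow, Cmod_R, Rabs_pos_eq in HM2 by lra.
      apply Rmult_le_reg_l with (x ^ 4)%R; [lra|]. replace (x ^ 4 * (K * / x ^ 4))%R with K by (field; lra). unfold K. lra.
Qed.

(** ** The quotient by y - x0 *)

Lemma pder_unique (f : R -> C) (x : R) (a b : C) : pder f x a -> pder f x b -> a = b.
Proof.
  rewrite !pder_eps. intros Ha Hb. apply Ceq_minus, Cmod_eq_0.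
  destruct (Cmod_ge_0 (a - b)) as [P|P]; [exfalso|auto].
  assert (P4 : (0 < Cmod (a - b) / 4)%R) by lra.
  destruct (Ha _ P4) as [d1 [D1 H1]]. destruct (Hb _ P4) as [d2 [D2 H2]].
  set (h := (Rmin d1 d2 / 2)%R). assert (M1 := Rmin_l d1 d2). assert (M2 := Rmin_r d1 d2).
  assert (M0 : (0 < Rmin d1 d2)%R) by now apply Rmin_pos.
  assert (Hh : (0 < h)%R) by (unfold h; lra).
  specialize (H1 (x + h)%R). specialize (H2 (x + h)%R). replace (x + h - x)%R with h in H1, H2 by ring.
  rewrite Rabs_pos_eq in H1, H2 by lra. specialize (H1 ltac:(unfold h; lra)). specialize (H2 ltac:(unfold h; lra)).
  assert (Q : (Cmod ((a - b) * RtoC h) <= Cmod (a - b) / 4 * h + Cmod (a - b) / 4 * h)%R).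
  { replace ((a - b) * RtoC h) with ((f (x + h)%R - f x - b * RtoC h) - (f (x + h)%R - f x - a * RtoC h)) by ring.
    eapply Rle_trans; [apply Cmod_triangle|]. rewrite Cmod_opp. lra. }
  rewrite Cmod_mult, Cmod_R, Rabs_pos_eq in Q by lra. nra.
Qed.

Lemma schwartz_pos_pow_bound (phi : R -> C) : schwartz_pos phi -> exists M, (0 <= M)%R /\
  (forall x, (0 <= x)%R -> (Cmod (phi x) <= M)%R) /\ (forall x, (1 <= x)%R -> (Cmod (phi x) <= M * / x ^ 3)%R).
Proof.
  intros [H1 H2].
  destruct (schwartz_posR_bound_0 0 _ H1) as [M1 [P1 B1]]. destruct (schwartz_posR_bound_0 0 _ H2) as [M2 [P2 B2]].
  destruct (schwartz_posR_bound_infty 3 _ H1) as [M3 [P3 B3]]. destruct (schwartz_posR_bound_infty 3 _ H2) as [M4 [P4 B4]].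
  exists (M1 + M2 + M3 + M4)%R. repeat split; [lra| |].
  - intros x Hx. eapply Rle_trans; [apply Cmod_le_sum|]. specialize (B1 x Hx). specialize (B2 x Hx).
    unfold Re, Im in *. simpl in *. lra.
  - intros x Hx. eapply Rle_trans; [apply Cmod_le_sum|]. specialize (B3 x Hx). specialize (B4 x Hx).
    unfold Re, Im in *. assert (0 < / x ^ 3)%R by (apply Rinv_0_lt_compat, pow_lt; lra). nra.
Qed.

(** [kk] is the quotient by y - x0 of [NN], the difference of phi and the kernel
    scaled to have the value phi x0 at x0.  [q1] and [q2] are the Hadamard quotients of
    the two parts of phi. *)
Section Quotient.
Context (phi : R -> C) (x0 : R) (q1 q2 dq1 dq2 : R -> R).
Context (Hphi : schwartz_pos phi) (Hx0 : (0 < x0)%R).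
Context (Q1 : forall y, Re (phi y) = (Re (phi x0) + (y - x0) * q1 y)%R).
Context (Q2 : forall y, Im (phi y) = (Im (phi x0) + (y - x0) * q2 y)%R).
Context (D1 : forall y, is_derive q1 y (dq1 y)) (D2 : forall y, is_derive q2 y (dq2 y)).
Context (C1 : forall y, continuous dq1 y) (C2 : forall y, continuous dq2 y).

Let A : C := phi x0.
Let kk (y : R) : C := (q1 y, q2 y) + A * RtoC (kerq (y / x0) / x0).
Let dk (y : R) : C := (dq1 y, dq2 y) + A * RtoC (dkerq (y / x0) / x0 / x0).
Let NN (y : R) : C := phi y - A * RtoC (kerE (y / x0)).
Let dN (y : R) : C := dphi phi y + A * RtoC ((1 * kerq (y / x0) + (y / x0 - 1) * dkerq (y / x0)) / x0).

Lemma quot_eq (y : R) : NN y = RtoC (y - x0) * kk y.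
Proof.
  unfold NN, kk. assert (E : phi y = A + RtoC (y - x0) * (q1 y, q2 y)).
  { assert (E1 := Q1 y). assert (E2 := Q2 y). unfold A. destruct (phi y) as [u v], (phi x0) as [u0 v0].
    simpl in E1, E2. rewrite E1, E2. Cext; ring. }
  rewrite E. unfold kerE.
  replace (RtoC (1 - (y / x0 - 1) * kerq (y / x0))) with (1 - RtoC (y - x0) * RtoC (kerq (y / x0) / x0)).
  - ring.
  - rewrite <- RtoC_mult, <- RtoC_minus. f_equal. field. lra.
Qed.

Lemma div_x0_derive (y : R) : is_derive (fun y => (y / x0)%R) y (/ x0)%R.
Proof. auto_derive; auto. field. lra. Qed.

Lemma div_x0_pos (y : R) : (0 < y -> 0 < y / x0)%R.
Proof. intros. now apply Rdiv_lt_0_compat. Qed.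

Lemma kk_pder (y : R) : (0 < y)%R -> pder kk y (dk y).
Proof.
  intros Hy. unfold kk, dk. apply pder_plus; [now apply pder_pair|].
  eapply pder_eq; [|apply pder_mult; [apply pder_const|apply pder_RtoC]].
  2:{ apply (is_derive_scal_l (K := R_AbsRing) (V := R_NormedModule) (fun y => kerq (y / x0)) y (/ x0 * dkerq (y / x0))%R (/ x0)%R).
      apply (is_derive_comp (K := R_AbsRing) (V := R_NormedModule) kerq (fun y => (y / x0)%R)); [now apply kerq_derive, div_x0_pos|apply div_x0_derive]. }
  cbv beta. unfold scal; simpl; unfold mult; simpl.
  replace (/ x0 * dkerq (y / x0) * / x0)%R with (dkerq (y / x0) / x0 / x0)%R by (field; lra). ring.
Qed.

Lemma NN_pder (y : R) : (0 < y)%R -> pder NN y (dN y).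
Proof.
  intros Hy. unfold NN, dN.
  eapply pder_eq; [|apply pder_minus; [now apply schwartz_pos_pder|apply pder_mult; [apply pder_const|apply pder_RtoC]]].
  2:{ apply (is_derive_comp (K := R_AbsRing) (V := R_NormedModule) kerE (fun y => (y / x0)%R)); [now apply kerE_derive, div_x0_pos|apply div_x0_derive]. }
  cbv beta. unfold scal; simpl; unfold mult; simpl.
  match goal with |- _ = _ + _ * RtoC ?r => replace r with (- (/ x0 * - (1 * kerq (y / x0) + (y / x0 - 1) * dkerq (y / x0))))%R by (field; lra) end.
  rewrite RtoC_opp. ring.
Qed.

(** An identity between derivatives of [NN] and of its factorization; it bounds the
    derivative of the quotient at the ends by that of [NN]. *)
Lemma dN_dk (y : R) : (0 < y)%R -> dN y = kk y + RtoC (y - x0) * dk y.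
Proof.
  intros Hy. apply (pder_unique NN y); [now apply NN_pder|].
  apply pder_ext with (fun u => RtoC (u - x0) * kk u); [intros; symmetry; apply quot_eq|].
  eapply pder_eq; [|apply pder_mult; [apply pder_RtoC|now apply kk_pder]].
  2:{ auto_derive; auto. }
  cbv beta. ring.
Qed.

Lemma dk_cont (y : R) : (0 < y)%R -> @ccont R_UniformSpace dk y.
Proof.
  intros Hy. unfold dk. capply clim_plus.
  - capply clim_pair; [apply C1|apply C2].
  - capply clim_mult; [capply clim_const|]. capply clim_RtoC.
    unfold Rdiv at 1 3.
    assert (X : continuous (fun y => dkerq (y / x0) / x0 / x0)%R y); [|exact X].
    apply (continuous_mult (K := R_AbsRing)); [|apply continuous_const].
    apply (continuous_mult (K := R_AbsRing)); [|apply continuous_const].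
    apply (continuous_comp (fun y => (y / x0)%R) dkerq); [|now apply dkerq_continuous, div_x0_pos].
    eapply is_derive_continuous, div_x0_derive.
Qed.

(** The exponents -1 and 4 are those of the kernel (2/u near 0, 2/u^3 near infinity)
    divided by y - x0; they leave the strip 1 < Re s < 4, which contains the lines
    Re s = 2 and Re s = 3 used for the inversion. *)
Lemma quot_dom : (exists K, dom kk (-1) 4 K) /\ (exists K, dom (fun y => RtoC y * dk y) (-1) 4 K).
Proof.
  destruct (schwartz_pos_pow_bound phi Hphi) as [Ma [Pa [Ba1 Ba2]]].
  destruct (schwartz_pos_pow_bound _ (schwartz_pos_euler phi Hphi)) as [Mb [Pb [Bb1 Bb2]]].
  set (M := (Ma + Mb)%R). set (P := Cmod A). assert (P0 : (0 <= P)%R) by apply Cmod_ge_0.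
  set (KA := (M + P * (2 * x0 + 1))%R). set (KB := (M + 10 * P * x0 ^ 3)%R).
  assert (X3 : (0 < x0 ^ 3)%R) by now apply pow_lt.
  assert (HKA : (0 <= KA)%R) by (unfold KA, M; nra). assert (HKB : (0 <= KB)%R) by (unfold KB, M; nra).
  assert (Eu : forall y, (0 < y)%R -> RtoC y * dN y = RtoC y * dphi phi y + A * RtoC (y / x0 * (1 * kerq (y / x0) + (y / x0 - 1) * dkerq (y / x0)))).
  { intros y Hy. unfold dN.
    replace (RtoC (y / x0 * (1 * kerq (y / x0) + (y / x0 - 1) * dkerq (y / x0)))) with (RtoC y * RtoC ((1 * kerq (y / x0) + (y / x0 - 1) * dkerq (y / x0)) / x0)).
    - ring.
    - rewrite <- RtoC_mult. f_equal. field. lra. }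
  set (al := Rmin (x0 / 2) 1). set (be := Rmax (2 * x0) 1).
  assert (al1 := Rmin_l (x0 / 2) 1). assert (al2 := Rmin_r (x0 / 2) 1). fold al in al1, al2.
  assert (be1 := Rmax_l (2 * x0) 1). assert (be2 := Rmax_r (2 * x0) 1). fold be in be1, be2.
  assert (al0 : (0 < al)%R) by (apply Rmin_pos; lra).
  assert (LN : forall y, (0 < y <= al)%R -> (Cmod (NN y) <= KA * / y)%R /\ (Cmod (RtoC y * dN y) <= KA * / y)%R).
  { intros y Hy. assert (Iy : (1 <= / y)%R) by (rewrite <- Rinv_1; apply Rinv_le_contravar; lra).
    assert (Hu : (0 < y / x0 < 1)%R).
    { split; [apply div_x0_pos; lra|]. apply Rmult_lt_reg_r with x0; [auto|]. unfold Rdiv. rewrite Rmult_assoc, Rinv_l by lra. lra. }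
    assert (E2 : (2 / (y / x0) = 2 * x0 * / y)%R) by (field; lra).
    split.
    - unfold NN. eapply Rle_trans; [apply Cmod_triangle|]. rewrite Cmod_opp, Cmod_mult, Cmod_R, kerE_left, E2 by lra. fold P.
      assert (Rabs (2 * x0 * / y - 1) <= (2 * x0 + 1) * / y)%R by (apply Rabs_le; nra).
      assert (B := Ba1 y ltac:(lra)).
      assert (P * Rabs (2 * x0 * / y - 1) <= P * ((2 * x0 + 1) * / y))%R by (apply Rmult_le_compat_l; auto).
      assert (Ma <= M * / y)%R by (unfold M; nra). unfold KA. nra.
    - rewrite Eu by lra. eapply Rle_trans; [apply Cmod_triangle|]. rewrite (Cmod_mult A), Cmod_R, kerE_euler_left, E2 by lra. fold P.
      rewrite Rabs_pos_eq by nra.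
      assert (B := Bb1 y ltac:(lra)). cbv beta in B.
      assert (Mb <= M * / y)%R by (unfold M; nra).
      assert (0 <= P * / y)%R by nra. unfold KA. nra. }
  assert (RN : forall y, (be <= y)%R -> (Cmod (NN y) <= KB * / y ^ 3)%R /\ (Cmod (RtoC y * dN y) <= KB * / y ^ 3)%R).
  { intros y Hy.
    assert (Hu : (2 <= y / x0)%R).
    { apply Rmult_le_reg_r with x0; [auto|]. unfold Rdiv. rewrite Rmult_assoc, Rinv_l by lra. lra. }
    assert (Py3 : (0 < / y ^ 3)%R) by (apply Rinv_0_lt_compat, pow_lt; lra).
    set (u := (y / x0)%R) in *.
    assert (U3 : (/ u ^ 3 = x0 ^ 3 * / y ^ 3)%R) by (unfold u; field; lra).
    assert (U30 : (0 < / u ^ 3)%R) by (apply Rinv_0_lt_compat, pow_lt; lra).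
    assert (U4 : (0 < / u ^ 4 <= / u ^ 3)%R).
    { split; [apply Rinv_0_lt_compat, pow_lt; lra|]. apply Rinv_le_contravar; [apply pow_lt; lra|].
      assert (0 < u ^ 3)%R by (apply pow_lt; lra). simpl in *. nra. }
    assert (Fin : forall (m : C) (r c : R), (Cmod m <= M * / y ^ 3)%R -> (0 <= c <= 10)%R -> (Rabs r <= c * / u ^ 3)%R -> (Cmod (m + A * RtoC r) <= KB * / y ^ 3)%R).
    { intros m r c Hm Hc Hr. eapply Rle_trans; [apply Cmod_triangle|]. rewrite Cmod_mult, Cmod_R. fold P.
      assert (P * Rabs r <= P * (10 * / u ^ 3))%R by (apply Rmult_le_compat_l; nra).
      rewrite U3 in H. unfold KB. nra. }
    split.
    - unfold NN. replace (phi y - A * RtoC (kerE (y / x0))) with (phi y + A * RtoC (- kerE (y / x0))) by (rewrite RtoC_opp; ring).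
      apply (Fin _ _ 3%R); [|lra|].
      + eapply Rle_trans; [apply Ba2; lra|]. apply Rmult_le_compat_r; [lra|unfold M; lra].
      + fold u. rewrite Rabs_Ropp, kerE_right by lra. apply Rabs_le. unfold Rdiv. lra.
    - rewrite Eu by lra. apply (Fin _ _ 10%R); [|lra|].
      + eapply Rle_trans; [apply Bb2; lra|]. apply Rmult_le_compat_r; [lra|unfold M; lra].
      + fold u. rewrite kerE_euler_right by lra. apply Rabs_le. unfold Rdiv. lra. }
  assert (Cy : forall y, RtoC (y - x0) = 0 -> y = x0) by (intros y E; apply RtoC_inj in E; lra).
  assert (Kabs : forall y, y <> x0 -> Cmod (kk y) = (Cmod (NN y) * / Rabs (y - x0))%R).
  { intros y Hy. rewrite quot_eq, Cmod_mult, Cmod_R. field. apply Rabs_no_R0. lra. }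
  assert (Dabs : forall y, (0 < y)%R -> y <> x0 -> (Cmod (RtoC y * dk y) <= (Cmod (RtoC y * dN y) + y * Cmod (kk y)) * / Rabs (y - x0))%R).
  { intros y Py Hy. assert (Pd : (0 < Rabs (y - x0))%R) by (apply Rabs_pos_lt; lra).
    apply Rmult_le_reg_r with (Rabs (y - x0)); [auto|]. rewrite Rmult_assoc, Rinv_l, Rmult_1_r by lra.
    rewrite <- Cmod_R at 1. rewrite <- Cmod_mult.
    replace (RtoC y * dk y * RtoC (y - x0)) with (RtoC y * dN y - RtoC y * kk y) by (rewrite dN_dk by auto; ring).
    eapply Rle_trans; [apply Cmod_triangle|]. rewrite Cmod_opp, (Cmod_mult (RtoC y) (kk y)), Cmod_R, (Rabs_pos_eq y) by lra. lra. }
  assert (KL : forall y, (0 < y <= al)%R -> (Cmod (kk y) <= (2 / x0 * KA) * / y)%R).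
  { intros y Hy. rewrite Kabs by lra. rewrite Rabs_left by lra.
    assert (I : (/ - (y - x0) <= / (x0 / 2))%R) by (apply Rinv_le_contravar; lra).
    assert (I0 : (0 < / - (y - x0))%R) by (apply Rinv_0_lt_compat; lra).
    replace (2 / x0 * KA * / y)%R with (KA * / y * / (x0 / 2))%R by (field; lra).
    apply Rmult_le_compat; [apply Cmod_ge_0|lra|now apply LN|exact I]. }
  assert (KR : forall y, (be <= y)%R -> (Cmod (kk y) <= (2 * KB) * / y ^ 4)%R).
  { intros y Hy. rewrite Kabs by lra. rewrite Rabs_pos_eq by lra.
    assert (I : (/ (y - x0) <= / (y / 2))%R) by (apply Rinv_le_contravar; lra).
    assert (I0 : (0 < / (y - x0))%R) by (apply Rinv_0_lt_compat; lra).
    replace (2 * KB * / y ^ 4)%R with (KB * / y ^ 3 * / (y / 2))%R by (field; lra).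
    apply Rmult_le_compat; [apply Cmod_ge_0|lra|now apply RN|exact I]. }
  split.
  - apply (dom_of_ends kk al be (2 / x0 * KA) (2 * KB)); auto; [lra|].
    intros y Hy. eapply pder_cont, kk_pder; auto.
  - apply (dom_of_ends _ al be ((KA + 2 / x0 * KA) * (2 / x0)) (6 * KB)); auto; [lra| | |].
    + intros y Hy. capply clim_mult; [apply ccont_RtoC|now apply dk_cont].
    + intros y Hy. eapply Rle_trans; [apply Dabs; lra|]. rewrite Rabs_left by lra.
      assert (I : (/ - (y - x0) <= / (x0 / 2))%R) by (apply Rinv_le_contravar; lra).
      assert (I0 : (0 < / - (y - x0))%R) by (apply Rinv_0_lt_compat; lra).
      replace ((KA + 2 / x0 * KA) * (2 / x0) * / y)%R with ((KA * / y + 2 / x0 * KA * / y) * / (x0 / 2))%R by (field; lra).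
      destruct (LN y Hy) as [_ L2]. specialize (KL y Hy). assert (Z := Cmod_ge_0 (kk y)).
      apply Rmult_le_compat; [|lra| |exact I].
      * apply Rplus_le_le_0_compat; [apply Cmod_ge_0|nra].
      * apply Rplus_le_compat; [exact L2|]. nra.
    + intros y Hy. eapply Rle_trans; [apply Dabs; lra|]. rewrite Rabs_pos_eq by lra.
      assert (I : (/ (y - x0) <= / (y / 2))%R) by (apply Rinv_le_contravar; lra).
      assert (I0 : (0 < / (y - x0))%R) by (apply Rinv_0_lt_compat; lra).
      replace (6 * KB * / y ^ 4)%R with ((KB * / y ^ 3 + y * (2 * KB * / y ^ 4)) * / (y / 2))%R by (field; lra).
      destruct (RN y Hy) as [_ L2]. specialize (KR y Hy). assert (Z := Cmod_ge_0 (kk y)).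
      apply Rmult_le_compat; [|lra| |exact I].
      * apply Rplus_le_le_0_compat; [apply Cmod_ge_0|nra].
      * apply Rplus_le_compat; [exact L2|]. apply Rmult_le_compat_l; [lra|exact KR].
Qed.

End Quotient.

(** In terms of transforms the last equation reads
    mellin (phi - phi x0 kerE(./x0)) s = mellin k (s + 1) - x0 mellin k s. *)
Lemma inversion_quotient (phi : R -> C) (x0 : R) : schwartz_pos phi -> (0 < x0)%R ->
  exists k dk : R -> C, (exists K, dom k (-1) 4 K) /\ (exists K, dom (fun y => RtoC y * dk y) (-1) 4 K) /\
   (forall y, (0 < y)%R -> pder k y (dk y)) /\
   (forall y, phi y - phi x0 * RtoC (kerE (/ x0 * y)) = RtoC y * k y - RtoC x0 * k y).
Proof.
  intros H Hx.
  destruct (hadamard (fun x => Re (phi x)) x0) as (q1 & dq1 & E1 & D1 & C1).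
  { intros k x. apply schwartz_posR_ex_derive, H. }
  destruct (hadamard (fun x => Im (phi x)) x0) as (q2 & dq2 & E2 & D2 & C2).
  { intros k x. apply schwartz_posR_ex_derive, H. }
  destruct (quot_dom phi x0 q1 q2 dq1 dq2 H Hx E1 E2 D1 D2 C1 C2) as [K1 K2].
  do 2 eexists. split; [exact K1|split; [exact K2|split]].
  - intros y Hy. now apply kk_pder.
  - intros y. assert (Q := quot_eq phi x0 q1 q2 dq1 dq2 Hx E1 E2 y). cbv beta in Q.
    replace (/ x0 * y)%R with (y / x0)%R by (unfold Rdiv; ring).
    rewrite Q, RtoC_minus. ring.
Qed.

(** ** Integrals over vertical lines *)

Lemma atan_lim : forall e, (0 < e)%R -> Rbar_locally p_infty (fun T => (Rabs (atan T - PI / 2) < e)%R).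
Proof.
  intros e He.
  assert (C0 : continuous atan 0%R) by (eapply is_derive_continuous, is_derive_Reals, derivable_pt_lim_atan).
  assert (N := filterlim_eps _ _ _ C0 e He). apply (proj1 (locally_R _ _)) in N. destruct N as [d [Hd HN]].
  exists (/ d)%R. intros T HT. assert (P : (0 < / d)%R) by now apply Rinv_0_lt_compat.
  assert (Q := atan_inv T ltac:(lra)).
  replace (atan T - PI / 2)%R with (- (atan (/ T) - atan 0))%R by (rewrite Q, atan_0; ring).
  rewrite Rabs_Ropp. apply HN. rewrite Rminus_0_r, Rabs_pos_eq by (left; apply Rinv_0_lt_compat; lra).
  rewrite <- (Rinv_inv d). apply Rinv_lt_contravar; [nra|exact HT].
Qed.

(** The primitive K atan of the majorant gives convergence; besides convergence, the symmetric integrals are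
    needed, because Mellin inversion and the shift of the contour produce these. *)
Lemma line_integral (f : R -> C) (K : R) : (forall t, @ccont R_UniformSpace f t) ->
  (forall t, (Cmod (f t) <= K * / (1 + t ^ 2))%R) ->
  exists l, Cis_gen f (Rbar_locally m_infty) (Rbar_locally p_infty) l /\ (Cmod l <= K * PI)%R /\
    clim (Rbar_locally p_infty) (fun T => CRInt f (- T) T) l.
Proof.
  intros Hc HB.
  assert (Ct : convexR (fun _ => True)) by (intros a b x _ _ _; exact I).
  assert (Lp : filterlim (fun t => K * atan t)%R (Rbar_locally p_infty) (locally (K * (PI / 2))%R)).
  { apply filterlim_scal_R; [typeclasses eauto|]. intros P HP. apply (proj1 (locally_R _ _)) in HP. destruct HP as [e [He HP]].
    destruct (atan_lim e He) as [M HM]. exists M. intros T HT. apply HP. now apply HM. }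
  assert (Lm : filterlim (fun t => K * atan t)%R (Rbar_locally m_infty) (locally (K * - (PI / 2))%R)).
  { apply filterlim_scal_R; [typeclasses eauto|]. intros P HP. apply (proj1 (locally_R _ _)) in HP. destruct HP as [e [He HP]].
    destruct (atan_lim e He) as [M HM]. exists (- M)%R. intros T HT. apply HP.
    specialize (HM (- T)%R ltac:(lra)). rewrite atan_opp in HM.
    replace (atan T - - (PI / 2))%R with (- (- atan T - PI / 2))%R by ring. now rewrite Rabs_Ropp. }
  destruct (Cis_gen_dominated (Fa := Rbar_locally m_infty) (Fb := Rbar_locally p_infty) f (fun t => K * / (1 + t ^ 2))%R (fun t => K * atan t)%R (fun _ => True) (K * - (PI / 2)) (K * (PI / 2))) as [l [L B]]; auto.
  - apply filter_forall; auto.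
  - apply filter_forall; auto.
  - exists (fun x => x < 0)%R (fun x => 0 < x)%R; [exists 0%R; auto|exists 0%R; auto|]. intros a b Ha Hb. simpl. lra.
  - intros t _. apply (is_derive_scal atan). apply is_derive_Reals.
    assert (Q := derivable_pt_lim_atan t). unfold Rsqr in Q. replace (1 + t ^ 2)%R with (1 + t * t)%R in * by ring. exact Q.
  - intros t _. apply (ex_derive_continuous (V := R_NormedModule)). auto_derive.
    assert (Q := pow2_ge_0 t). simpl in Q. lra.
  - exists l. split; [exact L|split; [lra|]].
    apply (Cis_gen_lim _ (fun _ => True)) in L; auto; try (apply filter_forall; auto).
    apply (clim_comp _ _ (fun T => (- T, T)%R) _ _ L). apply filterlim_pair; [|apply filterlim_id].
    intros P [M HM]. exists (- M)%R. intros T HT. apply HM. lra.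
Qed.

(** ** Inversion on the line Re s = 2 *)

(** On the line Re s = 2 the transform of the kernel is a difference of multiples of two
    Cauchy densities, of total mass 4 pi - 2 pi. *)
Lemma kerE_line (t : R) : (2 / ((2, t) - 1) - / (2, t) + (2 / (3 - (2, t)) - / (4 - (2, t)))) = RtoC (4 * / (1 + t ^ 2) - 4 * / (4 + t ^ 2)).
Proof.
  assert (P1 : (0 < 1 + t ^ 2)%R) by (assert (Q := pow2_ge_0 t); lra).
  assert (P4 : (0 < 4 + t ^ 2)%R) by lra.
  replace ((2, t) - 1) with ((1%R, t) : C) by (Cext; ring).
  replace (3 - (2, t)) with ((1, - t)%R : C) by (Cext; ring).
  replace (4 - (2, t)) with ((2, - t)%R : C) by (Cext; ring).
  unfold Cdiv, Cinv. simpl fst. simpl snd. Cext; field; simpl in *; lra.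
Qed.

Lemma kerE_line_integral (T : R) : Cis_RInt (fun t => RtoC (4 * / (1 + t ^ 2) - 4 * / (4 + t ^ 2))) (- T) T (RtoC (8 * atan T - 4 * atan (T / 2))).
Proof.
  apply C_is_RInt_RtoC.
  replace (8 * atan T - 4 * atan (T / 2))%R with ((4 * atan T - 2 * atan (T / 2)) - (4 * atan (- T) - 2 * atan (- T / 2)))%R.
  - apply (is_RInt_derive (V := R_CompleteNormedModule) (fun t => 4 * atan t - 2 * atan (t / 2))%R).
    + intros t _. assert (Q := pow2_ge_0 t). auto_derive; [auto|]. unfold Rsqr. simpl in *. field. simpl in *. lra.
    + intros t _. assert (Q := pow2_ge_0 t). apply (ex_derive_continuous (V := R_NormedModule)). auto_derive. simpl in *. lra.
  - replace (- T / 2)%R with (- (T / 2))%R by field. rewrite !atan_opp. ring.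
Qed.

(** By [inversion_quotient] the integrand is x0 (M (s + 1) - M s) plus the
    contribution of the kernel, where M s = x0^-s mellin k s is holomorphic for
    1 < Re s < 4.  The first part vanishes in the limit by moving the line Re s = 3
    to Re s = 2; the second is elementary and gives 2 pi phi x0. *)
Lemma mellin_inversion (phi : R -> C) (x0 : R) : schwartz_pos phi -> (0 < x0)%R ->
  clim (Rbar_locally p_infty) (fun T => CRInt (fun t => mellin phi (2, t) * cpow x0 (- (2, t))) (- T) T) (2 * RtoC PI * phi x0).
Proof.
  intros Hphi Hx0.
  destruct (inversion_quotient phi x0 Hphi Hx0) as (k & dk & [K1 Dk] & [K2 Ddk] & Pk & Ek).
  assert (K20 := dom_K_pos _ _ _ _ Ddk).
  (* One integration by parts: decay like 1/|s| suffices for the horizontal sides. *)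
  assert (Dec : forall s, (2 <= Re s <= 3)%R -> (Cmod s * Cmod (mellin k s) <= 2 * K2)%R).
  { intros s Hs. rewrite <- (Cmod_opp s), <- Cmod_mult.
    rewrite <- (mellin_by_parts k dk (-1) 4 K1 K2 s Pk Dk Ddk) by lra.
    destruct (mellin_dom _ _ _ _ s Ddk ltac:(lra)) as [_ B].
    assert (I1 : (/ (-1 + Re s) <= 1)%R) by (apply inv_le_1; lra).
    assert (I2 : (/ (4 - Re s) <= 1)%R) by (apply inv_le_1; lra). unfold Rdiv in B. nra. }
  set (M := fun s => cpow x0 (- s) * mellin k s).
  assert (HM : forall T, holo_rect M 2 3 (- T) T).
  { intros T x y Hx Hy. apply holo_mult.
    - apply holo_cpow, holo_opp, holo_id.
    - eapply mellin_holo; [exact Dk|simpl; lra]. }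
  set (W := Rmax (Rpower x0 (- (2))) (Rpower x0 (- (3)))).
  assert (HW : forall s, (2 <= Re s <= 3)%R -> (Cmod (cpow x0 (- s)) <= W)%R).
  { intros s Hs. rewrite Cmod_cpow. replace (Re (- s)) with (- Re s)%R by (destruct s; reflexivity).
    destruct (Rle_lt_dec x0 1).
    - eapply Rle_trans; [apply Rpower_mono_le1 with (a := (- (3))%R); lra|apply Rmax_r].
    - eapply Rle_trans; [apply Rpower_mono_ge1 with (b := (- (2))%R); lra|apply Rmax_l]. }
  assert (W0 : (0 <= W)%R) by (eapply Rle_trans; [left; apply Rpower_pos|apply Rmax_l]).
  assert (BM : forall T s, (0 < T)%R -> (2 <= Re s <= 3)%R -> Rabs (Im s) = T -> (Cmod (M s) <= W * (2 * K2) * / T)%R).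
  { intros T s HT Hs Him. unfold M. rewrite Cmod_mult. rewrite Rmult_assoc.
    apply Rmult_le_compat; try apply Cmod_ge_0; [now apply HW|].
    assert (Q := Dec s Hs). assert (Q2 := Cmod_snd s). change (snd s) with (Im s) in Q2. rewrite Him in Q2.
    apply Rmult_le_reg_l with T; [auto|]. replace (T * (2 * K2 * / T))%R with (2 * K2)%R by (field; lra).
    assert (Z := Cmod_ge_0 (mellin k s)). nra. }
  assert (Pt : forall t, mellin phi (2, t) * cpow x0 (- (2, t)) = RtoC x0 * (M (3, t) - M (2, t)) + phi x0 * RtoC (4 * / (1 + t ^ 2) - 4 * / (4 + t ^ 2))).
  { intros t. set (s := (2, t) : C).
    assert (I1 : is_mellin (fun y => RtoC y * k y) s (mellin k (s + 1))).
    { apply is_mellin_times_x. eapply mellin_correct; [exact Dk|simpl; lra]. }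
    assert (I2 : is_mellin k s (mellin k s)) by (eapply mellin_correct; [exact Dk|simpl; lra]).
    assert (I3 := is_mellin_minus _ _ _ _ _ I1 (is_mellin_scal _ (RtoC x0) _ _ I2)).
    assert (Hs : (1 < Re s < 3)%R) by (simpl; lra).
    assert (I4 := mellin_scale _ (/ x0) s _ (Rinv_0_lt_compat _ Hx0) (fun x Hx => pder_cont _ _ _ (pder_RtoC kerE x _ (kerE_derive x Hx))) (kerE_mellin s Hs)).
    unfold s in I4 at 3 4 5 6. rewrite kerE_line in I4.
    assert (I5 := is_mellin_minus _ _ _ _ _ (schwartz_pos_mellin phi s Hphi) (is_mellin_scal _ (phi x0) _ _ I4)).
    eapply is_mellin_ext in I5; [|intros x Hx; cbv beta; apply Ek].
    assert (E := eq_trans (eq_sym (is_mellin_unique _ _ _ I3)) (is_mellin_unique _ _ _ I5)).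
    assert (Ei : cpow (/ x0) (- s) = cpow x0 s).
    { unfold cpow. rewrite ln_Rinv by auto. rewrite RtoC_opp. f_equal. ring. }
    rewrite Ei in E.
    assert (E3 : (3, t) = s + 1) by (unfold s; Cext; ring).
    unfold M. rewrite E3.
    assert (Z : cpow x0 (- s) * cpow x0 s = 1).
    { rewrite <- cpow_plus. replace (- s + s) with (RtoC 0) by ring. apply cpow_0. }
    assert (Z1 : RtoC x0 * cpow x0 (- (s + 1)) = cpow x0 (- s)).
    { rewrite <- (cpow_1 x0) at 1 by auto. rewrite <- cpow_plus. f_equal. ring. }
    set (V := RtoC (4 * / (1 + t ^ 2) - 4 * / (4 + t ^ 2))) in *.
    replace (mellin phi s) with (mellin k (s + 1) - RtoC x0 * mellin k s + phi x0 * (cpow x0 s * V)) by (rewrite E; ring).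
    replace (RtoC x0 * (cpow x0 (- (s + 1)) * mellin k (s + 1) - cpow x0 (- s) * mellin k s)) with
      ((RtoC x0 * cpow x0 (- (s + 1))) * mellin k (s + 1) - RtoC x0 * cpow x0 (- s) * mellin k s) by ring.
    rewrite Z1.
    replace ((mellin k (s + 1) - RtoC x0 * mellin k s + phi x0 * (cpow x0 s * V)) * cpow x0 (- s)) with
      (cpow x0 (- s) * mellin k (s + 1) - RtoC x0 * cpow x0 (- s) * mellin k s + phi x0 * V * (cpow x0 (- s) * cpow x0 s)) by ring.
    rewrite Z. ring. }
  assert (Val : forall T, (0 < T)%R -> exists d, (Cmod d <= 2 * (W * (2 * K2) * / T))%R /\
     CRInt (fun t => mellin phi (2, t) * cpow x0 (- (2, t))) (- T) T = RtoC x0 * (- Ci * d) + phi x0 * RtoC (8 * atan T - 4 * atan (T / 2))).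
  { intros T HT.
    assert (G := goursat M 2 3 (- T) T ltac:(lra) ltac:(lra) (HM T)).
    destruct (rint_sides M 2 3 (- T) T ltac:(lra) ltac:(lra) (holo_rect_bcont _ _ _ _ _ (HM T))) as (b1 & r & t1 & l & H1 & H2 & H3 & H4 & E).
    rewrite G in E.
    exists (t1 - b1). split.
    - apply C_RInt_norm_const with (M := (W * (2 * K2) * / T)%R) in H1; [|lra|].
      2:{ intros x Hx. apply BM; simpl; auto. rewrite Rabs_Ropp, Rabs_pos_eq; lra. }
      apply C_RInt_norm_const with (M := (W * (2 * K2) * / T)%R) in H3; [|lra|].
      2:{ intros x Hx. apply BM; simpl; auto. rewrite Rabs_pos_eq; lra. }
      eapply Rle_trans; [apply Cmod_triangle|]. rewrite Cmod_opp. lra.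
    - apply C_RInt_unique.
      replace (- Ci * (t1 - b1)) with (r - l).
      2:{ assert (CC : Ci * Ci = - (1)) by (Cext; ring).
          replace (t1 - b1) with (Ci * r - Ci * l - (b1 + Ci * r - t1 - Ci * l)) by ring. rewrite <- E.
          replace (- Ci * (Ci * r - Ci * l - 0)) with (- (Ci * Ci) * (r - l)) by ring. rewrite CC. ring. }
      eapply C_is_RInt_ext; [|apply C_is_RInt_plus; [apply C_is_RInt_scal, (C_is_RInt_minus _ _ _ _ _ _ H2 H4)|apply C_is_RInt_scal, kerE_line_integral]].
      intros t _. cbv beta. symmetry. apply Pt. }
  assert (L : clim (Rbar_locally p_infty) (fun T => phi x0 * RtoC (8 * atan T - 4 * atan (T / 2))) (phi x0 * RtoC (2 * PI))).
  { capply clim_mult; [capply clim_const|]. intros e He.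
    assert (He' : (0 < e / 16)%R) by lra.
    destruct (atan_lim _ He') as [M1 HM1]. exists (Rmax M1 (2 * M1)). intros T HT.
    assert (Q1 := Rmax_l M1 (2 * M1)). assert (Q2 := Rmax_r M1 (2 * M1)).
    assert (A1 := HM1 T ltac:(lra)). assert (A2 := HM1 (T / 2)%R ltac:(lra)).
    rewrite <- RtoC_minus, Cmod_R. apply Rabs_def2 in A1. apply Rabs_def2 in A2. apply Rabs_def1; lra. }
  replace (2 * RtoC PI * phi x0) with (phi x0 * RtoC (2 * PI)) by (rewrite RtoC_mult; ring).
  set (Q := (x0 * (2 * (W * (2 * K2))))%R).
  assert (HQ : (0 <= Q)%R) by (unfold Q; repeat apply Rmult_le_pos; lra).
  intros e He.
  assert (He2 : (0 < e / 2)%R) by lra.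
  destruct (L _ He2) as [M1 HM1].
  exists (Rmax M1 ((Q + 1) / (e / 2))). intros T HT.
  assert (R1 := Rmax_l M1 ((Q + 1) / (e / 2))). assert (R2 := Rmax_r M1 ((Q + 1) / (e / 2))).
  assert (R3 : (0 < (Q + 1) / (e / 2))%R) by (apply Rdiv_lt_0_compat; lra).
  assert (HT0 : (0 < T)%R) by lra.
  destruct (Val T HT0) as [d [Bd ->]].
  specialize (HM1 T ltac:(lra)). cbv beta in HM1.
  match goal with |- (Cmod (?a + ?b - ?c) < _)%R => replace (a + b - c) with (a + (b - c)) by ring end.
  eapply Rle_lt_trans; [apply Cmod_triangle|].
  assert (S1 : (Cmod (RtoC x0 * (- Ci * d)) < e / 2)%R).
  { rewrite !Cmod_mult, Cmod_opp, Cmod_Ci, Cmod_R, Rabs_pos_eq by lra.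
    apply Rle_lt_trans with (Q * / T)%R.
    - unfold Q. rewrite Rmult_1_l. replace (x0 * (2 * (W * (2 * K2))) * / T)%R with (x0 * (2 * (W * (2 * K2) * / T)))%R by ring.
      apply Rmult_le_compat_l; lra.
    - apply Rmult_lt_reg_r with T; [auto|]. rewrite Rmult_assoc, Rinv_l, Rmult_1_r by lra.
      assert (Q + 1 < e / 2 * T)%R; [|lra].
      apply Rmult_lt_reg_r with (/ (e / 2))%R; [now apply Rinv_0_lt_compat|].
      replace (e / 2 * T * / (e / 2))%R with T by (field; lra). unfold Rdiv in *. lra. }
  lra.
Qed.

(** * The Dirichlet series of the divisor function *)

(** ** Finite sums over triples *)

Fixpoint lsum {A : Type} (l : list A) (F : A -> C) : C :=
  match l with nil => 0 | cons x l => F x + lsum l F end.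

Lemma lsum_app {A} (l m : list A) (F : A -> C) : lsum (l ++ m) F = lsum l F + lsum m F.
Proof. induction l as [|x l IH]; simpl; [ring|rewrite IH; ring]. Qed.

Lemma lsum_map {A B} (l : list A) (h : A -> B) (F : B -> C) : lsum (map h l) F = lsum l (fun x => F (h x)).
Proof. induction l as [|x l IH]; simpl; [reflexivity|now rewrite IH]. Qed.

Lemma lsum_prod {A B} (l : list A) (m : list B) (F : A * B -> C) :
  lsum (list_prod l m) F = lsum l (fun x => lsum m (fun y => F (x, y))).
Proof. induction l as [|x l IH]; simpl; [reflexivity|]. now rewrite lsum_app, lsum_map, IH. Qed.

Lemma lsum_seq (N : nat) (F : nat -> C) : lsum (seq 1 N) F = Cpsum F N.
Proof.
  induction N as [|N IH]; [reflexivity|]. rewrite seq_S, lsum_app, IH. simpl. ring.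
Qed.

Lemma lsum_count {A} (l : list A) (p : A -> bool) :
  RtoC (INR (length (filter p l))) = lsum l (fun x => if p x then 1 else 0).
Proof.
  induction l as [|x l IH]; [reflexivity|]. simpl filter. simpl lsum. destruct (p x).
  - simpl length. rewrite S_INR, RtoC_plus, IH. ring.
  - rewrite IH. ring.
Qed.

Lemma Cpsum_ext (a b : nat -> C) (N : nat) : (forall n, (1 <= n <= N)%nat -> a n = b n) -> Cpsum a N = Cpsum b N.
Proof.
  induction N as [|N IH]; intros E; simpl; [reflexivity|].
  rewrite IH, (E (Datatypes.S N)); [reflexivity|lia|intros; apply E; lia].
Qed.

Lemma Cpsum_0 (N : nat) : Cpsum (fun _ => 0) N = 0.
Proof. induction N as [|N IH]; simpl; [reflexivity|rewrite IH; ring]. Qed.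

Lemma Cpsum_scal (c : C) (a : nat -> C) (N : nat) : Cpsum (fun n => c * a n) N = c * Cpsum a N.
Proof. induction N as [|N IH]; simpl; [ring|rewrite IH; ring]. Qed.

Lemma Cpsum_plus (a b : nat -> C) (N : nat) : Cpsum (fun n => a n + b n) N = Cpsum a N + Cpsum b N.
Proof. induction N as [|N IH]; simpl; [ring|rewrite IH; ring]. Qed.

Lemma Cpsum_swap (F : nat -> nat -> C) (M N : nat) :
  Cpsum (fun m => Cpsum (F m) N) M = Cpsum (fun n => Cpsum (fun m => F m n) M) N.
Proof.
  induction M as [|M IH]; simpl; [now rewrite Cpsum_0|]. now rewrite IH, <- Cpsum_plus.
Qed.

Lemma Cpsum_cut (a : nat -> C) (k N : nat) : (k <= N)%nat -> (forall n, (k < n <= N)%nat -> a n = 0) -> Cpsum a N = Cpsum a k.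
Proof.
  induction 1 as [|N L IH]; intros Z; [reflexivity|]. simpl. rewrite IH, (Z (Datatypes.S N)); [ring|lia|intros; apply Z; lia].
Qed.

Lemma Cpsum_indicator (z : C) (n M : nat) : (1 <= n)%nat ->
  Cpsum (fun m => if Nat.eqb n m then z else 0) M = if Nat.leb n M then z else 0.
Proof.
  intros Hn. induction M as [|M IH]; [destruct n; [lia|reflexivity]|].
  cbn [Cpsum]. rewrite IH. destruct (Nat.eqb_spec n (Datatypes.S M)), (Nat.leb_spec n M), (Nat.leb_spec n (Datatypes.S M)); try lia; ring.
Qed.

Lemma Cpsum_bound (a : nat -> C) (b : nat -> R) (N : nat) : (forall n, (1 <= n <= N)%nat -> (Cmod (a n) <= b n)%R) -> (Cmod (Cpsum a N) <= psum b N)%R.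
Proof.
  induction N as [|N IH]; intros B; simpl; [rewrite Cmod_0; lra|].
  eapply Rle_trans; [apply Cmod_triangle|]. apply Rplus_le_compat; [apply IH; intros; apply B; lia|apply B; lia].
Qed.

Lemma psum_le (a b : nat -> R) (N : nat) : (forall n, (1 <= n <= N)%nat -> (a n <= b n)%R) -> (psum a N <= psum b N)%R.
Proof.
  induction N as [|N IH]; intros B; simpl; [lra|]. apply Rplus_le_compat; [apply IH; intros; apply B; lia|apply B; lia].
Qed.

Lemma psum_plus (a b : nat -> R) (N : nat) : psum (fun n => a n + b n)%R N = (psum a N + psum b N)%R.
Proof. induction N as [|N IH]; simpl; [ring|rewrite IH; ring]. Qed.

Lemma psum_scal (c : R) (a : nat -> R) (N : nat) : psum (fun n => c * a n)%R N = (c * psum a N)%R.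
Proof. induction N as [|N IH]; simpl; [ring|rewrite IH; ring]. Qed.

Lemma psum_cut_le (a : nat -> R) (k N : nat) : (k <= N)%nat -> (forall n, (1 <= n)%nat -> (0 <= a n)%R) ->
  (psum a k <= psum (fun n => if Nat.leb n k then a n else 0%R) N)%R.
Proof.
  intros L P. induction L as [|N L IH].
  - apply psum_le. intros n Hn. destruct (Nat.leb_spec n k); [lra|lia].
  - cbn [psum]. destruct (Nat.leb_spec (Datatypes.S N) k); [lia|lra].
Qed.

Definition Csum3 (N : nat) (F : nat -> nat -> nat -> C) : C :=
  Cpsum (fun a => Cpsum (fun b => Cpsum (F a b) N) N) N.

Definition psum3 (N : nat) (F : nat -> nat -> nat -> R) : R :=
  psum (fun a => psum (fun b => psum (F a b) N) N) N.

Lemma Csum3_ext (N : nat) (F G : nat -> nat -> nat -> C) :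
  (forall a b c, (1 <= a <= N)%nat -> (1 <= b <= N)%nat -> (1 <= c <= N)%nat -> F a b c = G a b c) -> Csum3 N F = Csum3 N G.
Proof. intros E. unfold Csum3. apply Cpsum_ext; intros a Ha. apply Cpsum_ext; intros b Hb. apply Cpsum_ext; intros c Hc. auto. Qed.

Lemma Csum3_scal (N : nat) (z : C) (F : nat -> nat -> nat -> C) : Csum3 N (fun a b c => z * F a b c) = z * Csum3 N F.
Proof.
  unfold Csum3. rewrite <- Cpsum_scal. apply Cpsum_ext; intros a _. rewrite <- Cpsum_scal. apply Cpsum_ext; intros b _.
  now rewrite <- Cpsum_scal.
Qed.

Lemma Csum3_plus (N : nat) (F G : nat -> nat -> nat -> C) : Csum3 N (fun a b c => F a b c + G a b c) = Csum3 N F + Csum3 N G.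
Proof.
  unfold Csum3. rewrite <- Cpsum_plus. apply Cpsum_ext; intros a _. rewrite <- Cpsum_plus. apply Cpsum_ext; intros b _.
  now rewrite <- Cpsum_plus.
Qed.

Lemma Csum3_prod (N : nat) (u : nat -> C) : Csum3 N (fun a b c => u a * u b * u c) = Cpsum u N ^ 3.
Proof.
  unfold Csum3. transitivity (Cpsum (fun a => (Cpsum u N * Cpsum u N) * u a) N).
  - apply Cpsum_ext; intros a _. transitivity (Cpsum (fun b => (u a * Cpsum u N) * u b) N).
    + apply Cpsum_ext; intros b _. rewrite Cpsum_scal. ring.
    + rewrite Cpsum_scal. ring.
  - rewrite Cpsum_scal. ring.
Qed.

Lemma psum3_prod (N : nat) (u : nat -> R) : psum3 N (fun a b c => u a * u b * u c)%R = (psum u N ^ 3)%R.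
Proof.
  assert (E : forall (a b : nat -> R) M, (forall n, a n = b n) -> psum a M = psum b M).
  { intros a b M H. induction M as [|M IH]; simpl; [reflexivity|now rewrite IH, H]. }
  unfold psum3. transitivity (psum (fun a => (psum u N * psum u N) * u a) N)%R.
  - apply E; intros a. transitivity (psum (fun b => (u a * psum u N) * u b) N)%R.
    + apply E; intros b. rewrite psum_scal. ring.
    + rewrite psum_scal. ring.
  - rewrite psum_scal. ring.
Qed.

Lemma Csum3_swap (M N : nat) (F : nat -> nat -> nat -> nat -> C) :
  Cpsum (fun m => Csum3 N (F m)) M = Csum3 N (fun a b c => Cpsum (fun m => F m a b c) M).
Proof.
  unfold Csum3. rewrite Cpsum_swap. apply Cpsum_ext; intros a _. rewrite Cpsum_swap. apply Cpsum_ext; intros b _.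
  now rewrite Cpsum_swap.
Qed.

(** Each triple with product m is counted once. *)
Lemma tau3_Csum3 (m : nat) : RtoC (INR (tau3 m)) = Csum3 m (fun a b c => if Nat.eqb (a * b * c) m then 1 else 0).
Proof.
  unfold tau3. rewrite lsum_count, !lsum_prod, lsum_seq. unfold Csum3. apply Cpsum_ext; intros a _.
  rewrite lsum_seq. apply Cpsum_ext; intros b _. now rewrite lsum_seq.
Qed.

(** For m <= N all factors of m lie in [1, N]; one cube serves for all m <= N. *)
Lemma tau3_cube (m N : nat) : (1 <= m <= N)%nat -> RtoC (INR (tau3 m)) = Csum3 N (fun a b c => if Nat.eqb (a * b * c) m then 1 else 0).
Proof.
  intros H. rewrite tau3_Csum3. unfold Csum3. symmetry.
  transitivity (Cpsum (fun a => Cpsum (fun b => Cpsum (fun c => if Nat.eqb (a * b * c) m then 1 else 0) m) m) N).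
  - apply Cpsum_ext; intros a Ha.
    transitivity (Cpsum (fun b => Cpsum (fun c => if Nat.eqb (a * b * c) m then 1 else 0) m) N).
    + apply Cpsum_ext; intros b Hb. apply Cpsum_cut; [lia|]. intros c Hc. destruct (Nat.eqb_spec (a * b * c) m); [|reflexivity].
      assert (1 <= a * b)%nat by nia. nia.
    + apply Cpsum_cut; [lia|]. intros b Hb. etransitivity; [|apply (Cpsum_0 m)]. apply Cpsum_ext; intros c Hc.
      destruct (Nat.eqb_spec (a * b * c) m); [|reflexivity]. assert (b <= a * b)%nat by nia. nia.
  - apply Cpsum_cut; [lia|]. intros a Ha. etransitivity; [|apply (Cpsum_0 m)]. apply Cpsum_ext; intros b Hb. etransitivity; [|apply (Cpsum_0 m)]. apply Cpsum_ext; intros c Hc.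
    destruct (Nat.eqb_spec (a * b * c) m); [|reflexivity]. assert (a <= a * b)%nat by nia. nia.
Qed.

Lemma tau3_partial_sum (g : nat -> C) (M : nat) :
  Cpsum (fun m => RtoC (INR (tau3 m)) * g m) M = Csum3 M (fun a b c => if Nat.leb (a * b * c) M then g (a * b * c)%nat else 0).
Proof.
  transitivity (Cpsum (fun m => Csum3 M (fun a b c => if Nat.eqb (a * b * c) m then g (a * b * c)%nat else 0)) M).
  - apply Cpsum_ext; intros m Hm. rewrite (tau3_cube m M) by lia. rewrite Cmult_comm, <- Csum3_scal. apply Csum3_ext; intros a b c _ _ _.
    destruct (Nat.eqb_spec (a * b * c) m) as [E|E]; [rewrite E|]; ring.
  - rewrite Csum3_swap. apply Csum3_ext; intros a b c Ha Hb Hc. apply Cpsum_indicator. nia.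
Qed.

Definition inv_sq (n : nat) : R := (/ INR n ^ 2)%R.

Lemma inv_sq_pos (n : nat) : (1 <= n)%nat -> (0 < inv_sq n)%R.
Proof. intros H. apply Rinv_0_lt_compat, pow_lt. now apply lt_0_INR. Qed.

Lemma inv_sq_mult (a b : nat) : (1 <= a)%nat -> (1 <= b)%nat -> inv_sq (a * b) = (inv_sq a * inv_sq b)%R.
Proof. intros Ha Hb. unfold inv_sq. rewrite mult_INR. field. split; apply not_0_INR; lia. Qed.

Lemma inv_sq_tail (k M : nat) : (1 <= k <= M)%nat -> (psum inv_sq M - psum inv_sq k <= / INR k - / INR M)%R.
Proof.
  intros [Hk L]. induction L as [|M L IH]; [lra|]. cbn [psum].
  assert (P : (1 <= INR M)%R) by (apply (le_INR 1); lia).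
  assert (E : (inv_sq (Datatypes.S M) <= / INR M - / INR (Datatypes.S M))%R); [|lra].
  unfold inv_sq. rewrite S_INR. replace (/ INR M - / (INR M + 1))%R with (/ (INR M * (INR M + 1)))%R by (field; lra).
  apply Rinv_le_contravar; nra.
Qed.

Lemma inv_sq_mono (k M : nat) : (k <= M)%nat -> (psum inv_sq k <= psum inv_sq M)%R.
Proof. induction 1 as [|M L IH]; [lra|]. cbn [psum]. assert (Q := inv_sq_pos (Datatypes.S M) ltac:(lia)). lra. Qed.

Lemma inv_sq_bound (M : nat) : (0 <= psum inv_sq M <= 2)%R.
Proof.
  split; [apply (inv_sq_mono 0); lia|]. destruct M as [|M]; [simpl; lra|].
  assert (Q := inv_sq_tail 1 (Datatypes.S M) ltac:(lia)).
  assert (0 < / INR (Datatypes.S M))%R by (apply Rinv_0_lt_compat, INR_S_pos).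
  assert (E : psum inv_sq 1 = 1%R) by (unfold inv_sq; simpl; field). rewrite E in Q. change (INR 1) with 1%R in Q. lra.
Qed.

(** A product [abc > M >= k^3] has a factor above [k], so the products outside the hyperbolic
    region only contribute a tail. *)
Lemma cube_excess (k M : nat) : (1 <= k)%nat -> (k ^ 3 <= M)%nat ->
  (psum3 M (fun a b c => if Nat.leb (a * b * c) M then 0 else inv_sq a * inv_sq b * inv_sq c) <= 12 * / INR k)%R.
Proof.
  intros Hk HM. assert (KM : (k <= M)%nat) by (simpl in HM; nia).
  set (h3 := fun a b c => (inv_sq a * inv_sq b * inv_sq c)%R).
  set (h3k := fun a b c => if Nat.leb a k then if Nat.leb b k then if Nat.leb c k then h3 a b c else 0%R else 0%R else 0%R).
  assert (P3 : forall a b c, (1 <= a)%nat -> (1 <= b)%nat -> (1 <= c)%nat -> (0 <= h3 a b c)%R).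
  { intros. unfold h3. repeat apply Rmult_le_pos; left; now apply inv_sq_pos. }
  assert (Ps : forall (u : nat -> R) N, (forall n, (1 <= n)%nat -> 0 <= u n)%R -> (0 <= psum u N)%R).
  { intros u N Hu. induction N as [|N IH]; simpl; [lra|]. specialize (Hu (Datatypes.S N) ltac:(lia)). lra. }
  assert (L1 : (psum3 k h3 <= psum3 M h3k)%R).
  { unfold psum3. eapply Rle_trans; [apply (psum_cut_le _ k M KM)|].
    - intros a Ha. apply Ps; intros b Hb. apply Ps; auto.
    - apply psum_le. intros a Ha. unfold h3k. destruct (Nat.leb_spec a k).
      + eapply Rle_trans; [apply (psum_cut_le _ k M KM)|].
        * intros b Hb. apply Ps; intros c Hc. apply P3; lia.
        * apply psum_le. intros b Hb. destruct (Nat.leb_spec b k).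
          -- eapply Rle_trans; [apply (psum_cut_le _ k M KM)|lra]. intros c Hc. apply P3; lia.
          -- apply Ps; intros; lra.
      + apply Ps; intros; apply Ps; intros; lra. }
  assert (L2 : (psum3 M (fun a b c => if Nat.leb (a * b * c) M then 0 else h3 a b c) + psum3 M h3k <= psum3 M h3)%R).
  { unfold psum3. rewrite <- psum_plus. apply psum_le; intros a Ha. rewrite <- psum_plus. apply psum_le; intros b Hb.
    rewrite <- psum_plus. apply psum_le; intros c Hc. assert (Q := P3 a b c ltac:(lia) ltac:(lia) ltac:(lia)). unfold h3k.
    destruct (Nat.leb_spec (a * b * c) M), (Nat.leb_spec a k), (Nat.leb_spec b k), (Nat.leb_spec c k); try lra.
    exfalso. assert (a * b <= k * k)%nat by (apply Nat.mul_le_mono; lia).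
    assert (a * b * c <= k * k * k)%nat by (apply Nat.mul_le_mono; lia). simpl in HM. lia. }
  unfold h3 in L1, L2 at 2. rewrite psum3_prod in L1. rewrite psum3_prod in L2.
  change (psum3 M (fun a b c => if Nat.leb (a * b * c) M then 0 else h3 a b c) <= 12 * / INR k)%R.
  assert (T := inv_sq_tail k M ltac:(lia)). assert (D := inv_sq_mono k M KM).
  assert (B1 := inv_sq_bound k). assert (B2 := inv_sq_bound M).
  assert (0 < / INR M)%R by (apply Rinv_0_lt_compat, lt_0_INR; lia).
  set (x := psum inv_sq M) in *. set (y := psum inv_sq k) in *.
  assert (x ^ 3 - y ^ 3 <= 12 * (x - y))%R.
  { replace (x ^ 3 - y ^ 3)%R with ((x - y) * (x * x + x * y + y * y))%R by ring.
    assert (x * x <= 2 * 2)%R by (apply Rmult_le_compat; lra). assert (x * y <= 2 * 2)%R by (apply Rmult_le_compat; lra).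
    assert (y * y <= 2 * 2)%R by (apply Rmult_le_compat; lra). rewrite (Rmult_comm 12). apply Rmult_le_compat_l; lra. }
  lra.
Qed.

(** The majorant does not depend on the twist in [g], which gives uniformity on the
    vertical line. *)
Lemma tau3_cube_approx (g : nat -> C) (k M : nat) : (forall n, (1 <= n)%nat -> (Cmod (g n) <= inv_sq n)%R) ->
  (1 <= k)%nat -> (k ^ 3 <= M)%nat ->
  (Cmod (Cpsum (fun m => RtoC (INR (tau3 m)) * g m)%C M - Csum3 M (fun a b c => g (a * b * c)%nat)) <= 12 * / INR k)%R.
Proof.
  intros Hg Hk HM. rewrite tau3_partial_sum.
  replace (Csum3 M (fun a b c => if Nat.leb (a * b * c) M then g (a * b * c)%nat else 0) - Csum3 M (fun a b c => g (a * b * c)%nat))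
    with (Csum3 M (fun a b c => if Nat.leb (a * b * c) M then 0 else - (1) * g (a * b * c)%nat)).
  - eapply Rle_trans; [|apply (cube_excess k M Hk HM)]. unfold Csum3, psum3.
    apply Cpsum_bound; intros a Ha. apply Cpsum_bound; intros b Hb. apply Cpsum_bound; intros c Hc.
    destruct (Nat.leb (a * b * c) M); [rewrite Cmod_0; lra|].
    assert (1 <= a * b)%nat by nia.
    rewrite Cmod_mult, Cmod_opp, Cmod_1, Rmult_1_l, <- !inv_sq_mult by lia. apply Hg. nia.
  - unfold Cminus. replace (- Csum3 M (fun a b c => g (a * b * c)%nat)) with (- (1) * Csum3 M (fun a b c => g (a * b * c)%nat)) by ring.
    rewrite <- Csum3_scal, <- Csum3_plus. apply Csum3_ext; intros a b c _ _ _. destruct (Nat.leb (a * b * c) M); ring.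
Qed.

(** ** Uniform convergence on the line Re s = 2 *)

(** Uniformity in Im s is what allows sums and integrals to be interchanged. *)
Definition uconv (f : nat -> C -> C) (l : C -> C) : Prop :=
  forall e, (0 < e)%R -> exists N, forall M, (N <= M)%nat -> forall s, Re s = 2%R -> (Cmod (f M s - l s) <= e)%R.

Lemma uconv_const (l : C -> C) : uconv (fun _ => l) l.
Proof. intros e He. exists 0%nat. intros M _ s _. replace (l s - l s) with (RtoC 0) by ring. rewrite Cmod_0. lra. Qed.

Lemma uconv_minus (f g : nat -> C -> C) (l m : C -> C) : uconv f l -> uconv g m -> uconv (fun M s => f M s - g M s) (fun s => l s - m s).
Proof.
  intros Hf Hg e He. destruct (Hf (e / 2)%R ltac:(lra)) as [N1 H1]. destruct (Hg (e / 2)%R ltac:(lra)) as [N2 H2].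
  exists (Nat.max N1 N2). intros M HM s Hs. specialize (H1 M ltac:(lia) s Hs). specialize (H2 M ltac:(lia) s Hs).
  replace (f M s - g M s - (l s - m s)) with ((f M s - l s) - (g M s - m s)) by ring.
  eapply Rle_trans; [apply Cmod_triangle|]. rewrite Cmod_opp. lra.
Qed.

Lemma uconv_mult (f g : nat -> C -> C) (l m : C -> C) (A B : R) :
  (forall M s, Re s = 2%R -> (Cmod (f M s) <= A)%R) -> (forall s, Re s = 2%R -> (Cmod (m s) <= B)%R) ->
  uconv f l -> uconv g m -> uconv (fun M s => f M s * g M s) (fun s => l s * m s).
Proof.
  intros HA HB Hf Hg e He.
  assert (A0 : (0 <= A)%R) by (eapply Rle_trans; [apply Cmod_ge_0|apply (HA 0%nat (RtoC 2)); reflexivity]).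
  assert (B0 : (0 <= B)%R) by (eapply Rle_trans; [apply Cmod_ge_0|apply (HB (RtoC 2)); reflexivity]).
  set (d := (e / (A + B + 1))%R). assert (D : (0 < d)%R) by (apply Rdiv_lt_0_compat; lra).
  destruct (Hf d D) as [N1 H1]. destruct (Hg d D) as [N2 H2].
  exists (Nat.max N1 N2). intros M HM s Hs. specialize (H1 M ltac:(lia) s Hs). specialize (H2 M ltac:(lia) s Hs).
  replace (f M s * g M s - l s * m s) with (f M s * (g M s - m s) + (f M s - l s) * m s) by ring.
  eapply Rle_trans; [apply Cmod_triangle|]. rewrite !Cmod_mult.
  assert (Cmod (f M s) * Cmod (g M s - m s) <= A * d)%R by (apply Rmult_le_compat; auto using Cmod_ge_0).
  assert (Cmod (f M s - l s) * Cmod (m s) <= d * B)%R by (apply Rmult_le_compat; auto using Cmod_ge_0).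
  assert (E : (e = (A + B + 1) * d)%R) by (unfold d; field; lra). nra.
Qed.

Lemma uconv_ext (f g : nat -> C -> C) (l m : C -> C) :
  (forall M s, Re s = 2%R -> f M s = g M s) -> (forall s, Re s = 2%R -> l s = m s) -> uconv f l -> uconv g m.
Proof.
  intros E1 E2 H e He. destruct (H e He) as [N HN]. exists N. intros M HM s Hs. rewrite <- E1, <- E2 by auto. now apply HN.
Qed.

Lemma inv_INR_small (e : R) : (0 < e)%R -> exists k, (1 <= k)%nat /\ (/ INR k <= e)%R.
Proof.
  intros He. assert (P : (0 < / e)%R) by now apply Rinv_0_lt_compat.
  destruct (INR_unbounded (/ e)) as [k Hk]. exists k. split.
  - destruct k; [simpl in Hk; lra|lia].
  - rewrite <- (Rinv_inv e). apply Rinv_le_contravar; lra.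
Qed.

Lemma Cmod_cpow_line (n : nat) (s : C) : (1 <= n)%nat -> Re s = 2%R -> Cmod (cpow (INR n) (- s)) = inv_sq n.
Proof.
  intros Hn Hs. rewrite Cmod_cpow. replace (Re (- s)) with (- (2))%R by (destruct s; simpl in *; lra).
  rewrite Rpower_Ropp. unfold inv_sq. f_equal. change 2%R with (INR 2). apply Rpower_pow. now apply lt_0_INR.
Qed.

Definition zsum (M : nat) (s : C) : C := Cpsum (fun n => cpow (INR n) (- s)) M.

Lemma zsum_bound (M : nat) (s : C) : Re s = 2%R -> (Cmod (zsum M s) <= 2)%R.
Proof.
  intros Hs. eapply Rle_trans; [|apply (inv_sq_bound M)]. apply Cpsum_bound. intros n Hn. rewrite Cmod_cpow_line by (auto; lia). lra.
Qed.

Lemma zsum_diff (k M : nat) (s : C) : (k <= M)%nat -> Re s = 2%R -> (Cmod (zsum M s - zsum k s) <= psum inv_sq M - psum inv_sq k)%R.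
Proof.
  intros L Hs. induction L as [|M L IH].
  - replace (zsum k s - zsum k s) with (RtoC 0) by ring. rewrite Cmod_0. lra.
  - change (zsum (Datatypes.S M) s) with (zsum M s + cpow (INR (Datatypes.S M)) (- s)). cbn [psum].
    replace (zsum M s + cpow (INR (Datatypes.S M)) (- s) - zsum k s) with ((zsum M s - zsum k s) + cpow (INR (Datatypes.S M)) (- s)) by ring.
    eapply Rle_trans; [apply Cmod_triangle|]. rewrite Cmod_cpow_line by (auto; lia). lra.
Qed.

Lemma zsum_tail (k : nat) (s : C) : (1 <= k)%nat -> Re s = 2%R -> (Cmod (zsum k s - EM s) <= / INR k)%R.
Proof.
  intros Hk Hs. assert (L := EM_series s ltac:(lra)).
  apply Rnot_lt_le. intros Lt. set (e := (Cmod (zsum k s - EM s) - / INR k)%R).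
  destruct (L e ltac:(unfold e; lra)) as [N HN]. specialize (HN (Nat.max N k) ltac:(lia)).
  fold (zsum (Nat.max N k) s) in HN.
  assert (D := zsum_diff k (Nat.max N k) s ltac:(lia) Hs). assert (T := inv_sq_tail k (Nat.max N k) ltac:(lia)).
  assert (0 < / INR (Nat.max N k))%R by (apply Rinv_0_lt_compat, lt_0_INR; lia).
  assert (Q : (Cmod (zsum k s - EM s) <= Cmod (zsum (Nat.max N k) s - EM s) + Cmod (zsum (Nat.max N k) s - zsum k s))%R).
  { replace (zsum k s - EM s) with ((zsum (Nat.max N k) s - EM s) - (zsum (Nat.max N k) s - zsum k s)) by ring.
    eapply Rle_trans; [apply Cmod_triangle|]. rewrite Cmod_opp. lra. }
  unfold e in HN. lra.
Qed.

Lemma EM_line_bound (s : C) : Re s = 2%R -> (Cmod (EM s) <= 3)%R.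
Proof.
  intros Hs. assert (T := zsum_tail 1 s ltac:(lia) Hs). assert (B := zsum_bound 1 s Hs).
  change (INR 1) with 1%R in T. rewrite Rinv_1 in T.
  replace (EM s) with (zsum 1 s - (zsum 1 s - EM s)) by ring. eapply Rle_trans; [apply Cmod_triangle|]. rewrite Cmod_opp. lra.
Qed.

Lemma uconv_zsum : uconv zsum EM.
Proof.
  intros e He. destruct (inv_INR_small e He) as [k [Hk Ek]]. exists k. intros M HM s Hs.
  eapply Rle_trans; [apply zsum_tail; auto; lia|]. eapply Rle_trans; [|exact Ek].
  apply Rinv_le_contravar; [now apply lt_0_INR|now apply le_INR].
Qed.

Lemma uconv_cube (f : nat -> C -> C) (l : C -> C) (A : R) : (forall M s, Re s = 2%R -> (Cmod (f M s) <= A)%R) ->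
  (forall s, Re s = 2%R -> (Cmod (l s) <= A)%R) -> uconv f l -> uconv (fun M s => f M s ^ 3) (fun s => l s ^ 3).
Proof.
  intros HA HB H.
  assert (A0 : (0 <= A)%R) by (eapply Rle_trans; [apply Cmod_ge_0|apply (HA 0%nat (RtoC 2)); reflexivity]).
  apply (uconv_ext (fun M s => f M s * f M s * f M s) _ (fun s => l s * l s * l s)); [intros; ring|intros; ring|].
  apply uconv_mult with (A * A)%R A; auto.
  - intros M s Hs. rewrite Cmod_mult. apply Rmult_le_compat; auto using Cmod_ge_0.
  - apply uconv_mult with A A; auto.
Qed.

(** Sums over cubes factor for completely multiplicative [g]; this lemma returns to
    the partial sums over m. *)
Lemma uconv_tau3 (g : C -> nat -> C) (l : C -> C) : (forall s n, Re s = 2%R -> (1 <= n)%nat -> (Cmod (g s n) <= inv_sq n)%R) ->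
  uconv (fun M s => Csum3 M (fun a b c => g s (a * b * c)%nat)) l ->
  uconv (fun M s => Cpsum (fun m => RtoC (INR (tau3 m)) * g s m) M) l.
Proof.
  intros Hg Hl e He. destruct (Hl (e / 2)%R ltac:(lra)) as [N HN]. destruct (inv_INR_small (e / 24)%R ltac:(lra)) as [k [Hk Ek]].
  exists (Nat.max N (k ^ 3)). intros M HM s Hs. specialize (HN M ltac:(lia) s Hs).
  assert (Q := tau3_cube_approx (g s) k M (fun n Hn => Hg s n Hs Hn) Hk ltac:(lia)).
  match goal with |- (Cmod (?x - ?y) <= _)%R => set (X := x) in *; set (Y := y) in * end.
  set (Z := Csum3 M (fun a b c => g s (a * b * c)%nat)) in *.
  replace (X - Y) with ((X - Z) + (Z - Y)) by ring.
  eapply Rle_trans; [apply Cmod_triangle|]. lra.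
Qed.

Lemma cpow_INR_mult3 (a b c : nat) (s : C) : (1 <= a)%nat -> (1 <= b)%nat -> (1 <= c)%nat ->
  cpow (INR (a * b * c)) s = cpow (INR a) s * cpow (INR b) s * cpow (INR c) s.
Proof.
  intros Ha Hb Hc. assert (A := lt_0_INR a ltac:(lia)). assert (B := lt_0_INR b ltac:(lia)). assert (D := lt_0_INR c ltac:(lia)).
  rewrite !mult_INR, !cpow_base_mult by (auto; nra). reflexivity.
Qed.

Lemma tau3_dirichlet : uconv (fun M s => Cpsum (fun m => RtoC (INR (tau3 m)) * cpow (INR m) (- s)) M) (fun s => EM s ^ 3).
Proof.
  apply (uconv_tau3 (fun s n => cpow (INR n) (- s))).
  - intros s n Hs Hn. rewrite Cmod_cpow_line by auto. lra.
  - apply (uconv_ext (fun M s => zsum M s ^ 3) _ (fun s => EM s ^ 3)); [|reflexivity|].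
    + intros M s Hs. unfold zsum. rewrite <- Csum3_prod. apply Csum3_ext; intros a b c Ha Hb Hc. rewrite cpow_INR_mult3 by lia. reflexivity.
    + apply uconv_cube with 3%R; [|apply EM_line_bound|apply uconv_zsum]. intros M s Hs. eapply Rle_trans; [now apply zsum_bound|lra].
Qed.

(** ** The alternating sign *)

Lemma even_sum (g : nat -> C) (j : nat) :
  Cpsum (fun n => if Nat.even n then g n else 0) (2 * j) = Cpsum (fun k => g (2 * k)%nat) j /\
  Cpsum (fun n => if Nat.even n then g n else 0) (Datatypes.S (2 * j)) = Cpsum (fun k => g (2 * k)%nat) j.
Proof.
  assert (O : forall j, Nat.even (Datatypes.S (2 * j)) = false) by (intros i; rewrite Nat.even_succ, Nat.odd_mul; reflexivity).
  assert (E : forall j, Nat.even (2 * j) = true) by (intros i; rewrite Nat.even_mul; reflexivity).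
  induction j as [|j [IH1 IH2]].
  - split; simpl; ring.
  - assert (H : Cpsum (fun n => if Nat.even n then g n else 0) (2 * Datatypes.S j) = Cpsum (fun k => g (2 * k)%nat) (Datatypes.S j)).
    { cbn [Cpsum]. rewrite <- IH2. replace (2 * Datatypes.S j)%nat with (Datatypes.S (Datatypes.S (2 * j))) by lia.
      cbn [Cpsum]. replace (Datatypes.S (Datatypes.S (2 * j))) with (2 * Datatypes.S j)%nat by lia. now rewrite E. }
    split; [exact H|]. cbn [Cpsum] in *. rewrite H, O. ring.
Qed.

Definition osum (M : nat) (s : C) : C := Cpsum (fun n => if Nat.odd n then cpow (INR n) (- s) else 0) M.

(** Removing the even terms: (2 k)^-s = 2^-s k^-s. *)
Lemma osum_eq (M : nat) (s : C) : osum M s = zsum M s - cpow 2 (- s) * zsum (Nat.div2 M) s.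
Proof.
  assert (E : Cpsum (fun n => if Nat.even n then cpow (INR n) (- s) else 0) M = cpow 2 (- s) * zsum (Nat.div2 M) s).
  { transitivity (Cpsum (fun k => cpow (INR (2 * k)) (- s)) (Nat.div2 M)).
    - destruct (even_sum (fun n => cpow (INR n) (- s)) (Nat.div2 M)) as [E1 E2].
      rewrite (Nat.div2_odd M) at 1. destruct (Nat.odd M); simpl Nat.b2n.
      + rewrite Nat.add_1_r. exact E2.
      + rewrite Nat.add_0_r. exact E1.
    - unfold zsum. rewrite <- Cpsum_scal. apply Cpsum_ext. intros n Hn. rewrite mult_INR. change (INR 2) with 2%R.
      rewrite cpow_base_mult; [reflexivity|lra|]. now apply lt_0_INR. }
  rewrite <- E. unfold zsum.
  replace (Cpsum (fun n => cpow (INR n) (- s)) M) with (Cpsum (fun n => (if Nat.odd n then cpow (INR n) (- s) else 0) + (if Nat.even n then cpow (INR n) (- s) else 0)) M).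
  - rewrite Cpsum_plus. unfold osum. ring.
  - apply Cpsum_ext. intros n _. rewrite <- Nat.negb_even. destruct (Nat.even n); simpl; ring.
Qed.

Lemma Cmod_cpow_2 (s : C) : Re s = 2%R -> Cmod (cpow 2 (- s)) = (/ 4)%R.
Proof.
  intros Hs. change 2%R with (INR 2). rewrite Cmod_cpow_line by (auto; lia). unfold inv_sq. simpl. field.
Qed.

Lemma uconv_osum : uconv osum (fun s => (1 - cpow 2 (- s)) * EM s).
Proof.
  apply (uconv_ext (fun M s => zsum M s - cpow 2 (- s) * zsum (Nat.div2 M) s) _ (fun s => EM s - cpow 2 (- s) * EM s)).
  - intros. now rewrite osum_eq.
  - intros. ring.
  - apply uconv_minus; [apply uconv_zsum|]. apply uconv_mult with (/ 4)%R 3%R.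
    + intros _ s Hs. rewrite Cmod_cpow_2 by auto. lra.
    + apply EM_line_bound.
    + apply uconv_const.
    + intros e He. destruct (uconv_zsum e He) as [N HN]. exists (2 * N)%nat. intros M HM s Hs. apply HN; [|auto].
      rewrite (Nat.div2_odd M) in HM. destruct (Nat.odd M); simpl in HM; lia.
Qed.

Lemma pow_neg1 (n : nat) : (- (1)) ^ n = 1 - 2 * (if Nat.odd n then 1 else 0 : C).
Proof.
  induction n as [|n IH]; [simpl; ring|]. rewrite Nat.odd_succ, <- Nat.negb_odd. simpl Cpow. rewrite IH. destruct (Nat.odd n); simpl; ring.
Qed.

(** Equal to -1 + 6/2^s - 6/4^s + 2/8^s; this form shows its origin in odd triples. *)
Definition altfac (s : C) : C := 1 - 2 * (1 - cpow 2 (- s)) ^ 3.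

(** The sign is 1 - 2 [a odd] [b odd] [c odd], so the sum over a cube is the cube of
    the full sum minus twice the cube of the sum over odd integers. *)
Lemma tau3_alternating_dirichlet :
  uconv (fun M s => Cpsum (fun m => RtoC (INR (tau3 m)) * ((- (1)) ^ m * cpow (INR m) (- s))) M) (fun s => altfac s * EM s ^ 3).
Proof.
  apply (uconv_tau3 (fun s n => (- (1)) ^ n * cpow (INR n) (- s))).
  - intros s n Hs Hn. rewrite Cmod_mult, Cmod_pow, Cmod_opp, Cmod_1, pow1, Cmod_cpow_line by auto. lra.
  - apply (uconv_ext (fun M s => zsum M s ^ 3 - 2 * osum M s ^ 3) _ (fun s => EM s ^ 3 - 2 * ((1 - cpow 2 (- s)) * EM s) ^ 3)).
    + intros M s Hs. unfold zsum, osum. rewrite <- !Csum3_prod.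
      match goal with |- Cminus ?x (Cmult ?c ?y) = _ => replace (Cminus x (Cmult c y)) with (x + - (2) * y) by ring end.
      rewrite <- Csum3_scal, <- Csum3_plus.
      apply Csum3_ext; intros a b c Ha Hb Hc. rewrite cpow_INR_mult3, pow_neg1, !Nat.odd_mul by lia.
      destruct (Nat.odd a), (Nat.odd b), (Nat.odd c); simpl; ring.
    + intros s Hs. unfold altfac. ring.
    + assert (Ob : forall s, Re s = 2%R -> (Cmod ((1 - cpow 2 (- s)) * EM s) <= 4)%R).
      { intros s Hs. rewrite Cmod_mult.
        assert (Cmod (1 - cpow 2 (- s)) <= 1 + / 4)%R.
        { eapply Rle_trans; [apply Cmod_triangle|]. rewrite Cmod_opp, Cmod_cpow_2, Cmod_1 by auto. lra. }
        assert (Q := EM_line_bound s Hs). assert (0 <= Cmod (EM s))%R by apply Cmod_ge_0. nra. }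
      apply uconv_minus.
      * apply uconv_cube with 3%R; [|apply EM_line_bound|apply uconv_zsum]. intros M s Hs. eapply Rle_trans; [now apply zsum_bound|lra].
      * apply uconv_mult with 2%R 64%R; [| |apply uconv_const|].
        -- intros _ s _. rewrite Cmod_R, Rabs_pos_eq; lra.
        -- intros s Hs. rewrite Cmod_pow. replace 64%R with (4 ^ 3)%R by ring. apply pow_incr. split; [apply Cmod_ge_0|auto].
        -- apply uconv_cube with 4%R; [|exact Ob|apply uconv_osum].
           intros M s Hs. rewrite osum_eq. eapply Rle_trans; [apply Cmod_triangle|]. rewrite Cmod_opp, Cmod_mult, Cmod_cpow_2 by auto.
           assert (B1 := zsum_bound M s Hs). assert (B2 := zsum_bound (Nat.div2 M) s Hs). lra.
Qed.

(** * The function under the contour integral *)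

Definition contour_fun (phi : R -> C) (s : C) : C := mellin phi s * EM s ^ 3 * altfac s.

Lemma altfac_holo (s : C) : holomorphic_at altfac s.
Proof.
  unfold altfac. apply holo_minus; [apply holo_const|]. apply holo_mult; [apply holo_const|].
  apply (holo_pow (fun s => 1 - cpow 2 (- s)) s 3). apply holo_minus; [apply holo_const|]. apply holo_cpow, holo_opp, holo_id.
Qed.

Lemma contour_fun_holo (phi : R -> C) (s : C) : schwartz_pos phi -> (-2 < Re s)%R -> s <> 1 -> holomorphic_at (contour_fun phi) s.
Proof.
  intros H Hs N. unfold contour_fun. apply holo_mult; [|apply altfac_holo].
  apply holo_mult; [now apply schwartz_pos_mellin_holo|]. apply (holo_pow EM s 3). now apply EM_holo.
Qed.

Lemma altfac_bound (s : C) : (-1 <= Re s)%R -> (Cmod (altfac s) <= 55)%R.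
Proof.
  intros Hs.
  assert (B : (Cmod (cpow 2 (- s)) <= 2)%R).
  { rewrite Cmod_cpow. replace (Re (- s)) with (- Re s)%R by (destruct s; reflexivity).
    rewrite <- (Rpower_1 2) at 2 by lra. apply Rpower_mono_ge1; lra. }
  assert (B1 : (Cmod (1 - cpow 2 (- s)) <= 3)%R).
  { eapply Rle_trans; [apply Cmod_triangle|]. rewrite Cmod_opp, Cmod_1. lra. }
  unfold altfac. eapply Rle_trans; [apply Cmod_triangle|]. rewrite Cmod_opp, Cmod_mult, Cmod_pow, Cmod_1, Cmod_R, Rabs_pos_eq by lra.
  assert (Cmod (1 - cpow 2 (- s)) ^ 3 <= 3 ^ 3)%R by (apply pow_incr; split; [apply Cmod_ge_0|auto]). lra.
Qed.

(** [EM] to the third power grows like the ninth power of |Im s|; eleven powers of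
    decay leave an integrable majorant. *)
Lemma mellin_EM3_decay (phi : R -> C) : schwartz_pos phi -> exists K, (0 <= K)%R /\
  forall s, (-1 <= Re s <= 2)%R -> (1 <= Cmod (s - 1))%R -> (Cmod (mellin phi s * EM s ^ 3) <= K * / (1 + Im s ^ 2))%R.
Proof.
  intros H. destruct (schwartz_pos_mellin_decay_line 11 phi H) as [K [K0 HK]]. exists (64 ^ 3 * K)%R. split; [nra|].
  intros s Hs H1. specialize (HK s Hs). assert (B := EM_bound s Hs H1).
  set (x := Rabs (Im s)) in *. assert (x0 : (0 <= x)%R) by apply Rabs_pos.
  assert (E : (Im s ^ 2 = x ^ 2)%R) by (unfold x; now rewrite pow2_abs).
  rewrite E, Cmod_mult, Cmod_pow.
  assert (P : (0 < 1 + x ^ 2)%R) by nra.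
  assert (B3 : (Cmod (EM s) ^ 3 <= 64 ^ 3 * (1 + x) ^ 9)%R).
  { replace (64 ^ 3 * (1 + x) ^ 9)%R with ((64 * (1 + x) ^ 3) ^ 3)%R by ring. apply pow_incr. split; [apply Cmod_ge_0|exact B]. }
  apply Rmult_le_reg_r with (1 + x ^ 2)%R; [exact P|].
  rewrite Rmult_assoc, Rmult_assoc, Rinv_l, Rmult_1_r by lra.
  assert (M0 := Cmod_ge_0 (mellin phi s)). set (m := Cmod (mellin phi s)) in *.
  assert (Z9 : (0 <= (1 + x) ^ 9)%R) by (apply pow_le; lra).
  apply Rle_trans with (m * (64 ^ 3 * (1 + x) ^ 9 * (1 + x) ^ 2))%R.
  - apply Rmult_le_compat_l; [auto|]. apply Rmult_le_compat; [apply pow_le, Cmod_ge_0|lra|exact B3|nra].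
  - replace (m * (64 ^ 3 * (1 + x) ^ 9 * (1 + x) ^ 2))%R with (64 ^ 3 * ((1 + x) ^ 11 * m))%R by ring.
    apply Rmult_le_compat_l; [apply pow_le; lra|exact HK].
Qed.

Lemma contour_fun_decay (phi : R -> C) : schwartz_pos phi -> exists K, (0 <= K)%R /\
  forall s, (-1 <= Re s <= 2)%R -> (1 <= Cmod (s - 1))%R -> (Cmod (contour_fun phi s) <= K * / (1 + Im s ^ 2))%R.
Proof.
  intros H. destruct (mellin_EM3_decay phi H) as [K [K0 HK]]. exists (55 * K)%R. split; [lra|].
  intros s Hs H1. unfold contour_fun. rewrite Cmod_mult. specialize (HK s Hs H1). assert (A := altfac_bound s ltac:(lra)).
  rewrite (Rmult_comm 55), (Rmult_assoc K), (Rmult_comm 55), <- Rmult_assoc.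
  apply Rmult_le_compat; auto using Cmod_ge_0.
Qed.

(** ** The Laurent expansion at 1 *)

(** (w - 1) EM w is holomorphic at 1, so the integrand is P z / (z - 1)^3 with P
    holomorphic; three divisions by z - 1 give the Laurent expansion, with regular
    part holomorphic on the whole half plane. *)
Lemma contour_fun_laurent (phi : R -> C) : schwartz_pos phi -> exists (g : C -> C) (p0 p1 p2 : C),
  (forall z, (-2 < Re z)%R -> holomorphic_at g z) /\
  (forall z : C, z <> 1 -> contour_fun phi z = g z + (p2 / (z - 1) + (p1 / (z - 1) ^ 2 + p0 / (z - 1) ^ 3))).
Proof.
  intros H.
  set (Z := fun w => 1 + (w - 1) * (/ 2 + w / 12 - w * (w + 1) * (w + 2) / 6 * mellin per1 (- w - 2))).
  assert (HZ : forall w, (-2 < Re w)%R -> holomorphic_at Z w).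
  { intros w Hw. unfold Z.
    assert (Hi : holomorphic_at (fun w => w) w) by apply holo_id.
    assert (Hcst : forall c : C, holomorphic_at (fun _ => c) w) by (intros; apply holo_const).
    apply holo_plus; [apply Hcst|]. apply holo_mult; [apply holo_minus; auto|].
    apply holo_minus.
    - apply holo_plus; [apply Hcst|]. apply holo_mult; [auto|apply Hcst].
    - apply holo_mult.
      + apply holo_mult; [|apply Hcst]. apply holo_mult; [apply holo_mult|]; [exact Hi| |]; apply holo_plus; auto.
      + apply (holo_comp (mellin per1) (fun w => - w - 2)).
        * apply holo_minus; [now apply holo_opp|apply Hcst].
        * eapply mellin_holo; [apply dom_per1|]. apply EM_integral_cond. exact Hw. }
  assert (EZ : forall w : C, w <> 1 -> EM w = Z w / (w - 1)).
  { intros w N. unfold Z, EM. field. now apply Cminus_eq_contra. }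
  set (P := fun w => mellin phi w * Z w ^ 3 * altfac w).
  assert (HP : forall w, (-2 < Re w)%R -> holomorphic_at P w).
  { intros w Hw. apply holo_mult; [|apply altfac_holo]. apply holo_mult; [now apply schwartz_pos_mellin_holo|].
    apply (holo_pow Z w 3). auto. }
  assert (HU : forall z, (Cmod (z - 1) <= 2 * 1)%R -> (-2 < Re z)%R).
  { intros z Hz. assert (Q := Re_close z 1). change (Re 1) with 1%R in Q.
    assert (Q' := Rle_abs (- (Re z - 1))). rewrite Rabs_Ropp in Q'. lra. }
  destruct (holo_divide (fun z => -2 < Re z)%R P 1 1 Rlt_0_1 HU HP) as [P1 [H1 E1]].
  destruct (holo_divide (fun z => -2 < Re z)%R P1 1 1 Rlt_0_1 HU H1) as [P2 [H2 E2]].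
  destruct (holo_divide (fun z => -2 < Re z)%R P2 1 1 Rlt_0_1 HU H2) as [P3 [H3 E3]].
  exists P3, (P 1), (P1 1), (P2 1). split; [exact H3|].
  intros z N. assert (N' : z - 1 <> 0) by now apply Cminus_eq_contra.
  transitivity (P z / (z - 1) ^ 3).
  - unfold contour_fun, P. rewrite EZ by auto. field. auto.
  - rewrite E1, E2, E3. field. auto.
Qed.

Lemma cpow_4 (s : C) : cpow 4 s = cpow 2 s ^ 2.
Proof. replace 4%R with (2 * 2)%R by ring. rewrite cpow_base_mult by lra. ring. Qed.

Lemma cpow_8 (s : C) : cpow 8 s = cpow 2 s ^ 3.
Proof. replace 8%R with (2 * (2 * 2))%R by ring. rewrite !cpow_base_mult by lra. ring. Qed.

Lemma altfac_eq (s : C) : - (1) + 6 / cpow 2 s - 6 / cpow 4 s + 2 / cpow 8 s = altfac s.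
Proof.
  rewrite cpow_4, cpow_8. unfold altfac. rewrite cpow_opp. field. apply cpow_nz.
Qed.

Lemma altfac_dual (s : C) : altfac (1 - s) = - (1) + 3 * cpow 2 s - 3 / 2 * cpow 4 s + 1 / 4 * cpow 8 s.
Proof.
  rewrite cpow_4, cpow_8. unfold altfac. replace (- (1 - s)) with (s - 1) by ring.
  unfold Cminus at 3. rewrite cpow_plus, cpow_opp, cpow_1 by lra.
  field.
Qed.

Lemma sum_n_3 (u : nat -> C) : @sum_n C_AbelianMonoid u 2 = u 0%nat + u 1%nat + u 2%nat.
Proof. rewrite !sum_Sn, sum_O. reflexivity. Qed.

Lemma residue_of_laurent (phi : R -> C) (g : C -> C) (p0 p1 p2 : C) :
  (forall z, (-2 < Re z)%R -> holomorphic_at g z) ->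
  (forall z : C, z <> 1 -> contour_fun phi z = g z + (p2 / (z - 1) + (p1 / (z - 1) ^ 2 + p0 / (z - 1) ^ 3))) ->
  is_residue (fun s => mellin phi s * zeta s ^ 3 * (- (1) + 6 / cpow 2 s - 6 / cpow 4 s + 2 / cpow 8 s)) 1 p2.
Proof.
  intros Hg E.
  exists 2%nat, (fun k => match k with O => p2 | 1%nat => p1 | _ => p0 end), g, 1%R.
  assert (HU : forall z, (Cmod (z - 1) < 1)%R -> (-2 < Re z)%R).
  { intros z Hz. assert (Q := Re_close z 1). change (Re 1) with 1%R in Q.
    assert (Q' := Rle_abs (- (Re z - 1))). rewrite Rabs_Ropp in Q'. lra. }
  split; [lra|split; [reflexivity|split]].
  - intros z Hz. apply Hg. auto.
  - intros z [Z1 Z2]. assert (N : z <> 1) by (intros ->; replace (1 - 1) with (RtoC 0) in Z1 by ring; rewrite Cmod_0 in Z1; lra).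
    rewrite altfac_eq, zeta_EM by auto. change (contour_fun phi z = g z + @sum_n C_AbelianMonoid (fun k => match k with O => p2 | 1%nat => p1 | _ => p0 end / (z - 1) ^ (Datatypes.S k)) 2).
    rewrite E, sum_n_3 by auto. field. now apply Cminus_eq_contra.
Qed.

(** The regular part contributes nothing, the higher powers of / (z - 1) have
    primitives, and / (z - 1) itself contributes 2 pi i. *)
Lemma rint_laurent (g : C -> C) (p0 p1 p2 : C) (f : C -> C) (T : R) : (1 <= T)%R ->
  (forall z, (-2 < Re z)%R -> holomorphic_at g z) ->
  (forall z : C, z <> 1 -> f z = g z + (p2 / (z - 1) + (p1 / (z - 1) ^ 2 + p0 / (z - 1) ^ 3))) ->
  rint f (-1) 2 (- T) T = p2 * (2 * RtoC PI * Ci).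
Proof.
  intros HT Hg E.
  assert (Nb : forall x y, on_border (-1) 2 (- T) T x y -> ((x, y) : C) - 1 <> 0).
  { intros x y (_ & _ & HB) Z. assert (Z1 := f_equal Re Z). assert (Z2 := f_equal Im Z). simpl in Z1, Z2. lra. }
  set (h1 := fun z : C => / (z - (1, 0)%R)). set (h2 := fun z : C => p1 / (z - 1) ^ 2 + p0 / (z - 1) ^ 3).
  assert (E10 : ((1, 0)%R : C) = 1) by reflexivity.
  assert (Hs : forall x y, holomorphic_at (fun w => w - 1) (x, y)) by (intros; apply holo_minus; [apply holo_id|apply holo_const]).
  assert (B1 : bcont h1 (-1) 2 (- T) T).
  { intros x y HB. apply holo_cont. unfold h1. rewrite E10. apply holo_inv; [now apply Nb|apply Hs]. }
  assert (B2 : bcont h2 (-1) 2 (- T) T).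
  { intros x y HB. apply holo_cont. specialize (Nb x y HB). unfold h2.
    apply holo_plus; (apply holo_div; [now apply Cpow_nz| |]).
    - apply holo_const. - apply (holo_pow (fun w => w - 1) (x, y) 2), Hs.
    - apply holo_const. - apply (holo_pow (fun w => w - 1) (x, y) 3), Hs. }
  assert (B3 : bcont (fun z => p2 * h1 z) (-1) 2 (- T) T) by (intros x y HB; capply clim_mult; [capply clim_const|now apply B1]).
  assert (R : holo_rect g (-1) 2 (- T) T) by (intros x y Hx Hy; apply Hg; simpl; lra).
  assert (B4 : bcont (fun z => p2 * h1 z + h2 z) (-1) 2 (- T) T) by (intros x y HB; capply clim_plus; [now apply B3|now apply B2]).
  assert (B5 := holo_rect_bcont _ _ _ _ _ R).
  rewrite <- (rint_ext (fun z => g z + (p2 * h1 z + h2 z))); [|lra|lra| |].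
  - rewrite rint_plus, rint_plus, rint_scal, goursat by (auto; lra). unfold h1. rewrite rint_inv by lra.
    rewrite (rint_primitive (fun z => - p1 * / (z - 1) - p0 / 2 * (/ (z - 1) * / (z - 1))) h2); [ring|lra|lra|exact B2|].
    intros x y HB. specialize (Nb x y HB).
    assert (I := cder_inv (fun w => w - 1) (x, y) _ Nb (cder_minus _ _ _ _ _ (cder_id (x, y)) (cder_const 1 (x, y)))).
    eapply cder_eq; [|apply cder_minus; [apply cder_mult; [apply cder_const|exact I]|apply cder_mult; [apply cder_const|apply cder_mult; exact I]]].
    unfold h2. cbv beta. field. exact Nb.
  - intros x y HB. specialize (Nb x y HB). rewrite E; [unfold h1, h2, Cdiv; rewrite E10; reflexivity|].
    intros Z. apply Nb. rewrite Z. ring.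
  - intros x y HB. capply clim_plus; [now apply B5|now apply B4].
Qed.

(** * Symmetric integrals over the line *)

(** Symmetric integrals: the form in which both Mellin inversion and the contour shift
    deliver integrals over a line. *)
Definition symint (f : R -> C) (l : C) : Prop := clim (Rbar_locally p_infty) (fun T => CRInt f (- T) T) l.

Lemma symint_unique (f : R -> C) (l m : C) : symint f l -> symint f m -> l = m.
Proof. apply clim_unique. typeclasses eauto. Qed.

Lemma symint_of_RInt (f : R -> C) (J : R -> C) (l : C) : (forall T, (0 < T)%R -> Cis_RInt f (- T) T (J T)) ->
  clim (Rbar_locally p_infty) J l -> symint f l.
Proof.
  intros H. apply clim_ext_loc; [typeclasses eauto|]. exists 0%R. intros T HT. symmetry. apply C_RInt_unique. auto.
Qed.

Lemma line_RInt (f : R -> C) (T : R) : (forall t, @ccont R_UniformSpace f t) -> Cis_RInt f (- T) T (CRInt f (- T) T).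
Proof. intros H. apply C_RInt_correct. auto. Qed.

Lemma symint_ext (f g : R -> C) (l : C) : (forall t, f t = g t) -> (forall t, @ccont R_UniformSpace f t) -> symint f l -> symint g l.
Proof.
  intros E Hf H. apply (symint_of_RInt _ (fun T => CRInt f (- T) T)); [|exact H].
  intros T HT. eapply C_is_RInt_ext; [|apply line_RInt, Hf]. auto.
Qed.

Lemma symint_plus (f g : R -> C) (l m : C) : (forall t, @ccont R_UniformSpace f t) -> (forall t, @ccont R_UniformSpace g t) ->
  symint f l -> symint g m -> symint (fun t => f t + g t) (l + m).
Proof.
  intros Cf Cg Hf Hg. apply (symint_of_RInt _ (fun T => CRInt f (- T) T + CRInt g (- T) T)).
  - intros T _. apply C_is_RInt_plus; now apply line_RInt.
  - capply clim_plus; [exact Hf|exact Hg].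
Qed.

Lemma symint_minus (f g : R -> C) (l m : C) : (forall t, @ccont R_UniformSpace f t) -> (forall t, @ccont R_UniformSpace g t) ->
  symint f l -> symint g m -> symint (fun t => f t - g t) (l - m).
Proof.
  intros Cf Cg Hf Hg. apply (symint_of_RInt _ (fun T => CRInt f (- T) T - CRInt g (- T) T)).
  - intros T _. apply C_is_RInt_minus; now apply line_RInt.
  - capply clim_minus; [exact Hf|exact Hg].
Qed.

Lemma symint_scal (f : R -> C) (c l : C) : (forall t, @ccont R_UniformSpace f t) ->
  symint f l -> symint (fun t => c * f t) (c * l).
Proof.
  intros Cf Hf. apply (symint_of_RInt _ (fun T => c * CRInt f (- T) T)).
  - intros T _. apply C_is_RInt_scal. now apply line_RInt.
  - capply clim_mult; [capply clim_const|exact Hf].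
Qed.

Lemma symint_0 : symint (fun _ => 0) 0.
Proof.
  apply (symint_of_RInt _ (fun _ => 0)); [|capply clim_const].
  intros T _. assert (Q := C_is_RInt_const 0 (- T) T). rewrite Cmult_0_l in Q. exact Q.
Qed.

Lemma symint_reflect (f : R -> C) (l : C) : (forall t, @ccont R_UniformSpace f t) -> symint f l -> symint (fun t => f (- t)%R) l.
Proof.
  intros Cf. apply symint_of_RInt. intros T _.
  assert (Q := line_RInt f T Cf).
  apply C_is_RInt_swap in Q. replace T with (- - T)%R in Q at 1 by ring.
  apply (is_RInt_comp_opp (V := C_R_NormedModule)) in Q.
  apply (C_is_RInt_scal _ _ _ (- (1))) in Q.
  replace (- (1) * - CRInt f (- T) T) with (CRInt f (- T) T) in Q by ring.
  eapply C_is_RInt_ext; [|exact Q]. intros t _. cbv beta. change (@opp C_R_NormedModule (f (- t)%R)) with (- f (- t)%R). ring.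
Qed.

Lemma ccont_Cpsum (a : nat -> C) (x : nat -> R -> C) (t : R) (M : nat) : (forall m, (1 <= m)%nat -> @ccont R_UniformSpace (x m) t) ->
  @ccont R_UniformSpace (fun t => Cpsum (fun m => a m * x m t) M) t.
Proof.
  intros H. induction M as [|M IH].
  - apply (clim_const (locally t) 0).
  - apply (clim_plus (locally t) (fun t => Cpsum (fun m => a m * x m t) M) (fun t => a (Datatypes.S M) * x (Datatypes.S M) t)); [exact IH|].
    capply clim_mult; [capply clim_const|apply H; lia].
Qed.

Lemma symint_Cpsum (f : R -> C) (a : nat -> C) (x : nat -> R -> C) (v : nat -> C) (M : nat) :
  (forall t, @ccont R_UniformSpace f t) -> (forall m t, (1 <= m)%nat -> @ccont R_UniformSpace (x m) t) ->
  (forall m, (1 <= m)%nat -> symint (fun t => f t * x m t) (v m)) ->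
  symint (fun t => f t * Cpsum (fun m => a m * x m t) M) (Cpsum (fun m => a m * v m) M).
Proof.
  intros Cf Cx Hv.
  assert (Cfx : forall m, (1 <= m)%nat -> forall t, @ccont R_UniformSpace (fun t => f t * x m t) t) by (intros m Hm t; capply clim_mult; [apply Cf|now apply Cx]).
  induction M as [|M IH].
  - apply (symint_ext (fun _ => 0)); [intros; simpl; ring|intros; capply clim_const|apply symint_0].
  - cbn [Cpsum]. apply (symint_ext (fun t => f t * Cpsum (fun m => a m * x m t) M + a (Datatypes.S M) * (f t * x (Datatypes.S M) t))).
    + intros t. ring.
    + intros t. capply clim_plus.
      * capply clim_mult; [apply Cf|apply (ccont_Cpsum a x t M); auto].
      * capply clim_mult; [capply clim_const|]. apply (Cfx (Datatypes.S M)); lia.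
    + apply symint_plus.
      * intros t. capply clim_mult; [apply Cf|apply (ccont_Cpsum a x t M); auto].
      * intros t. capply clim_mult; [capply clim_const|]. apply (Cfx (Datatypes.S M)); lia.
      * exact IH.
      * apply symint_scal; [apply Cfx; lia|apply Hv; lia].
Qed.

(** The error is at most eps K / (1 + t^2) pointwise, hence at most eps K pi. *)
Lemma symint_interchange (f g' : R -> C) (g : nat -> R -> C) (K : R) (u : nat -> C) (l : C) :
  (forall t, @ccont R_UniformSpace f t) -> (forall t, (Cmod (f t) <= K * / (1 + t ^ 2))%R) ->
  (forall M t, @ccont R_UniformSpace (g M) t) -> (forall t, @ccont R_UniformSpace g' t) ->
  (forall e, (0 < e)%R -> exists N, forall M, (N <= M)%nat -> forall t, (Cmod (g M t - g' t) <= e)%R) ->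
  (forall M, symint (fun t => f t * g M t) (u M)) -> symint (fun t => f t * g' t) l -> clim eventually u l.
Proof.
  intros Cf Bf Cg Cg' Hu Hg Hl e He.
  assert (K0 : (0 <= K)%R).
  { assert (Q := Bf 0%R). assert (Z := Cmod_ge_0 (f 0%R)). replace (1 + 0 ^ 2)%R with 1%R in Q by ring. rewrite Rinv_1, Rmult_1_r in Q. lra. }
  assert (P := PI_RGT_0).
  set (d := (e / (K * PI + 1))%R). assert (KP : (0 <= K * PI)%R) by (apply Rmult_le_pos; lra).
  assert (D : (0 < d)%R) by (apply Rdiv_lt_0_compat; lra).
  destruct (Hu d D) as [N HN]. exists N. intros M HM.
  assert (Cx : forall h : R -> C, (forall t, @ccont R_UniformSpace h t) -> forall t, @ccont R_UniformSpace (fun t => f t * h t) t).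
  { intros h Ch t. capply clim_mult; [apply Cf|apply Ch]. }
  assert (S1 := symint_minus _ _ _ _ (Cx _ (Cg M)) (Cx _ Cg') (Hg M) Hl).
  assert (CD : forall t, @ccont R_UniformSpace (fun t => f t * g M t - f t * g' t) t).
  { intros t. capply clim_minus; [now apply (Cx (g M))|now apply (Cx g')]. }
  destruct (line_integral _ (d * K)%R CD) as [l' [_ [B L']]].
  { intros t. replace (f t * g M t - f t * g' t) with ((g M t - g' t) * f t) by ring. rewrite Cmod_mult, Rmult_assoc.
    apply Rmult_le_compat; auto using Cmod_ge_0. }
  rewrite (symint_unique _ _ _ S1 L').
  eapply Rle_lt_trans; [exact B|].
  replace e with (d * (K * PI + 1))%R by (unfold d; field; lra). nra.
Qed.

(** * The summation formula *)

Lemma vline_away (c t : R) : (1 <= Rabs (c - 1))%R -> (1 <= Cmod ((c, t) - 1))%R.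
Proof. intros H. eapply Rle_trans; [exact H|]. exact (Cmod_fst ((c, t) - 1)). Qed.

Lemma vline_neq_1 (c t : R) : (1 <= Rabs (c - 1))%R -> ((c, t) : C) <> 1.
Proof.
  intros H E. assert (Q := vline_away c t H). rewrite E in Q. replace (1 - 1) with (RtoC 0) in Q by ring. rewrite Cmod_0 in Q. lra.
Qed.

Lemma ccont_contour_fun_line (phi : R -> C) (c t : R) : schwartz_pos phi -> (-2 < c)%R -> (1 <= Rabs (c - 1))%R ->
  @ccont R_UniformSpace (fun t => contour_fun phi (c, t)) t.
Proof. intros H Hc H1. apply ccont_vline, holo_cont, contour_fun_holo; [auto|simpl; lra|now apply vline_neq_1]. Qed.

Lemma abs_2 : (1 <= Rabs (2 - 1))%R.
Proof. rewrite Rabs_pos_eq; lra. Qed.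

Lemma abs_m1 : (1 <= Rabs (-1 - 1))%R.
Proof. rewrite Rabs_left; lra. Qed.

Lemma clim_inv_T (K : R) (f : R -> C) : (0 <= K)%R -> (forall T, (1 <= T)%R -> (Cmod (f T) <= K * / T)%R) -> clim (Rbar_locally p_infty) f 0.
Proof.
  intros K0 B e He. exists (Rmax 1 ((K + 1) / e)). intros T HT.
  assert (A1 := Rmax_l 1 ((K + 1) / e)). assert (A2 := Rmax_r 1 ((K + 1) / e)).
  replace (f T - 0) with (f T) by ring. eapply Rle_lt_trans; [apply B; lra|].
  apply Rmult_lt_reg_r with T; [lra|]. rewrite Rmult_assoc, Rinv_l, Rmult_1_r by lra.
  assert (Q : (K + 1 < T * e)%R).
  { replace (K + 1)%R with ((K + 1) / e * e)%R by (field; lra). apply Rmult_lt_compat_r; lra. }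
  lra.
Qed.

(** The horizontal sides at height T are O(1/T) by the decay of the integrand. *)
Lemma contour_shift (phi : R -> C) (p2 : C) : schwartz_pos phi -> (forall T, (1 <= T)%R -> rint (contour_fun phi) (-1) 2 (- T) T = p2 * (2 * RtoC PI * Ci)) ->
  exists l2 l1, symint (fun t => contour_fun phi (2, t)%R) l2 /\ symint (fun t => contour_fun phi (-1, t)%R) l1 /\ l2 = l1 + 2 * RtoC PI * p2.
Proof.
  intros H HR. destruct (contour_fun_decay phi H) as [K [K0 HK]].
  assert (C2 : forall t, @ccont R_UniformSpace (fun t => contour_fun phi (2, t)%R) t) by (intros; apply ccont_contour_fun_line; [auto|lra|apply abs_2]).
  assert (C1 : forall t, @ccont R_UniformSpace (fun t => contour_fun phi (-1, t)%R) t) by (intros; apply ccont_contour_fun_line; [auto|lra|apply abs_m1]).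
  destruct (line_integral _ K C2) as [l2 [_ [_ L2]]].
  { intros t. apply (HK (2, t)%R); [simpl; lra|]. apply vline_away, abs_2. }
  destruct (line_integral _ K C1) as [l1 [_ [_ L1]]].
  { intros t. apply (HK (-1, t)%R); [simpl; lra|]. apply vline_away, abs_m1. }
  exists l2, l1. split; [exact L2|split; [exact L1|]].
  assert (E : forall T, (1 <= T)%R -> exists d, (Cmod d <= 6 * K * / T)%R /\
    CRInt (fun t => contour_fun phi (2, t)%R) (- T) T - CRInt (fun t => contour_fun phi (-1, t)%R) (- T) T - 2 * RtoC PI * p2 = d).
  { intros T HT.
    assert (BC : bcont (contour_fun phi) (-1) 2 (- T) T).
    { intros x y HB. apply holo_cont, contour_fun_holo; [auto| |].
      - destruct HB as [? _]. simpl. lra.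
      - intros E. destruct HB as (_ & _ & HB). assert (E1 := f_equal Re E). assert (E2 := f_equal Im E). simpl in E1, E2. lra. }
    destruct (rint_sides (contour_fun phi) (-1) 2 (- T) T ltac:(lra) ltac:(lra) BC) as (b1 & r & t1 & l & H1 & H2 & H3 & H4 & E).
    rewrite HR in E by auto. apply C_RInt_unique in H2. apply C_RInt_unique in H4. rewrite H2, H4.
    assert (Bd : forall x y, (-1 <= x <= 2)%R -> Rabs y = T -> (Cmod (contour_fun phi (x, y)) <= K * / T)%R).
    { intros x y Hx Hy. eapply Rle_trans; [apply HK; [simpl; lra|]|].
      - rewrite <- Hy in HT. eapply Rle_trans; [exact HT|]. eapply Rle_trans; [|apply (Cmod_snd ((x, y) - 1))].
        replace (snd ((x, y) - 1)) with y by (simpl; ring). lra.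
      - apply Rmult_le_compat_l; [auto|]. change (Im (x, y)) with y. rewrite <- pow2_abs, Hy. apply Rinv_le_contravar; nra. }
    apply C_RInt_norm_const with (M := (K * / T)%R) in H1; [|lra|].
    2:{ intros x Hx. apply Bd; [lra|]. rewrite Rabs_Ropp, Rabs_pos_eq; lra. }
    apply C_RInt_norm_const with (M := (K * / T)%R) in H3; [|lra|].
    2:{ intros x Hx. apply Bd; [lra|]. rewrite Rabs_pos_eq; lra. }
    exists (- Ci * (t1 - b1)). split.
    - rewrite Cmod_mult, Cmod_opp, Cmod_Ci, Rmult_1_l. eapply Rle_trans; [apply Cmod_triangle|]. rewrite Cmod_opp. lra.
    - assert (CC : Ci * Ci = - (1)) by (Cext; ring).
      replace (t1 - b1) with (Ci * (r - l) - p2 * (2 * RtoC PI * Ci)) by (rewrite E; ring).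
      replace (- Ci * (Ci * (r - l) - p2 * (2 * RtoC PI * Ci))) with (- (Ci * Ci) * (r - l - 2 * RtoC PI * p2)) by ring.
      rewrite CC. ring. }
  assert (LL : clim (Rbar_locally p_infty) (fun T => CRInt (fun t => contour_fun phi (2, t)%R) (- T) T - CRInt (fun t => contour_fun phi (-1, t)%R) (- T) T - 2 * RtoC PI * p2) (l2 - l1 - 2 * RtoC PI * p2)).
  { capply clim_minus; [capply clim_minus; [exact L2|exact L1]|capply clim_const]. }
  assert (LZ : clim (Rbar_locally p_infty) (fun T => CRInt (fun t => contour_fun phi (2, t)%R) (- T) T - CRInt (fun t => contour_fun phi (-1, t)%R) (- T) T - 2 * RtoC PI * p2) 0).
  { apply clim_inv_T with (6 * K)%R; [lra|]. intros T HT. destruct (E T HT) as [d [B Ed]]. now rewrite Ed. }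
  assert (Z := clim_unique _ _ _ _ LL LZ).
  replace l2 with (l2 - l1 - 2 * RtoC PI * p2 + (l1 + 2 * RtoC PI * p2)) by ring. rewrite Z. ring.
Qed.

Lemma PI_nz : RtoC PI <> 0.
Proof. intros E. apply RtoC_inj in E. assert (P := PI_RGT_0). lra. Qed.

(** ** The alternating sum as an integral on Re s = 2 *)

Lemma mellin_line (phi : R -> C) : schwartz_pos phi -> exists K, forall s, (-1 <= Re s <= 2)%R -> (Cmod (mellin phi s) <= K * / (1 + Im s ^ 2))%R.
Proof.
  intros H. destruct (schwartz_pos_mellin_decay_line 2 phi H) as [K [K0 HK]]. exists K. intros s Hs. specialize (HK s Hs).
  assert (Q := pow2_ge_0 (Im s)). assert (A := Rabs_pos (Im s)).
  apply Rmult_le_reg_r with (1 + Im s ^ 2)%R; [lra|]. rewrite (Rmult_assoc K), Rinv_l, Rmult_1_r by lra.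
  eapply Rle_trans; [|exact HK]. rewrite Rmult_comm. apply Rmult_le_compat_r; [apply Cmod_ge_0|].
  rewrite <- (pow2_abs (Im s)). nra.
Qed.

Lemma ccont_cpow_line (x t : R) : @ccont R_UniformSpace (fun t => cpow x (- (2, t)%R)) t.
Proof.
  apply (ccont_vline (fun s => cpow x (- s))). apply holo_cont, holo_cpow, holo_opp, holo_id.
Qed.

Lemma ccont_EM_line (t : R) : @ccont R_UniformSpace (fun t => EM (2, t)%R) t.
Proof.
  apply (ccont_vline EM). apply holo_cont, EM_holo; [simpl; lra|apply vline_neq_1, abs_2].
Qed.

Lemma ccont_EM3_line (t : R) : @ccont R_UniformSpace (fun t => EM (2, t)%R ^ 3) t.
Proof. apply (clim_pow (locally t) (fun t => EM (2, t)%R) (EM (2, t)%R) 3), ccont_EM_line. Qed.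

Lemma alternating_side (phi : R -> C) (l : C) : schwartz_pos phi -> symint (fun t => contour_fun phi (2, t)%R) l ->
  clim eventually (Cpsum (fun m => RtoC (INR (tau3 m)) * (- (1)) ^ m * phi (INR m))) (/ (2 * RtoC PI) * l).
Proof.
  intros H Hl. destruct (mellin_line phi H) as [K HK].
  assert (Cm : forall t, @ccont R_UniformSpace (fun t => mellin phi (2, t)%R) t).
  { intros t. apply (ccont_vline (mellin phi)), holo_cont. now apply schwartz_pos_mellin_holo. }
  set (a := fun m => RtoC (INR (tau3 m)) * (- (1)) ^ m).
  assert (I : clim eventually (fun M => Cpsum (fun m => a m * (2 * RtoC PI * phi (INR m))) M) l).
  { apply (symint_interchange (fun t => mellin phi (2, t)%R) (fun t => altfac (2, t)%R * EM (2, t)%R ^ 3)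
      (fun M t => Cpsum (fun m => a m * cpow (INR m) (- (2, t)%R)) M) K).
    - exact Cm.
    - intros t. apply (HK (2, t)%R). simpl. lra.
    - intros M t. apply (ccont_Cpsum a (fun m t => cpow (INR m) (- (2, t)%R))). intros; apply ccont_cpow_line.
    - intros t. capply clim_mult; [|apply ccont_EM3_line]. apply (ccont_vline altfac), holo_cont, altfac_holo.
    - intros e He. destruct (tau3_alternating_dirichlet e He) as [N HN]. exists N. intros M HM t.
      specialize (HN M HM (2, t)%R eq_refl). cbv beta in HN.
      replace (Cpsum (fun m => a m * cpow (INR m) (- (2, t)%R)) M) with (Cpsum (fun m => RtoC (INR (tau3 m)) * ((- (1)) ^ m * cpow (INR m) (- (2, t)%R))) M); [exact HN|].
      apply Cpsum_ext. intros m _. unfold a. ring.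
    - intros M. apply (symint_Cpsum _ a (fun m t => cpow (INR m) (- (2, t)%R)) (fun m => 2 * RtoC PI * phi (INR m))); [exact Cm|intros; apply ccont_cpow_line|].
      intros m Hm. apply mellin_inversion; [exact H|]. now apply lt_0_INR.
    - eapply symint_ext; [| |exact Hl].
      + intros t. unfold contour_fun. ring.
      + intros t. apply ccont_contour_fun_line; [auto|lra|apply abs_2]. }
  apply (clim_ext eventually (fun M => / (2 * RtoC PI) * Cpsum (fun m => a m * (2 * RtoC PI * phi (INR m))) M)).
  - intros M. rewrite <- Cpsum_scal. apply Cpsum_ext. intros m _. unfold a. field. exact PI_nz.
  - capply clim_mult; [capply clim_const|exact I].
Qed.

(** ** The dual sum as an integral on Re s = -1 *)

Definition dualF (phi : R -> C) (s : C) : C := mellin phi (1 - s) * chi (1 - s) ^ 3.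

Lemma reflect_line (t : R) : 1 - (2, t)%R = ((-1, - t)%R : C).
Proof. Cext; ring. Qed.

(** The functional equation in a form free of division by zeta. *)
Lemma dualF_EM (phi : R -> C) (s : C) : Re s = 2%R -> dualF phi s * EM s ^ 3 = mellin phi (1 - s) * EM (1 - s) ^ 3.
Proof.
  intros Hs. unfold dualF. rewrite (chi_EM (1 - s)) by (rewrite Re_minus; simpl; lra).
  replace (1 - (1 - s)) with s by ring. ring.
Qed.

(** A bound for chi on the line is read off from the functional equation, since zeta
    is bounded away from 0 on Re s = 2. *)
Lemma dualF_decay (phi : R -> C) : schwartz_pos phi -> exists K, (0 <= K)%R /\ forall t, (Cmod (dualF phi (2, t)%R) <= K * / (1 + t ^ 2))%R.
Proof.
  intros H. destruct (mellin_EM3_decay phi H) as [K [K0 HK]]. exists (64 * K)%R. split; [lra|]. intros t.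
  assert (B : (Cmod (dualF phi (2, t)%R) * Cmod (EM (2, t)%R) ^ 3 <= K * / (1 + t ^ 2))%R).
  { rewrite <- Cmod_pow, <- Cmod_mult, dualF_EM by reflexivity. rewrite reflect_line.
    replace (t ^ 2)%R with ((- t) ^ 2)%R by ring. apply (HK (-1, - t)%R); [simpl; lra|apply vline_away, abs_m1]. }
  assert (L := EM_lower (2, t)%R eq_refl).
  assert (L3 : ((/ 4) ^ 3 <= Cmod (EM (2, t)%R) ^ 3)%R) by (apply pow_incr; lra).
  assert (Q := Cmod_ge_0 (dualF phi (2, t)%R)). nra.
Qed.

Lemma ccont_dualF (phi : R -> C) (t : R) : schwartz_pos phi -> @ccont R_UniformSpace (fun t => dualF phi (2, t)%R) t.
Proof.
  intros H. apply (ccont_vline (dualF phi)), holo_cont. unfold dualF.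
  assert (Hr : holomorphic_at (fun s => 1 - s) (2, t)%R) by (apply holo_minus; [apply holo_const|apply holo_id]).
  apply holo_mult.
  - apply (holo_comp (mellin phi) (fun s => 1 - s)); [exact Hr|now apply schwartz_pos_mellin_holo].
  - apply (holo_pow (fun s => chi (1 - s)) _ 3). apply (holo_comp chi (fun s => 1 - s)); [exact Hr|].
    apply chi_holo. simpl. lra.
Qed.

(** Absolute convergence identifies the improper integral in H with the limit of
    symmetric ones. *)
Lemma H_symint (phi : R -> C) (x : R) : schwartz_pos phi ->
  symint (fun t => dualF phi (2, t)%R * cpow x (- (2, t)%R)) (2 * RtoC PI * H phi x).
Proof.
  intros Hc. destruct (dualF_decay phi Hc) as [K [K0 HK]].
  assert (Cc : forall t, @ccont R_UniformSpace (fun t => dualF phi (2, t)%R * cpow x (- (2, t)%R)) t).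
  { intros t. capply clim_mult; [exact (ccont_dualF phi t Hc)|exact (ccont_cpow_line x t)]. }
  destruct (line_integral _ (K * Rpower x (- (2)))%R Cc) as [l [G [_ L]]].
  { intros t. rewrite Cmod_mult, Cmod_cpow. change (Re (- (2, t)%R)) with (- (2))%R. specialize (HK t).
    assert (Q := Rpower_pos x (- (2))).
    replace (K * Rpower x (- (2)) * / (1 + t ^ 2))%R with (K * / (1 + t ^ 2) * Rpower x (- (2)))%R by ring.
    apply Rmult_le_compat_r; [left; exact Q|exact HK]. }
  replace (2 * RtoC PI * H phi x) with l; [exact L|].
  assert (E : vline_int 2 (fun s => mellin phi (1 - s) * chi (1 - s) ^ 3 * cpow x (- s)) = Ci * l).
  { unfold vline_int. f_equal. exact (Cis_gen_unique (Fa := Rbar_locally m_infty) (Fb := Rbar_locally p_infty) _ l G). }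
  unfold H. rewrite E. field. split; [|exact PI_nz].
  intros Z. apply (f_equal Im) in Z. simpl in Z. lra.
Qed.

Definition dual_term (phi : R -> C) (m : nat) : C :=
  - H phi (INR m) + 3 * H phi (INR m / 2) - 3 / 2 * H phi (INR m / 4) + 1 / 4 * H phi (INR m / 8).

Lemma cpow_div (x a : R) (s : C) : (0 < x)%R -> (0 < a)%R -> cpow (x / a) (- s) = cpow a s * cpow x (- s).
Proof.
  intros Hx Ha. unfold Rdiv. rewrite cpow_base_mult by (auto; now apply Rinv_0_lt_compat).
  replace (cpow (/ a) (- s)) with (cpow a s); [ring|]. unfold cpow. rewrite ln_Rinv, RtoC_opp by auto. f_equal. ring.
Qed.

(** Scaling: (m / a)^-s = a^s m^-s, so the combination of the four values of H has the
    integrand of H(m) multiplied by A(1 - s). *)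
Lemma dual_term_symint (phi : R -> C) (m : nat) : schwartz_pos phi -> (1 <= m)%nat ->
  symint (fun t => dualF phi (2, t)%R * altfac (1 - (2, t)%R) * cpow (INR m) (- (2, t)%R)) (2 * RtoC PI * dual_term phi m).
Proof.
  intros Hc Hm. assert (P := lt_0_INR m ltac:(lia)).
  set (h := fun x t => dualF phi (2, t)%R * cpow x (- (2, t)%R)).
  assert (Ch : forall x t, @ccont R_UniformSpace (h x) t).
  { intros x t. unfold h. capply clim_mult; [exact (ccont_dualF phi t Hc)|exact (ccont_cpow_line x t)]. }
  assert (Cs : forall c x t, @ccont R_UniformSpace (fun t => c * h x t) t) by (intros c x t; capply clim_mult; [capply clim_const|apply Ch]).
  assert (Sh : forall c x, symint (fun t => c * h x t) (c * (2 * RtoC PI * H phi x))) by (intros c x; apply symint_scal; [apply Ch|now apply H_symint]).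
  assert (C12 : forall t, @ccont R_UniformSpace (fun t => - (1) * h (INR m) t + 3 * h (INR m / 2)%R t) t) by (intros t; capply clim_plus; apply Cs).
  assert (C123 : forall t, @ccont R_UniformSpace (fun t => (- (1) * h (INR m) t + 3 * h (INR m / 2)%R t) + - (3 / 2) * h (INR m / 4)%R t) t) by (intros t; capply clim_plus; [apply C12|apply Cs]).
  assert (C1234 : forall t, @ccont R_UniformSpace (fun t => ((- (1) * h (INR m) t + 3 * h (INR m / 2)%R t) + - (3 / 2) * h (INR m / 4)%R t) + 1 / 4 * h (INR m / 8)%R t) t) by (intros t; capply clim_plus; [apply C123|apply Cs]).
  assert (Q := symint_plus _ _ _ _ C123 (Cs (1 / 4) (INR m / 8)%R) (symint_plus _ _ _ _ C12 (Cs (- (3 / 2)) (INR m / 4)%R)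
     (symint_plus _ _ _ _ (Cs (- (1)) (INR m)) (Cs 3 (INR m / 2)%R) (Sh _ _) (Sh _ _)) (Sh _ _)) (Sh _ _)).
  match goal with |- symint _ ?x => match type of Q with symint _ ?y => replace x with y end end.
  - refine (symint_ext _ _ _ _ C1234 Q). intros t. unfold h. rewrite altfac_dual, !cpow_div by lra. ring.
  - unfold dual_term. ring.
Qed.

(** After the interchange of sum and integral the integrand is the one on the line
    Re s = -1, traversed by 1 - s. *)
Lemma dual_side (phi : R -> C) (l : C) : schwartz_pos phi -> symint (fun t => contour_fun phi (-1, t)%R) l ->
  clim eventually (Cpsum (fun m => RtoC (INR (tau3 m)) * dual_term phi m)) (/ (2 * RtoC PI) * l).
Proof.
  intros Hc Hl. destruct (dualF_decay phi Hc) as [K [K0 HK]].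
  assert (C1 : forall t, @ccont R_UniformSpace (fun t => contour_fun phi (-1, t)%R) t) by (intros; apply ccont_contour_fun_line; [auto|lra|apply abs_m1]).
  assert (Ca : forall t, @ccont R_UniformSpace (fun t => altfac (1 - (2, t)%R)) t).
  { intros t. apply (ccont_vline (fun s => altfac (1 - s))), holo_cont. apply (holo_comp altfac (fun s => 1 - s)); [|apply altfac_holo].
    apply holo_minus; [apply holo_const|apply holo_id]. }
  assert (Cf : forall t, @ccont R_UniformSpace (fun t => dualF phi (2, t)%R * altfac (1 - (2, t)%R)) t).
  { intros t. capply clim_mult; [exact (ccont_dualF phi t Hc)|exact (Ca t)]. }
  set (a := fun m => RtoC (INR (tau3 m))).
  assert (I : clim eventually (fun M => Cpsum (fun m => a m * (2 * RtoC PI * dual_term phi m)) M) l).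
  { apply (symint_interchange (fun t => dualF phi (2, t)%R * altfac (1 - (2, t)%R)) (fun t => EM (2, t)%R ^ 3)
      (fun M t => Cpsum (fun m => a m * cpow (INR m) (- (2, t)%R)) M) (K * 55)%R).
    - exact Cf.
    - intros t. rewrite Cmod_mult. replace (K * 55 * / (1 + t ^ 2))%R with (K * / (1 + t ^ 2) * 55)%R by ring.
      apply Rmult_le_compat; auto using Cmod_ge_0. apply altfac_bound. simpl. lra.
    - intros M t. apply (ccont_Cpsum a (fun m t => cpow (INR m) (- (2, t)%R))). intros; apply ccont_cpow_line.
    - intros t. apply ccont_EM3_line.
    - intros e He. destruct (tau3_dirichlet e He) as [N HN]. exists N. intros M HM t. exact (HN M HM (2, t)%R eq_refl).
    - intros M. apply (symint_Cpsum _ a (fun m t => cpow (INR m) (- (2, t)%R)) (fun m => 2 * RtoC PI * dual_term phi m)); [exact Cf|intros; apply ccont_cpow_line|].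
      intros m Hm. now apply dual_term_symint.
    - refine (symint_ext _ _ _ _ _ (symint_reflect _ _ C1 Hl)).
      + intros t. cbv beta. unfold contour_fun. rewrite <- reflect_line.
        rewrite <- dualF_EM by reflexivity. ring.
      + intros t. apply (ccont_comp (T := R_UniformSpace) (U := R_UniformSpace) (fun t => - t)%R (fun t => contour_fun phi (-1, t)%R)); [apply C1|].
        apply (ex_derive_continuous (V := R_NormedModule)). auto_derive. auto. }
  apply (clim_ext eventually (fun M => / (2 * RtoC PI) * Cpsum (fun m => a m * (2 * RtoC PI * dual_term phi m)) M)).
  - intros M. rewrite <- Cpsum_scal. apply Cpsum_ext. intros m _. unfold a. field. exact PI_nz.
  - capply clim_mult; [capply clim_const|exact I].
Qed.

Theorem corollary1p2 (phi : R -> C)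
  (phi_schwartz : schwartz phi) (phi_supp : supported_in_pos phi) :
  exists res dual : C,
    is_residue
      (fun s : C =>
         mellin phi s * zeta s ^ 3 *
         (- (1) + 6 / cpow 2 s - 6 / cpow 4 s + 2 / cpow 8 s))
      1 res /\
    @is_series C_AbsRing C_NormedModule
      (fun n : nat =>
         let m := S n in
         RtoC (INR (tau3 m)) *
         (- H phi (INR m) + 3 * H phi (INR m / 2)
          - 3 / 2 * H phi (INR m / 4) + 1 / 4 * H phi (INR m / 8)))
      dual /\
    @is_series C_AbsRing C_NormedModule
      (fun n : nat =>
         let m := S n in
         RtoC (INR (tau3 m)) * (- (1)) ^ m * phi (INR m))
      (res + dual).
Proof.
  assert (Hc := schwartz_pos_of_schwartz phi phi_schwartz phi_supp).
  destruct (contour_fun_laurent phi Hc) as (g & p0 & p1 & p2 & Hg & E).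
  destruct (contour_shift phi p2 Hc) as (l2 & l1 & L2 & L1 & El).
  { intros T HT. exact (rint_laurent g p0 p1 p2 (contour_fun phi) T HT Hg E). }
  exists p2, (/ (2 * RtoC PI) * l1). split; [exact (residue_of_laurent phi g p0 p1 p2 Hg E)|split].
  - apply (is_series_Cpsum (fun m => RtoC (INR (tau3 m)) * dual_term phi m)). now apply dual_side.
  - apply (is_series_Cpsum (fun m => RtoC (INR (tau3 m)) * (- (1)) ^ m * phi (INR m))).
    replace (p2 + / (2 * RtoC PI) * l1) with (/ (2 * RtoC PI) * l2) by (rewrite El; field; exact PI_nz).
    now apply alternating_side.
Qed.
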